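(* Assume the generalized Riemann hypothesis (GRH). Let $k\geq 1$ be a fixed integer and let $a_1,\ldots,a_k$ and $A$ be fixed positive real numbers. Let $X$ be a large real number and let $t=(t_1,\ldots,t_k)$ be a real $k$-tuple with $|t_j|\leq X^A$ for all $j$. Then \begin{align*} &\sum_{\substack{p\leq X\\ p \text{ odd prime}}}\log p\,\big|L(1/2+it_1,\chi^{(8p)})\big|^{a_1}\cdots\big|L(1/2+it_k,\chi^{(8p)})\big|^{a_k}\\ &\ll X(\log X)^{(a_1^2+\cdots+a_k^2)/4}\prod_{1\leq m<\ell\leq k}\Big|\zeta\Big(1+i(t_m-t_\ell)+\tfrac{1}{\log X}\Big)\Big|^{a_ma_\ell/2}\Big|\zeta\Big(1+i(t_m+t_\ell)+\tfrac{1}{\log X}\Big)\Big|^{a_ma_\ell/2}\\ &\qquad\times\prod_{1\leq m\leq k}\Big|\zeta\Big(1+2it_m+\tfrac{1}{\log X}\Big)\Big|^{a_m^2/4+a_m/2}, \end{align*} where the implied constant depends on $k$, $A$ and the $a_j$, but not on $X$ or the $t_j$.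
   Context: For an integer $d$, $\chi^{(d)}=\left(\frac{d}{\cdot}\right)$ denotes the Kronecker symbol; for an odd prime $p$, $\chi^{(8p)}$ is a real primitive Dirichlet character modulo $8p$, and $L(s,\chi^{(8p)})$ is its Dirichlet $L$-function. $\zeta(s)$ is the Riemann zeta function. The letter $p$ denotes primes. *)

(* Defs.v *)
From Stdlib Require Import Reals ZArith List.
From Coquelicot Require Import Coquelicot.
From mathcomp Require prime.
Open Scope R_scope.

Definition kron_prime (d : Z) (q : nat) : Z :=
  if Nat.eqb q 2 then
    (if Z.even d then 0%Z
     else let r := Z.modulo d 8 in
          if orb (Z.eqb r 1) (Z.eqb r 7) then 1%Z else (-1)%Z)
  else
    let qz := Z.of_nat q in
    let r := Z.modulo (Z.pow (Z.modulo d qz) ((qz - 1) / 2)) qz in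
    if Z.eqb r 0 then 0%Z else if Z.eqb r 1 then 1%Z else (-1)%Z.

Definition kronecker (d : Z) (n : nat) : Z :=
  fold_right (fun pe acc => (Z.pow (kron_prime d (fst pe)) (Z.of_nat (snd pe)) * acc)%Z)
             1%Z (prime.prime_decomp n).

(* n^{-s} for n >= 1 and complex s (value 0 at n = 0, so the sum starts at n = 1). *)
Definition ncpow (n : nat) (s : C) : C :=
  match n with
  | O => (0, 0)
  | S _ => (exp (- Re s * ln (INR n)) * cos (Im s * ln (INR n)),
            - (exp (- Re s * ln (INR n)) * sin (Im s * ln (INR n))))
  end.

Definition dpsum (chi : nat -> C) (s : C) (N : nat) : C :=
  sum_n (fun n => Cmult (chi n) (ncpow n s)) N.

Definition dseries (chi : nat -> C) (s : C) : C :=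
  (real (Lim_seq (fun N => Re (dpsum chi s N))),
   real (Lim_seq (fun N => Im (dpsum chi s N)))).

Definition kron_char (d : Z) : nat -> C := fun n => RtoC (IZR (kronecker d n)).

(* L(s, chi^{(d)}) for non-principal chi^{(d)}: the Dirichlet series converges
   (conditionally) for Re s > 0 and equals the analytic continuation there. *)
Definition Lkron (d : Z) (s : C) : C := dseries (kron_char d) s.

(* zeta(s) for Re s > 1 (absolutely convergent Dirichlet series). *)
Definition zeta (s : C) : C := dseries (fun _ => RtoC 1) s.

(* Dirichlet eta function, eta(s) = (1 - 2^{1-s}) zeta(s), convergent for Re s > 0. *)
Definition eta (s : C) : C :=
  dseries (fun n => if Nat.odd n then RtoC 1 else RtoC (-1)) s.

Definition dirichlet_char (q : nat) (chi : nat -> C) : Prop :=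
  (1 <= q)%nat /\
  (forall m n, chi (m * n)%nat = Cmult (chi m) (chi n)) /\
  (forall n, chi (n + q)%nat = chi n) /\
  (forall n, chi n <> RtoC 0 <-> Nat.gcd n q = 1%nat).

Definition nonprincipal (q : nat) (chi : nat -> C) : Prop :=
  exists n, Nat.gcd n q = 1%nat /\ chi n <> RtoC 1.

(* GRH: RH for zeta (stated through eta, whose zeros in the critical strip
   are those of zeta) and, for every non-principal Dirichlet character, all zeros
   of L(s,chi) in 0 < Re s < 1 lie on Re s = 1/2. *)
Definition GRH : Prop :=
  (forall s : C, 0 < Re s < 1 -> eta s = RtoC 0 -> Re s = 1/2) /\
  (forall (q : nat) (chi : nat -> C), dirichlet_char q chi -> nonprincipal q chi ->
     forall s : C, 0 < Re s < 1 -> dseries chi s = RtoC 0 -> Re s = 1/2).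

(* x^y for x >= 0, with 0^y = 0 (y > 0 in all uses). *)
Definition rpow (x y : R) : R := if Req_EM_T x 0 then 0 else Rpower x y.

Fixpoint prodR (f : nat -> R) (n : nat) : R :=
  match n with O => 1 | S m => prodR f m * f m end.

Fixpoint sumR (f : nat -> R) (n : nat) : R :=
  match n with O => 0 | S m => sumR f m + f m end.

Definition is_odd_prime (p : nat) : bool := andb (prime.prime p) (Nat.odd p).

Definition moment_sum (k : nat) (a t : nat -> R) (X : R) : R :=
  sumR (fun p =>
          if andb (is_odd_prime p) (if Rle_dec (INR p) X then true else false) then
            ln (INR p) *
            prodR (fun j => rpow (Cmod (Lkron (8 * Z.of_nat p) (1/2, t j))) (a j)) k
          else 0)
       (S (Z.to_nat (up X))).

Definition moment_bound (k : nat) (a t : nat -> R) (X : R) : R :=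
  let c := 1 + 1 / ln X in
  X * rpow (ln X) (sumR (fun j => a j ^ 2) k / 4) *
  prodR (fun l => prodR (fun m =>
      rpow (Cmod (zeta (c, t m - t l))) (a m * a l / 2) *
      rpow (Cmod (zeta (c, t m + t l))) (a m * a l / 2)) l) k *
  prodR (fun m => rpow (Cmod (zeta (c, 2 * t m))) (a m ^ 2 / 4 + a m / 2)) k.

(* Main.v *)
Require Import Defs.
From Stdlib Require Import Reals ZArith List.
From Coquelicot Require Import Coquelicot.
From Stdlib Require Import Lra Lia Psatz Classical ClassicalEpsilon.
From HB Require Import structures.
From mathcomp Require all_boot all_algebra all_field.
From mathcomp Require zify.
Open Scope R_scope.

(** Under GRH, log|L(1/2+it)| is bounded above by a short sum over primes, and the moment becomes an
    exponential moment of sums that behave like sums of independent random signs. Four ideas carry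
    this.

    (1) A one-sided formula for log|L|. Let W be a positive finite average of L'/L over points of
    the vertical line through s, built so that it multiplies n^(-s) by nearly F(log n / H) / log n,
    where F ([Ff]) equals 1 from 1 on. Then log L + W is nearly a sum over prime powers with log n
    <= H. This is checked on Re s = 2 and carried towards Re s = 1/2 by the maximum principle.
    Absence of zeros for Re s > 1/2 gives Re L'/L >= -O(log(q(2+|t|))) there ([Re_logder_lower]),
    and the weights of W have total mass O(1/H); hence log|L(1/2+it)| is at most the real part of
    the short sum plus O(log(q(2+|t|))/H) ([kernel_half], [DS_half_bound], [Lkron_bound]). Zeros on
    Re s = 1 are excluded separately ([nonvanish_line1], [L_one_neq0]), and quadratic reciprocity
    identifies (8p/n) as a character of n ([kronecker_psi]).

    (2) Averaging over p. The primes p > D are majorized by a nonnegative sieve weight [nu], whose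
    mean is O(1/log D) and which is 1 at these primes. Against this weight a product of symbols
    (8m/q) over a word of primes q averages out unless every prime has even multiplicity, exactly as
    for independent signs, up to an error governed by the length of the word ([nu_eps], [nu_pol]).

    (3) Replacing exponentials by short polynomials. The primes are cut into blocks of decreasing
    size. While the sum over a block stays below a threshold, its exponential is at most a constant
    times the square of a Taylor polynomial ([EN_exp_bound]), whose average over signs obeys the
    Gaussian bound ([Av_block]). For given p let r be the first level from which all blocks behave
    ([stopping]). Working at level r loses e^(O(2^r)), but the block just above has exceeded its
    threshold, and a high even moment shows this to be rare enough to pay for the loss ([pointwise],
    [main_termS], [mean_sum]).

    (4) Computing the exponent. Half the variance is a sum over q of (sum_j a_j cos(t_j log q))^2 /
    (2q). Expanded, it involves cos((t_m - t_l) log q), cos((t_m + t_l) log q) and cos(2 t_m log q),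
    and each resulting prime sum is at most log|zeta| at 1 + 1/log X plus the corresponding
    imaginary frequency, up to O(1) ([zeta_compare]). The squares of primes supply the additional
    a_m/2. Together they give the exponent in the theorem ([expo_bound], [moment_bound_exp]).

    [hybrid_moment] fixes the parameters; primes below sqrt X are estimated individually. *)

Module HybridMoment.
Import all_boot Coquelicot.Coquelicot zify.
Set Implicit Arguments. Unset Strict Implicit. Unset Printing Implicit Defensive.

(** * Quadratic reciprocity by Gauss's lemma and Eisenstein's lattice-point count *)

Module Legendre.
Import all_boot all_algebra all_field zify GRing.Theory.
Delimit Scope Z_scope with ZZ.
Local Open Scope ring_scope.

Section Legendre.
Variable q : nat.
Hypothesis qp : prime q.
Hypothesis qo : odd q.

Let h := (q.-1)./2.

Lemma hq : (q = h.*2.+1)%N.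
Proof. by have := prime_gt0 qp; have := qo; rewrite /h; lia. Qed.
Lemma h_gt0 : (0 < h)%N.
Proof. by have := prime_gt1 qp; have := hq; lia. Qed.

Lemma natF0 a : ((a%:R : 'F_q) == 0) = (q %| a)%N.
Proof. by rewrite -(dvdn_pcharf (pchar_Fp qp)). Qed.

Lemma natF_mod a b : ((a%:R : 'F_q) == b%:R) = (a == b %[mod q])%N.
Proof.
apply/eqP/eqP => [e|e]; last by rewrite -(Fp_nat_mod qp a) e Fp_nat_mod.
by rewrite -!(val_Fp_nat qp) e.
Qed.

Lemma neg1F : (-1 : 'F_q) != 1.
Proof.
rewrite eq_sym -subr_eq0 opprK -[1 + 1]/(2%:R) natF0.
by apply/negP => /dvdn_leq; have := hq; have := h_gt0; lia.
Qed.

(** By Fermat a^(q-1) = 1, so a^h is a root of (x - 1)(x + 1) in the field ['F_q]. *)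
Lemma euler a : ~~ (q %| a)%N -> (a%:R : 'F_q) ^+ h = 1 \/ (a%:R : 'F_q) ^+ h = -1.
Proof.
rewrite -natF0 => a0.
have e : (a%:R : 'F_q) ^+ q.-1 = 1.
  have := expf_card (a%:R : 'F_q); rewrite card_Fp // => e.
  by apply: (mulfI a0); rewrite mulr1 -exprS prednK // prime_gt0.
have : ((a%:R : 'F_q) ^+ h - 1) * ((a%:R : 'F_q) ^+ h + 1) = 0.
  rewrite -subr_sqr expr1n -exprM (_ : (h * 2 = q.-1)%N) ?e ?subrr //; have := hq; lia.
by move/eqP; rewrite mulf_eq0 subr_eq0 addr_eq0 => /orP [] /eqP; [left | right].
Qed.

(** Moves the modular exponentiation over Z inside [kron_prime] into the field ['F_q], where it can
    be handled algebraically. *)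
Lemma kron_natE a : kron_prime (Z.of_nat a) q =
  (if ((a%:R : 'F_q) ^+ h == 0)%R then 0 else if ((a%:R : 'F_q) ^+ h == 1)%R then 1 else -1)%ZZ.
Proof.
rewrite /kron_prime.
have -> : Nat.eqb q 2 = false by apply/Nat.eqb_neq => e; move: qo; rewrite e.
have q0 := prime_gt0 qp.
have -> : ((Z.of_nat q - 1) / 2 = Z.of_nat h)%ZZ.
  by rewrite (_ : (_ - _ = Z.of_nat h * 2)%ZZ); [rewrite Z.div_mul | have := hq; lia].
have modE m : (Z.of_nat m mod Z.of_nat q = Z.of_nat (m %% q))%ZZ.
  have := divn_eq m q; have := ltn_pmod m q0.
  move: (m %/ q)%N (m %% q)%N => d r lt ->.
  by rewrite (_ : Z.of_nat _ = (Z.of_nat r + Z.of_nat d * Z.of_nat q)%ZZ) ?Z.mod_add ?Z.mod_small; lia.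
rewrite modE.
have pw : forall b n, (Z.of_nat b ^ Z.of_nat n = Z.of_nat (b ^ n))%ZZ.
  move=> b; elim=> [|n IH]; first by [].
  by rewrite Nat2Z.inj_succ Z.pow_succ_r ?IH ?expnS; lia.
rewrite pw.
rewrite modE modnXm.
have e0 : ((a%:R : 'F_q) ^+ h == 0) = ((a ^ h) %% q == 0)%N by rewrite -natrX natF0.
have e1 : ((a%:R : 'F_q) ^+ h == 1) = ((a ^ h) %% q == 1)%N.
  by rewrite -natrX (natF_mod _ 1) (modn_small (prime_gt1 qp)).
rewrite e0 e1.
do 2?case: Z.eqb_spec => ?; do 2?case: eqP => ? //; lia.
Qed.

Definition leg a : Z := kron_prime (Z.of_nat a) q.

Lemma leg0 a : (q %| a)%N -> leg a = 0%ZZ.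
Proof. by rewrite /leg kron_natE -natF0 => /eqP ->; rewrite expr0n eqn0Ngt h_gt0 eqxx. Qed.

Lemma legP a : ~~ (q %| a)%N ->
  ((a%:R : 'F_q) ^+ h = 1 /\ leg a = 1%ZZ) \/ ((a%:R : 'F_q) ^+ h = -1 /\ leg a = (-1)%ZZ).
Proof.
move=> /euler [] e; rewrite /leg kron_natE e; [left | right].
  by rewrite oner_eq0 eqxx.
by rewrite oppr_eq0 oner_eq0 (negbTE neg1F).
Qed.

Lemma leg_mod a b : (a = b %[mod q])%N -> leg a = leg b.
Proof. by move=> /eqP; rewrite -natF_mod => /eqP e; rewrite /leg !kron_natE e. Qed.

Lemma leg_M a b : leg (a * b) = (leg a * leg b)%ZZ.
Proof.
case: (boolP (q %| a)%N) => ha; first by rewrite (leg0 ha) leg0 // dvdn_mulr.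
case: (boolP (q %| b)%N) => hb; first by rewrite (leg0 hb) Z.mul_0_r leg0 // dvdn_mull.
have hab : ~~ (q %| a * b)%N by rewrite Euclid_dvdM // negb_or ha.
have n : (-1 : 'F_q) <> 1 by exact/eqP/neg1F.
case: (legP ha) => [[e1 ->]|[e1 ->]]; case: (legP hb) => [[e2 ->]|[e2 ->]]; case: (legP hab) => [[]|[]]; rewrite natrM exprMn e1 e2 ?mulrNN ?mul1r ?mulr1 => e3 -> //; first [case: (n e3) | case: (n (esym e3))].
Qed.

(** If all q - 1 = 2h nonzero residues had symbol 1, they would all be roots of X^h - 1, which has
    at most h. The nonresidue later flips the sign of a character sum ([mean0_word]). *)
Lemma leg_nonres : exists b, ~~ (q %| b)%N /\ leg b = (-1)%ZZ.
Proof.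
case: (boolP (has (fun b => Z.eqb (leg b) (-1)%ZZ) (iota 1 q.-1))) => [/hasP [b]|/hasPn H].
  rewrite mem_iota => hb /Z.eqb_eq e; exists b; split=> //.
  by apply/negP => /dvdn_leq; lia.
have P0 : ('X^h - 1 : {poly 'F_q}) != 0 by rewrite -size_poly_eq0 size_XnsubC ?h_gt0.
have := @max_poly_roots _ _ [seq (b%:R : 'F_q) | b <- iota 1 q.-1] P0.
rewrite size_XnsubC ?h_gt0 // size_map size_iota => C.
have : (q.-1 < h.+1)%N; last by have := hq; have := h_gt0; lia.
apply: C.
  apply/allP => x /mapP [b hb ->]; rewrite /root !hornerE subr_eq0; apply/eqP.
  have nb : ~~ (q %| b)%N by rewrite mem_iota in hb; apply/negP => /dvdn_leq; lia.
  by case: (legP nb) => [[]|[]] // _ e; have := H _ hb; rewrite e.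
rewrite map_inj_in_uniq ?iota_uniq // => b c; rewrite !mem_iota => hb hc /eqP.
by rewrite natF_mod !modn_small; [move/eqP | lia | lia].
Qed.

(** Gauss's exponent; its parity decides the symbol of a. *)
Definition gs a := (\sum_(1 <= j < h.+1) (h < (a * j) %% q))%N.

(** Absolute value of the residue of aj nearest to 0. *)
Let sm a j := if (h < (a * j) %% q)%N then (q - (a * j) %% q)%N else ((a * j) %% q)%N.

(** If two of these values agree, q divides a(j - k) or a(j + k), which is impossible for distinct
    j, k in [1, h]. So the h values, all in [1, h], fill the range. *)
Lemma sm_perm a : ~~ (q %| a)%N -> perm_eq [seq sm a j | j <- index_iota 1 h.+1] (index_iota 1 h.+1).
Proof.
move=> ha; have q0 := prime_gt0 qp; have hQ := hq.
have rng j : (0 < j < h.+1)%N -> (0 < (a * j) %% q < q)%N.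
  move=> hj; rewrite ltn_pmod // andbT lt0n -/(dvdn _ _) Euclid_dvdM // negb_or ha.
  by apply/negP => /dvdn_leq; lia.
have inj : {in index_iota 1 h.+1 &, injective (sm a)}.
  move=> j k; rewrite !mem_index_iota => hj hk.
  have dj := rng j hj; have dk := rng k hk.
  have key x y : (0 < x <= y)%N -> (y < q)%N -> ((a * x) %% q = (a * y) %% q)%N -> x = y.
    move=> hx hy /eqP e; rewrite eq_sym eqn_mod_dvd in e; last by rewrite leq_mul2l; lia.
    rewrite -mulnBr Euclid_dvdM // (negbTE ha) /= in e.
    case: (ltnP x y) => ?; last by lia.
    by have := dvdn_leq _ e; lia.
  have key2 : ((a * j) %% q + (a * k) %% q = q)%N -> False.
    move=> e; have : (q %| a * (j + k))%N.
      by rewrite mulnDr /dvdn -modnDm e modnn.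
    rewrite Euclid_dvdM // (negbTE ha) /= => /dvdn_leq; lia.
  rewrite /sm; case: ltnP => h1; case: ltnP => h2 e.
  - by case: (leqP j k) => hjk; [apply: key | apply/esym/key]; lia.
  - by case: key2; lia.
  - by case: key2; lia.
  - by case: (leqP j k) => hjk; [apply: key | apply/esym/key]; lia.
have un : uniq [seq sm a j | j <- index_iota 1 h.+1] by rewrite map_inj_in_uniq ?iota_uniq.
apply: uniq_perm => //; first exact: iota_uniq.
have [] // := @uniq_min_size _ [seq sm a j | j <- index_iota 1 h.+1] (index_iota 1 h.+1) un; last first.
  by rewrite size_map.
move=> x /mapP [j]; rewrite !mem_index_iota => hj ->; have := rng j hj.
by rewrite /sm; case: ifP; lia.
Qed.

(** Multiply a, 2a, ..., ha in ['F_q]: up to a sign -1 for each residue in the upper half, the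
    factors are a permutation of 1, ..., h, and h! cancels. *)
Lemma gauss_lemma a : ~~ (q %| a)%N -> (a%:R : 'F_q) ^+ h = (-1) ^+ gs a.
Proof.
move=> ha.
have e : \prod_(1 <= j < h.+1) ((a * j)%:R : 'F_q) = (-1) ^+ gs a * \prod_(1 <= j < h.+1) (j%:R : 'F_q).
  rewrite -[X in _ = _ * X](perm_big _ (sm_perm ha)) big_map /gs -prodrXr -big_split /=.
  apply: eq_bigr => j _; rewrite -(Fp_nat_mod qp (a * j)) /sm.
  have lt := ltn_pmod (a * j) (prime_gt0 qp).
  case: ifP => hj; rewrite ?expr1 ?expr0 ?mul1r //.
  by rewrite natrB 1?ltnW // -[q%:R]Fp_nat_mod // modnn mulN1r opprB subr0.
have n0 : \prod_(1 <= j < h.+1) (j%:R : 'F_q) != 0.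
  rewrite prodf_seq_neq0; apply/allP => j; rewrite mem_index_iota /= => hj.
  by rewrite natF0; apply/negP => /dvdn_leq; have := hq; lia.
apply: (mulIf n0); rewrite -e.
under [RHS]eq_bigr => j _ do rewrite natrM.
by rewrite big_split /= prodr_const_nat subn1.
Qed.

(** Reduce a j = q floor(a j / q) + r modulo 2 and sum over j: q is odd, and r has the parity of
    [sm a j], changed exactly when r lies in the upper half. By [sm_perm] the [sm a j] add up to 1 +
    ... + h. *)
Lemma gs_parity a : ~~ (q %| a)%N ->
  odd (a * \sum_(1 <= j < h.+1) j) = odd (\sum_(1 <= j < h.+1) (a * j) %/ q + \sum_(1 <= j < h.+1) j + gs a).
Proof.
move=> ha; rewrite -{2}(perm_big _ (sm_perm ha)) big_map /gs big_distrr /= -!big_split /=.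
have : forall F G : nat -> nat, (forall j, odd (F j) = odd (G j)) -> odd (\sum_(1 <= j < h.+1) F j) = odd (\sum_(1 <= j < h.+1) G j).
  move=> F G FG; elim/big_rec2: _ => // j x y _ xy; by rewrite !oddD FG xy.
apply => j; rewrite /sm; have := divn_eq (a * j) q; have := hq; have := ltn_pmod (a * j) (prime_gt0 qp).
move: (_ %/ _)%N (_ %% _)%N => d r lt e1 ->.
have sb : odd (q - r) = ~~ odd r by rewrite oddB ?(ltnW lt) // qo.
by rewrite !oddD oddM qo andbT; case: ltnP => /= hr; rewrite ?sb; case: (odd d); case: (odd r).
Qed.

Lemma leg_gs a : ~~ (q %| a)%N -> leg a = if odd (gs a) then (-1)%ZZ else 1%ZZ.
Proof.
move=> ha; have := gauss_lemma ha; rewrite -signr_odd.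
have n : (-1 : 'F_q) <> 1 by exact/eqP/neg1F.
case: (legP ha) => [[-> ->]|[-> ->]]; case: (odd _) => //=; rewrite ?expr1 ?expr0 => e; first [case: (n e) | case: (n (esym e))].
Qed.

(** For a = 2 all floors vanish, so the parity of [gs 2] is that of 1 + ... + h = h(h+1)/2, which
    depends only on h modulo 4. *)
Lemma leg_two : leg 2 = if (q %% 8 == 1)%N || (q %% 8 == 7)%N then 1%ZZ else (-1)%ZZ.
Proof.
have n2 : ~~ (q %| 2)%N by apply/negP => /dvdn_leq; have := hq; have := h_gt0; lia.
have := gs_parity n2; rewrite leg_gs // oddM /= !oddD.
have -> : (\sum_(1 <= j < h.+1) (2 * j) %/ q = 0)%N.
  rewrite big_nat big1 // => j hj; rewrite divn_small //; have := hq; lia.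
have s : (2 * \sum_(1 <= j < h.+1) j = h * h.+1)%N.
  elim: (h) => [|n IH]; first by rewrite big_geq.
  by rewrite big_nat_recr //= mulnDr IH; lia.
move=> /esym/negbT; rewrite negb_add /= => /eqP <-.
set S := (\sum_(_ <= _ < _) _)%N in s *.
have E := hq; rewrite E.
have : (h = h %/ 4 * 4 + h %% 4)%N by exact: divn_eq.
have : (h %% 4 < 4)%N by rewrite ltn_mod.
move: (h %/ 4)%N (h %% 4)%N => u v lt hE.
rewrite hE in s *.
case: v lt s {hE} => [|[|[|[|v]]]] // _ s.
- have -> : S = ((u * (4 * u + 1)).*2)%N by nia.
  by rewrite odd_double (_ : (_ == _) || _ = true) //; lia.
- have -> : S = ((u * (4 * u + 3)).*2.+1)%N by nia.
  by rewrite /= odd_double (_ : (_ == _) || _ = false) //; lia.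
- have -> : S = ((u * (4 * u + 5) + 1).*2.+1)%N by nia.
  by rewrite /= odd_double (_ : (_ == _) || _ = false) //; lia.
- have -> : S = ((u * (4 * u + 7) + 3).*2)%N by nia.
  by rewrite odd_double (_ : (_ == _) || _ = true) //; lia.
Qed.

Lemma leg_eis a : odd a -> ~~ (q %| a)%N ->
  leg a = if odd (\sum_(1 <= j < h.+1) (a * j) %/ q) then (-1)%ZZ else 1%ZZ.
Proof.
move=> oa ha; rewrite leg_gs //; have := gs_parity ha.
rewrite oddM oa !oddD.
by case: (odd _); case: (odd _); case: (odd _).
Qed.

End Legendre.

(** The two sums count the lattice points (j, i) of the rectangle [1, (q-1)/2] x [1, (p-1)/2] below
    and above the line q i = p j. No point lies on the line because p and q are distinct primes. *)
Lemma lattice p q : prime p -> prime q -> odd p -> odd q -> p != q ->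
  (\sum_(1 <= j < (q.-1)./2.+1) (p * j) %/ q + \sum_(1 <= i < (p.-1)./2.+1) (q * i) %/ p = (p.-1)./2 * (q.-1)./2)%N.
Proof.
move=> pp qp op oq npq.
have cnt a b n j : (0 < b)%N -> (a * j < b * n.+1)%N -> ((a * j) %/ b = \sum_(1 <= i < n.+1) (b * i <= a * j))%N.
  move=> b0 lt; have : ((a * j) %/ b <= n)%N by rewrite -ltnS ltn_divLR // (mulnC n.+1).
  move: (a * j)%N {lt} => m.
  elim: n => [|n IH]; first by rewrite big_geq // leqn0 => /eqP.
  rewrite big_nat_recr //= (mulnC b) -leq_divRL // => h.
  case: (ltnP n (m %/ b)) => h2; last by rewrite IH // addn0.
  rewrite [LHS](_ : _ = n.+1); last by lia.
  rewrite big_nat (eq_bigr (fun _ => 1%N)); last first.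
    by move=> i hi; rewrite (mulnC b) -leq_divRL //; case: leqP => //; lia.
  by rewrite -big_nat sum_nat_const_nat; lia.
have hp := hq pp op; have hQ := hq qp oq.
rewrite (eq_big_nat _ _ (F2 := fun j => \sum_(1 <= i < (p.-1)./2.+1) (q * i <= p * j))%N); last first.
  move=> j hj; apply: cnt; first exact: prime_gt0.
  by move: (p.-1)./2 (q.-1)./2 hp hQ hj => x y -> ->; nia.
rewrite [X in (_ + X)%N](eq_big_nat _ _ (F2 := fun i => \sum_(1 <= j < (q.-1)./2.+1) (p * j <= q * i))%N); last first.
  move=> j hj; apply: cnt; first exact: prime_gt0.
  by move: (p.-1)./2 (q.-1)./2 hp hQ hj => x y -> ->; nia.
rewrite [X in (_ + X)%N]exchange_big /= -big_split /=.
rewrite (eq_big_nat _ _ (F2 := fun j => (p.-1)./2)); last first.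
  move=> j hj; rewrite -big_split /= (eq_big_nat _ _ (F2 := fun i => 1%N)); last first.
    move=> i hi; have : (q * i != p * j)%N.
      apply/eqP => e; have : (q %| p * j)%N by rewrite -e dvdn_mulr.
      rewrite Euclid_dvdM // dvdn_prime2 // eq_sym (negbTE npq) /= => /dvdn_leq; lia.
    by case: ltngtP.
  by rewrite sum_nat_const_nat; lia.
by rewrite sum_nat_const_nat; lia.
Qed.

Lemma quad_recip p q : prime p -> prime q -> odd p -> odd q -> p != q ->
  (leg q p * leg p q)%ZZ = if odd ((p.-1)./2 * (q.-1)./2) then (-1)%ZZ else 1%ZZ.
Proof.
move=> pp qp op oq npq.
rewrite (leg_eis qp oq op) ?(leg_eis pp op oq) ?dvdn_prime2 // 1?eq_sym //.
rewrite -(lattice pp qp op oq npq) oddD.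
by case: (odd _); case: (odd _).
Qed.

End Legendre.

Import Legendre(hq, leg, leg0, legP, leg_mod, leg_M, leg_nonres, leg_two, quad_recip).

(** * The Kronecker symbol (8p/n) as a character of n modulo 8p *)

Module Kronecker.
Local Open Scope Z_scope.

(** Value of (2/n) at an odd n congruent to r modulo 8, multiplied, when [f] holds, by (-1/n). With
    [f] saying that (p-1)/2 is odd, the second factor is the sign that reciprocity puts between
    (p/n) and (n/p). *)
Definition sg (f : bool) (r : nat) : Z :=
  (if (r == 1)%N || (r == 7)%N then 1 else -1) * (if f && (r %% 4 == 3)%N then -1 else 1).

Lemma sg_M f m n : odd m -> odd n -> sg f ((m * n) %% 8)%N = sg f (m %% 8)%N * sg f (n %% 8)%N.
Proof.
move=> om on; rewrite -modnMm.
have : odd (m %% 8)%N by lia. have : odd (n %% 8)%N by lia.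
have := ltn_pmod m (isT : (0 < 8)%N); have := ltn_pmod n (isT : (0 < 8)%N).
move: (m %% 8)%N (n %% 8)%N => r s.
by case: f; do 8 (case: r => [|r]; first by do 8 (case: s => [|s] //)).
Qed.

Lemma sg_V f r : sg f r = 1 \/ sg f r = -1.
Proof. by rewrite /sg; case: (_ || _); case: (_ && _); [right|left|left|right]. Qed.

Section Kron.
Variable p : nat.
Hypothesis pp : prime p.
Hypothesis op : odd p.

(** Closed form of (8p/n) provided by reciprocity. Periodicity in n, which the definition of
    [kronecker] through the factorization of n hides, can be read off it. *)
Definition psi (n : nat) : Z :=
  if odd n then sg (odd (p.-1)./2) (n %% 8)%N * leg p n else 0.

Lemma psi_M m n : psi (m * n)%N = psi m * psi n.
Proof.
rewrite /psi oddM; case: (boolP (odd m)) => om //=; case: (boolP (odd n)) => on /=; last by lia.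
rewrite sg_M // leg_M //; lia.
Qed.

Lemma psi_1 : psi 1 = 1.
Proof.
have n1 : ~~ (p %| 1)%N by rewrite dvdn1; apply/eqP => e; move: pp; rewrite e.
have l : leg p 1 * leg p 1 = leg p 1 by rewrite -leg_M.
have -> : psi 1 = leg p 1 by rewrite /psi /sg /= andbF; lia.
by case: (legP pp op n1) => [[_ ->]|[_ e]] //; rewrite e in l.
Qed.

Lemma psi_V n : psi n = 0 \/ psi n = 1 \/ psi n = -1.
Proof.
rewrite /psi; case: (odd n); last by left.
case: (boolP (p %| n)%N) => h; first by left; rewrite leg0 //; lia.
by case: (legP pp op h) => [[_ ->]|[_ ->]]; case: (sg_V (odd p.-1./2) (n %% 8)%N) => ->; lia.
Qed.

Lemma psi_0 n : psi n = 0 <-> (~~ odd n || (p %| n)%N).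
Proof.
rewrite /psi; case: (odd n) => //=.
case: (boolP (p %| n)%N) => h; first by rewrite leg0 //; split=> //; lia.
by split=> //; case: (legP pp op h) => [[_ ->]|[_ ->]]; case: (sg_V (odd p.-1./2) (n %% 8)%N) => ->.
Qed.

(** Since p is odd, adding 4p moves n modulo 8 by 4: this flips (2/n) and fixes n modulo 4 and
    modulo p. From it come the period 8p, the vanishing sum over a period and the value -1 at 1 +
    4p. *)
Lemma psi_half n : psi (n + 4 * p)%N = - psi n.
Proof.
rewrite /psi oddD oddM /= addbF; case: (boolP (odd n)) => on; last by [].
rewrite (leg_mod pp op (a := (n + 4 * p)%N) (b := n)); last by rewrite addnC modnMDl.
have -> : ((n + 4 * p) %% 8 = (n %% 8 + 4) %% 8)%N by lia.
have : odd (n %% 8)%N by lia.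
have := ltn_pmod n (isT : (0 < 8)%N).
rewrite -Z.mul_opp_l; move: (n %% 8)%N => r lt orr; congr (_ * _).
by do 8 (case: r lt orr => [|r] lt orr; first by case: (odd _)).
Qed.

Lemma psi_per n : psi (n + 8 * p)%N = psi n.
Proof.
have -> : (n + 8 * p = n + 4 * p + 4 * p)%N by lia.
rewrite !psi_half; lia.
Qed.

(** (8p/q) = (2/q)^3 (p/q) = (2/q)(p/q) for odd q, and reciprocity exchanges p and q. At q = 2 both
    sides are 0. *)
Lemma psi_prime q : prime q -> kron_prime (8 * Z.of_nat p) q = psi q.
Proof.
move=> qp.
case: (boolP (odd q)) => oq; last first.
  have -> : q = 2%N by have := even_prime qp => -[] // h; rewrite h in oq.
  by rewrite /kron_prime Nat.eqb_refl Z.even_mul.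
have -> : 8 * Z.of_nat p = Z.of_nat (2 * 2 * 2 * p)%N by lia.
rewrite -/(leg q _) !leg_M //.
have e2 : leg q 2 * leg q 2 = 1 by rewrite leg_two //; case: (_ || _).
rewrite /psi oq e2 Z.mul_1_l leg_two //.
case: (eqVneq q p) => [e|npq]; first by rewrite e !leg0 //; lia.
have := quad_recip qp pp oq op npq.
have np : ~~ (p %| q)%N by rewrite dvdn_prime2 // eq_sym.
have -> : odd (q.-1./2 * p.-1./2)%N = odd p.-1./2 && (q %% 8 %% 4 == 3)%N.
  rewrite oddM andbC; congr (_ && _); have := hq qp oq; lia.
by rewrite /sg; case: (legP pp op np) => [[_ ->]|[_ ->]]; case: (_ || _); case: (_ && _); lia.
Qed.

Lemma kronecker_psi n : (0 < n)%N -> kronecker (8 * Z.of_nat p) n = psi n.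
Proof.
move=> n0; rewrite [in RHS](prod_prime_decomp n0) /kronecker.
have psiX q e : psi (q ^ e)%N = psi q ^ Z.of_nat e.
  elim: e => [|e IH]; first by rewrite expn0 psi_1.
  by rewrite expnS psi_M IH Nat2Z.inj_succ Z.pow_succ_r //; lia.
have : all (fun f => prime f.1) (prime_decomp n).
  by apply/allP => -[q e] /mem_prime_decomp [].
elim: (prime_decomp n) => [|[q e] s IH] /=; first by rewrite big_nil psi_1.
by move=> /andP [qp /IH ->]; rewrite big_cons psi_M psiX psi_prime.
Qed.

Lemma psi_gcd n : psi n <> 0 <-> Nat.gcd n (8 * p)%N = 1%N.
Proof.
have cop : (~~ odd n || (p %| n)%N) = ~~ coprime n (8 * p)%N.
  by rewrite coprimeMr (@coprime_pexpr 3 n 2 isT : coprime n 8 = _) coprimen2 [coprime n p]coprime_sym prime_coprime // negb_and negbK.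
have -> : Nat.gcd n (8 * p)%N = gcdn n (8 * p)%N.
  apply: Nat.gcd_unique.
  - by have [k e] := dvdnP (dvdn_gcdl n (8 * p)%N); exists k; exact: e.
  - by have [k e] := dvdnP (dvdn_gcdr n (8 * p)%N); exists k.
  - by move=> d [a ha] [b hb]; have : (d %| gcdn n (8 * p))%N; [rewrite dvdn_gcd; apply/andP; split; apply/dvdnP; [exists a | exists b] | move=> /dvdnP [k e]; exists k].
rewrite psi_0 cop; split; last by move=> e; rewrite /coprime e.
by move/negP; rewrite negbK => /eqP.
Qed.

End Kron.

End Kronecker.
Import Kronecker.

(* Notation for real sums over lists, over ranges and over primes *)
Reserved Notation "\rsum_ ( i <- r | P ) F"
  (at level 36, F at level 36, i at level 50, r at level 50).
Reserved Notation "\rsum_ ( i <- r ) F" (at level 36, F at level 36, i at level 50, r at level 50).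
Reserved Notation "\rsum_ ( m <= i < n | P ) F" (at level 36, F at level 36, i at level 50).
Reserved Notation "\rsum_ ( m <= i < n ) F" (at level 36, F at level 36, i at level 50).
Reserved Notation "\psum_ ( i <= n | P ) F" (at level 36, F at level 36, i at level 60, n at level 50).
Reserved Notation "\psum_ ( i <= n ) F" (at level 36, F at level 36, i at level 60, n at level 50).
Notation "\rsum_ ( i <- r | P ) F" := (\big[Rplus/0]_(i <- r | P%B) F) : R_scope.
Notation "\rsum_ ( i <- r ) F" := (\big[Rplus/0]_(i <- r) F) : R_scope.
Notation "\rsum_ ( m <= i < n | P ) F" := (\big[Rplus/0]_(m <= i < n | P%B) F) : R_scope.
Notation "\rsum_ ( m <= i < n ) F" := (\big[Rplus/0]_(m <= i < n) F) : R_scope.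
Notation "\psum_ ( i <= n | P ) F" := (\big[Rplus/0]_(0 <= i < n.+1 | prime i && P%B) F) : R_scope.
Notation "\psum_ ( i <= n ) F" := (\big[Rplus/0]_(0 <= i < n.+1 | prime i) F) : R_scope.
Notation lnN n := (ln (INR n)).

Lemma Rinv_ge0 x : 0 < x -> 0 <= / x.
Proof. by move=> /Rinv_0_lt_compat; lra. Qed.
Lemma exp_ge0 x : 0 <= exp x.
Proof. by have := exp_pos x; lra. Qed.

(** * Complex exponential and complex derivatives *)

Notation cderiv f z d := (@is_derive C_AbsRing (AbsRing_NormedModule C_AbsRing) f (z : C) (d : C)).

Definition cexp (z : C) : C := (exp (Re z) * cos (Im z), exp (Re z) * sin (Im z)).

Lemma C_eq (x y : C) : Re x = Re y -> Im x = Im y -> x = y.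
Proof. by case: x y => [a b] [c d] /= -> ->. Qed.

Lemma Re_plus (x y : C) : Re (x + y)%C = Re x + Re y. Proof. by []. Qed.
Lemma Im_plus (x y : C) : Im (x + y)%C = Im x + Im y. Proof. by []. Qed.
Lemma Re_mult (x y : C) : Re (x * y)%C = Re x * Re y - Im x * Im y. Proof. by []. Qed.
Lemma Im_mult (x y : C) : Im (x * y)%C = Re x * Im y + Im x * Re y. Proof. by []. Qed.
Lemma Re_opp (x : C) : Re (- x)%C = - Re x. Proof. by []. Qed.
Lemma Im_opp (x : C) : Im (- x)%C = - Im x. Proof. by []. Qed.
Lemma Re_RtoC (x : R) : Re (RtoC x) = x. Proof. by []. Qed.
Lemma Im_RtoC (x : R) : Im (RtoC x) = 0. Proof. by []. Qed.
Lemma Re_minus (x y : C) : Re (x - y)%C = Re x - Re y. Proof. by []. Qed.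
Lemma Im_minus (x y : C) : Im (x - y)%C = Im x - Im y. Proof. by []. Qed.

Definition CRI := (Re_plus, Im_plus, Re_mult, Im_mult, Re_minus, Im_minus, Re_opp, Im_opp, Re_RtoC, Im_RtoC).

Lemma cexp_plus (x y : C) : cexp (x + y)%C = (cexp x * cexp y)%C.
Proof.
case: x y => [a b] [c d]; apply: C_eq; rewrite /cexp /= exp_plus.
- rewrite cos_plus; ring.
- rewrite sin_plus; ring.
Qed.

Lemma cexp_0 : cexp 0 = 1.
Proof. by rewrite /cexp /= exp_0 cos_0 sin_0 Rmult_1_r Rmult_0_r. Qed.

Lemma Cmod_cexp z : Cmod (cexp z) = exp (Re z).
Proof.
rewrite /Cmod /cexp /=.
have -> : exp (Re z) * cos (Im z) * (exp (Re z) * cos (Im z) * 1) +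
  exp (Re z) * sin (Im z) * (exp (Re z) * sin (Im z) * 1) =
  (exp (Re z))^2 * (Rsqr (sin (Im z)) + Rsqr (cos (Im z))) by rewrite /Rsqr; ring.
rewrite sin2_cos2 Rmult_1_r /= Rmult_1_r sqrt_square //; apply/exp_ge0.
Qed.

Lemma cexp_neq0 z : cexp z <> 0.
Proof. by apply/Cmod_gt_0; rewrite Cmod_cexp; apply: exp_pos. Qed.

Lemma cexp_opp z : cexp (- z)%C = (/ cexp z)%C.
Proof.
have h : (cexp z * cexp (- z) = 1)%C by rewrite -cexp_plus -cexp_0; congr cexp; ring.
have h0 := @cexp_neq0 z.
by rewrite -[cexp (- z)%C]Cmult_1_l -(Cinv_l _ h0) -Cmult_assoc h Cmult_1_r.
Qed.

Lemma cexp_R (x : R) : cexp x = RtoC (exp x).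
Proof. apply: C_eq; rewrite /cexp /= ?cos_0 ?sin_0; ring. Qed.

Lemma im_le_Cmod (z : C) : Rabs (Im z) <= Cmod z.
Proof. apply: Rle_trans (Rmax_Cmod z); exact: Rmax_r. Qed.

Lemma Cmod_le_ReIm (z : C) : Cmod z <= Rabs (Re z) + Rabs (Im z).
Proof.
have {1}-> : z = (RtoC (Re z) + (0, Im z))%C by apply: C_eq => /=; rewrite /Re /Im /=; ring.
apply: Rle_trans (Cmod_triangle _ _) _; rewrite Cmod_R; apply: Rplus_le_compat_l.
rewrite {1}/Cmod /= -(sqrt_Rsqr_abs (Im z)) /Rsqr; right; congr sqrt; ring.
Qed.

Lemma Cmod_minus_sym (x y : C) : Cmod (x - y)%C = Cmod (y - x)%C.
Proof. by rewrite -(Cmod_opp (x - y)%C); congr Cmod; ring. Qed.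

Lemma Cmod_minus_le (x y : C) : Cmod (x - y)%C <= Cmod x + Cmod y.
Proof. by apply: Rle_trans (Cmod_triangle _ _) _; rewrite Cmod_opp; lra. Qed.

Lemma Cmod_triangle_inv (x y : C) : Cmod x - Cmod y <= Cmod (x - y)%C.
Proof. have := Cmod_triangle (x - y)%C y; have -> : (x - y + y = x)%C by ring. lra. Qed.

(** A second-order remainder is enough for differentiability; the derivatives of [cexp], of the
    inverse and of series are obtained in this form. *)
Lemma cd_taylor (f : C -> C) z d (r B : R) : 0 < r ->
  (forall w, Cmod w < r -> Cmod (f (z + w)%C - f z - d * w)%C <= B * (Cmod w)^2) ->
  cderiv f z d.
Proof.
move=> r0 H; split; first exact: is_linear_scal_l.
move=> x Hx.
have -> : x = z by exact: (esym (@is_filter_lim_locally_unique C_AbsRing (AbsRing_NormedModule C_AbsRing) z x Hx)).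
clear x Hx.
move=> eps.
have Bp : 0 < Rabs B + 1 by have := Rabs_pos B; lra.
have dp : 0 < Rmin r (eps / (Rabs B + 1)) by apply: Rmin_pos => //; apply: Rdiv_lt_0_compat => //; exact: cond_pos.
exists (mkposreal _ dp) => y hy.
have hy2 : Cmod (y - z)%C < Rmin r (eps / (Rabs B + 1)) by exact: hy.
have h1 := H (y - z)%C (Rlt_le_trans _ _ _ hy2 (Rmin_l _ _)).
have e1 : (z + (y - z) = y)%C by ring.
rewrite e1 in h1.
have -> : norm (minus y z) = Cmod (y - z)%C by [].
apply: (Rle_trans _ (Cmod (f y - f z - d * (y - z))%C)).
  right; apply: (f_equal Cmod); rewrite /minus /plus /opp /scal /= /mult /=; ring.
apply: Rle_trans h1 _.
have c0 := Cmod_ge_0 (y - z)%C.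
have h2 : Cmod (y - z)%C <= eps / (Rabs B + 1) by apply: Rlt_le; apply: Rlt_le_trans hy2 (Rmin_r _ _).
have h3 : (Rabs B + 1) * Cmod (y - z)%C <= eps.
  apply: Rle_trans (Rmult_le_compat_l _ _ _ (Rlt_le _ _ Bp) h2) _; right; field; lra.
have := Rle_abs B; nra.
Qed.

Lemma cd_eq (f : C -> C) z d d' : cderiv f z d -> d = d' -> cderiv f z d'.
Proof. by move=> h <-. Qed.

Lemma cd_const (a : C) z : cderiv (fun _ => a) z 0.
Proof. exact: is_derive_const. Qed.
Lemma cd_id z : cderiv (fun w => w) z 1.
Proof. exact: is_derive_id. Qed.
Lemma cd_plus (f g : C -> C) z d e : cderiv f z d -> cderiv g z e -> cderiv (fun w => f w + g w)%C z (d + e)%C.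
Proof. exact: is_derive_plus. Qed.
Lemma cd_opp (f : C -> C) z d : cderiv f z d -> cderiv (fun w => - f w)%C z (- d)%C.
Proof. exact: is_derive_opp. Qed.
Lemma cd_minus (f g : C -> C) z d e : cderiv f z d -> cderiv g z e -> cderiv (fun w => f w - g w)%C z (d - e)%C.
Proof. exact: is_derive_minus. Qed.
Lemma cd_mult (f g : C -> C) z d e : cderiv f z d -> cderiv g z e ->
  cderiv (fun w => f w * g w)%C z (d * g z + f z * e)%C.
Proof. move=> h1 h2; apply: (is_derive_mult f g z d e h1 h2) => n m; exact: Cmult_comm. Qed.
Lemma cd_comp (f g : C -> C) z d e : cderiv f (g z) d -> cderiv g z e -> cderiv (fun w => f (g w)) z (e * d)%C.
Proof. exact: is_derive_comp. Qed.
Lemma cd_scal (a : C) (f : C -> C) z d : cderiv f z d -> cderiv (fun w => a * f w)%C z (a * d)%C.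
Proof. move=> h; apply: cd_eq (cd_mult (cd_const a z) h) _; ring. Qed.
Lemma cd_lin (a b : C) z : cderiv (fun w => a * w + b)%C z a.
Proof. apply: cd_eq (cd_plus (cd_scal a (cd_id z)) (cd_const b z)) _; ring. Qed.

Lemma cd_small (f : C -> C) z d eps : cderiv f z d -> 0 < eps ->
  exists r, 0 < r /\ forall w, Cmod w < r -> Cmod (f (z + w)%C - f z)%C < eps.
Proof.
move=> h e0.
have hc : @continuous (AbsRing_UniformSpace C_AbsRing) (AbsRing_UniformSpace C_AbsRing) f z.
  by apply: (ex_derive_continuous (K:=C_AbsRing) (V:=AbsRing_NormedModule C_AbsRing)); exists d.
have [[r r0] H] := (hc _ (@locally_ball (AbsRing_UniformSpace C_AbsRing) (f z) (mkposreal _ e0))).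
exists r; split=> // w hw; apply: (H (z + w)%C).
by rewrite /ball /= /AbsRing_ball /abs /minus /plus /opp /=; have -> : (z + w + - z)%C = w by ring.
Qed.

(* Restriction of a complex-differentiable function to a real line with direction [v]. *)
Lemma cd_line (f : C -> C) z v (t : R) d : cderiv f (z + t * v)%C d ->
  is_derive (fun h : R => Re (f (z + h * v)%C)) t (Re (d * v)%C) /\
  is_derive (fun h : R => Im (f (z + h * v)%C)) t (Im (d * v)%C).
Proof.
move=> [_ /(_ (z + t * v)%C (fun P H => H)) H].
have K : forall eps : posreal, locally t (fun h => Cmod (f (z + h * v)%C - f (z + t * v)%C - d * ((h - t) * v))%C
   <= eps * (Cmod v * Rabs (h - t))).
  move=> eps; have [r Hr] := H eps.
  have vp : 0 < Cmod v + 1 by have := Cmod_ge_0 v; lra.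
  exists (mkposreal _ (Rdiv_lt_0_compat _ _ (cond_pos r) vp)) => h hh.
  rewrite /ball /= /AbsRing_ball /abs /minus /plus /opp /= in hh.
  have c : Cmod (z + h * v - (z + t * v))%C = Cmod v * Rabs (h - t).
    have -> : (z + h * v - (z + t * v) = RtoC (h - t) * v)%C by rewrite RtoC_minus; ring.
    by rewrite Cmod_mult Cmod_R Rmult_comm.
  have hb : @ball (AbsRing_UniformSpace C_AbsRing) (z + t * v)%C r (z + h * v)%C.
    rewrite /ball /= /AbsRing_ball /abs.
    apply: (Rle_lt_trans _ (Cmod (z + h * v - (z + t * v))%C)); first by right.
    rewrite c.
    have h2 : Rabs (h - t) < r / (Cmod v + 1) by [].
    have h3 : (Cmod v + 1) * Rabs (h - t) < r.
      have := Rmult_lt_compat_l _ _ _ vp h2; have -> : (Cmod v + 1) * (r / (Cmod v + 1)) = r by field; lra.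
      by [].
    have := Rabs_pos (h - t); have := Cmod_ge_0 v; nra.
  rewrite -c; have := Hr _ hb.
  move=> h4; apply: Rle_trans h4; right.
  apply: (f_equal Cmod); rewrite /minus /plus /opp /scal /= /mult /=; ring.
have L : forall (g : C -> R), (forall x y, g (x - y)%C = g x - g y) -> (forall (a : R) x, g (a * x)%C = a * g x) ->
   (forall x, Rabs (g x) <= Cmod x) -> is_derive (fun h : R => g (f (z + h * v)%C)) t (g (d * v)%C).
  move=> g g1 g2 g3; split; first exact: is_linear_scal_l.
  move=> x Hx; have -> : x = t by exact: (esym (@is_filter_lim_locally_unique R_AbsRing (AbsRing_NormedModule R_AbsRing) t x Hx)).
  move=> eps.
  have vp : 0 < Cmod v + 1 by have := Cmod_ge_0 v; lra.
  apply: filter_imp (K (mkposreal _ (Rdiv_lt_0_compat _ _ (cond_pos eps) vp))) => h hh.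
  have -> : norm (minus (minus (g (f (z + h * v)%C)) (g (f (z + t * v)%C))) (scal (minus h t) (g (d * v)%C)))
     = Rabs (g (f (z + h * v)%C - f (z + t * v)%C - d * ((h - t) * v))%C).
    rewrite /norm /= /abs /= /minus /plus /opp /scal /= /mult /= !g1.
    have -> : (d * ((h - t) * v) = RtoC (h - t) * (d * v))%C by rewrite RtoC_minus; ring.
    rewrite g2; congr Rabs; ring.
  apply: Rle_trans (g3 _) _; apply: Rle_trans hh _ => /=.
  have -> : norm (minus h t) = Rabs (h - t) by [].
  have := Cmod_ge_0 v; have := Rabs_pos (h - t) => a b.
  have e : eps / (Cmod v + 1) * (Cmod v * Rabs (h - t)) = eps * Rabs (h - t) * (Cmod v / (Cmod v + 1)) by field; lra.
  rewrite e.
  have h1 : Cmod v / (Cmod v + 1) <= 1 by apply/Rle_div_l; lra.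
  have h2 : 0 <= eps * Rabs (h - t) by apply: Rmult_le_pos => //; apply: Rlt_le; exact: cond_pos.
  nra.
split.
- apply: (L Re) => //; [by move=> a x; rewrite CRI /=; ring | exact: re_le_Cmod].
- apply: (L Im) => //; [by move=> a x; rewrite CRI /=; ring | exact: im_le_Cmod].
Qed.

Lemma cd_ext (f g : C -> C) z d : (forall w, f w = g w) -> cderiv f z d -> cderiv g z d.
Proof. by move=> h; apply: is_derive_ext. Qed.

(** Project the curve on the direction (p, q) of its total increment: the real mean value theorem
    applies to p u + q v, and Cauchy-Schwarz bounds its derivative by |(p, q)| B. *)
Lemma mvt_C (u v du dv : R -> R) (a b B : R) : a <= b ->
  (forall t, a <= t <= b -> is_derive u t (du t) /\ is_derive v t (dv t)) ->
  (forall t, a <= t <= b -> Cmod (du t, dv t) <= B) ->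
  Cmod (u b - u a, v b - v a) <= B * (b - a).
Proof.
move=> ab Hd HB.
set p := u b - u a; set q := v b - v a.
have [c [hc1 hc2]] : exists c, a <= c <= b /\
   (p * u b + q * v b) - (p * u a + q * v a) = (p * du c + q * dv c) * (b - a).
  have := MVT_gen (fun t => p * u t + q * v t) a b (fun t => p * du t + q * dv t).
  rewrite Rmin_left // Rmax_right //; case.
  - move=> x hx.
    have [h1 h2] : is_derive u x (du x) /\ is_derive v x (dv x) by apply: Hd; lra.
    by apply: (is_derive_plus (fun t => p * u t) (fun t => q * v t)); apply: is_derive_scal.
  - move=> x hx; apply/continuity_pt_filterlim.
    have [h1 h2] : is_derive u x (du x) /\ is_derive v x (dv x) by apply: Hd; lra.
    apply: (ex_derive_continuous (fun t => p * u t + q * v t)); exists (p * du x + q * dv x).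
    by apply: (is_derive_plus (fun t => p * u t) (fun t => q * v t)); apply: is_derive_scal.
  by move=> c [h1 h2]; exists c.
have CS : p * du c + q * dv c <= Cmod (p, q) * Cmod (du c, dv c).
  have -> : p * du c + q * dv c = Re ((p, q) * Cconj (du c, dv c))%C by rewrite /= ; ring.
  apply: Rle_trans (Rle_abs _) _; apply: Rle_trans (re_le_Cmod _) _.
  by rewrite Cmod_mult Cmod_conj; lra.
have hm := HB c hc1.
have e : Cmod (p, q) ^ 2 = (p * du c + q * dv c) * (b - a).
  rewrite -hc2 Cmod2_alt /= /p /q; ring.
have m0 := Cmod_ge_0 (p, q); have m1 := Cmod_ge_0 (du c, dv c).
case: (Req_dec (Cmod (p, q)) 0) => [->|n0]; first by apply: Rmult_le_pos; lra.
apply: (Rmult_le_reg_l (Cmod (p, q))); first lra.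
have : Cmod (p, q) * Cmod (p, q) <= (Cmod (p, q) * Cmod (du c, dv c)) * (b - a).
  have -> : Cmod (p, q) * Cmod (p, q) = Cmod (p, q) ^ 2 by ring.
  by rewrite e; apply: Rmult_le_compat_r; lra.
move=> h; apply: Rle_trans h _.
rewrite Rmult_assoc; apply: Rmult_le_compat_l; first lra.
apply: Rmult_le_compat_r; lra.
Qed.

Lemma mvt_cd (f f' : C -> C) z w B :
  (forall t : R, 0 <= t <= 1 -> cderiv f (z + t * w)%C (f' (z + t * w)%C)) ->
  (forall t : R, 0 <= t <= 1 -> Cmod (f' (z + t * w)%C) <= B) ->
  Cmod (f (z + w) - f z)%C <= B * Cmod w.
Proof.
move=> Hd HB.
have := @mvt_C (fun t : R => Re (f (z + t * w)%C)) (fun t : R => Im (f (z + t * w)%C))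
  (fun t : R => Re (f' (z + t * w) * w)%C) (fun t : R => Im (f' (z + t * w) * w)%C) 0 1 (B * Cmod w) Rle_0_1 _ _.
rewrite Rminus_0_r Rmult_1_r.
have -> : (z + 1 * w = z + w)%C by ring.
have -> : (z + 0 * w = z)%C by ring.
apply.
- by move=> t ht; apply: cd_line; apply: Hd.
- move=> t ht.
  have -> : (Re (f' (z + t * w) * w)%C, Im (f' (z + t * w) * w)%C) = (f' (z + t * w) * w)%C by apply: C_eq.
  rewrite Cmod_mult; apply: Rmult_le_compat_r; [exact: Cmod_ge_0 | exact: HB].
Qed.

(** The mean value inequality, used on f' and then on x -> f(x) - f'(z) x. *)
Lemma taylor2 (f f' f'' : C -> C) z r B :
  (forall w, Cmod w < r -> cderiv f (z + w)%C (f' (z + w)%C)) ->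
  (forall w, Cmod w < r -> cderiv f' (z + w)%C (f'' (z + w)%C)) ->
  (forall w, Cmod w < r -> Cmod (f'' (z + w)%C) <= B) ->
  forall w, Cmod w < r -> Cmod (f (z + w) - f z - f' z * w)%C <= B * Cmod w ^ 2.
Proof.
move=> H1 H2 H3 w hw.
have m0 := Cmod_ge_0 w.
have sm : forall (t : R) x, 0 <= t <= 1 -> Cmod x < r -> Cmod (t * x)%C < r.
  move=> t x ht hx; rewrite Cmod_mult Cmod_R Rabs_pos_eq; last lra.
  have := Cmod_ge_0 x; nra.
have B0 : 0 <= B by apply: Rle_trans (Cmod_ge_0 _) (H3 w hw).
have K : forall x, Cmod x < r -> Cmod (f' (z + x) - f' z)%C <= B * Cmod x.
  move=> x hx; apply: (mvt_cd (f' := f'')) => t ht; [apply: H2 | apply: H3]; exact: sm.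
have := @mvt_cd (fun x => f x - f' z * x)%C (fun x => f' x - f' z)%C z w (B * Cmod w) _ _.
have -> : (f (z + w) - f' z * (z + w) - (f z - f' z * z) = f (z + w) - f z - f' z * w)%C by ring.
move=> h; apply: Rle_trans (h _ _) _; last by right; ring.
- move=> t ht; apply: cd_minus; first by apply: H1; apply: sm.
  by apply: cd_eq (cd_scal _ (cd_id _)) _; ring.
- move=> t ht; apply: Rle_trans (K _ (sm _ _ ht hw)) _.
  apply: Rmult_le_compat_l => //; rewrite Cmod_mult Cmod_R Rabs_pos_eq; nra.
Qed.

Lemma cd_of_taylor (f f' f'' : C -> C) z r B : 0 < r ->
  (forall w, Cmod w < r -> Cmod (f (z + w) - f z - f' z * w)%C <= B * Cmod w ^ 2) -> cderiv f z (f' z).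
Proof. by move=> r0 H; apply: (cd_taylor r0 H). Qed.

(** * Convergent complex series and term-by-term differentiation *)

Definition CSer (u : nat -> C) : C := (Series (fun n => Re (u n)), Series (fun n => Im (u n))).

Lemma sum_n_Re (u : nat -> C) N : Re (sum_n u N) = sum_n (fun n => Re (u n)) N.
Proof.
elim: N => [|N IH]; first by rewrite !sum_O.
by rewrite !sum_Sn -IH.
Qed.
Lemma sum_n_Im (u : nat -> C) N : Im (sum_n u N) = sum_n (fun n => Im (u n)) N.
Proof.
elim: N => [|N IH]; first by rewrite !sum_O.
by rewrite !sum_Sn -IH.
Qed.

Section CSer.
Variables (u : nat -> C) (b : nat -> R).
Hypothesis ub : forall n, Cmod (u n) <= b n.
Hypothesis eb : ex_series b.

Lemma CSer_ex_Re : ex_series (fun n => Re (u n)).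
Proof.
apply: (ex_series_le (fun n => Re (u n)) b) => // n; apply: Rle_trans (ub n).
exact: re_le_Cmod.
Qed.
Lemma CSer_ex_Im : ex_series (fun n => Im (u n)).
Proof.
apply: (ex_series_le (fun n => Im (u n)) b) => // n; apply: Rle_trans (ub n).
exact: im_le_Cmod.
Qed.

Lemma Cmod_sum_n N : Cmod (sum_n u N) <= sum_n b N.
Proof.
elim: N => [|N IH]; first by rewrite !sum_O.
rewrite !sum_Sn; apply: Rle_trans (Cmod_triangle _ _) _; exact: Rplus_le_compat.
Qed.

Lemma b_nonneg n : 0 <= b n. Proof. exact: Rle_trans (Cmod_ge_0 _) (ub n). Qed.

Lemma sum_n_le_Series N : sum_n b N <= Series b.
Proof.
have h := Series_correct _ eb.
apply: (is_lim_seq_incr_compare (sum_n b)) => // n.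
rewrite sum_Sn; rewrite /plus /=; have := b_nonneg n.+1; lra.
Qed.

(** A violation of the triangle inequality by 4d would already show on a partial sum whose real and
    imaginary parts are within d of their limits. *)
Lemma CSer_bound : Cmod (CSer u) <= Series b.
Proof.
have h1 : is_lim_seq (sum_n (fun n => Re (u n))) (Series (fun n => Re (u n))) := Series_correct _ CSer_ex_Re.
have h2 : is_lim_seq (sum_n (fun n => Im (u n))) (Series (fun n => Im (u n))) := Series_correct _ CSer_ex_Im.
apply: Rnot_lt_le => h.
set d := (Cmod (CSer u) - Series b) / 4.
have d0 : 0 < d by rewrite /d; lra.
have [N1 H1] := (proj2 (is_lim_seq_spec _ _) h1 (mkposreal _ d0)).
have [N2 H2] := (proj2 (is_lim_seq_spec _ _) h2 (mkposreal _ d0)).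
set N := (N1 + N2)%coq_nat.
have a1 := H1 N (Nat.le_add_r _ _). have a2 := H2 N (Nat.le_add_l _ _).
rewrite /= -sum_n_Re in a1; rewrite /= -sum_n_Im in a2.
have := Cmod_triangle (sum_n u N) (CSer u - sum_n u N)%C.
have -> : (sum_n u N + (CSer u - sum_n u N) = CSer u)%C by ring.
have := Cmod_le_ReIm (CSer u - sum_n u N)%C.
rewrite Re_minus Im_minus /= => a3.
rewrite (Rabs_minus_sym (Series _)) (Rabs_minus_sym (Series _)) in a3.
have := Cmod_sum_n N; have := sum_n_le_Series N.
have : Cmod (CSer u) = Series b + 4 * d by rewrite /d; field.
rewrite /= in a1 a2 *. lra.
Qed.

End CSer.

Lemma CSer_lin (u v : nat -> C) (c : C) : ex_series (fun n => Re (u n)) -> ex_series (fun n => Im (u n)) ->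
  ex_series (fun n => Re (v n)) -> ex_series (fun n => Im (v n)) ->
  CSer (fun n => u n + c * v n)%C = (CSer u + c * CSer v)%C.
Proof.
move=> h1 h2 h3 h4; apply: C_eq; rewrite /= /Cplus /Cmult /=.
- rewrite (Series_plus _ (fun n => Re c * Re (v n) - Im c * Im (v n))) //.
    rewrite Series_minus; try by apply: (ex_series_scal (K:=R_AbsRing)).
    by rewrite !Series_scal_l.
  by apply: (ex_series_minus (K:=R_AbsRing)); apply: (ex_series_scal (K:=R_AbsRing)).
- rewrite (Series_plus _ (fun n => Re c * Im (v n) + Im c * Re (v n))) //.
    rewrite Series_plus; try by apply: (ex_series_scal (K:=R_AbsRing)).
    by rewrite !Series_scal_l.
  by apply: (ex_series_plus (K:=R_AbsRing)); apply: (ex_series_scal (K:=R_AbsRing)).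
Qed.

Lemma CSer_ext (u v : nat -> C) : (forall n, u n = v n) -> CSer u = CSer v.
Proof. by move=> h; apply: C_eq; rewrite /=; apply: Series_ext => n; rewrite h. Qed.

(* Term-by-term differentiation, from a summable bound on second derivatives. *)
Lemma CSer_cd (f f' f'' : nat -> C -> C) z r (b0 b1 b2 : nat -> R) : 0 < r ->
  ex_series b0 -> ex_series b1 -> ex_series b2 ->
  (forall n w, Cmod w < r -> cderiv (f n) (z + w)%C (f' n (z + w)%C)) ->
  (forall n w, Cmod w < r -> cderiv (f' n) (z + w)%C (f'' n (z + w)%C)) ->
  (forall n w, Cmod w < r -> Cmod (f n (z + w)%C) <= b0 n) ->
  (forall n, Cmod (f' n z) <= b1 n) ->
  (forall n w, Cmod w < r -> Cmod (f'' n (z + w)%C) <= b2 n) ->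
  cderiv (fun s => CSer (fun n => f n s)) z (CSer (fun n => f' n z)).
Proof.
move=> r0 e0 e1 e2 H0 H1 B0 B1 B2.
apply: (cd_taylor (r := r) (B := Series b2)) => // w hw.
have z0 : forall n, Cmod (f n z) <= b0 n.
  by move=> n; have := B0 n 0%C; rewrite Cplus_0_r Cmod_0; apply.
have T := fun n => taylor2 (H0 n) (H1 n) (B2 n) hw.
have x1 := CSer_ex_Re (fun n => B0 n w hw) e0. have x2 := CSer_ex_Im (fun n => B0 n w hw) e0.
have x3 := CSer_ex_Re z0 e0. have x4 := CSer_ex_Im z0 e0.
have x5 := CSer_ex_Re B1 e1. have x6 := CSer_ex_Im B1 e1.
have E : CSer (fun n => f n (z + w) - f n z - f' n z * w)%C =
  (CSer (fun n => f n (z + w)) - CSer (fun n => f n z) - CSer (fun n => f' n z) * w)%C.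
  have -> : (CSer (fun n => f n (z + w)) - CSer (fun n => f n z) - CSer (fun n => f' n z) * w =
     (CSer (fun n => f n (z + w)) + (- (1)) * CSer (fun n => f n z)) + (- w) * CSer (fun n => f' n z))%C by ring.
  rewrite -CSer_lin // -CSer_lin //; first by apply: CSer_ext => n; ring.
  - apply: (ex_series_ext (fun n => Re (f n (z + w)%C) - Re (f n z))).
      by move=> n; rewrite !CRI /=; ring.
    by apply: (ex_series_minus (K:=R_AbsRing)).
  - apply: (ex_series_ext (fun n => Im (f n (z + w)%C) - Im (f n z))).
      by move=> n; rewrite !CRI /=; ring.
    by apply: (ex_series_minus (K:=R_AbsRing)).
rewrite -E.
have := CSer_bound T.
rewrite Series_scal_r => h; apply: h.
exact: ex_series_scal_r.
Qed.

(** Induction on j: the derivative of (j+1)! e^t - t^(j+1) is j + 1 times the same expression at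
    j. *)
Lemma pow_le_exp (j : nat) x : 0 <= x -> x ^ j <= INR (fact j) * exp x.
Proof.
elim: j x => [|j IH] x hx.
  rewrite /= Rmult_1_l; have := exp_ineq1_le x; lra.
have := MVT_gen (fun t => INR (fact j.+1) * exp t - t ^ j.+1) 0 x
  (fun t => INR (fact j.+1) * exp t - INR j.+1 * t ^ j).
rewrite Rmin_left // Rmax_right //; case.
- move=> t ht; auto_derive => //; rewrite -/(INR j.+1) /=; ring.
- move=> t ht; apply/continuity_pt_filterlim; apply: (ex_derive_continuous (fun t => INR (fact j.+1) * exp t - t ^ j.+1)).
  by auto_derive.
move=> c [h1 h2].
have h3 : 0 <= INR (fact j.+1) * exp c - INR j.+1 * c ^ j.
  have := IH c (proj1 h1) => h.
  rewrite fact_simpl mult_INR; have := pos_INR j.+1 => hp; nra.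
have : 0 <= (INR (fact j.+1) * exp c - INR j.+1 * c ^ j) * (x - 0) by apply: Rmult_le_pos; lra.
rewrite -h2 exp_0 Rmult_1_r pow_i; last by lia.
have := pos_INR (fact j.+1); lra.
Qed.

(** * Dirichlet series summed by parts *)

Lemma ln_le_sub1 x : 0 < x -> ln x <= x - 1.
Proof. move=> h; have := exp_ineq1_le (ln x); rewrite exp_ln //; lra. Qed.

(** n^(-x), with the value 0 at n = 0 so that sums may start there. *)
Definition pw (x : R) (n : nat) : R := if n is 0 then 0 else exp (- x * lnN n).

Lemma pw_ge0 x n : 0 <= pw x n.
Proof. case: n => [|n]; rewrite /pw; [lra | exact/exp_ge0]. Qed.

Lemma ln_succ n : (1 <= n)%N -> 0 <= lnN n /\ lnN n <= lnN n.+1 <= lnN n + / INR n.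
Proof.
move=> h; have hn : 1 <= INR n by apply: (le_INR 1); lia.
have h1 : lnN n.+1 = lnN n + ln (1 + / INR n).
  rewrite -ln_mult; try lra; last by have := Rinv_0_lt_compat (INR n); lra.
  congr ln; rewrite S_INR; field; lra.
have i0 : 0 < / INR n by apply: Rinv_0_lt_compat; lra.
split; first by rewrite -ln_1; apply: ln_le; lra.
have h2 : ln (1 + / INR n) <= / INR n.
  have := @ln_le_sub1 (1 + / INR n); lra.
have h3 : 0 <= ln (1 + / INR n) by rewrite -ln_1; apply: ln_le; lra.
lra.
Qed.

Lemma ln_INR_le m n : (1 <= m)%N -> (m <= n)%N -> lnN m <= lnN n.
Proof. by move=> h1 h2; apply: ln_le; [apply: lt_0_INR; lia | apply: le_INR; lia]. Qed.

(** Integral comparison in discrete form: log((n+1)/n) >= 1/(n+1), hence n^(-k) - (n+1)^(-k) >= k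
    (n+1)^(-1-k). *)
Lemma pw_telescope k n : 0 < k -> (1 <= n)%N -> pw (1 + k) n.+1 <= / k * (pw k n - pw k n.+1).
Proof.
move=> k0 hn; have [a [b c]] := ln_succ hn.
case: n hn a b c => // n _ a b c.
have hn : 1 <= INR n.+1 by apply: (le_INR 1); lia.
have N0 : 0 < INR n.+2 by apply: lt_0_INR; lia.
rewrite /pw.
set u := lnN n.+1 in a b c *; set v := lnN n.+2 in b c *.
have e : exp (- (1 + k) * v) = exp (- k * v) * / INR n.+2.
  have -> : - (1 + k) * v = - k * v + - v by ring.
  by rewrite exp_plus (exp_Ropp v) exp_ln.
have e2 : exp (- k * u) = exp (- k * v) * exp (k * (v - u)) by rewrite -exp_plus; congr exp; ring.
rewrite e e2.
have h := exp_ineq1_le (k * (v - u)).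
have hv : / INR n.+2 <= v - u.
  have : ln (INR n.+1 / INR n.+2) <= INR n.+1 / INR n.+2 - 1.
    by apply: ln_le_sub1; apply: Rdiv_lt_0_compat; lra.
  rewrite ln_div; try lra; rewrite -/u -/v.
  have -> : INR n.+1 / INR n.+2 - 1 = - / INR n.+2 by rewrite (S_INR n.+1); field; rewrite -S_INR; lra.
  lra.
have E := exp_pos (- k * v).
have -> : / k * (exp (- k * v) * exp (k * (v - u)) - exp (- k * v)) = exp (- k * v) * (/ k * (exp (k * (v - u)) - 1)) by ring.
apply: Rmult_le_compat_l; first lra.
apply: Rle_trans hv _.
apply: (Rmult_le_reg_l k) => //; rewrite -Rmult_assoc Rinv_r; lra.
Qed.

Lemma pw_sum_le k N : 0 < k -> sum_n (pw (1 + k)) N <= 1 + / k.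
Proof.
move=> k0; have i0 := Rinv_0_lt_compat k k0.
have P : forall n, sum_n (pw (1 + k)) n.+1 <= 1 + / k * (1 - pw k n.+1).
  elim=> [|n IH].
    by rewrite sum_Sn sum_O /pw /plus /= ln_1 !Rmult_0_r exp_0; lra.
  rewrite sum_Sn; have := @pw_telescope k n.+1 k0 isT => h.
  apply: Rle_trans (Rplus_le_compat _ _ _ _ IH h) _; lra.
case: N => [|n]; first by rewrite sum_O /=; lra.
have := pw_ge0 k n.+1; have := P n => a b; nra.
Qed.

Lemma ex_series_pw k : 0 < k -> ex_series (pw (1 + k)).
Proof.
move=> k0; have : ex_finite_lim_seq (sum_n (pw (1 + k))).
  apply: (ex_finite_lim_seq_incr _ (1 + / k)) => n.
    rewrite sum_Sn -[X in X <= _]Rplus_0_r; apply: Rplus_le_compat_l; exact: pw_ge0.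
  exact: pw_sum_le.
by [].
Qed.

Lemma Series_pw_le k : 0 < k -> Series (pw (1 + k)) <= 1 + / k.
Proof.
move=> k0; have h : is_lim_seq (sum_n (pw (1 + k))) (Series (pw (1 + k))) := Series_correct _ (ex_series_pw k0).
have := is_lim_seq_le _ (fun _ => 1 + / k) _ _ (fun n => pw_sum_le n k0) h (is_lim_seq_const _).
by [].
Qed.

(** The j-th derivative in s of n^(-s). *)
Definition fj (j n : nat) (s : C) : C := (RtoC ((- lnN n) ^ j) * cexp (- s * lnN n))%C.
Definition Tn (j n : nat) (s : C) : C := (fj j n s - fj j n.+1 s)%C.
Fixpoint Sp (a : nat -> R) (N : nat) : R := if N is n.+1 then Sp a n + a n.+1 else 0.
(** The j-th derivative of the Dirichlet series of [a], in the form produced by partial summation.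
    It converges absolutely for Re s > th as soon as [Sp a n] is O(n^th), which for a non-principal
    character covers Re s > 0. *)
Definition DS (a : nat -> R) (j : nat) (s : C) : C := CSer (fun n => Sp a n * Tn j n s)%C.
Definition dterm (a : nat -> R) (j : nat) (s : C) (n : nat) : C := if n is 0 then 0 else (a n * fj j n s)%C.
Definition dps (a : nat -> R) (j : nat) (s : C) (N : nat) : C := sum_n (dterm a j s) N.

(** Along the segment from 0 to w the second derivative of t -> e^(tw) has modulus at most e |w|^2
    <= 3 |w|^2, and two mean value inequalities turn this into a quadratic remainder. *)
Lemma cd_cexp z : cderiv cexp z (cexp z).
Proof.
apply: (cd_taylor (r := 1) (B := exp (Re z) * 10)) => [|w hw]; first lra.
have -> : (cexp (z + w) - cexp z - cexp z * w = cexp z * (cexp w - 1 - w))%C by rewrite cexp_plus; ring.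
rewrite Cmod_mult Cmod_cexp Rmult_assoc; apply: Rmult_le_compat_l; first exact/exp_ge0.
have m0 := Cmod_ge_0 w.
have hr := re_le_Cmod w; have hi := im_le_Cmod w.
set u := Re w in hr *; set v := Im w in hi *.
pose re (t : R) := exp (t * u) * cos (t * v) - 1 - t * u.
pose im (t : R) := exp (t * u) * sin (t * v) - t * v.
pose re1 (t : R) := exp (t * u) * (u * cos (t * v) - v * sin (t * v)) - u.
pose im1 (t : R) := exp (t * u) * (u * sin (t * v) + v * cos (t * v)) - v.
pose re2 (t : R) := exp (t * u) * ((u * u - v * v) * cos (t * v) - 2 * u * v * sin (t * v)).
pose im2 (t : R) := exp (t * u) * ((u * u - v * v) * sin (t * v) + 2 * u * v * cos (t * v)).
have A2 : forall t, 0 <= t <= 1 -> Cmod (re2 t, im2 t) <= 3 * Cmod w ^ 2.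
  move=> t ht.
  have -> : (re2 t, im2 t) = (cexp (t * w) * (w * w))%C.
    by apply: C_eq; rewrite /re2 /im2 /cexp !CRI /=; rewrite -/u -/v !Rmult_0_l !Rminus_0_r ?Rplus_0_r /u /v /Re /Im /=; ring.
  rewrite Cmod_mult Cmod_cexp Cmod_mult.
  have -> : Cmod w ^ 2 = Cmod w * Cmod w by ring.
  apply: Rmult_le_compat_r; first nra.
  rewrite !CRI -/u Rmult_0_l Rminus_0_r.
  have : exp (t * u) <= exp 1.
    have : t * u <= 1 by have := Rle_abs u; nra.
    by case => [/exp_increasing|->]; lra.
  have := exp_le_3; lra.
have A1 : forall t, 0 <= t <= 1 -> Cmod (re1 t, im1 t) <= 3 * Cmod w ^ 2.
  move=> t ht.
  have := @mvt_C re1 im1 re2 im2 0 t (3 * Cmod w ^ 2) (proj1 ht) _ _.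
  have -> : re1 0 = 0 by rewrite /re1 !Rmult_0_l exp_0 cos_0 sin_0; ring.
  have -> : im1 0 = 0 by rewrite /im1 !Rmult_0_l exp_0 cos_0 sin_0; ring.
  rewrite !Rminus_0_r => h; apply: Rle_trans (h _ _) _.
  - by move=> x hx; split; rewrite /re1 /im1 /re2 /im2; auto_derive => //; ring.
  - by move=> x hx; apply: A2; lra.
  - nra.
have := @mvt_C re im re1 im1 0 1 (3 * Cmod w ^ 2) Rle_0_1 _ _.
have -> : re 0 = 0 by rewrite /re !Rmult_0_l exp_0 cos_0; ring.
have -> : im 0 = 0 by rewrite /im !Rmult_0_l exp_0 sin_0; ring.
rewrite !Rminus_0_r => h.
have -> : (cexp w - 1 - w)%C = (re 1, im 1).
  by apply: C_eq; rewrite /re /im /cexp !CRI /= !Rmult_1_l -/u -/v; rewrite /u /v /Re /Im /=; ring.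
apply: Rle_trans (h _ _) _; last nra.
- by move=> x hx; split; rewrite /re1 /im1 /re /im; auto_derive => //; ring.
- by move=> x hx; apply: A1.
Qed.

Lemma fj_cd j n s : cderiv (fj j n) s (fj j.+1 n s).
Proof.
apply: cd_eq (cd_scal _ (cd_comp (f := cexp) (g := fun w => (- w * lnN n)%C) (cd_cexp _) (e := (- lnN n)%C) _)) _.
  apply: (cd_ext (f := fun w => ((- lnN n) * w + 0)%C)); first by move=> w; ring.
  exact: cd_lin.
by rewrite /fj /= RtoC_mult RtoC_opp; ring.
Qed.

Lemma Tn_cd j n s : cderiv (Tn j n) s (Tn j.+1 n s).
Proof. apply: cd_minus; exact: fj_cd. Qed.

(** Mean value inequality for x -> (-x)^j e^(-sx) between log n and log(n+1), an interval of length
    at most 1/n. *)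
Lemma Cmod_le_pw (j n : nat) s : (1 <= n)%N -> 0 <= Re s ->
  Cmod (Tn j n s) <= (INR j + Cmod s) * (1 + lnN n.+1) ^ j * exp (- Re s * lnN n) * / INR n.
Proof.
move=> hn hs; have [l0 [l1 l2]] := ln_succ hn.
set u := lnN n in l0 l1 l2 *; set v := lnN n.+1 in l1 l2 *.
pose g (w : C) : C := (RtoC (1) * ((- w) ^ j) * cexp (- s * w))%C.
pose g' (w : C) : C := ((- INR j) * (- w) ^ (j.-1) * cexp (- s * w) + (- w) ^ j * (- s * cexp (- s * w)))%C.
have pd : forall w i, cderiv (fun w => (- w) ^ i)%C w ((- INR i) * (- w) ^ (i.-1))%C.
  move=> w; elim=> [|i IH]; first by apply: cd_eq (cd_const _ _) _; rewrite /=; ring.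
  apply: cd_eq (cd_mult (cd_opp (cd_id w)) IH) _.
  case: i {IH} => [|i]; rewrite /= ; first by ring.
  rewrite -/(INR i.+1) RtoC_plus; ring.
have gd : forall w, cderiv g w (g' w).
  move=> w; rewrite /g /g'.
  apply: (cd_ext (f := fun w => ((- w) ^ j * cexp (- s * w))%C)); first by move=> x; rewrite Cmult_1_l.
  apply: cd_mult; first exact: pd.
  apply: cd_comp; first exact: cd_cexp.
  apply: (cd_ext (f := fun w => ((- s) * w + 0)%C)); first by move=> x; ring.
  exact: cd_lin.
have E : forall x, fj j x s = g (RtoC (lnN x)).
  by move=> x; rewrite /fj /g RtoC_pow RtoC_opp; ring.
rewrite /Tn !E -/u -/v Cmod_minus_sym.
have -> : RtoC v = (RtoC u + RtoC (v - u))%C by rewrite RtoC_minus; ring.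
apply: Rle_trans (mvt_cd (f' := g') (B := (INR j + Cmod s) * (1 + v) ^ j * exp (- Re s * u)) _ _) _.
- by move=> t ht.
- move=> t ht.
  have -> : (u + t * RtoC (v - u))%C = RtoC (u + t * (v - u)) by rewrite RtoC_plus RtoC_mult.
  set x := u + t * (v - u).
  have hx : u <= x <= v by rewrite /x; nra.
  have hpow : forall i, (i <= j)%N -> x ^ i <= (1 + v) ^ j.
    move=> i hi; apply: (Rle_trans _ ((1 + v) ^ i)); first by apply: pow_incr; lra.
    by apply: Rle_pow; [lra | lia].
  have hc : Cmod (cexp (- s * x)) <= exp (- Re s * u).
    rewrite Cmod_cexp !CRI.
    have -> : - Re s * x - - Im s * 0 = - (Re s * x) by ring.
    have : - (Re s * x) <= - Re s * u by nra.
    by case=> [/exp_increasing|->]; lra.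
  have px : forall i, Cmod ((- RtoC x) ^ i) = x ^ i.
    by move=> i; rewrite Cmod_pow Cmod_opp Cmod_R Rabs_pos_eq //; lra.
  have c0 := Cmod_ge_0 (cexp (- s * x)). have s0 := Cmod_ge_0 s.
  apply: Rle_trans (Cmod_triangle _ _) _; rewrite !Cmod_mult !px Cmod_opp Cmod_opp Cmod_R Rabs_pos_eq; last exact: pos_INR.
  have p1 := hpow j.-1 (leq_pred j). have p2 := hpow j (leqnn j).
  have q1 : 0 <= x ^ j.-1 by apply: pow_le; lra. have q2 : 0 <= x ^ j by apply: pow_le; lra.
  have J := pos_INR j.
  have r1 : INR j * x ^ j.-1 * Cmod (cexp (- s * x)) <= INR j * (1 + v) ^ j * exp (- Re s * u).
    by apply: Rmult_le_compat => //; [apply: Rmult_le_pos | apply: Rmult_le_compat_l].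
  have r2 : x ^ j * (Cmod s * Cmod (cexp (- s * x))) <= (1 + v) ^ j * (Cmod s * exp (- Re s * u)).
    by apply: Rmult_le_compat => //; [apply: Rmult_le_pos | apply: Rmult_le_compat_l].
  lra.
- rewrite Cmod_R Rabs_pos_eq; last lra.
  apply: Rmult_le_compat_l; last lra.
  apply: Rmult_le_pos; last exact/exp_ge0.
  apply: Rmult_le_pos; last by apply: pow_le; lra.
  have := pos_INR j; have := Cmod_ge_0 s; lra.
Qed.

Definition sum_growth (a : nat -> R) (B th : R) :=
  forall n, (1 <= n)%N -> Rabs (Sp a n) <= B * exp (th * lnN n).

(** Powers of the logarithm are absorbed in n^k through y^j <= j! e^y at y = k (1 + log(n+1)). *)
Lemma log_pow_le (j n : nat) k : 0 < k -> (1 <= n)%N ->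
  (1 + lnN n.+1) ^ j <= INR (fact j) * (/ k) ^ j * exp (2 * k) * exp (k * lnN n).
Proof.
move=> k0 hn; have [l0 [l1 l2]] := ln_succ hn.
have hi : / INR n <= 1.
  rewrite -Rinv_1; apply: Rinv_le_contravar; first lra; apply: (le_INR 1); lia.
set y := 1 + lnN n.+1.
have y0 : 0 <= y by rewrite /y; lra.
have k1 := Rinv_0_lt_compat k k0.
have := @pow_le_exp j (k * y) (Rmult_le_pos _ _ (Rlt_le _ _ k0) y0).
rewrite Rpow_mult_distr => h.
have e : y ^ j = (/ k) ^ j * (k ^ j * y ^ j).
  by rewrite -Rmult_assoc -Rpow_mult_distr Rinv_l ?pow1; lra.
rewrite e.
have -> : INR (fact j) * (/ k) ^ j * exp (2 * k) * exp (k * lnN n) =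
  (/ k) ^ j * (INR (fact j) * (exp (2 * k + k * lnN n))) by rewrite exp_plus; ring.
apply: Rmult_le_compat_l; first by apply: pow_le; lra.
apply: Rle_trans h _; apply: Rmult_le_compat_l; first exact: pos_INR.
have : k * y <= 2 * k + k * lnN n by rewrite /y; nra.
by case=> [/exp_increasing|->]; lra.
Qed.

(** Constant of the termwise bound for [DS] when |s| <= m and Re s exceeds the growth exponent by at
    least 2k. *)
Definition DSK (B : R) (j : nat) (k m : R) : R :=
  B * (INR j + m) * (INR (fact j) * (/ k) ^ j * exp (2 * k)).

Section DS.
Variables (a : nat -> R) (B th : R).
Hypothesis B0 : 0 <= B.
Hypothesis aB : sum_growth a B th.
Hypothesis th0 : 0 <= th.

Lemma DS_term_bound j n s k m : 0 < k -> th + 2 * k <= Re s -> Cmod s <= m ->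
  Cmod (Sp a n * Tn j n s)%C <= DSK B j k m * pw (1 + k) n.
Proof.
move=> k0 hs hm; case: n => [|n]; first by rewrite /= Cmult_0_l Cmod_0; lra.
rewrite Cmod_mult Cmod_R.
have h1 := aB (n:=n.+1) isT.
have h2 := @Cmod_le_pw j n.+1 s isT _.
have {}h2 := h2 (ltac:(lra)).
have h3 := @log_pow_le j n.+1 k k0 isT.
have s0 := Cmod_ge_0 s. have J := pos_INR j.
set u := lnN n.+1 in h1 h2 h3 *.
have u0 : 0 <= u by have [] := @ln_succ n.+1 isT.
have i0 : 0 < / INR n.+1 by apply: Rinv_0_lt_compat; apply: lt_0_INR; lia.
have ei : / INR n.+1 = exp (- u) by rewrite /u exp_Ropp exp_ln //; apply: lt_0_INR; lia.
rewrite ei in h2.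
have L0 : 0 <= 1 + lnN n.+2.
  have [x [y z]] := @ln_succ n.+1 isT; lra.
have step : Cmod (Tn j n.+1 s) <= (INR j + m) * (INR (fact j) * (/ k) ^ j * exp (2 * k)) * (exp (k * u) * (exp (- Re s * u) * exp (- u))).
  apply: Rle_trans h2 _.
  rewrite !Rmult_assoc; apply: Rmult_le_compat; try lra.
    apply: Rmult_le_pos; first exact: pow_le.
    by apply: Rmult_le_pos; apply/exp_ge0.
  rewrite -!Rmult_assoc; apply: Rmult_le_compat_r; first by apply/exp_ge0.
  apply: Rmult_le_compat_r; first by apply/exp_ge0.
  by rewrite !Rmult_assoc in h3 *.
have c0 : 0 <= (INR j + m) * (INR (fact j) * (/ k) ^ j * exp (2 * k)).
  apply: Rmult_le_pos; first lra.
  apply: Rmult_le_pos; last by apply/exp_ge0.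
  by apply: Rmult_le_pos; [exact: pos_INR | apply: pow_le; have := Rinv_0_lt_compat k k0; lra].
apply: (Rle_trans _ (B * exp (th * u) * ((INR j + m) * (INR (fact j) * (/ k) ^ j * exp (2 * k)) * (exp (k * u) * (exp (- Re s * u) * exp (- u)))))).
  by apply: Rmult_le_compat => //; [exact: Rabs_pos | exact: Cmod_ge_0].
have -> : B * exp (th * u) * ((INR j + m) * (INR (fact j) * (/ k) ^ j * exp (2 * k)) * (exp (k * u) * (exp (- Re s * u) * exp (- u)))) =
 DSK B j k m * exp (th * u + (k * u + (- Re s * u + - u))) by rewrite !exp_plus /DSK; ring.
apply: Rmult_le_compat_l; first by rewrite /DSK Rmult_assoc; apply: Rmult_le_pos.
have : th * u + (k * u + (- Re s * u + - u)) <= - (1 + k) * u by nra.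
by rewrite /pw -/u; case=> [/exp_increasing|->]; lra.
Qed.

Lemma DS_bound j s k : 0 < k -> th + 2 * k <= Re s -> Cmod (DS a j s) <= DSK B j k (Cmod s) * (1 + / k).
Proof.
move=> k0 hs.
have h := CSer_bound (fun n => DS_term_bound j n k0 hs (Rle_refl _))
   (ex_series_scal_l (DSK B j k (Cmod s)) _ (ex_series_pw k0)).
apply: Rle_trans h _; rewrite Series_scal_l; apply: Rmult_le_compat_l; last exact: Series_pw_le.
rewrite /DSK; apply: Rmult_le_pos.
  by apply: Rmult_le_pos => //; have := pos_INR j; have := Cmod_ge_0 s; lra.
apply: Rmult_le_pos; last by apply/exp_ge0.
by apply: Rmult_le_pos; [exact: pos_INR | apply: pow_le; have := Rinv_0_lt_compat k k0; lra].
Qed.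

Lemma DS_cd j s : th < Re s -> cderiv (DS a j) s (DS a j.+1 s).
Proof.
(* A quarter of the distance to the line Re s = th: the disc of radius 2k about s stays at distance
   2k from that line. *)
move=> hs; set k := (Re s - th) / 4.
have k0 : 0 < k by rewrite /k; lra.
have hk : th + 4 * k = Re s by rewrite /k; field.
set m := Cmod s + 2 * k.
have near : forall w, Cmod w < 2 * k -> th + 2 * k <= Re (s + w)%C /\ Cmod (s + w)%C <= m.
  move=> w hw; split.
    by rewrite Re_plus; have := re_le_Cmod w; have := Rle_abs (- Re w); rewrite Rabs_Ropp; lra.
  by apply: Rle_trans (Cmod_triangle _ _) _; rewrite /m; lra.
have near0 : th + 2 * k <= Re s /\ Cmod s <= m by split; rewrite /m; lra.
apply: (@CSer_cd _ (fun n w => (Sp a n * Tn j.+1 n w)%C) (fun n w => (Sp a n * Tn j.+2 n w)%C) s (2 * k)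
   (fun n => DSK B j k m * pw (1 + k) n) (fun n => DSK B j.+1 k m * pw (1 + k) n)
   (fun n => DSK B j.+2 k m * pw (1 + k) n)); try (apply: ex_series_scal_l; exact: ex_series_pw).
- lra.
- by move=> n w hw; apply: cd_scal; exact: Tn_cd.
- by move=> n w hw; apply: cd_scal; exact: Tn_cd.
- by move=> n w /near [h1 h2]; apply: DS_term_bound.
- by move=> n; case: near0 => h1 h2; apply: DS_term_bound.
- by move=> n w /near [h1 h2]; apply: DS_term_bound.
Qed.

Lemma dps_abel (b : nat -> R) j s N : dps b j s N = (sum_n (fun n => Sp b n * Tn j n s) N + Sp b N * fj j N.+1 s)%C.
Proof.
elim: N => [|N IH].
  by rewrite /dps !sum_O /=; ring.
rewrite /dps !sum_Sn -/(dps b j s N) IH.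
rewrite /plus /= /Tn RtoC_plus; ring.
Qed.

Lemma DS_lim j s : th < Re s -> forall eps, 0 < eps -> exists N0, forall N, (N0 <= N)%N -> Cmod (dps a j s N - DS a j s)%C < eps.
Proof.
move=> hs eps e0; set k := (Re s - th) / 4.
have k0 : 0 < k by rewrite /k; lra.
have hk : th + 4 * k = Re s by rewrite /k; field.
have hs2 : th + 2 * k <= Re s by lra.
have tb := fun n => DS_term_bound j n k0 hs2 (Rle_refl _).
have es := ex_series_scal_l (DSK B j k (Cmod s)) _ (ex_series_pw k0).
have h1 : is_lim_seq (sum_n (fun n => Re (Sp a n * Tn j n s)%C)) (Re (DS a j s)) := Series_correct _ (CSer_ex_Re tb es).
have h2 : is_lim_seq (sum_n (fun n => Im (Sp a n * Tn j n s)%C)) (Im (DS a j s)) := Series_correct _ (CSer_ex_Im tb es).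
have e3 : 0 < eps / 3 by lra.
have [N1 H1] := (proj2 (is_lim_seq_spec _ _) h1 (mkposreal _ e3)).
have [N2 H2] := (proj2 (is_lim_seq_spec _ _) h2 (mkposreal _ e3)).
(* the boundary term is at most [K * n^{-2k}] *)
set K := B * (INR (fact j) * (/ k) ^ j * exp (2 * k)).
have K0 : 0 <= K.
  apply: Rmult_le_pos => //; apply: Rmult_le_pos; last by apply/exp_ge0.
  by apply: Rmult_le_pos; [exact: pos_INR | apply: pow_le; have := Rinv_0_lt_compat k k0; lra].
have bt : forall n, (1 <= n)%N -> Cmod (Sp a n * fj j n.+1 s)%C <= K * exp (- k * lnN n).
  move=> n hn; have [l0 [l1 l2]] := ln_succ hn.
  rewrite !Cmod_mult !Cmod_R Cmod_cexp -RPow_abs Rabs_Ropp (Rabs_pos_eq (ln _)); last lra.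
  have a1 := aB hn. have a2 := @log_pow_le j n k k0 hn.
  have a3 : lnN n.+1 ^ j <= (1 + lnN n.+1) ^ j by apply: pow_incr; lra.
  have a4 : exp (Re (- s * lnN n.+1)%C) <= exp (- Re s * lnN n).
    rewrite !CRI.
    have : - Re s * lnN n.+1 - - Im s * 0 <= - Re s * lnN n by nra.
    by case=> [/exp_increasing|->]; lra.
  set u := lnN n in l0 l1 l2 a1 a2 a4 *.
  apply: (Rle_trans _ ((B * exp (th * u)) * ((INR (fact j) * (/ k) ^ j * exp (2 * k) * exp (k * u)) * exp (- Re s * u)))).
    apply: Rmult_le_compat => //; first exact: Rabs_pos.
      by apply: Rmult_le_pos; [apply: pow_le; lra | apply/exp_ge0].
    apply: Rmult_le_compat => //; [by apply: pow_le; lra | by apply/exp_ge0 | by lra].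
  have -> : (B * exp (th * u)) * ((INR (fact j) * (/ k) ^ j * exp (2 * k) * exp (k * u)) * exp (- Re s * u))
    = K * exp (th * u + (k * u + - Re s * u)) by rewrite !exp_plus /K; ring.
  apply: Rmult_le_compat_l => //.
  have ku : 0 <= k * u by apply: Rmult_le_pos; lra.
  have : th * u + (k * u + - Re s * u) <= - k * u by rewrite -hk; nra.
  by case=> [/exp_increasing|->]; lra.
have [N3 H3] : exists N3, forall n, (N3 <= n)%N -> K * exp (- k * lnN n) < eps / 3.
  have [n0 hn0] := nfloor_ex (exp (/ k * (1 + K / (eps / 3)))) (Rlt_le _ _ (exp_pos _)).
  exists n0.+1 => n hn.
  have hl : / k * (1 + K / (eps / 3)) < lnN n.
    rewrite -[X in X < _]ln_exp; apply: ln_increasing; first exact: exp_pos.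
    apply: Rlt_le_trans (proj2 hn0) _; rewrite -S_INR; apply: le_INR; lia.
  have hl2 : 1 + K / (eps / 3) < k * lnN n.
    have := Rmult_lt_compat_l _ _ _ k0 hl; rewrite -Rmult_assoc Rinv_r; lra.
  have := exp_ineq1_le (k * lnN n) => h.
  have -> : - k * lnN n = - (k * lnN n) by ring.
  rewrite exp_Ropp; have E := exp_pos (k * lnN n).
  apply/Rlt_div_l => //.
  have -> : K = (K / (eps / 3)) * (eps / 3) by field; lra.
  rewrite Rmult_comm; apply: Rmult_lt_compat_l; lra.
exists (N1 + N2 + N3 + 1)%N => N hN.
have b1 := H1 N (ltac:(lia)). have b2 := H2 N (ltac:(lia)). have b3 := H3 N (ltac:(lia)).
have b4 := bt N (ltac:(lia)).
rewrite dps_abel.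
have -> : (sum_n (fun n => Sp a n * Tn j n s) N + Sp a N * fj j N.+1 s - DS a j s =
  (sum_n (fun n => Sp a n * Tn j n s) N - DS a j s) + Sp a N * fj j N.+1 s)%C by ring.
apply: Rle_lt_trans (Cmod_triangle _ _) _.
have := Cmod_le_ReIm (sum_n (fun n => Sp a n * Tn j n s)%C N - DS a j s)%C.
rewrite !Re_minus !Im_minus sum_n_Re sum_n_Im => c1.
rewrite /= in b1 b2; rewrite /= in c1 *; lra.
Qed.

(** Identifies [DS] with the limit of plain partial sums through which L-functions and zeta are
    defined. *)
Lemma DS_dseries s : th < Re s -> dseries (fun n => RtoC (a n)) s = DS a 0 s.
Proof.
move=> hs; have H := DS_lim 0 hs.
have E : forall N, dpsum (fun n => RtoC (a n)) s N = dps a 0 s N.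
  move=> N; rewrite /dpsum /dps; apply: sum_n_ext => n; rewrite /dterm; case: n => [|n].
    by rewrite /ncpow; apply: C_eq; rewrite !CRI /=; ring.
  rewrite /fj pow_O Cmult_1_l; congr Cmult; rewrite /ncpow /cexp !CRI.
  have -> : - Re s * lnN n.+1 - - Im s * 0 = - Re s * lnN n.+1 by ring.
  have -> : - Re s * 0 + - Im s * lnN n.+1 = - (Im s * lnN n.+1) by ring.
  by rewrite cos_neg sin_neg; apply: C_eq => /=; rewrite /Re /Im /=; ring.
have lim1 : is_lim_seq (fun N => Re (dpsum (fun n => RtoC (a n)) s N)) (Re (DS a 0 s)).
  apply/is_lim_seq_spec => eps; have [N0 h] := H eps (cond_pos eps).
  exists N0 => n hn; rewrite E -Re_minus; apply: Rle_lt_trans (re_le_Cmod _) _; apply: h; lia.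
have lim2 : is_lim_seq (fun N => Im (dpsum (fun n => RtoC (a n)) s N)) (Im (DS a 0 s)).
  apply/is_lim_seq_spec => eps; have [N0 h] := H eps (cond_pos eps).
  exists N0 => n hn; rewrite E -Im_minus; apply: Rle_lt_trans (im_le_Cmod _) _; apply: h; lia.
by rewrite /dseries (is_lim_seq_unique _ _ lim1) (is_lim_seq_unique _ _ lim2); apply: C_eq.
Qed.

End DS.

(** * Maximum principle for holomorphic functions *)

Definition contC (F : C -> R) (z : C) :=
  forall eps, 0 < eps -> exists r, 0 < r /\ forall w, Cmod w < r -> Rabs (F (z + w)%C - F z) < eps.

Definition in_rect (a b c d : R) (z : C) := a <= Re z <= b /\ c <= Im z <= d.

Lemma contC_const k z : contC (fun _ => k) z.
Proof. by move=> e e0; exists 1; split=> [|w _]; rewrite ?Rminus_diag ?Rabs_R0; lra. Qed.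

Lemma contC_ext F G z : (forall w, F w = G w) -> contC F z -> contC G z.
Proof. by move=> h H e e0; have [r [r0 Hr]] := H e e0; exists r; split=> // w hw; rewrite -!h; apply: Hr. Qed.

Lemma contC_comp F z (g : R -> R) : contC F z -> continuity_pt g (F z) -> contC (fun w => g (F w)) z.
Proof.
move=> H hg e e0; have [d [d0 hd]] := hg e e0.
have [r [r0 Hr]] := H d d0; exists r; split=> // w /Hr hw.
case: (Req_dec (F z) (F (z + w)%C)) => [->|ne]; first by rewrite Rminus_diag Rabs_R0.
by apply: (hd (F (z + w)%C)).
Qed.

Lemma contC_plus F G z : contC F z -> contC G z -> contC (fun w => F w + G w) z.
Proof.
move=> h1 h2 e e0; have e2 : 0 < e / 2 by lra.
have [r [r0 Hr]] := h1 _ e2; have [q [q0 Hq]] := h2 _ e2.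
exists (Rmin r q); split; first exact: Rmin_pos.
move=> w hw; have {}Hr := Hr w (Rlt_le_trans _ _ _ hw (Rmin_l _ _)).
have {}Hq := Hq w (Rlt_le_trans _ _ _ hw (Rmin_r _ _)).
have -> : F (z + w)%C + G (z + w)%C - (F z + G z) = (F (z + w)%C - F z) + (G (z + w)%C - G z) by ring.
apply: Rle_lt_trans (Rabs_triang _ _) _; lra.
Qed.

Lemma contC_sqr F z : contC F z -> contC (fun w => F w * F w) z.
Proof.
move=> h; apply: (contC_comp (g := fun x => x * x) h).
apply/continuity_pt_filterlim; apply: (ex_derive_continuous (fun x => x * x)); by auto_derive.
Qed.

Lemma contC_scal k F z : contC F z -> contC (fun w => k * F w) z.
Proof.
move=> h; apply: (contC_comp (g := fun x => k * x) h).
apply/continuity_pt_filterlim; apply: (ex_derive_continuous (fun x => k * x)); by auto_derive.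
Qed.

(** Polarization: FG = ((F+G)^2 - (F-G)^2)/4 reduces products to squares. *)
Lemma contC_mult F G z : contC F z -> contC G z -> contC (fun w => F w * G w) z.
Proof.
move=> h1 h2.
apply: (contC_ext (F := fun w => / 4 * ((F w + G w) * (F w + G w)) + - (/ 4) * ((F w + (-1) * G w) * (F w + (-1) * G w)))).
  by move=> w; field.
by apply: contC_plus; apply: contC_scal; apply: contC_sqr; apply: contC_plus => //; apply: contC_scal.
Qed.

Lemma contC_Re f z d : cderiv f z d -> contC (fun w => Re (f w)) z.
Proof.
move=> h e e0; have [r [r0 H]] := cd_small h e0; exists r; split=> // w /H hw.
by rewrite -Re_minus; apply: Rle_lt_trans (re_le_Cmod _) hw.
Qed.
Lemma contC_Im f z d : cderiv f z d -> contC (fun w => Im (f w)) z.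
Proof.
move=> h e e0; have [r [r0 H]] := cd_small h e0; exists r; split=> // w /H hw.
by rewrite -Im_minus; apply: Rle_lt_trans (im_le_Cmod _) hw.
Qed.

Definition nsq (z : C) : R := Re z * Re z + Im z * Im z.
Lemma nsqE z : nsq z = Cmod z * Cmod z.
Proof. have -> : Cmod z * Cmod z = Cmod z ^ 2 by ring. by rewrite Cmod2_alt /nsq; ring. Qed.

Lemma contC_nsq f z d : cderiv f z d -> contC (fun w => nsq (f w)) z.
Proof.
by move=> h; apply: contC_plus; apply: contC_sqr; [exact: contC_Re h | exact: contC_Im h].
Qed.

(** Compactness: give each point a radius on whose double F varies by less than 1 and which is at
    most 1/(|F|+1). A positive lower bound e for the radii needed to cover the rectangle bounds F by
    1/e + 1. *)
Lemma bounded_rect (F : C -> R) a b c d :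
  (forall z, in_rect a b c d z -> contC F z) -> exists M, forall z, in_rect a b c d z -> F z <= M.
Proof.
move=> H.
have ch : forall x y, exists p : posreal, in_rect a b c d (x, y) ->
   p * (Rabs (F (x, y)) + 1) <= 1 /\ forall w, Cmod w < 2 * p -> Rabs (F ((x, y) + w)%C - F (x, y)) < 1.
  move=> x y; case: (classic (in_rect a b c d (x, y))) => [h|h]; last by exists (mkposreal 1 Rlt_0_1).
  have [r [r0 Hr]] := H _ h 1 Rlt_0_1.
  have A : 0 < Rabs (F (x, y)) + 1 by have := Rabs_pos (F (x, y)); lra.
  have p0 : 0 < Rmin (r / 2) (/ (Rabs (F (x, y)) + 1)) by apply: Rmin_pos; [lra | exact: Rinv_0_lt_compat].
  exists (mkposreal _ p0) => _ /=; split.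
    apply: (Rle_trans _ (/ (Rabs (F (x, y)) + 1) * (Rabs (F (x, y)) + 1))).
      by apply: Rmult_le_compat_r; [lra | exact: Rmin_r].
    rewrite Rinv_l; lra.
  by move=> w hw; apply: Hr; have := Rmin_l (r / 2) (/ (Rabs (F (x, y)) + 1)); lra.
pose dl x y := proj1_sig (constructive_indefinite_description _ (ch x y)).
have dlP x y : in_rect a b c d (x, y) -> dl x y * (Rabs (F (x, y)) + 1) <= 1 /\
   forall w, Cmod w < 2 * dl x y -> Rabs (F ((x, y) + w)%C - F (x, y)) < 1.
  exact: (proj2_sig (constructive_indefinite_description _ (ch x y))).
have [e He] := compactness_value_2d a b c d dl.
exists (/ e + 1) => -[x y] [/= hx hy].
apply: NNPP => N; apply: (He x y hx hy) => -[u [v [hu [hv [xu [yv ed]]]]]]; apply: N.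
have [h1 h2] := dlP u v (conj hu hv).
have := h2 ((x, y) - (u, v))%C.
have -> : ((u, v) + ((x, y) - (u, v)) = (x, y))%C by ring.
have := Cmod_le_ReIm ((x, y) - (u, v))%C; rewrite Re_minus Im_minus /= => k1 k2.
have {}k2 := k2 (ltac:(lra)).
have e0 := cond_pos e.
have e1 : Rabs (F (u, v)) + 1 <= / e.
  apply: (Rmult_le_reg_l e) => //; rewrite Rinv_r; last lra.
  apply: Rle_trans h1; apply: Rmult_le_compat_r => //; have := Rabs_pos (F (u, v)); lra.
have := Rle_abs (F (u, v)); have := Rle_abs (F (x, y) - F (u, v)); lra.
Qed.

(** If the supremum m were not attained, 1/(m - F) would be continuous, hence bounded, and F would
    stay below m by a fixed amount. *)
Lemma evt_rect (F : C -> R) a b c d : a <= b -> c <= d ->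
  (forall z, in_rect a b c d z -> contC F z) ->
  exists z0, in_rect a b c d z0 /\ forall z, in_rect a b c d z -> F z <= F z0.
Proof.
move=> ab cd H; have [M0 HM0] := bounded_rect H.
pose E x := exists z, in_rect a b c d z /\ x = F z.
have [m [m1 m2]] : {m | is_lub E m}.
  apply: completeness; first by exists M0 => x [z [hz ->]]; exact: HM0.
  by exists (F (a, c)); exists (a, c); split=> //; split => /=; lra.
apply: NNPP => N.
have lt : forall z, in_rect a b c d z -> F z < m.
  move=> z hz; case: (Rle_lt_or_eq_dec (F z) m) => //; first by apply: m1; exists z.
  by move=> e; case: N; exists z; split=> // w hw; rewrite e; apply: m1; exists w.
have [K HK] : exists K, forall z, in_rect a b c d z -> / (m - F z) <= K.
  apply: (bounded_rect (F := fun z => / (m - F z))) => z hz.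
  apply: (contC_comp (g := fun x => / (m - x)) (H z hz)).
  apply/continuity_pt_filterlim; apply: (ex_derive_continuous (fun x => / (m - x))); auto_derive.
  by have := lt z hz; lra.
have hac : in_rect a b c d (a, c) by split => /=; lra.
have K0 : 0 < K by apply: Rlt_le_trans (HK _ hac); apply: Rinv_0_lt_compat; have := lt _ hac; lra.
have : m <= m - / K.
  apply: m2 => x [z [hz ->]].
  have h := HK z hz; have h2 := lt z hz.
  have h3 : / K <= m - F z.
    rewrite -[m - F z]Rinv_inv; apply: Rinv_le_contravar => //.
    by apply: Rinv_0_lt_compat; lra.
  lra.
have := Rinv_0_lt_compat K K0; lra.
Qed.

Lemma second_derivative_max (f f1 : R -> R) l r : 0 < r ->
  (forall t, Rabs t < r -> is_derive f t (f1 t)) -> is_derive f1 0 l ->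
  (forall t, Rabs t < r -> f t <= f 0) -> l <= 0.
Proof.
move=> r0 H1 H2 Hm.
have r1 : Rabs 0 < r by rewrite Rabs_R0.
have z : f1 0 = 0.
  have h := H1 0 r1.
  have {}h := proj1 (is_derive_Reals _ _ _) h.
  have pr : derivable_pt f 0 by exists (f1 0).
  have e : derive_pt f 0 pr = f1 0 by apply: derive_pt_eq_0.
  rewrite -e; apply: (deriv_maximum f (- r) r 0 pr); try lra.
  by move=> x x1 x2; apply: Hm; apply: Rabs_def1; lra.
apply: Rnot_lt_le => l0.
have {}H2 := proj1 (is_derive_Reals _ _ _) H2.
have [d Hd] := H2 (l / 2) (ltac:(lra)).
have d0 := cond_pos d.
set t := Rmin (d / 2) (r / 2).
have t0 : 0 < t by apply: Rmin_pos; lra.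
have td : t < d by have := Rmin_l (d / 2) (r / 2); rewrite -/t; lra.
have tr : t < r by have := Rmin_r (d / 2) (r / 2); rewrite -/t; lra.
have pos : forall x, 0 < x <= t -> 0 < f1 x.
  move=> x hx; have := Hd x (ltac:(lra)); rewrite Rabs_pos_eq; last lra.
  move=> /(_ (ltac:(lra))); rewrite Rplus_0_l z Rminus_0_r => /Rabs_def2 [_ h].
  have : l / 2 < f1 x / x by lra.
  move=> h3; have : 0 < f1 x / x by lra.
  by move=> h4; have := Rmult_lt_0_compat _ _ h4 (proj1 hx); rewrite /Rdiv Rmult_assoc Rinv_l; lra.
have := MVT_cor2 f f1 0 t t0; case.
  by move=> c hc; apply/is_derive_Reals; apply: H1; apply: Rabs_def1; lra.
move=> c [h1 h2].
have := Hm t (ltac:(apply: Rabs_def1; lra)).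
have := pos c (ltac:(lra)); nra.
Qed.

Lemma near_interior a b c d z : a < Re z < b -> c < Im z < d -> exists r, 0 < r /\
  forall w, Cmod w < r -> in_rect a b c d (z + w)%C.
Proof.
move=> h1 h2; set r := Rmin (Rmin (Re z - a) (b - Re z)) (Rmin (Im z - c) (d - Im z)).
exists r; split; first by repeat apply: Rmin_pos; lra.
move=> w hw.
have r1 : r <= Re z - a by apply: Rle_trans (Rmin_l _ _) (Rmin_l _ _).
have r2 : r <= b - Re z by apply: Rle_trans (Rmin_l _ _) (Rmin_r _ _).
have r3 : r <= Im z - c by apply: Rle_trans (Rmin_r _ _) (Rmin_l _ _).
have r4 : r <= d - Im z by apply: Rle_trans (Rmin_r _ _) (Rmin_r _ _).
have := re_le_Cmod w; have := im_le_Cmod w => i1 i2.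
have := Rle_abs (Re w); have := Rle_abs (- Re w); have := Rle_abs (Im w); have := Rle_abs (- Im w).
rewrite !Rabs_Ropp => j1 j2 j3 j4.
by split; rewrite ?Re_plus ?Im_plus; lra.
Qed.

Lemma Cmod_lineR (t : R) v r : Cmod v <= 1 -> Rabs t < r -> Cmod (t * v)%C < r.
Proof. by move=> h1 h2; rewrite Cmod_mult Cmod_R; have := Rabs_pos t; have := Cmod_ge_0 v; nra. Qed.

Lemma cd_line_der (f f1 : C -> C) z v r : Cmod v <= 1 ->
  (forall w, Cmod w < r -> cderiv f (z + w)%C (f1 (z + w)%C)) ->
  forall t : R, Rabs t < r ->
  is_derive (fun t : R => Re (f (z + t * v)%C)) t (Re (f1 (z + t * v) * v)%C) /\
  is_derive (fun t : R => Im (f (z + t * v)%C)) t (Im (f1 (z + t * v) * v)%C).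
Proof. by move=> hv H t ht; apply: cd_line; apply: H; apply: Cmod_lineR. Qed.

(** If |f(z0)| > M, then |f|^2 + e (Re z - a)^2 with small e > 0 has an interior maximum, where its
    Laplacian must be <= 0. But |f|^2 is subharmonic and the added term has Laplacian 2e > 0. *)
Lemma max_rect (f f1 f2 : C -> C) a b c d M :
  a < b -> c < d -> 0 <= M ->
  (forall z, in_rect a b c d z -> cderiv f z (f1 z)) ->
  (forall z, in_rect a b c d z -> cderiv f1 z (f2 z)) ->
  (forall z, in_rect a b c d z -> Re z = a \/ Re z = b \/ Im z = c \/ Im z = d -> Cmod (f z) <= M) ->
  forall z, in_rect a b c d z -> Cmod (f z) <= M.
Proof.
move=> ab cd M0 H1 H2 HM z0 hz0; apply: Rnot_lt_le => lt.
(* Small enough that the added term is at most half of the excess |f(z0)|^2 - M^2, so that boundary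
   points stay below z0. *)
set e := (nsq (f z0) - M * M) / (2 * ((b - a) * (b - a))).
have ba : 0 < (b - a) * (b - a) by nra.
have e0 : 0 < e.
  rewrite /e nsqE; apply: Rdiv_lt_0_compat; last lra.
  nra.
have ee : e * ((b - a) * (b - a)) = (nsq (f z0) - M * M) / 2 by rewrite /e; field; lra.
pose F z := nsq (f z) + e * ((Re z - a) * (Re z - a)).
have [z1 [h1 hm]] : exists z1, in_rect a b c d z1 /\ forall z, in_rect a b c d z -> F z <= F z1.
  apply: evt_rect; try lra.
  move=> z /H1 hz; apply: contC_plus; first exact: contC_nsq hz.
  apply: contC_scal; apply: contC_sqr.
  by apply: (contC_plus (G := fun _ => - a)); [exact: contC_Re (cd_id _) | exact: contC_const].
have [[x1 x2] [x3 x4]] := h1.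
have F0 : nsq (f z0) <= F z0.
  by rewrite /F; have := Rle_0_sqr (Re z0 - a); rewrite /Rsqr => q; nra.
have N0 : M * M < nsq (f z0) by rewrite nsqE; nra.
have nb : ~ (Re z1 = a \/ Re z1 = b \/ Im z1 = c \/ Im z1 = d).
  move=> hb; have h := HM _ h1 hb.
  have q1 : nsq (f z1) <= M * M by rewrite nsqE; have := Cmod_ge_0 (f z1); nra.
  have q2 : (Re z1 - a) * (Re z1 - a) <= (b - a) * (b - a) by nra.
  have q3 : e * ((Re z1 - a) * (Re z1 - a)) <= e * ((b - a) * (b - a)) by nra.
  have := hm z0 hz0; rewrite {2}/F; lra.
have [r [r0 Hr]] : exists r, 0 < r /\ forall w, Cmod w < r -> in_rect a b c d (z1 + w)%C.
  by apply: near_interior; lra.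
(* the Laplacian of [F] at [z1] is [4 |f1|^2 + 2 e] *)
have key : forall v : C, Cmod v <= 1 ->
   2 * (nsq (f1 z1 * v)%C + Re (f2 z1 * v * v)%C * Re (f z1) + Im (f2 z1 * v * v)%C * Im (f z1)) + 2 * e * (Re v * Re v) <= 0.
  move=> v hv.
  have L0 := cd_line_der hv (fun w hw => H1 _ (Hr w hw)).
  have L1 := cd_line_der hv (fun w hw => H2 _ (Hr w hw)).
  pose u t := Re (f (z1 + RtoC t * v)%C); pose w t := Im (f (z1 + RtoC t * v)%C).
  pose u1 t := Re (f1 (z1 + RtoC t * v) * v)%C; pose w1 t := Im (f1 (z1 + RtoC t * v) * v)%C.
  apply: (@second_derivative_max (fun t => F (z1 + RtoC t * v)%C)
     (fun t => 2 * (u t * u1 t + w t * w1 t) + 2 * e * ((Re z1 + t * Re v - a) * Re v)) _ r) => //.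
  - move=> t /L0 [d1 d2].
    apply: (is_derive_ext (fun t => u t * u t + w t * w t + e * ((Re z1 + t * Re v - a) * (Re z1 + t * Re v - a)))).
      by move=> t'; rewrite /F /nsq /u /w !CRI Rmult_0_l Rminus_0_r.
    auto_derive.
      by repeat split; first [exact (ex_intro _ _ d1) | exact (ex_intro _ _ d2)].
    rewrite (is_derive_unique _ _ _ d1) (is_derive_unique _ _ _ d2) /u1 /w1; ring.
  - have [d1 d2] := L0 0 (ltac:(rewrite Rabs_R0; exact: r0)).
    have [d3 d4] := L1 0 (ltac:(rewrite Rabs_R0; exact: r0)).
    have z00 : (z1 + RtoC 0 * v = z1)%C by ring.
    have e3 : is_derive u1 0 (Re (f2 z1 * v * v)%C).
      apply: (is_derive_ext (fun t => Re v * Re (f1 (z1 + RtoC t * v)%C) - Im v * Im (f1 (z1 + RtoC t * v)%C))).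
        by move=> t; rewrite /u1 !CRI /=; ring.
      have -> : Re (f2 z1 * v * v)%C = Re v * Re (f2 z1 * v)%C - Im v * Im (f2 z1 * v)%C by rewrite (Re_mult (_ * _)); ring.
      rewrite z00 in d3 d4.
      by apply: (is_derive_minus (V := R_NormedModule)); apply: is_derive_scal.
    have e4 : is_derive w1 0 (Im (f2 z1 * v * v)%C).
      apply: (is_derive_ext (fun t => Re v * Im (f1 (z1 + RtoC t * v)%C) + Im v * Re (f1 (z1 + RtoC t * v)%C))).
        by move=> t; rewrite /w1 !CRI /=; ring.
      have -> : Im (f2 z1 * v * v)%C = Re v * Im (f2 z1 * v)%C + Im v * Re (f2 z1 * v)%C by rewrite (Im_mult (_ * _)); ring.
      rewrite z00 in d3 d4.
      by apply: (is_derive_plus (V := R_NormedModule)); apply: is_derive_scal.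
    auto_derive.
      by repeat split; first [exact (ex_intro _ _ d1) | exact (ex_intro _ _ d2) | exact (ex_intro _ _ e3) | exact (ex_intro _ _ e4)].
    rewrite (is_derive_unique _ _ _ d1) (is_derive_unique _ _ _ d2) (is_derive_unique _ _ _ e3) (is_derive_unique _ _ _ e4).
    by rewrite /u /w /u1 /w1 /nsq z00; ring.
  - move=> t ht; have -> : (z1 + RtoC 0 * v = z1)%C by ring.
    apply: hm; apply: Hr; exact: Cmod_lineR.
have k1 := key 1 (ltac:(rewrite Cmod_1; lra)).
have k2 := key Ci (ltac:(rewrite Cmod_Ci; lra)).
move: k1 k2; rewrite /nsq !CRI /= => k1 k2.
have s1 := Rle_0_sqr (Re (f1 z1)); have s2 := Rle_0_sqr (Im (f1 z1)); rewrite /Rsqr in s1 s2.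
nra.
Qed.

(* Three lines with no growth at infinity: a bound on the sides and far up and down the strip. *)
Lemma max_strip (f f1 f2 : C -> C) a b M T :
  a < b -> 0 <= M ->
  (forall z, a <= Re z <= b -> cderiv f z (f1 z)) ->
  (forall z, a <= Re z <= b -> cderiv f1 z (f2 z)) ->
  (forall z, Re z = a \/ Re z = b -> Cmod (f z) <= M) ->
  (forall z, a <= Re z <= b -> T <= Rabs (Im z) -> Cmod (f z) <= M) ->
  forall z, a <= Re z <= b -> Cmod (f z) <= M.
Proof.
move=> ab M0 H1 H2 HM HT z hz.
set S := Rmax (Rmax T 1) (Rabs (Im z)).
have S1 : T <= S by apply: Rle_trans (Rmax_l _ _) (Rmax_l _ _).
have S2 : 1 <= S by apply: Rle_trans (Rmax_r T _) (Rmax_l _ _).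
have S3 : Rabs (Im z) <= S by exact: Rmax_r.
apply: (@max_rect f f1 f2 a b (- S) S M) => //; try lra.
- by move=> w [h _]; exact: H1.
- by move=> w [h _]; exact: H2.
- move=> w [h1 h2] [h|[h|[h|h]]]; try (by apply: HM; tauto).
    apply: HT => //; rewrite h Rabs_Ropp Rabs_pos_eq; lra.
  apply: HT => //; rewrite h Rabs_pos_eq; lra.
- by split=> //; apply/Rabs_le_between.
Qed.

(** * Logarithms of moduli, Ahlfors' Schwarz lemma and Harnack's inequality *)

Lemma nsq_ge0 (z : C) : 0 <= nsq z.
Proof. by rewrite nsqE; have := Cmod_ge_0 z; nra. Qed.

Lemma nsq_gt0 (z : C) : z <> 0 -> 0 < nsq z.
Proof. by move=> h0; have h := proj1 (Cmod_gt_0 z) h0; rewrite nsqE; nra. Qed.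

Lemma ln_nsq (z : C) : z <> 0 -> ln (nsq z) = 2 * ln (Cmod z).
Proof. move=> h0; have h := proj1 (Cmod_gt_0 z) h0; rewrite nsqE ln_mult //; ring. Qed.

Lemma cd_inv (f : C -> C) z d : cderiv f z d -> f z <> 0 -> cderiv (fun w => / f w)%C z (- d / (f z * f z))%C.
Proof.
move=> h h0.
have K : forall w0 : C, w0 <> 0 -> cderiv (fun w => / w)%C w0 (- (/ (w0 * w0)))%C.
  move=> w0 n0; have p0 : 0 < Cmod w0 by apply/Cmod_gt_0.
  have p3 : 0 < Cmod w0 * Cmod w0 * Cmod w0 by do 2 apply: Rmult_lt_0_compat => //.
  apply: (@cd_taylor (fun w => / w)%C w0 _ (Cmod w0 / 2) (2 / (Cmod w0 * Cmod w0 * Cmod w0))); first lra.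
  move=> w hw.
  have hb : Cmod w0 / 2 <= Cmod (w0 + w)%C.
    have := Cmod_triangle_inv w0 (- w)%C; rewrite Cmod_opp.
    have -> : (w0 - - w = w0 + w)%C by ring.
    lra.
  have n1 : (w0 + w)%C <> 0 by apply/Cmod_gt_0; lra.
  have -> : (/ (w0 + w) - / w0 - - / (w0 * w0) * w = (w * w) / ((w0 + w) * (w0 * w0)))%C by field.
  rewrite Cmod_div; last by apply: Cmult_neq_0 => //; apply: Cmult_neq_0.
  rewrite !Cmod_mult.
  have -> : 2 / (Cmod w0 * Cmod w0 * Cmod w0) * Cmod w ^ 2 = (Cmod w * Cmod w) * / ((Cmod w0 / 2) * (Cmod w0 * Cmod w0)).
    by field; lra.
  apply: Rmult_le_compat_l; first by have := Cmod_ge_0 w; nra.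
  apply: Rinv_le_contravar; first by apply: Rmult_lt_0_compat; nra.
  by apply: Rmult_le_compat_r; nra.
apply: cd_eq (cd_comp (f := fun w => (/ w)%C) (K _ h0) h) _; by field.
Qed.

Lemma cd_div (f g : C -> C) z d e : cderiv f z d -> cderiv g z e -> g z <> 0 ->
  cderiv (fun w => f w / g w)%C z (d / g z - f z / g z * (e / g z))%C.
Proof. by move=> h1 h2 h0; apply: cd_eq (cd_mult h1 (cd_inv h2 h0)) _; field. Qed.

Lemma ln_nsq_der (f : C -> C) (f1 : C) z v (t : R) : cderiv f (z + t * v)%C f1 -> f (z + t * v)%C <> 0 ->
  is_derive (fun t : R => ln (nsq (f (z + t * v)%C))) t (2 * Re (f1 / f (z + t * v) * v)%C).
Proof.
move=> h h0; have [d1 d2] := cd_line h.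
have p0 := nsq_gt0 h0.
pose u t := Re (f (z + RtoC t * v)%C); pose w t := Im (f (z + RtoC t * v)%C).
apply: (is_derive_ext (fun t => ln (u t * u t + w t * w t))) => //.
have p1 : 0 < u t * u t + w t * w t by [].
auto_derive.
  by repeat split; first [exact (ex_intro _ _ d1) | exact (ex_intro _ _ d2) | exact: p1].
rewrite (is_derive_unique _ _ _ d1) (is_derive_unique _ _ _ d2).
have -> : (f1 / f (z + t * v) * v = (f1 * v) * / f (z + t * v))%C by rewrite /Cdiv; ring.
move: p0; rewrite /u /w /nsq; move: (f (z + t * v)%C) (f1 * v)%C => [a b] [x y] /=.
rewrite /Re /Im /= => p0; field; nra.
Qed.

Section Ahlfors.
Variables (L L1 L2 L3 : C -> C) (c : C) (R0 M : R).
Let inr z := in_rect (Re c - R0) (Re c + R0) (Im c - R0) (Im c + R0) z.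
Hypothesis Rpos : 0 < R0.
Hypothesis H1 : forall z, inr z -> cderiv L z (L1 z).
Hypothesis H2 : forall z, inr z -> cderiv L1 z (L2 z).
Hypothesis H3 : forall z, inr z -> cderiv L2 z (L3 z).
Hypothesis L0 : forall z, inr z -> L z <> 0.
Hypothesis LM : forall z, inr z -> ln (Cmod (L z)) < M.

Let D z := (L1 z / L z)%C.
Let D1 z := (L2 z / L z - D z * D z)%C.
(** The positive harmonic function M - log|L|, written with |L|^2 so that differentiation is
    immediate. *)
Let A z := M - ln (nsq (L z)) / 2.

Lemma AE z : inr z -> A z = M - ln (Cmod (L z)).
Proof. by move=> /L0 h; rewrite /A ln_nsq //; field. Qed.

Lemma A_pos z : inr z -> 0 < A z.
Proof. by move=> h; rewrite AE //; have := LM h; lra. Qed.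

Lemma D_cd z : inr z -> cderiv D z (D1 z).
Proof. by move=> h; apply: cd_div; [exact: H2 | exact: H1 | exact: L0]. Qed.

Lemma D1_cd z : inr z -> exists d, cderiv D1 z d.
Proof.
move=> h; eexists; apply: cd_minus.
  by apply: cd_div; [exact: H3 | exact: H1 | exact: L0].
by apply: cd_mult; exact: D_cd.
Qed.

Lemma disc_in_rect w : Cmod w <= R0 -> inr (c + w)%C.
Proof.
move=> hw; have h1 := re_le_Cmod w; have h2 := im_le_Cmod w.
have := Rle_abs (Re w); have := Rle_abs (- Re w); have := Rle_abs (Im w); have := Rle_abs (- Im w).
rewrite !Rabs_Ropp => j1 j2 j3 j4; split; rewrite ?Re_plus ?Im_plus; lra.
Qed.

(* Ahlfors' form of the Schwarz lemma: the maximum of the ratio of the pulled-back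
   hyperbolic metric [|D|/A] of a half-plane to that of the disc. *)
Lemma ahlfors w : Cmod w <= R0 -> Cmod (D (c + w)%C) * (R0 * R0 - Cmod w * Cmod w) <= 2 * R0 * A (c + w)%C.
Proof.
pose rho z := R0 * R0 - nsq (z - c)%C.
(* Square of the ratio of the two metrics. [Rmax 0] extends it by zero from the disc to the
   rectangle, where the extreme value theorem is at hand. *)
pose Th z := nsq (D z) * (Rmax 0 (rho z) * Rmax 0 (rho z)) * (/ A z * / A z).
have [z1 [h1 hm]] : exists z1, inr z1 /\ forall z, inr z -> Th z <= Th z1.
  apply: evt_rect; try lra.
  move=> z hz; apply: contC_mult; first apply: contC_mult.
  - exact: contC_nsq (D_cd hz).
  - apply: contC_sqr; apply: (contC_comp (F := rho) (g := fun x => Rmax 0 x)).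
      apply: contC_plus; first exact: contC_const.
      apply: (contC_ext (F := fun w => (-1) * nsq (w - c)%C)); first by move=> x; ring.
      by apply: contC_scal; apply: contC_nsq (cd_minus (cd_id z) (cd_const c z)).
    apply/continuity_pt_filterlim.
    apply: (continuous_ext (fun x => (x + Rabs x) / 2)).
      by move=> x; rewrite /Rmax /Rabs; case: Rle_dec; case: Rcase_abs => ? ?; lra.
    apply: (continuous_mult (K := R_AbsRing) (fun x => x + Rabs x) (fun _ => / 2)); last exact: continuous_const.
    by apply: (continuous_plus (V := R_NormedModule)); [exact: continuous_id | exact: continuous_Rabs].
  - apply: contC_sqr.
    apply: (contC_comp (F := fun w => nsq (L w)) (g := fun x => / (M - ln x / 2))); first exact: contC_nsq (H1 hz).
    apply/continuity_pt_filterlim; apply: (ex_derive_continuous (fun x => / (M - ln x / 2))); auto_derive.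
    have := A_pos hz; rewrite /A => p; repeat split; [exact: nsq_gt0 (L0 hz) | lra].
have Th_le : Th z1 <= 4 * (R0 * R0).
  case: (Req_dec (Th z1) 0) => [->|n0]; first nra.
  have A1 := A_pos h1.
  have rp : 0 < rho z1.
    apply: Rnot_le_lt => h; apply: n0; rewrite /Th Rmax_left //; ring.
  have Dn0 : D z1 <> 0.
    by move=> h; apply: n0; rewrite /Th h /nsq /=; ring.
  have rpE : nsq (z1 - c)%C < R0 * R0 by move: rp; rewrite /rho; lra.
  have cm : Cmod (z1 - c)%C < R0.
    by rewrite nsqE in rpE; apply: Rnot_le_lt => h; have := Cmod_ge_0 (z1 - c)%C; nra.
  have [r1 [r10 Hr1]] := cd_small (D_cd h1) (ltac:(apply/Cmod_gt_0; exact: Dn0) : 0 < Cmod (D z1)).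
  set r := Rmin r1 (R0 - Cmod (z1 - c)%C).
  have r0 : 0 < r by apply: Rmin_pos; lra.
  have In : forall w, Cmod w < r -> inr (z1 + w)%C /\ 0 < rho (z1 + w)%C /\ D (z1 + w)%C <> 0.
    move=> x hx.
    have hx1 : Cmod x < r1 := Rlt_le_trans _ _ _ hx (Rmin_l _ _).
    have hx2 : Cmod x < R0 - Cmod (z1 - c)%C := Rlt_le_trans _ _ _ hx (Rmin_r _ _).
    have e : (z1 + x = c + ((z1 - c) + x))%C by ring.
    have e2 : Cmod ((z1 - c) + x)%C < R0 by apply: Rle_lt_trans (Cmod_triangle _ _) _; lra.
    split; first by rewrite e; apply: disc_in_rect; lra.
    split.
      rewrite /rho; have -> : (z1 + x - c = (z1 - c) + x)%C by ring.
      by rewrite nsqE; have := Cmod_ge_0 ((z1 - c) + x)%C; nra.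
    move=> h; have := Hr1 x hx1; rewrite h.
    have -> : (0 - D z1 = - D z1)%C by ring.
    by rewrite Cmod_opp; lra.
  have [D2 hD2] := D1_cd h1.
  pose q z := (D1 z / D z)%C.
  have hq : exists q1, cderiv q z1 q1.
    by eexists; apply: cd_div; [exact: hD2 | exact: D_cd | exact: Dn0].
  have [q1 hq1] := hq.
  set px := Re (z1 - c)%C; set py := Im (z1 - c)%C.
  (* Second derivative of log Th at its maximum in the direction v. Adding the cases v = 1 and v = i
     cancels log|D|^2, which is harmonic, and the terms in D1; what is left is |D|^2/A^2 <= 4
     R0^2/rho^2. *)
  have key : forall v : C, Cmod v <= 1 ->
     2 * Re (q1 * v * v)%C
     + 2 * (- 2 * (Re v * Re v + Im v * Im v) / rho z1 - 4 * ((px * Re v + py * Im v) * (px * Re v + py * Im v)) / (rho z1 * rho z1))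
     + 2 * (Re (D1 z1 * v * v)%C / A z1 + (Re (D z1 * v)%C * Re (D z1 * v)%C) / (A z1 * A z1)) <= 0.
    move=> v hv.
    pose a t := ln (nsq (D (z1 + RtoC t * v)%C)).
    pose a1 t := 2 * Re (q (z1 + RtoC t * v) * v)%C.
    pose al t := A (z1 + RtoC t * v)%C.
    pose d t := Re (D (z1 + RtoC t * v) * v)%C.
    pose rh (t : R) := R0 * R0 - ((px + t * Re v) * (px + t * Re v) + (py + t * Im v) * (py + t * Im v)).
    have rhE : forall t, rh t = rho (z1 + RtoC t * v)%C.
      move=> t; rewrite /rh /rho /nsq; have -> : (z1 + RtoC t * v - c = (z1 - c) + RtoC t * v)%C by ring.
      by rewrite !CRI -?Re_minus -?Im_minus -/px -/py /=; rewrite /px /py !CRI; ring.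
    have z00 : (z1 + RtoC 0 * v = z1)%C by ring.
    have B0 : Rabs 0 < r by rewrite Rabs_R0.
    have da : forall t, Rabs t < r -> is_derive a t (a1 t).
      move=> t ht; have [i1 [i2 i3]] := In _ (Cmod_lineR hv ht).
      exact: (ln_nsq_der (D_cd i1) i3).
    have dal : forall t, Rabs t < r -> is_derive al t (- d t).
      move=> t ht; have [i1 [i2 i3]] := In _ (Cmod_lineR hv ht).
      have h := ln_nsq_der (H1 i1) (L0 i1).
      pose lg t := ln (nsq (L (z1 + RtoC t * v)%C)).
      apply: (is_derive_ext (fun t => M - lg t / 2)) => //.
      auto_derive; first by repeat split; exact (ex_intro _ _ h).
      rewrite (is_derive_unique _ _ _ h) /d /D; field.
    have da1 : is_derive a1 0 (2 * Re (q1 * v * v)%C).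
      have [d3 d4] := @cd_line q z1 v 0 q1 (ltac:(rewrite z00; exact: hq1)).
      apply: (is_derive_ext (fun t => 2 * (Re v * Re (q (z1 + RtoC t * v)%C) - Im v * Im (q (z1 + RtoC t * v)%C)))).
        by move=> t; rewrite /a1 !CRI /=; ring.
      apply: is_derive_scal.
      have -> : Re (q1 * v * v)%C = Re v * Re (q1 * v)%C - Im v * Im (q1 * v)%C by rewrite (Re_mult (_ * _)); ring.
      by apply: (is_derive_minus (V := R_NormedModule)); apply: is_derive_scal.
    have dd : is_derive d 0 (Re (D1 z1 * v * v)%C).
      have [d3 d4] := @cd_line D z1 v 0 (D1 z1) (ltac:(rewrite z00; exact: D_cd)).
      apply: (is_derive_ext (fun t => (Re v * Re (D (z1 + RtoC t * v)%C) - Im v * Im (D (z1 + RtoC t * v)%C)))).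
        by move=> t; rewrite /d !CRI /=; ring.
      have -> : Re (D1 z1 * v * v)%C = Re v * Re (D1 z1 * v)%C - Im v * Im (D1 z1 * v)%C by rewrite (Re_mult (_ * _)); ring.
      by apply: (is_derive_minus (V := R_NormedModule)); apply: is_derive_scal.
    have rh0 : rh 0 = rho z1 by rewrite rhE z00.
    have al0 : al 0 = A z1 by rewrite /al z00.
    have d0 : d 0 = Re (D z1 * v)%C by rewrite /d z00.
    have rhp : forall t, Rabs t < r -> 0 < rh t.
      by move=> t ht; rewrite rhE; have [i1 [i2 i3]] := In _ (Cmod_lineR hv ht).
    have alp : forall t, Rabs t < r -> 0 < al t.
      by move=> t ht; have [i1 [i2 i3]] := In _ (Cmod_lineR hv ht); exact: A_pos.
    apply: (@second_derivative_max (fun t => a t + 2 * ln (rh t) - 2 * ln (al t))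
      (fun t => a1 t + 2 * (- 2 * ((px + t * Re v) * Re v + (py + t * Im v) * Im v) / rh t) + 2 * (d t / al t)) _ r) => //.
    - move=> t ht; have h1' := da t ht; have h2' := dal t ht; have h3' := rhp t ht; have h4' := alp t ht.
      rewrite /rh in h3' *; auto_derive.
        by repeat split; first [exact (ex_intro _ _ h1') | exact (ex_intro _ _ h2') | exact: h4' | exact: h3'].
      rewrite (is_derive_unique _ _ _ h1') (is_derive_unique _ _ _ h2'); field; lra.
    - have h1' := da1; have h2' := dd; have h3' := dal 0 B0; have h4' := rhp 0 B0; have h5' := alp 0 B0.
      have h6 : rh 0 <> 0 by lra. have h7 : al 0 <> 0 by lra.
      have h4 := h4'. rewrite /rh in h4.
      rewrite /rh; auto_derive.
        by repeat split; first [exact (ex_intro _ _ h1') | exact (ex_intro _ _ h2') | exact (ex_intro _ _ h3') | exact: h7 | (rewrite -/(rh 0); exact: h6) | lra ].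
      rewrite (is_derive_unique _ _ _ h1') (is_derive_unique _ _ _ h2') (is_derive_unique _ _ _ h3').
      rewrite -rh0 -al0 -d0 /rh; field; split; first exact: h7; lra.
    - move=> t ht; have [i1 [i2 i3]] := In _ (Cmod_lineR hv ht).
      have := hm _ i1; rewrite /Th !Rmax_right; try lra.
      rewrite -!rhE.
      have a0 := alp 0 B0; have at0 := alp t ht; have rt := rhp t ht; have r00 := rhp 0 B0.
      rewrite -[rho z1]rh0 -[A z1]al0 -/(al t).
      have n1 := nsq_gt0 i3; have n2 := nsq_gt0 Dn0.
      have ia := Rinv_0_lt_compat _ at0; have ia0 := Rinv_0_lt_compat _ a0.
      move=> hh.
      have : ln (nsq (D (z1 + RtoC t * v)%C) * (rh t * rh t) * (/ al t * / al t)) <=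
             ln (nsq (D z1) * (rh 0 * rh 0) * (/ al 0 * / al 0)).
        by apply: ln_le => //; apply: Rmult_lt_0_compat; [apply: Rmult_lt_0_compat => //; nra | nra].
      rewrite !ln_mult ?ln_Rinv //; try nra.
        rewrite /a z00; lra.
      by apply: Rmult_lt_0_compat; nra.
      by apply: Rmult_lt_0_compat; nra.
  have k1 := key 1 (ltac:(rewrite Cmod_1; lra)).
  have k2 := key Ci (ltac:(rewrite Cmod_Ci; lra)).
  have : nsq (D z1) / (A z1 * A z1) <= 4 * (R0 * R0) / (rho z1 * rho z1).
    have -> : 4 * (R0 * R0) / (rho z1 * rho z1) = 4 / rho z1 + 4 * (px * px + py * py) / (rho z1 * rho z1).
      have -> : px * px + py * py = R0 * R0 - rho z1 by rewrite /rho /nsq; rewrite /px /py; ring.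
      field; lra.
    move: k1 k2; move: (D1 z1) (D z1) (rho z1) (A z1) => E1 E0 rh al; rewrite /nsq !CRI /= /Rdiv.
    move: (/ rh) (/ al) (/ (rh * rh)) (/ (al * al)) => ir ia ir2 ia2 k1 k2; nra.
  have rr : 0 < rho z1 * rho z1 by nra.
  move=> h; have := Rmult_le_compat_r _ _ _ (Rlt_le _ _ rr) h.
  have -> : 4 * (R0 * R0) / (rho z1 * rho z1) * (rho z1 * rho z1) = 4 * (R0 * R0) by field; lra.
  move=> h'; apply: Rle_trans h'; right; rewrite /Th Rmax_right; last lra.
  field; lra.
move=> hw; have hi := disc_in_rect hw.
have := Rle_trans _ _ _ (hm _ hi) Th_le.
have rE : rho (c + w)%C = R0 * R0 - Cmod w * Cmod w.
  rewrite /rho -nsqE; congr (_ - nsq _); ring.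
have rp : 0 <= rho (c + w)%C by rewrite rE; have := Cmod_ge_0 w; nra.
rewrite /Th Rmax_right // nsqE -rE => h.
have Ap := A_pos hi.
have m0 := Cmod_ge_0 (D (c + w)%C).
apply: Rnot_lt_le => lt.
have : (2 * R0 * A (c + w)%C) * (2 * R0 * A (c + w)%C) < (Cmod (D (c + w)%C) * rho (c + w)%C) * (Cmod (D (c + w)%C) * rho (c + w)%C).
  have : 0 <= 2 * R0 * A (c + w)%C by nra.
  nra.
have e : (Cmod (D (c + w)%C) * rho (c + w)%C) * (Cmod (D (c + w)%C) * rho (c + w)%C) =
   (Cmod (D (c + w)%C) * Cmod (D (c + w)%C) * (rho (c + w)%C * rho (c + w)%C) * (/ A (c + w)%C * / A (c + w)%C)) * (A (c + w)%C * A (c + w)%C) by field; lra.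
rewrite e => h2.
have := Rmult_le_compat_r (A (c + w)%C * A (c + w)%C) _ _ (ltac:(nra)) h; nra.
Qed.

(** Along a radius [ahlfors] bounds the derivative of log A by 2 R0/(R0^2 - t^2) = 1/(R0 + t) +
    1/(R0 - t), so log A - log(R0 + t) + log(R0 - t) decreases. *)
Lemma harnack w : Cmod w < R0 -> A (c + w)%C * (R0 - Cmod w) <= A c * (R0 + Cmod w).
Proof.
move=> hw.
have m0 := Cmod_ge_0 w.
case: (Req_dec (Cmod w) 0) => [/Cmod_eq_0 ->|n0].
  by rewrite Cplus_0_r Cmod_0; right; ring.
set m := Cmod w in hw m0 n0 *.
pose v := (RtoC (/ m) * w)%C.
have v1 : Cmod v = 1.
  rewrite /v Cmod_mult Cmod_R Rabs_pos_eq -/m; first by field.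
  by apply/Rinv_ge0; lra.
have ew : (c + w = c + RtoC m * v)%C.
  by rewrite /v Cmult_assoc -RtoC_mult Rinv_r // Cmult_1_l.
have ec : (c = c + RtoC 0 * v)%C by ring.
have In : forall t, 0 <= t <= m -> Cmod (RtoC t * v)%C = t.
  by move=> t ht; rewrite Cmod_mult v1 Cmod_R Rabs_pos_eq; lra.
pose lg t := ln (nsq (L (c + RtoC t * v)%C)).
pose al t := A (c + RtoC t * v)%C.
have dlg : forall t, 0 <= t <= m -> is_derive lg t (2 * Re (D (c + RtoC t * v) * v)%C).
  move=> t ht; have i1 := @disc_in_rect (RtoC t * v)%C (ltac:(rewrite In //; lra)).
  exact: ln_nsq_der (H1 i1) (L0 i1).
have alp : forall t, 0 <= t <= m -> 0 < al t.
  by move=> t ht; apply: A_pos; apply: disc_in_rect; rewrite In //; lra.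
pose f t := ln (al t) - ln (R0 + t) + ln (R0 - t).
pose f' t := - Re (D (c + RtoC t * v) * v)%C / al t - / (R0 + t) - / (R0 - t).
have df : forall t, 0 <= t <= m -> is_derive f t (f' t).
  move=> t ht; have h := dlg t ht; have p := alp t ht.
  have p' : 0 < M - lg t / 2 by exact: p.
  apply: (is_derive_ext (fun t => ln (M - lg t / 2) - ln (R0 + t) + ln (R0 - t))) => //.
  auto_derive; first by repeat split; try exact (ex_intro _ _ h); lra.
  rewrite (is_derive_unique _ _ _ h) /f'; have -> : al t = M - lg t / 2 by [].
  field; lra.
have neg : forall t, 0 <= t <= m -> f' t <= 0.
  move=> t ht; have p := alp t ht.
  have := ahlfors (w := (RtoC t * v)%C) (ltac:(rewrite In //; lra)).
  rewrite In // -/(al t) => h.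
  have h2 : - Re (D (c + RtoC t * v) * v)%C <= Cmod (D (c + RtoC t * v)%C).
    apply: Rle_trans (Rle_abs _) _; rewrite Rabs_Ropp; apply: Rle_trans (re_le_Cmod _) _.
    by rewrite Cmod_mult v1; lra.
  rewrite /f'.
  have -> : forall x, x / al t - / (R0 + t) - / (R0 - t) = (x * (R0 * R0 - t * t) - 2 * R0 * al t) / (al t * (R0 * R0 - t * t)).
    by move=> x; field; repeat split; nra.
  have q : 0 < R0 * R0 - t * t by nra.
  apply: Rmult_le_reg_r (al t * (R0 * R0 - t * t)) _ _ _ _; first nra.
  rewrite /Rdiv Rmult_assoc Rinv_l; nra.
have := MVT_gen f 0 m f'; rewrite Rmin_left // Rmax_right //; case.
- by move=> t ht; apply: df; lra.
- by move=> t ht; apply/continuity_pt_filterlim; apply: ex_derive_continuous; exists (f' t); exact: df.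
move=> t [ht hf].
have := neg t ht => hn.
have : f m <= f 0 by nra.
rewrite /f Rplus_0_r Rminus_0_r.
have p1 := alp m (ltac:(lra)). have p2 := alp 0 (ltac:(lra)).
move=> h.
have : ln (al m * (R0 - m)) <= ln (al 0 * (R0 + m)) by rewrite !ln_mult //; lra.
move=> h3; have : al m * (R0 - m) <= al 0 * (R0 + m).
  apply: Rnot_lt_le => lt; have : ln (al 0 * (R0 + m)) < ln (al m * (R0 - m)) by apply: ln_increasing => //; apply: Rmult_lt_0_compat; lra.
  lra.
by rewrite /al -ec -ew.
Qed.

End Ahlfors.

(** * Growth of L and L'/L in a zero-free half-plane *)

Lemma exp_le x y : x <= y -> exp x <= exp y.
Proof. by case=> [/exp_increasing|->]; lra. Qed.
Lemma exp_le1 x : x <= 0 -> exp x <= 1.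
Proof. by move=> /exp_le; rewrite exp_0. Qed.

(** Logarithm of the analytic conductor at height t, [lq] being the logarithm of the modulus. *)
Definition ell (lq t : R) := lq + ln (2 + Rabs t).

Lemma ell_ge lq t : 0 <= lq -> / 2 < ell lq t.
Proof.
move=> h; have := ln_lt_2; have := Rabs_pos t => h1.
have : ln 2 <= ln (2 + Rabs t) by apply: ln_le; lra.
rewrite /ell; lra.
Qed.

Lemma ell_shift lq t t' : ell lq t' <= ell lq t + Rabs (t' - t) / 2.
Proof.
have h := Rabs_pos t; have h1 := Rabs_pos (t' - t); have h2 := Rabs_triang t (t' - t).
have e : t + (t' - t) = t' by ring.
rewrite e in h2.
have h3 : ln (2 + Rabs t') <= ln ((2 + Rabs t) * (1 + Rabs (t' - t) / 2)) by apply: ln_le; have := Rabs_pos t'; nra.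
rewrite ln_mult in h3; try lra.
have h4 := @ln_le_sub1 (1 + Rabs (t' - t) / 2) (ltac:(lra)).
rewrite /ell; lra.
Qed.

Lemma Cmod_conjC (L : C -> C) s : (forall s, L (Cconj s) = Cconj (L s)) -> Cmod (L (Cconj s)) = Cmod (L s).
Proof. by move=> ->; exact: Cmod_conj. Qed.

Lemma cderiv_subst (f f' : C -> C) (g : C -> C) z d : cderiv f (g z) (f' (g z)) -> cderiv g z d ->
  cderiv (fun w => f (g w)) z (f' (g z) * d)%C.
Proof. by move=> h1 h2; apply: cd_eq (cd_comp h1 h2) _; ring. Qed.

Lemma conj_reflect (s : C) (t : R) : (s + RtoC (- t) * 1)%C = Cconj (Cconj s + - RtoC t)%C.
Proof. by case: s => a b; apply: C_eq => /=; ring. Qed.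

(** [L j] stands for the j-th derivative of an L-function. Zero-freeness for Re s > 1/2 is the deep
    input; the other hypotheses are symmetry, a crude upper bound in a strip and a lower bound on Re
    s = 2. *)
Section Growth.
Variables (L : nat -> C -> C) (lq G : R).
Hypothesis lq0 : 0 <= lq.
Hypothesis G1 : 1 <= G.
Hypothesis Lcd : forall j s, 0 < Re s -> cderiv (L j) s (L j.+1 s).
Hypothesis L0 : forall s, / 2 < Re s -> L 0 s <> 0.
Hypothesis Lconj : forall s, L 0 (Cconj s) = Cconj (L 0 s).
Hypothesis Lup : forall s, / 4 <= Re s <= 4 -> Cmod (L 0 s) < exp (G * ell lq (Im s)).
Hypothesis Llow : forall t, exp (- (G * ell lq t)) <= Cmod (L 0 (2, t)).

Lemma ln_up s : / 2 < Re s <= 4 -> ln (Cmod (L 0 s)) < G * ell lq (Im s).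
Proof.
move=> hs; rewrite -[G * _]ln_exp; apply: ln_increasing.
  by apply/Cmod_gt_0; apply: L0; lra.
by apply: Lup; lra.
Qed.

(** On the disc about 2 + it that reaches Re s = 1/2 + e/2, log|L| is harmonic and below 3 G ell.
    Harnack from the centre gives the lower bound at x + it, and [ahlfors] the bound for L'/L. That
    point lies e/2 inside the disc, whence the powers of 1/e. *)
Lemma growth_rect x t e : 0 < e <= 1 -> / 2 + e <= x <= 5 / 2 ->
  - (24 * G * ell lq t / e) <= ln (Cmod (L 0 (x, t))) /\
  Cmod (L 1 (x, t) / L 0 (x, t))%C <= 100 * G * ell lq t / (e * e).
Proof.
move=> he hx.
set c : C := (2, t); set R0 := 3 / 2 - e / 2.
set M := 3 * G * ell lq t.
have l0 := ell_ge t lq0.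
have rc : Re c = 2 by []. have ic : Im c = t by [].
have HR : forall z, in_rect (Re c - R0) (Re c + R0) (Im c - R0) (Im c + R0) z -> / 2 < Re z <= 4.
  by move=> z [h1 h2]; rewrite rc /R0 in h1; lra.
have HM : forall z, in_rect (Re c - R0) (Re c + R0) (Im c - R0) (Im c + R0) z -> ln (Cmod (L 0 z)) < M.
  move=> z hz; have a3 := ln_up (HR z hz); move: hz => [h1 h2]; rewrite ic /R0 in h2.
  have a2 := ell_shift lq t (Im z).
  have a1 : Rabs (Im z - t) <= 3 / 2 by apply: Rabs_le; lra.
  have a4 : ell lq (Im z) <= 3 * ell lq t by lra.
  rewrite /M; nra.
have H1 : forall z, in_rect (Re c - R0) (Re c + R0) (Im c - R0) (Im c + R0) z -> cderiv (L 0) z (L 1 z).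
  by move=> z /HR hz; apply: Lcd; lra.
have H2 : forall z, in_rect (Re c - R0) (Re c + R0) (Im c - R0) (Im c + R0) z -> cderiv (L 1) z (L 2 z).
  by move=> z /HR hz; apply: Lcd; lra.
have H3 : forall z, in_rect (Re c - R0) (Re c + R0) (Im c - R0) (Im c + R0) z -> cderiv (L 2) z (L 3 z).
  by move=> z /HR hz; apply: Lcd; lra.
have H0 : forall z, in_rect (Re c - R0) (Re c + R0) (Im c - R0) (Im c + R0) z -> L 0 z <> 0.
  by move=> z /HR hz; apply: L0; lra.
have Rp : 0 < R0 by rewrite /R0; lra.
pose w : C := (x - 2, 0).
have cw : (c + w)%C = (x, t) by apply: C_eq; rewrite /= ; lra.
have mw : Cmod w = Rabs (x - 2) by rewrite -Cmod_R.
have mw2 : Cmod w <= R0 - e / 2 by rewrite mw /R0; apply: Rabs_le; lra.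
have m0 := Cmod_ge_0 w.
have hk := harnack Rp H1 H2 H3 H0 HM (w := w) (ltac:(lra)).
have ak := ahlfors Rp H1 H2 H3 H0 HM (w := w) (ltac:(lra)).
rewrite cw in hk ak.
have n0 : L 0 (x, t) <> 0 by apply: L0; rewrite /=; lra.
have nc : L 0 c <> 0 by apply: L0; rewrite rc; lra.
rewrite (ln_nsq n0) in hk ak; rewrite (ln_nsq nc) in hk.
have lc : - (G * ell lq t) <= ln (Cmod (L 0 c)).
  rewrite -[X in X <= _]ln_exp; apply: ln_le; first exact: exp_pos.
  exact: Llow.
set u := ln (Cmod (L 0 (x, t))) in hk ak *.
have El : 0 < G * ell lq t by nra.
have A0 : M - u <= 24 * G * ell lq t / e.
  apply: (Rmult_le_reg_r (R0 - Cmod w)); first lra.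
  have b1 : (M - 2 * u / 2) * (R0 - Cmod w) <= 4 * (G * ell lq t) * 3.
    apply: Rle_trans hk _; apply: Rmult_le_compat; rewrite /R0 in mw2 *; try lra.
      by have := @HM c (ltac:(split; lra)); lra.
    by rewrite /M; lra.
  have b2 : 24 * G * ell lq t / e * (e / 2) <= 24 * G * ell lq t / e * (R0 - Cmod w).
    by apply: Rmult_le_compat_l; [apply: Rdiv_le_0_compat; lra | lra].
  have b3 : 24 * G * ell lq t / e * (e / 2) = 12 * (G * ell lq t) by field; lra.
  lra.
split; first by rewrite /M in A0; lra.
have mD := Cmod_ge_0 (L 1 (x, t) / L 0 (x, t))%C.
set dd := Cmod _ in ak mD *.
have c1 : dd * (R0 * (e / 2)) <= dd * (R0 * R0 - Cmod w * Cmod w) by apply: Rmult_le_compat_l => //; nra.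
have c2 : dd * (e / 2) <= 2 * (24 * G * ell lq t / e).
  apply: (Rmult_le_reg_r R0) => //; nra.
apply: (Rmult_le_reg_r (e * e)); first nra.
have -> : 100 * G * ell lq t / (e * e) * (e * e) = 100 * (G * ell lq t) by field; lra.
have := Rmult_le_compat_r (2 * e) _ _ (ltac:(lra)) c2.
have -> : 2 * (24 * G * ell lq t / e) * (2 * e) = 96 * (G * ell lq t) by field; lra.
lra.
Qed.

Definition Dpos_const : R := 4 * (97 * G) + 2 * (4 * ((97 * G) * (97 * G) + 2)).

(* Reflection in the line through [s0]: [L(conj s0 - z)/L(s0 + z)] has modulus 1 on [Re z = 0]. *)
Lemma Re_logder_lower s0 : / 2 < Re s0 <= 2 ->
  - (Dpos_const * ell lq (Im s0)) <= Re (L 1 s0 / L 0 s0)%C.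
Proof.
move=> hs.
set t0 := Im s0. set x0 := Re s0 in hs *.
have l0 := ell_ge t0 lq0; rewrite /= in l0.
set E := ell lq t0 in l0 *.
(* 97 = 1 + 24 * 4 is the constant that [growth_rect] yields at e = 1/4; K0 is large enough for
   e^(-4 K0 Re z) to bring |q| below 1 on the side Re z = 1/4. *)
set K0 := 97 * G * E + (97 * G) * (97 * G) + 2.
have K00 : 0 < K0 by rewrite /K0; nra.
pose q (z : C) := (L 0 (Cconj s0 + - z) / L 0 (s0 + z) * cexp (z * z - 4 * K0 * z))%C.
have reA z : Re (Cconj s0 + - z)%C = x0 - Re z by rewrite Re_plus Re_opp -[Re (Cconj s0)]/x0; ring.
have reB z : Re (s0 + z)%C = x0 + Re z by rewrite Re_plus.
have imB z : Im (s0 + z)%C = t0 + Im z by rewrite Im_plus.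
have imA z : Im (Cconj s0 + - z)%C = - (t0 + Im z) by rewrite Im_plus Im_opp -[Im (Cconj s0)]/(- t0); ring.
have ellN t : ell lq (- t) = ell lq t by rewrite /ell Rabs_Ropp.
have numb z : 0 <= Re z <= / 4 -> Cmod (L 0 (Cconj s0 + - z)%C) <= exp (G * ell lq (t0 + Im z)).
  by move=> hz; apply: Rlt_le; have := Lup (s := (Cconj s0 + - z)%C); rewrite reA imA ellN; apply; lra.
have den z : 0 <= Re z <= / 4 -> L 0 (s0 + z)%C <> 0 by move=> hz; apply: L0; rewrite reB; lra.
have ex z : Cmod (cexp (z * z - 4 * K0 * z)%C) = exp (Re z * Re z - Im z * Im z - 4 * K0 * Re z).
  by rewrite Cmod_cexp !CRI /=; congr exp; ring.
have shift y : ell lq (t0 + y) <= E + Rabs y / 2.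
  by have := ell_shift lq t0 (t0 + y); have -> : t0 + y - t0 = y by ring.
have lowb z e : 0 < e <= 1 -> 0 <= Re z <= / 4 -> / 2 + e <= x0 + Re z ->
   exp (- (24 * G * ell lq (t0 + Im z) / e)) <= Cmod (L 0 (s0 + z)%C).
  move=> he hz hx; rewrite -[Cmod _]exp_ln; last by apply/Cmod_gt_0; exact: den.
  have [] := @growth_rect (x0 + Re z) (t0 + Im z) e he (ltac:(lra)).
  have -> : (x0 + Re z, t0 + Im z) = (s0 + z)%C by apply: C_eq; rewrite ?reB ?imB.
  by case=> [/exp_increasing h _|-> _]; lra.
have qb z e : 0 < e <= 1 -> 0 <= Re z <= / 4 -> / 2 + e <= x0 + Re z ->
   Cmod (q z) <= exp ((G + 24 * G / e) * (E + Rabs (Im z) / 2) + 1 - Im z * Im z - 4 * K0 * Re z).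
  move=> he hz hx; rewrite /q Cmod_mult Cmod_div; last exact: den.
  rewrite ex.
  have h1 := numb z hz; have h2 := lowb z e he hz hx.
  have h3 := exp_pos (- (24 * G * ell lq (t0 + Im z) / e)).
  have h4 : Cmod (L 0 (Cconj s0 + - z)%C) / Cmod (L 0 (s0 + z)%C) <= exp (G * ell lq (t0 + Im z)) * exp (24 * G * ell lq (t0 + Im z) / e).
    apply: Rmult_le_compat => //; first exact: Cmod_ge_0.
      by apply/Rinv_ge0; lra.
    rewrite -[X in _ <= X]Rinv_inv -exp_Ropp; exact: Rinv_le_contravar.
  apply: Rle_trans (Rmult_le_compat_r _ _ _ (Rlt_le _ _ (exp_pos _)) h4) _.
  rewrite -!exp_plus.
  have sh := shift (Im z).
  have g0 : 0 <= G / e by apply: Rdiv_le_0_compat; lra.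
  have -> : 24 * G * ell lq (t0 + Im z) / e = 24 * (G / e) * ell lq (t0 + Im z) by field; lra.
  have -> : 24 * G / e = 24 * (G / e) by field; lra.
  have : G * ell lq (t0 + Im z) + 24 * (G / e) * ell lq (t0 + Im z) + (Re z * Re z - Im z * Im z - 4 * K0 * Re z) <=
    (G + 24 * (G / e)) * (E + Rabs (Im z) / 2) + 1 - Im z * Im z - 4 * K0 * Re z by nra.
  by case=> [/exp_increasing|->]; lra.
(* Maximum principle in a strip: |q| <= 1 on Re z = 0 by symmetry, on Re z = 1/4 by the choice of
   K0, and far up and down because e^(z^2) decays like a Gaussian. *)
have q1 : forall z, 0 <= Re z <= / 4 -> Cmod (q z) <= 1.
  pose e := Rmin (x0 - / 2) 1.
  have he : 0 < e <= 1 by split; [apply: Rmin_pos; lra | exact: Rmin_r].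
  have hx : / 2 + e <= x0 by have h : e <= x0 - / 2 := Rmin_l _ _; lra.
  set a := G + 24 * G / e.
  have a0 : 1 <= a.
    have : 0 <= 24 * G / e by apply: Rdiv_le_0_compat; lra.
    by rewrite /a; lra.
  pose F (z : C) := (L 0 (Cconj s0 + - z) / L 0 (s0 + z))%C.
  pose A1 (z : C) := (L 1 (Cconj s0 + - z) * - (1))%C.
  pose A2 (z : C) := (L 2 (Cconj s0 + - z) * - (1) * - (1))%C.
  have dA : forall z, 0 <= Re z <= / 4 -> cderiv (fun z => (Cconj s0 + - z)%C) z (- (1))%C.
    move=> z hz; apply: cd_eq (cd_plus (cd_const _ _) (cd_opp (cd_id z))) _; ring.
  have dB : forall z, cderiv (fun z => (s0 + z)%C) z 1.
    move=> z; apply: cd_eq (cd_plus (cd_const _ _) (cd_id z)) _; ring.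
  have cA : forall j z, 0 <= Re z <= / 4 -> cderiv (fun z => L j (Cconj s0 + - z)%C) z (L j.+1 (Cconj s0 + - z) * - (1))%C.
    move=> j z hz; apply: (cderiv_subst (g := fun z => (Cconj s0 + - z)%C)); last exact: dA.
    by apply: Lcd; rewrite reA; lra.
  have cB : forall j z, 0 <= Re z <= / 4 -> cderiv (fun z => L j (s0 + z)%C) z (L j.+1 (s0 + z))%C.
    move=> j z hz; apply: cd_eq (cderiv_subst (f' := L j.+1) (g := fun z => (s0 + z)%C) _ (dB z)) _; last ring.
    by apply: Lcd; rewrite reB; lra.
  have cE : forall z, cderiv (fun z => cexp (z * z - 4 * K0 * z)%C) z (cexp (z * z - 4 * K0 * z) * (2 * z - 4 * K0))%C.
    move=> z; apply: (cderiv_subst (f' := cexp) (g := fun z => (z * z - 4 * K0 * z)%C)); first exact: cd_cexp.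
    apply: cd_eq (cd_minus (cd_mult (cd_id z) (cd_id z)) (cd_scal _ (cd_id z))) _; ring.
  pose q1 z := ((A1 z / L 0 (s0 + z) - F z * (L 1 (s0 + z) / L 0 (s0 + z))) * cexp (z * z - 4 * K0 * z) + F z * (cexp (z * z - 4 * K0 * z) * (2 * z - 4 * K0)))%C.
  have dF : forall z, 0 <= Re z <= / 4 -> cderiv F z (A1 z / L 0 (s0 + z) - F z * (L 1 (s0 + z) / L 0 (s0 + z)))%C.
    by move=> z hz; apply: cd_div; [exact: cA | exact: cB | exact: den].
  have dq : forall z, 0 <= Re z <= / 4 -> cderiv q z (q1 z).
    by move=> z hz; apply: cd_mult; [exact: dF | exact: cE].
  have dq1 : forall z, exists q2, 0 <= Re z <= / 4 -> cderiv q1 z q2.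
    move=> z; case: (classic (0 <= Re z <= / 4)) => [hz|hz]; last by exists 0.
    eexists => _; rewrite /q1; apply: cd_plus; apply: cd_mult.
    - apply: cd_minus.
        apply: cd_div; [|exact: cB|exact: den].
        by apply: cd_mult; [exact: cA | exact: cd_const].
      by apply: cd_mult; [exact: dF | apply: cd_div; [exact: cB | exact: cB | exact: den]].
    - exact: cE.
    - exact: dF.
    - apply: cd_mult; first exact: cE.
      by apply: cd_minus; [apply: cd_scal; exact: cd_id | exact: cd_const].
  pose q2 z := proj1_sig (constructive_indefinite_description _ (dq1 z)).
  have dq2 : forall z, 0 <= Re z <= / 4 -> cderiv q1 z (q2 z).
    by move=> z; exact: (proj2_sig (constructive_indefinite_description _ (dq1 z))).
  apply: (@max_strip q q1 q2 0 (/ 4) 1 (a * (E + 1) + a + 1)) => //; try lra.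
  - move=> z [hz|hz].
      rewrite /q Cmod_mult Cmod_div; last by apply: den; lra.
      have -> : (Cconj s0 + - z)%C = Cconj (s0 + z)%C.
        apply: C_eq; rewrite ?reA ?imA.
          by rewrite -[Re (Cconj _)]/(Re (s0 + z)%C) reB hz; ring.
        by rewrite -[Im (Cconj _)]/(- Im (s0 + z)%C) imB.
      rewrite Cmod_conjC // ex hz.
      have p0 : 0 < Cmod (L 0 (s0 + z)%C) by apply/Cmod_gt_0; apply: den; lra.
      rewrite /Rdiv Rinv_r ?Rmult_1_l; last lra.
      by apply: exp_le1; nra.
    have h := qb z (/ 4) (ltac:(lra)) (ltac:(lra)) (ltac:(lra)).
    apply: Rle_trans h _; rewrite hz; apply: exp_le1.
    have : (G + 24 * G / / 4) * (E + Rabs (Im z) / 2) + 1 - Im z * Im z - 4 * K0 * / 4 <= 0.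
      have -> : Im z * Im z = Rabs (Im z) * Rabs (Im z) by rewrite -Rabs_mult Rabs_pos_eq //; nra.
      have := Rabs_pos (Im z); move: (Rabs (Im z)) => y y0.
      have -> : 24 * G / / 4 = 96 * G by field.
      rewrite /K0; have := Rle_0_sqr (y - 97 * G / 4); rewrite /Rsqr; nra.
    by [].
  - move=> z hz hT; have h := qb z e he hz (ltac:(lra)).
    apply: Rle_trans h _; rewrite -/a; apply: exp_le1.
    have : a * (E + Rabs (Im z) / 2) + 1 - Im z * Im z - 4 * K0 * Re z <= 0.
      have -> : Im z * Im z = Rabs (Im z) * Rabs (Im z) by rewrite -Rabs_mult Rabs_pos_eq //; nra.
      move: (Rabs (Im z)) hT => y hy.
      have : 0 <= K0 * Re z by nra.
      have : 0 <= a * E by nra.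
      have : a * E + a + 1 <= y by nra.
      nra.
    by [].
have n0 : L 0 s0 <> 0 by apply: L0; rewrite -/x0; lra.
apply: Rnot_lt_le => lt.
set d := Re (L 1 s0 / L 0 s0)%C in lt *.
have d2 : 4 * K0 < - 2 * d.
  rewrite /K0; rewrite /Dpos_const in lt.
  have : (97 * G * (97 * G) + 2) <= 2 * ((97 * G * (97 * G) + 2) * E) by nra.
  nra.
pose lg (t : R) := ln (nsq (L 0 (s0 + RtoC t * 1)%C)).
have z0 : (s0 + RtoC 0 * 1)%C = s0 by ring.
have dlg : is_derive lg 0 (2 * d).
  have := @ln_nsq_der (L 0) (L 1 s0) s0 1 0; rewrite z0 => H.
  have -> : d = Re (L 1 s0 / L 0 s0 * 1)%C by rewrite Cmult_1_r.
  by apply: H => //; apply: Lcd; rewrite -/x0; lra.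
(* This is log|q(t)| - t^2 for real t. Were Re L'/L too negative at s0, its derivative at 0 would be
   positive and |q| would exceed 1 just to the right of 0. *)
pose g t := (lg (- t) - lg t) / 2 - 4 * K0 * t.
have dg : is_derive g 0 (- 2 * d - 4 * K0).
  have dl' : is_derive lg (- 0) (2 * d) by rewrite Ropp_0.
  rewrite /g; auto_derive.
    by repeat split; first [exact (ex_intro _ _ dlg) | exact (ex_intro _ _ dl')].
  rewrite (is_derive_unique _ _ _ dlg) (is_derive_unique _ _ _ dl'); field.
have {}dg := proj1 (is_derive_Reals _ _ _) dg.
have [dl Hd] := dg (- 2 * d - 4 * K0) (ltac:(lra)).
have dl0 := cond_pos dl.
pose t := Rmin (dl / 2) (Rmin (/ 4) ((x0 - / 2) / 2)).
have t1 : t <= dl / 2 := Rmin_l _ _.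
have t2 : t <= / 4 := Rle_trans _ _ _ (Rmin_r _ _) (Rmin_l _ _).
have t3 : t <= (x0 - / 2) / 2 := Rle_trans _ _ _ (Rmin_r _ _) (Rmin_r _ _).
have t4 : 0 < t by repeat apply: Rmin_pos; lra.
have := Hd t (ltac:(lra)) (ltac:(rewrite Rabs_pos_eq; lra)).
have g0 : g 0 = 0 by rewrite /g Ropp_0; field.
rewrite Rplus_0_l g0 Rminus_0_r => /Rabs_def2 [_ hg].
have gp : 0 < g t.
  have h : 0 < g t / t by lra.
  by have := Rmult_lt_0_compat _ _ h t4; rewrite /Rdiv Rmult_assoc Rinv_l; lra.
have := q1 (RtoC t) (ltac:(rewrite /=; lra)).
have na : L 0 (Cconj s0 + - RtoC t)%C <> 0 by apply: L0; rewrite reA /=; lra.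
have nb : L 0 (s0 + RtoC t)%C <> 0 by apply: L0; rewrite reB /=; lra.
have pa := proj1 (Cmod_gt_0 _) na. have pb := proj1 (Cmod_gt_0 _) nb.
rewrite /q Cmod_mult Cmod_div // ex /= => hq.
have : ln (Cmod (L 0 (Cconj s0 + - RtoC t)%C) / Cmod (L 0 (s0 + RtoC t)%C) * exp (t * t - 0 * 0 - 4 * K0 * t)) <= ln 1.
  by apply: ln_le => //; apply: Rmult_lt_0_compat; [exact: Rdiv_lt_0_compat | exact: exp_pos].
rewrite ln_mult; [|exact: Rdiv_lt_0_compat|exact: exp_pos].
rewrite ln_div // ln_1 ln_exp.
move: gp; rewrite /g /lg.
have -> : (s0 + RtoC t * 1)%C = (s0 + RtoC t)%C by ring.
rewrite conj_reflect !nsqE Cmod_conjC // !ln_mult //; nra.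
Qed.

End Growth.

(** * Fourier series of a smoothed square wave *)

Lemma sumR_ext f g n : (forall i, (i < n)%N -> f i = g i) -> sumR f n = sumR g n.
Proof.
elim: n => //= n IH h; rewrite IH; last by move=> i hi; apply: h; lia.
by rewrite h.
Qed.
Lemma sumR_plus f g n : sumR (fun i => f i + g i) n = sumR f n + sumR g n.
Proof. by elim: n => /= [|n ->]; ring. Qed.
Lemma sumR_scal k f n : sumR (fun i => k * f i) n = k * sumR f n.
Proof. by elim: n => /= [|n ->]; ring. Qed.
Lemma sumR_le f g n : (forall i, (i < n)%N -> f i <= g i) -> sumR f n <= sumR g n.
Proof.
elim: n => /= [|n IH] h; first lra.
apply: Rplus_le_compat; last exact: h.
by apply: IH => i hi; apply: h; lia.
Qed.
Lemma sumR_abs f n : Rabs (sumR f n) <= sumR (fun i => Rabs (f i)) n.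
Proof.
elim: n => /= [|n IH]; first by rewrite Rabs_R0; lra.
by apply: Rle_trans (Rabs_triang _ _) _; lra.
Qed.
Lemma sumR_0 n : sumR (fun _ => 0) n = 0.
Proof. by elim: n => //= n ->; ring. Qed.
Lemma sumR_ge0 f n : (forall i, (i < n)%N -> 0 <= f i) -> 0 <= sumR f n.
Proof. by move=> h; rewrite -(sumR_0 n); exact: sumR_le. Qed.

Lemma is_derive_sumR (f f' : nat -> R -> R) n x : (forall i, is_derive (f i) x (f' i x)) ->
  is_derive (fun x => sumR (fun i => f i x) n) x (sumR (fun i => f' i x) n).
Proof.
move=> h; elim: n => /= [|n IH]; first exact: is_derive_const.
exact: (is_derive_plus (V := R_NormedModule)).
Qed.

Lemma mvt_R (f f' : R -> R) a b B : (forall t, Rmin a b <= t <= Rmax a b -> is_derive f t (f' t)) ->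
  (forall t, Rmin a b <= t <= Rmax a b -> Rabs (f' t) <= B) -> Rabs (f b - f a) <= B * Rabs (b - a).
Proof.
move=> h1 h2; have := MVT_gen f a b f'; case.
- by move=> t ht; apply: h1; lra.
- by move=> t ht; apply/continuity_pt_filterlim; apply: ex_derive_continuous; exists (f' t); exact: h1.
move=> c [hc ->]; rewrite Rabs_mult; apply: Rmult_le_compat_r; [exact: Rabs_pos | exact: h2].
Qed.

Definition od (i : nat) : R := 2 * INR i + 1.
Lemma od_ge1 i : 1 <= od i. Proof. by rewrite /od; have := pos_INR i; lra. Qed.

(** [Uf], [Rf], [Cf] are partial sums of series that converge on (0, pi) to pi/4, (pi/4)(pi/2 - x)
    and pi x (pi - x)/8. Up to sign each is a primitive of the one before. *)
Definition Uf n x := sumR (fun i => sin (od i * x) / od i) n.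
Definition Rf n x := sumR (fun i => cos (od i * x) / (od i * od i)) n.
Definition Cf n x := sumR (fun i => sin (od i * x) / (od i * od i * od i)) n.

Lemma sum_cos_od n x : 2 * sin x * sumR (fun i => cos (od i * x)) n = sin (2 * INR n * x).
Proof.
elim: n => [|n IH]; first by rewrite /= !Rmult_0_r Rmult_0_l sin_0.
rewrite [sumR _ _]/= Rmult_plus_distr_l IH S_INR /od.
have -> : 2 * (INR n + 1) * x = (2 * INR n * x + x) + x by ring.
have -> : (2 * INR n + 1) * x = 2 * INR n * x + x by ring.
rewrite (sin_plus (_ + x) x).
have -> : sin (2 * INR n * x) = sin ((2 * INR n * x + x) - x) by congr sin; ring.
rewrite sin_minus; ring.
Qed.

(** At pi/2 the sum is the Leibniz series, bracketed by its alternating partial sums. *)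
Lemma Uf_half n : (1 <= n)%N -> Rabs (Uf n (PI / 2) - PI / 4) <= / INR n.
Proof.
move=> hn.
have E : forall m, Uf m.+1 (PI / 2) = sum_f_R0 (tg_alt PI_tg) m.
  have T : forall i, sin (od i * (PI / 2)) / od i = tg_alt PI_tg i.
    move=> i; rewrite /tg_alt /PI_tg /od.
    have -> : (2 * INR i + 1) * (PI / 2) = PI / 2 + INR i * PI by field.
    have -> : sin (PI / 2 + INR i * PI) = (-1) ^ i.
      elim: i => [|i IH]; first by rewrite /= Rmult_0_l Rplus_0_r sin_PI2.
      rewrite S_INR; have -> : PI / 2 + (INR i + 1) * PI = (PI / 2 + INR i * PI) + PI by ring.
      by rewrite neg_sin IH /=; ring.
    by rewrite plus_INR mult_INR.
  elim=> [|m IH]; first by rewrite /Uf /= T; ring.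
  by rewrite tech5 -IH /Uf -T.
have tgb : forall m, tg_alt PI_tg (2 * m)%coq_nat.+1 = - / (4 * INR m + 3).
  move=> m; rewrite /tg_alt /PI_tg pow_1_odd.
  have -> : (2 * (2 * m)%coq_nat.+1 + 1 = 4 * m + 3)%coq_nat by lia.
  by rewrite plus_INR mult_INR /=; ring_simplify; congr (- / _); ring.
have P4 : PI / 4 = Alt_PI / 4 by rewrite Alt_PI_eq.
have hb : forall m, 0 < 4 * INR m + 3 by move=> m; have := pos_INR m; lra.
have [m [hm|hm]] : exists m, n = (2 * m)%coq_nat.+1 \/ n = (2 * m)%coq_nat.+2.
  by case: (Nat.Even_or_Odd n) => -[m hm]; [exists m.-1; right | exists m; left]; lia.
- have [h1 h2] := Alt_PI_ineq m.
  rewrite -[S _]/((2 * m)%coq_nat.+1) tech5 tgb in h1.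
  rewrite hm E P4 Rabs_pos_eq; last by lra.
  apply: (Rle_trans _ (/ (4 * INR m + 3))); first by lra.
  apply: Rinv_le_contravar; first by apply: lt_0_INR; lia.
  rewrite S_INR mult_INR /=; have := pos_INR m; lra.
- have [h1 h2] := Alt_PI_ineq m.
  rewrite hm E P4 Rabs_minus_sym Rabs_pos_eq; last by lra.
  rewrite tech5 tgb; rewrite tech5 tgb in h1.
  apply: (Rle_trans _ (/ (4 * INR m + 3))); first by lra.
  apply: Rinv_le_contravar; first by apply: lt_0_INR; lia.
  rewrite !S_INR mult_INR /=; have := pos_INR m; lra.
Qed.

(** The derivative sin(2nx)/(2 sin x) of [Uf] oscillates. Adding cos(2nx)/(4n sin x) removes the
    oscillation and leaves a derivative O(1/n) on [d, pi - d], so the value near pi/4 at pi/2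
    propagates. *)
Lemma Uf_close n d x : (1 <= n)%N -> 0 < d < 1 -> d <= x <= PI - d ->
  Rabs (Uf n x - PI / 4) <= 4 / (INR n * (sin d * sin d)).
Proof.
move=> hn hd hx.
have n0 : 0 < INR n by apply: lt_0_INR; lia.
have P1 := PI_4. have P2 := PI2_1.
have s0 : 0 < sin d by apply: sin_gt_0; lra.
have s1 : sin d <= 1 by have := SIN_bound d; lra.
have sb : forall t, d <= t <= PI - d -> sin d <= sin t.
  move=> t ht; case: (Rle_dec t (PI / 2)) => h; first by apply: sin_incr_1; lra.
  by rewrite -(sin_PI_x t); apply: sin_incr_1; lra.
pose E t := Uf n t + cos (2 * INR n * t) / (4 * INR n * sin t).
pose E' t := - cos (2 * INR n * t) * cos t / (4 * INR n * (sin t * sin t)).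
have dE : forall t, d <= t <= PI - d -> is_derive E t (E' t).
  move=> t ht; have st := sb t ht.
  have h1 : is_derive (Uf n) t (sumR (fun i => cos (od i * t)) n).
    apply: (is_derive_sumR (f := fun i x => sin (od i * x) / od i) (f' := fun i x => cos (od i * x))) => i.
    by auto_derive => //; field; have := od_ge1 i; lra.
  have h2 : is_derive (fun t => cos (2 * INR n * t) / (4 * INR n * sin t)) t
     (- sin (2 * INR n * t) / (2 * sin t) + E' t).
    rewrite /E'; auto_derive; first nra.
    field; lra.
  have := is_derive_plus (V := R_NormedModule) _ _ _ _ _ h1 h2.
  have -> : plus (sumR (fun i => cos (od i * t)) n) (- sin (2 * INR n * t) / (2 * sin t) + E' t) = E' t.
    by rewrite /plus /= -sum_cos_od; field; lra.
  by [].
have bE : forall t, d <= t <= PI - d -> Rabs (E' t) <= / (4 * INR n * (sin d * sin d)).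
  move=> t ht; have st := sb t ht.
  have pp : 0 < 4 * INR n * (sin t * sin t) by apply: Rmult_lt_0_compat; nra.
  rewrite /E' Rabs_div; last by lra.
  rewrite Rabs_mult Rabs_Ropp.
  have c1 : Rabs (cos (2 * INR n * t)) <= 1 by apply: Rabs_le; exact: COS_bound.
  have c2 : Rabs (cos t) <= 1 by apply: Rabs_le; exact: COS_bound.
  rewrite (Rabs_pos_eq (4 * _ * _)); last by nra.
  rewrite -[X in _ <= X]Rmult_1_l /Rdiv; apply: Rmult_le_compat.
  - by apply: Rmult_le_pos; exact: Rabs_pos.
  - by apply/Rinv_ge0; nra.
  - by have := Rabs_pos (cos (2 * INR n * t)); have := Rabs_pos (cos t); nra.
  - apply: Rinv_le_contravar; first by apply: Rmult_lt_0_compat; nra.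
    by apply: Rmult_le_compat_l; [lra | apply: Rmult_le_compat; lra].
have m1 : d <= Rmin (PI / 2) x by apply: Rmin_glb; lra.
have m2 : Rmax (PI / 2) x <= PI - d by apply: Rmax_lub; lra.
have := @mvt_R E E' (PI / 2) x (/ (4 * INR n * (sin d * sin d))) (fun t ht => dE t (ltac:(lra))) (fun t ht => bE t (ltac:(lra))).
have ab : Rabs (x - PI / 2) <= 4 by apply: Rabs_le; lra.
have hh := Uf_half hn.
have cb : forall t, d <= t <= PI - d -> Rabs (E t - Uf n t) <= / (4 * INR n * sin d).
  move=> t ht; have st := sb t ht; rewrite /E.
  have -> : Uf n t + cos (2 * INR n * t) / (4 * INR n * sin t) - Uf n t = cos (2 * INR n * t) / (4 * INR n * sin t) by ring.
  have pp : 0 < 4 * INR n * sin t by nra.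
  rewrite Rabs_div; last by lra.
  have c1 : Rabs (cos (2 * INR n * t)) <= 1 by apply: Rabs_le; exact: COS_bound.
  rewrite (Rabs_pos_eq (4 * _ * _)); last by nra.
  rewrite -[X in _ <= X]Rmult_1_l /Rdiv; apply: Rmult_le_compat => //; first exact: Rabs_pos.
    by apply/Rinv_ge0; nra.
  by apply: Rinv_le_contravar; nra.
have c1 := cb x hx. have c2 := cb (PI / 2) (ltac:(lra)).
set k := / (INR n * (sin d * sin d)).
have k0 : 0 < k by apply: Rinv_0_lt_compat; apply: Rmult_lt_0_compat; nra.
have e1 : / (4 * INR n * (sin d * sin d)) = k / 4 by rewrite /k; field; lra.
have ss : sin d * sin d <= sin d by nra.
have e2 : / (4 * INR n * sin d) <= k / 4.
  by rewrite -e1; apply: Rinv_le_contravar; [apply: Rmult_lt_0_compat; nra | apply: Rmult_le_compat_l; lra].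
have e3 : / INR n <= k.
  by apply: Rinv_le_contravar; [apply: Rmult_lt_0_compat; nra | rewrite -[X in _ <= X]Rmult_1_r; apply: Rmult_le_compat_l; nra].
rewrite e1 => h3.
have h4 : k / 4 * Rabs (x - PI / 2) <= k by nra.
have -> : 4 / (INR n * (sin d * sin d)) = 4 * k by [].
have -> : Uf n x - PI / 4 = (E x - E (PI / 2)) - (E x - Uf n x) + (E (PI / 2) - Uf n (PI / 2)) + (Uf n (PI / 2) - PI / 4) by ring.
apply: Rle_trans (Rabs_triang _ _) _; apply: Rle_trans (Rplus_le_compat_r _ _ _ (Rabs_triang _ _)) _.
apply: Rle_trans (Rplus_le_compat_r _ _ _ (Rplus_le_compat_r _ _ _ (Rabs_triang _ _))) _.
rewrite Rabs_Ropp; lra.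
Qed.

Lemma Rf_half n : Rf n (PI / 2) = 0.
Proof.
rewrite -(sumR_0 n); apply: sumR_ext => i _.
have -> : cos (od i * (PI / 2)) = 0; last by rewrite /Rdiv Rmult_0_l.
rewrite /od; elim: i => [|i IH].
  have -> : (2 * INR 0 + 1) * (PI / 2) = PI / 2 by rewrite /=; field.
  by rewrite cos_PI2.
rewrite S_INR.
have -> : (2 * (INR i + 1) + 1) * (PI / 2) = (2 * INR i + 1) * (PI / 2) + PI by field.
by rewrite neg_cos IH Ropp_0.
Qed.

Lemma Rf_close n d x : (1 <= n)%N -> 0 < d < 1 -> d <= x <= PI - d ->
  Rabs (Rf n x - PI / 4 * (PI / 2 - x)) <= 16 / (INR n * (sin d * sin d)).
Proof.
move=> hn hd hx.
have n0 : 0 < INR n by apply: lt_0_INR; lia.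
have P1 := PI_4. have P2 := PI2_1.
have s0 : 0 < sin d by apply: sin_gt_0; lra.
pose r t := Rf n t - PI / 4 * (PI / 2 - t).
have dr : forall t, is_derive r t (- (Uf n t - PI / 4)).
  move=> t.
  have h1 : is_derive (Rf n) t (sumR (fun i => (-1) * (sin (od i * t) / od i)) n).
    apply: (is_derive_sumR (f := fun i x => cos (od i * x) / (od i * od i)) (f' := fun i x => (-1) * (sin (od i * x) / od i))) => i.
    by auto_derive => //; field; have := od_ge1 i; lra.
  rewrite sumR_scal -/(Uf n t) in h1.
  rewrite /r; auto_derive; first by exists ((-1) * Uf n t).
  rewrite (is_derive_unique (fun x => Rf n x) _ _ h1); field.
have m1 : d <= Rmin (PI / 2) x by apply: Rmin_glb; lra.
have m2 : Rmax (PI / 2) x <= PI - d by apply: Rmax_lub; lra.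
have := @mvt_R r (fun t => - (Uf n t - PI / 4)) (PI / 2) x (4 / (INR n * (sin d * sin d))) (fun t ht => dr t) _.
have r0 : r (PI / 2) = 0 by rewrite /r Rf_half; ring.
rewrite r0 Rminus_0_r => h; apply: Rle_trans (h _) _.
  by move=> t ht; rewrite Rabs_Ropp; apply: Uf_close => //; lra.
have ab : Rabs (x - PI / 2) <= 4 by apply: Rabs_le; lra.
have k0 : 0 < / (INR n * (sin d * sin d)) by apply: Rinv_0_lt_compat; apply: Rmult_lt_0_compat; nra.
rewrite /Rdiv; nra.
Qed.

Lemma sum_inv_sq n : sumR (fun i => / (od i * od i)) n <= 2.
Proof.
have P : forall m, sumR (fun i => / (od i * od i)) m.+1 <= 2 - / od m.
  elim=> [|m IH].
    by rewrite /= /od /=; lra.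
  rewrite [sumR _ _]/=.
  have := od_ge1 m => h.
  have -> : od m.+1 = od m + 2 by rewrite /od S_INR; ring.
  have : / ((od m + 2) * (od m + 2)) <= / od m - / (od m + 2).
    have -> : / od m - / (od m + 2) = 2 / (od m * (od m + 2)) by field; lra.
    rewrite /Rdiv -[X in X <= _]Rmult_1_l; apply: Rmult_le_compat; try lra.
      by apply/Rinv_ge0; nra.
    by apply: Rinv_le_contravar; nra.
  have e : sumR (fun i => / (od i * od i)) m.+1 = sumR (fun i => / (od i * od i)) m + / (od m * od m) by [].
  rewrite e in IH; lra.
case: n => [|n]; first by rewrite /=; lra.
have := P n; have := Rinv_0_lt_compat (od n) (ltac:(have := od_ge1 n; lra)); lra.
Qed.

Lemma Rf_bound n x : Rabs (Rf n x) <= 2.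
Proof.
apply: Rle_trans (sumR_abs _ _) _; apply: Rle_trans (sum_inv_sq n).
apply: sumR_le => i _; have := od_ge1 i => h.
have p : 0 < od i * od i by nra.
rewrite Rabs_div; last lra.
rewrite (Rabs_pos_eq (od i * od i)); last lra.
have c1 : Rabs (cos (od i * x)) <= 1 by apply: Rabs_le; exact: COS_bound.
have := Rinv_0_lt_compat _ p; rewrite /Rdiv; nra.
Qed.

(** On [d, pi - d] the derivative of the error is small by [Rf_close]; on the two end intervals, of
    length d, it is at most 4. *)
Lemma Cf_close d n x : (1 <= n)%N -> 0 < d < 1 -> 0 <= x <= PI ->
  Rabs (Cf n x - PI * x * (PI - x) / 8) <= 8 * d + 64 / (INR n * (sin d * sin d)).
Proof.
move=> hn hd hx.
have n0 : 0 < INR n by apply: lt_0_INR; lia.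
have P1 := PI_4. have P2 := PI2_1.
have s0 : 0 < sin d by apply: sin_gt_0; lra.
set k := 16 / (INR n * (sin d * sin d)).
have k0 : 0 < k by apply: Rdiv_lt_0_compat; [lra | apply: Rmult_lt_0_compat; nra].
pose V t := Cf n t - PI * t * (PI - t) / 8.
have dV : forall t, is_derive V t (Rf n t - PI / 4 * (PI / 2 - t)).
  move=> t.
  have h1 : is_derive (Cf n) t (Rf n t).
    apply: (is_derive_sumR (f := fun i x => sin (od i * x) / (od i * od i * od i)) (f' := fun i x => cos (od i * x) / (od i * od i))) => i.
    by auto_derive => //; field; have := od_ge1 i; lra.
  rewrite /V; auto_derive; first by exists (Rf n t).
  rewrite (is_derive_unique (fun x => Cf n x) _ _ h1); field.
have all : forall t, 0 <= t <= PI -> Rabs (Rf n t - PI / 4 * (PI / 2 - t)) <= 4.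
  move=> t ht; have h := Rf_bound n t.
  apply: Rle_trans (Rabs_triang _ _) _; rewrite Rabs_Ropp.
  have : Rabs (PI / 4 * (PI / 2 - t)) <= 2 by apply: Rabs_le; nra.
  lra.
have V0 : V 0 = 0.
  rewrite /V; have -> : Cf n 0 = 0; last by field.
  apply: (eq_trans _ (sumR_0 n)); rewrite /Cf; apply: sumR_ext => i _; rewrite Rmult_0_r sin_0 /Rdiv; ring.
have st1 : forall t, 0 <= t <= d -> Rabs (V t) <= 4 * d.
  move=> t ht; have := @mvt_R V _ 0 t 4 (fun x _ => dV x).
  rewrite Rmin_left ?Rmax_right; try lra.
  rewrite V0 !Rminus_0_r => h; apply: Rle_trans (h _) _.
    by move=> y hy; apply: all; lra.
  by rewrite Rabs_pos_eq; lra.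
have st2 : forall t, d <= t <= PI - d -> Rabs (V t) <= 4 * d + 4 * k.
  move=> t ht; have := @mvt_R V _ d t k (fun x _ => dV x).
  rewrite Rmin_left ?Rmax_right; try lra.
  move=> h; have {}h : Rabs (V t - V d) <= k * Rabs (t - d).
    by apply: h => y hy; apply: Rf_close => //; lra.
  have h2 := st1 d (ltac:(lra)).
  have h3 := Rabs_triang (V t - V d) (V d).
  have e : V t - V d + V d = V t by ring.
  rewrite e in h3.
  have ab : Rabs (t - d) <= 4 by apply: Rabs_le; lra.
  nra.
have -> : 64 / (INR n * (sin d * sin d)) = 4 * k by rewrite /k; field; nra.
rewrite -/(V x).
case: (Rle_dec x d) => h1; first by have := st1 x (ltac:(lra)); lra.
case: (Rle_dec x (PI - d)) => h2; first by have := st2 x (ltac:(lra)); lra.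
have := @mvt_R V _ (PI - d) x 4 (fun x _ => dV x).
rewrite Rmin_left ?Rmax_right; try lra.
move=> h; have {}h : Rabs (V x - V (PI - d)) <= 4 * Rabs (x - (PI - d)).
  by apply: h => y hy; apply: all; lra.
have h4 := st2 (PI - d) (ltac:(lra)).
have h3 := Rabs_triang (V x - V (PI - d)) (V (PI - d)).
have e : V x - V (PI - d) + V (PI - d) = V x by ring.
rewrite e in h3.
have ab : Rabs (x - (PI - d)) <= d by apply: Rabs_le; lra.
lra.
Qed.

Lemma Cf_lim eps : 0 < eps -> exists n0, forall n, (n0 <= n)%N -> forall x, 0 <= x <= PI ->
  Rabs (Cf n x - PI * x * (PI - x) / 8) <= eps.
Proof.
move=> e0; set d := Rmin (/ 2) (eps / 16).
have d0 : 0 < d by apply: Rmin_pos; lra.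
have d1 : d <= / 2 := Rmin_l _ _. have d2 : d <= eps / 16 := Rmin_r _ _.
have P2 := PI2_1.
have s0 : 0 < sin d by apply: sin_gt_0; lra.
have s2 : 0 < sin d * sin d by nra.
have [m hm] := nfloor_ex (128 / (sin d * sin d) / eps) (ltac:(apply: Rdiv_le_0_compat; [apply: Rdiv_le_0_compat; lra | lra])).
exists m.+1 => n hn x hx.
apply: Rle_trans (@Cf_close d n x (ltac:(lia)) (ltac:(lra)) hx) _.
have h : 128 / (sin d * sin d) / eps <= INR n.
  apply: Rle_trans (Rlt_le _ _ (proj2 hm)) _; rewrite -S_INR; apply: le_INR; lia.
have n0 : 0 < INR n by apply: lt_0_INR; lia.
have : 64 / (INR n * (sin d * sin d)) <= eps / 2.
  apply: (Rmult_le_reg_r (INR n)) => //.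
  have -> : 64 / (INR n * (sin d * sin d)) * INR n = (128 / (sin d * sin d) / eps) * (eps / 2) by field; lra.
  rewrite (Rmult_comm (eps / 2)); apply: Rmult_le_compat_r; lra.
lra.
Qed.

(** These coefficients are nonnegative, which allows a one-sided bound on L'/L to be averaged. *)
Definition mb (al : R) (i : nat) : R := 4 / (PI * od i) * ((sin (od i * al) / (od i * al)) ^ 2).
Definition Tf (al : R) (n : nat) (x : R) : R := sumR (fun i => mb al i * sin (od i * x)) n.
(** Profile of the smoothed wave near 0, in units of the smoothing length: a parabola rising to 1 at
    l = 1. *)
Definition Ff (l : R) : R := if Rle_dec l 1 then 1 - (1 - l) ^ 2 else 1.

Lemma mb_ge0 al i : 0 <= mb al i.
Proof.
apply: Rmult_le_pos; last exact: pow2_ge_0.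
by apply: Rdiv_le_0_compat; [lra | have := PI_RGT_0; have := od_ge1 i; nra].
Qed.

(** The factor sin^2 in [mb] is a second difference, 2 - 2 cos(2y) = 4 sin^2 y, so [Tf] is a
    symmetric second difference of [Cf] with step 2 al. *)
Lemma Tf_Cf al n x : 0 < al -> Tf al n x = / (PI * (al * al)) * (2 * Cf n x - Cf n (x + 2 * al) - Cf n (x - 2 * al)).
Proof.
move=> a0; have P := PI_RGT_0.
have -> : 2 * Cf n x - Cf n (x + 2 * al) - Cf n (x - 2 * al) =
   2 * Cf n x + (-1) * Cf n (x + 2 * al) + (-1) * Cf n (x - 2 * al) by ring.
rewrite /Cf -!sumR_scal -!sumR_plus -sumR_scal; apply: sumR_ext => i _.
have h := od_ge1 i.
rewrite /mb.
have -> : od i * (x + 2 * al) = od i * x + 2 * (od i * al) by ring.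
have -> : od i * (x - 2 * al) = od i * x - 2 * (od i * al) by ring.
rewrite sin_plus sin_minus cos_2a_sin; field; repeat split; nra.
Qed.

Lemma Cf_odd n x : Cf n (- x) = - Cf n x.
Proof.
apply: (eq_trans _ (_ : (-1) * Cf n x = _)); last by ring.
rewrite /Cf -sumR_scal; apply: sumR_ext => i _.
have -> : od i * - x = - (od i * x) by ring.
rewrite sin_neg /Rdiv; ring.
Qed.

(* [Ff] is a square wave smoothed twice by an interval of length [2 al]; the [mb al i] are its sine coefficients. *)
Lemma Tf_lim al eps : 0 < al -> 0 < eps -> exists n0, forall n, (n0 <= n)%N -> forall x, 0 <= x -> x + 2 * al <= PI ->
  Rabs (Tf al n x - Ff (x / (2 * al))) <= eps.
Proof.
move=> a0 e0; have P := PI_RGT_0.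
set e1 := eps * (PI * (al * al)) / 4.
have pa : 0 < PI * (al * al) by apply: Rmult_lt_0_compat => //; nra.
have e10 : 0 < e1 by have := Rmult_lt_0_compat _ _ e0 pa; rewrite /e1; lra.
have [n0 H] := Cf_lim e10; exists n0 => n hn x hx hx2.
have h1 := H n hn x (ltac:(lra)). have h2 := H n hn (x + 2 * al) (ltac:(lra)).
have [q [hq1 hq2]] : exists q, Rabs (Cf n (x - 2 * al) - q) <= e1 /\
  Ff (x / (2 * al)) = / (PI * (al * al)) * (2 * (PI * x * (PI - x) / 8) - PI * (x + 2 * al) * (PI - (x + 2 * al)) / 8 - q).
  rewrite /Ff; case: Rle_dec => hl /=.
    have hl2 : x <= 2 * al.
      have := Rmult_le_compat_r (2 * al) _ _ (ltac:(lra)) hl; rewrite /Rdiv Rmult_assoc Rinv_l; lra.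
    exists (- (PI * (2 * al - x) * (PI - (2 * al - x)) / 8)); split; last by field; lra.
    have := H n hn (2 * al - x) (ltac:(lra)).
    have -> : x - 2 * al = - (2 * al - x) by ring.
    rewrite Cf_odd -(Rabs_Ropp (- _ - _)) => h; apply: Rle_trans h; right; congr Rabs; ring.
  have hl2 : 2 * al <= x.
    apply: Rnot_lt_le => h; apply: hl; apply: (Rmult_le_reg_r (2 * al)); first lra.
    rewrite /Rdiv Rmult_assoc Rinv_l; lra.
  exists (PI * (x - 2 * al) * (PI - (x - 2 * al)) / 8); split; last by field; lra.
  by apply: H => //; lra.
rewrite Tf_Cf // hq2.
set a := Cf n x in h1 *; set b := Cf n (x + 2 * al) in h2 *; set c := Cf n (x - 2 * al) in hq1 *.
set a' := PI * x * (PI - x) / 8 in h1 *; set b' := PI * (x + 2 * al) * _ / 8 in h2 *.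
have -> : / (PI * (al * al)) * (2 * a - b - c) - / (PI * (al * al)) * (2 * a' - b' - q) =
   / (PI * (al * al)) * (2 * (a - a') - (b - b') - (c - q)) by ring.
rewrite Rabs_mult Rabs_pos_eq; last by apply/Rinv_ge0.
have : Rabs (2 * (a - a') - (b - b') - (c - q)) <= 4 * e1.
  by apply/Rabs_le_between; move/Rabs_le_between: h1; move/Rabs_le_between: h2; move/Rabs_le_between: hq1; lra.
move=> h; apply: (Rle_trans _ (/ (PI * (al * al)) * (4 * e1))).
  by apply: Rmult_le_compat_l => //; apply/Rinv_ge0.
by right; rewrite /e1; field; lra.
Qed.

(** * A positive finite average over a vertical line and its action on n^(-s) *)

Fixpoint sumC (f : nat -> C) (n : nat) : C := if n is m.+1 then (sumC f m + f m)%C else 0.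

Lemma sumC_ext f g n : (forall i, (i < n)%N -> f i = g i) -> sumC f n = sumC g n.
Proof.
elim: n => //= n IH h; rewrite IH; last by move=> i hi; apply: h; lia.
by rewrite h.
Qed.
Lemma sumC_plus f g n : sumC (fun i => f i + g i)%C n = (sumC f n + sumC g n)%C.
Proof. by elim: n => /= [|n ->]; ring. Qed.
Lemma sumC_scal k f n : sumC (fun i => k * f i)%C n = (k * sumC f n)%C.
Proof. by elim: n => /= [|n ->]; ring. Qed.
Lemma sumC_abs f n : Cmod (sumC f n) <= sumR (fun i => Cmod (f i)) n.
Proof.
elim: n => /= [|n IH]; first by rewrite Cmod_0; lra.
by apply: Rle_trans (Cmod_triangle _ _) _; lra.
Qed.
Lemma sumC_Re f n : Re (sumC f n) = sumR (fun i => Re (f i)) n.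
Proof. by elim: n => //= n IH; rewrite -IH. Qed.

(* Twice complex differentiable on the strip [a <= Re z <= b]. *)
Definition tw (a b : R) (f : C -> C) := exists f1 f2 : C -> C, forall z, a <= Re z <= b ->
  cderiv f z (f1 z) /\ cderiv f1 z (f2 z).

Section Tw.
Variables a b : R.
Implicit Types f g : C -> C.

Lemma tw_ext f g : (forall z, f z = g z) -> tw a b f -> tw a b g.
Proof.
move=> h [f1 [f2 H]]; exists f1, f2 => z /H [h1 h2]; split=> //; exact: cd_ext h h1.
Qed.
Lemma tw_const k : tw a b (fun _ => k).
Proof. by exists (fun _ => RtoC 0), (fun _ => RtoC 0) => z _; split; exact: cd_const. Qed.
Lemma tw_id : tw a b (fun z => z).
Proof. by exists (fun _ => RtoC 1), (fun _ => RtoC 0) => z _; split; [exact: cd_id | exact: cd_const]. Qed.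
Lemma tw_plus f g : tw a b f -> tw a b g -> tw a b (fun z => f z + g z)%C.
Proof.
move=> [f1 [f2 Hf]] [g1 [g2 Hg]]; exists (fun z => f1 z + g1 z)%C, (fun z => f2 z + g2 z)%C => z hz.
by have [h1 h2] := Hf z hz; have [h3 h4] := Hg z hz; split; apply: cd_plus.
Qed.
Lemma tw_mult f g : tw a b f -> tw a b g -> tw a b (fun z => f z * g z)%C.
Proof.
move=> [f1 [f2 Hf]] [g1 [g2 Hg]]; exists (fun z => f1 z * g z + f z * g1 z)%C,
  (fun z => (f2 z * g z + f1 z * g1 z) + (f1 z * g1 z + f z * g2 z))%C => z hz.
have [h1 h2] := Hf z hz; have [h3 h4] := Hg z hz; split; first exact: cd_mult.
by apply: cd_plus; apply: cd_mult.
Qed.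
Lemma tw_scal k f : tw a b f -> tw a b (fun z => k * f z)%C.
Proof. by move=> h; apply: tw_mult => //; exact: tw_const. Qed.
Lemma tw_opp f : tw a b f -> tw a b (fun z => - f z)%C.
Proof. move=> h; apply: (tw_ext (f := fun z => (- (1)) * f z)%C); [by move=> z; ring | exact: tw_scal]. Qed.
Lemma tw_minus f g : tw a b f -> tw a b g -> tw a b (fun z => f z - g z)%C.
Proof. by move=> h1 h2; apply: tw_plus => //; exact: tw_opp. Qed.
Lemma tw_inv f : (forall z, a <= Re z <= b -> f z <> 0) -> tw a b f -> tw a b (fun z => / f z)%C.
Proof.
move=> h0 [f1 [f2 Hf]]; pose g z := (/ f z)%C.
exists (fun z => - f1 z / (f z * f z))%C.
(* The second derivative is found point by point; choice assembles it into a function. *)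
suff : forall z, exists d, a <= Re z <= b -> cderiv (fun z => - f1 z / (f z * f z))%C z d.
  move=> H; exists (fun z => proj1_sig (constructive_indefinite_description _ (H z))) => z hz.
  have [h1 h2] := Hf z hz; split; first by apply: cd_inv => //; exact: h0.
  exact: (proj2_sig (constructive_indefinite_description _ (H z))).
move=> z; case: (classic (a <= Re z <= b)) => hz; last by exists 0.
have [h1 h2] := Hf z hz; eexists => _; apply: cd_div.
- exact: cd_opp h2.
- exact: (cd_mult h1 h1).
- by apply: Cmult_neq_0; exact: h0.
Qed.
Lemma tw_cexp f : tw a b f -> tw a b (fun z => cexp (f z)).
Proof.
move=> [f1 [f2 Hf]]; exists (fun z => cexp (f z) * f1 z)%C, (fun z => (cexp (f z) * f1 z) * f1 z + cexp (f z) * f2 z)%C => z hz.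
have [h1 h2] := Hf z hz.
have h3 : cderiv (fun z => cexp (f z)) z (cexp (f z) * f1 z)%C by apply: (cderiv_subst (f' := cexp)) => //; exact: cd_cexp.
by split=> //; apply: cd_mult.
Qed.
Lemma tw_shift f (v : C) : Re v = 0 -> tw a b f -> tw a b (fun z => f (z + v)%C).
Proof.
move=> hv [f1 [f2 Hf]]; exists (fun z => f1 (z + v)%C), (fun z => f2 (z + v)%C) => z hz.
have [h1 h2] := Hf (z + v)%C (ltac:(rewrite Re_plus hv; lra)).
have s : cderiv (fun z => z + v)%C z 1 by apply: cd_eq (cd_plus (cd_id z) (cd_const v z)) _; ring.
by split; [apply: cd_eq (cderiv_subst (f' := f1) (g := fun z => (z + v)%C) h1 s) _ |
   apply: cd_eq (cderiv_subst (f' := f2) (g := fun z => (z + v)%C) h2 s) _]; ring.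
Qed.
Lemma tw_sumC (f : nat -> C -> C) n : (forall i, tw a b (f i)) -> tw a b (fun z => sumC (fun i => f i z) n).
Proof. by move=> h; elim: n => /= [|n IH]; [exact: tw_const | exact: tw_plus]. Qed.

Lemma tw_max f M T : a < b -> 0 <= M -> tw a b f ->
  (forall z, Re z = a \/ Re z = b -> Cmod (f z) <= M) ->
  (forall z, a <= Re z <= b -> T <= Rabs (Im z) -> Cmod (f z) <= M) ->
  forall z, a <= Re z <= b -> Cmod (f z) <= M.
Proof.
move=> ab M0 [f1 [f2 H]]; apply: (max_strip ab M0 (f1 := f1) (f2 := f2)).
- by move=> z /H [].
- by move=> z /H [].
Qed.
End Tw.

Section Wop.
Variables (dl al : R) (K : nat).
Definition iy (j : nat) : C := (0, 2 * (INR j + 1) * dl).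
Definition box (f : C -> C) (i : nat) (s : C) : C := (f s + sumC (fun j => f (s + iy j) + f (s + - iy j)) i)%C.
(** A positive combination of vertical translates by multiples of 2 dl, standing for convolution
    with a positive kernel along the line. Being a finite sum, it preserves differentiability and
    commutes with limits. *)
Definition Wop (f : C -> C) (s : C) : C := sumC (fun i => RtoC (mb al i * dl) * box f i s)%C K.

Lemma Wop_plus f g s : Wop (fun z => f z + g z)%C s = (Wop f s + Wop g s)%C.
Proof.
rewrite /Wop -sumC_plus; apply: sumC_ext => i _; rewrite -Cmult_plus_distr_l; congr Cmult.
rewrite /box.
have -> : sumC (fun j => f (s + iy j) + g (s + iy j) + (f (s + - iy j) + g (s + - iy j)))%C i =
  (sumC (fun j => f (s + iy j) + f (s + - iy j)) i + sumC (fun j => g (s + iy j) + g (s + - iy j)) i)%C.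
  by rewrite -sumC_plus; apply: sumC_ext => j _; ring.
ring.
Qed.
Lemma Wop_ext f g s : (forall z, f z = g z) -> Wop f s = Wop g s.
Proof.
move=> h; apply: sumC_ext => i _; rewrite /box h; congr (_ * (_ + _))%C.
by apply: sumC_ext => j _; rewrite !h.
Qed.
Lemma tw_Wop a b f : tw a b f -> tw a b (Wop f).
Proof.
move=> h; apply: tw_sumC => i; apply: tw_scal; apply: tw_plus => //.
apply: tw_sumC => j; apply: tw_plus; apply: tw_shift => //=; ring.
Qed.

(** The multiplier by which [Wop] acts on n^(-s), at x = log n. *)
Definition kap (x : R) : R := sumR (fun i => mb al i * dl * (1 + sumR (fun j => 2 * cos (2 * (INR j + 1) * (dl * x))) i)) K.

Lemma dirichlet_kernel i x : sin x * (1 + sumR (fun j => 2 * cos (2 * (INR j + 1) * x)) i) = sin (od i * x).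
Proof.
elim: i => [|i IH].
  rewrite /od /= Rplus_0_r; have -> : (2 * 0 + 1) * x = x by ring.
  ring.
rewrite [sumR _ _]/= -Rplus_assoc Rmult_plus_distr_l IH.
have -> : od i * x = 2 * (INR i + 1) * x - x by rewrite /od; ring.
have -> : od i.+1 * x = 2 * (INR i + 1) * x + x by rewrite /od S_INR; ring.
rewrite sin_plus sin_minus; ring.
Qed.

(** Each box sum is a Dirichlet kernel, so kap(x) = dl Tf(dl x)/sin(dl x). For al = dl H/2, small dl
    and large K this is close to Ff(x/H)/x. *)
Lemma kap_Tf x : sin (dl * x) * kap x = dl * Tf al K (dl * x).
Proof.
rewrite /kap /Tf -!sumR_scal; apply: sumR_ext => i _.
rewrite -dirichlet_kernel; ring.
Qed.

Lemma Wop_fj n s : Wop (fj 0 n) s = (RtoC (kap (lnN n)) * fj 0 n s)%C.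
Proof.
set x := lnN n.
have sh : forall j, (fj 0 n (s + iy j) + fj 0 n (s + - iy j) = RtoC (2 * cos (2 * (INR j + 1) * (dl * x))) * fj 0 n s)%C.
  move=> j; rewrite /fj -/x pow_O.
  pose y := 2 * (INR j + 1) * (dl * x). pose y' := - y.
  have e1 : (- (s + iy j) * x = - s * x + ((0, y') : C))%C.
    by rewrite /y' /y; case: (s) => u v; apply: C_eq; rewrite /= ; ring.
  have e2 : (- (s + - iy j) * x = - s * x + ((0, y) : C))%C.
    by rewrite /y; case: (s) => u v; apply: C_eq; rewrite /= ; ring.
  rewrite e1 e2 !cexp_plus -/y.
  have e3 : (cexp (0, y') + cexp (0, y) = RtoC (2 * cos y))%C.
    by apply: C_eq; rewrite /y' /cexp /= exp_0 ?cos_neg ?sin_neg; ring.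
  by rewrite -e3; ring.
rewrite /Wop /kap.
pose g m := sumR (fun i => mb al i * dl * (1 + sumR (fun j => 2 * cos (2 * (INR j + 1) * (dl * x))) i)) m.
suff : forall m, (sumC (fun i => RtoC (mb al i * dl) * box (fj 0 n) i s) m = RtoC (g m) * fj 0 n s)%C by [].
elim=> [|m IH]; first by rewrite Cmult_0_l.
rewrite [LHS]/= IH [g _]/= RtoC_plus (RtoC_mult (mb al m * dl)) Cmult_plus_distr_r; congr (_ + _)%C.
rewrite -Cmult_assoc; congr (_ * _)%C.
rewrite /box RtoC_plus Cmult_plus_distr_r Cmult_1_l; congr (_ + _)%C.
elim: m {IH} => [|m IH]; first by rewrite Cmult_0_l.
by rewrite [LHS]/= [sumR _ _]/= IH sh RtoC_plus; ring.
Qed.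

(* With [u = od i * al], [(sin u / u)^2 <= 4 / (1+u)^2], and [1/(1+u)^(3/2)] telescopes. *)
Hypothesis dl0 : 0 < dl.
Hypothesis al0 : 0 < al < / 2.

Lemma mb_sum : sumR (fun i => mb al i * od i * sqrt (1 + od i * al)) K <= 24 / al.
Proof.
have P := PI_RGT_0. have P3 := PI2_3_2.
have term : forall i, mb al i * od i * sqrt (1 + od i * al) <= 12 / al * (/ sqrt (1 + (od i - 2) * al) - / sqrt (1 + od i * al)).
  move=> i; have o := od_ge1 i; rewrite /mb.
  set u := od i * al. have u0 : 0 < u by rewrite /u; nra.
  have -> : 1 + (od i - 2) * al = 1 + u - 2 * al by rewrite /u; ring.
  have p1 : 0 < 1 + u - 2 * al by lra.
  have a0 := sqrt_lt_R0 _ p1. have b0 := sqrt_lt_R0 (1 + u) (ltac:(lra)).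
  have a2 := sqrt_sqrt (1 + u - 2 * al) (ltac:(lra)). have b2 := sqrt_sqrt (1 + u) (ltac:(lra)).
  set p := sqrt (1 + u - 2 * al) in a0 a2 *; set q := sqrt (1 + u) in b0 b2 *.
  have pq : p <= q by apply: sqrt_le_1_alt; lra.
  have s1 : (sin u / u) ^ 2 <= 4 / ((q * q) * (q * q)).
    rewrite b2.
    have -> : (sin u / u) ^ 2 = (sin u * sin u) / (u * u) by field; lra.
    have sb := SIN_bound u.
    have su : sin u * sin u <= u * u.
      have := sin_lt_x u u0; have h : - u <= sin u by case: (Rle_dec u PI) => h; [have := sin_ge_0 u (ltac:(lra)) h; lra | lra].
      nra.
    have s1 : sin u * sin u <= 1 by nra.
    have uu : 0 < u * u by nra.
    apply: (Rmult_le_reg_r ((u * u) * ((1 + u) * (1 + u)))); first by apply: Rmult_lt_0_compat; nra.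
    have -> : sin u * sin u / (u * u) * (u * u * ((1 + u) * (1 + u))) = sin u * sin u * ((1 + u) * (1 + u)) by field; lra.
    have -> : 4 / ((1 + u) * (1 + u)) * (u * u * ((1 + u) * (1 + u))) = 4 * (u * u) by field; lra.
    case: (Rle_dec u 1) => h.
      apply: (Rle_trans _ ((u * u) * ((1 + u) * (1 + u)))); first by apply: Rmult_le_compat_r; nra.
      have h4 : (1 + u) * (1 + u) <= 4 by nra.
      have := Rmult_le_compat_l (u * u) _ _ (Rlt_le _ _ uu) h4; lra.
    apply: (Rle_trans _ (1 * ((1 + u) * (1 + u)))); first by apply: Rmult_le_compat_r; nra.
    nra.
  have e1 : 4 / (PI * od i) * (sin u / u) ^ 2 * od i * q = 4 / PI * ((sin u / u) ^ 2 * q) by field; lra.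
  rewrite e1.
  have k1 : 4 / PI <= 3.
    apply: (Rmult_le_reg_r PI) => //; rewrite /Rdiv Rmult_assoc Rinv_l; lra.
  have k2 : (sin u / u) ^ 2 * q <= 4 / ((q * q) * (q * q)) * q by apply: Rmult_le_compat_r; lra.
  have e2 : 4 / ((q * q) * (q * q)) * q = 4 * / (q * q * q) by field; lra.
  rewrite e2 in k2.
  have k3 : al * / (q * q * q) <= / p - / q.
    have -> : / p - / q = (q * q - p * p) / (p * q * (p + q)) by field; repeat split; lra.
    have -> : q * q - p * p = 2 * al by lra.
    apply: (Rle_trans _ (2 * al / (q * q * (q + q)))); first by right; field; lra.
    rewrite /Rdiv; apply: Rmult_le_compat_l; first lra.
    apply: Rinv_le_contravar; first by apply: Rmult_lt_0_compat; nra.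
    by apply: Rmult_le_compat; nra.
  have k4 : 0 <= (sin u / u) ^ 2 * q by apply: Rmult_le_pos; [exact: pow2_ge_0 | lra].
  have k5 : 0 < 4 / PI by apply: Rdiv_lt_0_compat; lra.
  apply: (Rle_trans _ (12 * / (q * q * q))); first nra.
  have -> : 12 * / (q * q * q) = 12 / al * (al * / (q * q * q)) by field; lra.
  apply: Rmult_le_compat_l => //; apply: Rdiv_le_0_compat; lra.
apply: Rle_trans (sumR_le (fun i _ => term i)) _; rewrite sumR_scal.
have -> : 24 / al = 12 / al * 2 by field; lra.
apply: Rmult_le_compat_l; first by apply: Rdiv_le_0_compat; lra.
have tel : forall m, sumR (fun i => / sqrt (1 + (od i - 2) * al) - / sqrt (1 + od i * al)) m = / sqrt (1 - al) - / sqrt (1 + (od m - 2) * al).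
  elim=> [|m IH] /=.
    rewrite /od /=; have -> : 1 + (2 * 0 + 1 - 2) * al = 1 - al by ring.
    ring.
  rewrite IH; have -> : od m.+1 - 2 = od m by rewrite /od S_INR; ring.
  ring.
rewrite tel.
have : / sqrt (1 - al) <= 2.
  rewrite -[X in _ <= X]Rinv_inv; apply: Rinv_le_contravar; first lra.
  have -> : / 2 = sqrt (/ 4) by rewrite -(sqrt_square (/ 2)); [congr sqrt; field | lra].
  by apply: sqrt_le_1_alt; lra.
have : 0 <= / sqrt (1 + (od K - 2) * al).
  apply/Rinv_ge0/sqrt_lt_R0; have := od_ge1 K; nra.
lra.
Qed.

End Wop.

Lemma ell_add lq t y : ell lq (t + y) <= ell lq t + ln (1 + Rabs y).
Proof.
rewrite /ell Rplus_assoc; apply: Rplus_le_compat_l.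
have h := Rabs_pos t; have h1 := Rabs_pos y; have h2 := Rabs_triang t y.
rewrite -ln_mult; try lra.
apply: ln_le; last nra.
have := Rabs_pos (t + y); lra.
Qed.

(** [Wop] for a real function of the height: same weights and same nodes. *)
Definition wsum (dl al : R) (K : nat) (f : R -> R) : R :=
  sumR (fun i => mb al i * dl * (f 0 + sumR (fun j => f (2 * (INR j + 1) * dl) + f (- (2 * (INR j + 1) * dl))) i)) K.

(** The nodes of the i-th box satisfy |y| <= 4u with u = od(i) al, where ell(t + y) <= 9 ell(t)
    sqrt(1 + u). [mb_sum] adds the weights up to O(1/al), and dl/al = 2/H. Only f from above
    matters: it may be very negative. *)
Lemma wsum_le dl H K f lq t B : 0 < dl -> / 2 <= H -> dl * H < 1 -> 0 <= lq -> 0 <= B ->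
  (forall y, f y <= B * ell lq (t + y)) -> wsum dl (dl * H / 2) K f <= 432 * B * ell lq t / H.
Proof.
move=> d0 H0 dH l0 B0 hf; set al := dl * H / 2.
have a0 : 0 < al < / 2 by rewrite /al; nra.
have E := ell_ge t l0. set e := ell lq t in E *.
have key : forall i, mb al i * dl * (f 0 + sumR (fun j => f (2 * (INR j + 1) * dl) + f (- (2 * (INR j + 1) * dl))) i) <=
   (9 * B * e * dl) * (mb al i * od i * sqrt (1 + od i * al)).
  move=> i; have m0 := mb_ge0 al i; have o := od_ge1 i.
  set u := od i * al. have u0 : 0 < u by rewrite /u; nra.
  set q := sqrt (1 + u).
  have q1 : 1 <= q by rewrite /q -{1}sqrt_1; apply: sqrt_le_1_alt; lra.
  have q2 : q * q = 1 + u by apply: sqrt_sqrt; lra.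
  have fb : forall y, Rabs y <= 4 * u -> f y <= 9 * B * e * q.
    move=> y hy; apply: Rle_trans (hf y) _.
    have h1 := ell_add lq t y.
    have h2 : ln (1 + Rabs y) <= 4 * q.
      have : ln (1 + Rabs y) <= ln ((2 * q) * (2 * q)) by apply: ln_le; [have := Rabs_pos y; lra | nra].
      rewrite ln_mult; try lra.
      have := @ln_le_sub1 (2 * q) (ltac:(lra)); lra.
    have h3 : ell lq (t + y) <= 9 * e * q by rewrite -/e in h1; nra.
    have := Rmult_le_compat_l _ _ _ B0 h3; lra.
  have sb : f 0 + sumR (fun j => f (2 * (INR j + 1) * dl) + f (- (2 * (INR j + 1) * dl))) i <= od i * (9 * B * e * q).
    have s1 : sumR (fun j => f (2 * (INR j + 1) * dl) + f (- (2 * (INR j + 1) * dl))) i <= sumR (fun j => 2 * (9 * B * e * q)) i.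
      apply: sumR_le => j hj.
      have yb : 0 <= 2 * (INR j + 1) * dl <= 4 * u.
        have ji : INR j + 1 <= INR i by rewrite -S_INR; apply: le_INR; lia.
        have := pos_INR j; rewrite /u /al /od => j0; split; first nra.
        have : dl <= 2 * (dl * H) by nra.
        nra.
      have := fb (2 * (INR j + 1) * dl) (ltac:(rewrite Rabs_pos_eq; lra)).
      have := fb (- (2 * (INR j + 1) * dl)) (ltac:(rewrite Rabs_Ropp Rabs_pos_eq; lra)).
      lra.
    have s2 : sumR (fun j => 2 * (9 * B * e * q)) i = 2 * INR i * (9 * B * e * q).
      by elim: (i) => [|m IH]; [rewrite /=; ring | rewrite [LHS]/= IH S_INR; ring].
    have := fb 0 (ltac:(rewrite Rabs_R0; lra)); rewrite /od; lra.
  have -> : (9 * B * e * dl) * (mb al i * od i * q) = mb al i * dl * (od i * (9 * B * e * q)) by ring.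
  by apply: Rmult_le_compat_l => //; nra.
apply: Rle_trans (sumR_le (fun i _ => key i)) _; rewrite sumR_scal.
have be : 0 <= B * e by nra.
have c0 : 0 <= 9 * B * e * dl by have := Rmult_le_pos _ _ be (Rlt_le _ _ d0); lra.
apply: Rle_trans (Rmult_le_compat_l _ _ _ c0 (mb_sum K a0)) _.
right; rewrite /al; field; lra.
Qed.

Lemma Re_Wop dl al K f s : Re (Wop dl al K f s) = wsum dl al K (fun y => Re (f (s + (0, y))%C)).
Proof.
rewrite /Wop sumC_Re; apply: sumR_ext => i _.
rewrite Re_mult Re_RtoC Im_RtoC Rmult_0_l Rminus_0_r; congr (_ * _); rewrite /box Re_plus sumC_Re; congr (_ + _).
  by congr (Re (f _)); case: (s) => a b; apply: C_eq => /=; ring.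
apply: sumR_ext => j _; rewrite Re_plus; congr (_ + Re (f _)).
by case: (s) => a b; apply: C_eq => /=; ring.
Qed.

Lemma Cmod_Wop dl al K f s : 0 <= dl -> Cmod (Wop dl al K f s) <= wsum dl al K (fun y => Cmod (f (s + (0, y))%C)).
Proof.
move=> d0; apply: Rle_trans (sumC_abs _ _) _; apply: sumR_le => i _.
have m0 := mb_ge0 al i.
rewrite Cmod_mult Cmod_R Rabs_pos_eq; last by apply: Rmult_le_pos.
apply: Rmult_le_compat_l; first exact: Rmult_le_pos.
apply: Rle_trans (Cmod_triangle _ _) _; apply: Rplus_le_compat.
  by right; congr (Cmod (f _)); case: (s) => a b; apply: C_eq => /=; ring.
apply: Rle_trans (sumC_abs _ _) _; apply: sumR_le => j _.
apply: Rle_trans (Cmod_triangle _ _) _; apply: Rplus_le_compat; first by right.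
by right; congr (Cmod (f _)); case: (s) => a b; apply: C_eq => /=; ring.
Qed.

(** [wsum_le] for the constant 1, which is at most 2 ell since ell > 1/2. *)
Lemma kap_bound dl H K x : 0 < dl -> / 2 <= H -> dl * H < 1 -> Rabs (kap dl (dl * H / 2) K x) <= 864 / H.
Proof.
move=> d0 H0 dH.
have h := @wsum_le dl H K (fun _ => 1) 0 0 2 d0 H0 dH (Rle_refl _) (ltac:(lra)) _.
have -> : 864 / H = 432 * 2 * 1 / H by field; lra.
have e1 : ell 0 0 <= 1.
  by rewrite /ell Rabs_R0 Rplus_0_l Rplus_0_r; have := @ln_le_sub1 2 (ltac:(lra)); lra.
apply: (Rle_trans _ (432 * 2 * ell 0 0 / H)); last first.
  by apply: Rmult_le_compat_r; [apply/Rinv_ge0; lra | lra].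
apply: Rle_trans (h _); last first.
  by move=> y; have := @ell_ge 0 (0 + y) (Rle_refl _); lra.
rewrite /kap /wsum; apply: Rle_trans (sumR_abs _ _) _; apply: sumR_le => i _.
have m0 := mb_ge0 (dl * H / 2) i.
rewrite Rabs_mult Rabs_pos_eq; last by apply: Rmult_le_pos; lra.
apply: Rmult_le_compat_l; first by apply: Rmult_le_pos; lra.
apply: Rle_trans (Rabs_triang _ _) _; rewrite Rabs_R1; apply: Rplus_le_compat_l.
apply: Rle_trans (sumR_abs _ _) _; apply: sumR_le => j _.
by have := COS_bound (2 * (INR j + 1) * (dl * x)) => cb; apply: Rabs_le; lra.
Qed.

Lemma Ff_01 l : 0 <= l -> 0 <= Ff l <= 1.
Proof. by move=> l0; rewrite /Ff; case: Rle_dec => h /=; [split; nra | lra]. Qed.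

(** Distance of log n times the multiplier from the intended value Ff(log n / H). *)
Definition kerr dl H K n := Rabs (Ff (lnN n / H) - lnN n * kap dl (dl * H / 2) K (lnN n)).

Lemma theta_sin x : 0 < x <= / 2 -> 0 < sin x /\ 1 <= x / sin x <= 1 + x.
Proof.
move=> hx; have P := PI2_1.
have s0 : 0 < sin x by apply: sin_gt_0; lra.
split=> //.
have sx : sin x < x by apply: sin_lt_x; lra.
have : x * (1 - x * x / 2) <= sin x.
  have := MVT_cor2 sin cos 0 x (proj1 hx) (fun c _ => derivable_pt_lim_sin c); case=> c [].
  rewrite sin_0 !Rminus_0_r => -> hc.
  have : 1 - x * x / 2 <= cos c.
    have -> : c = 2 * (c / 2) by field.
    rewrite cos_2a_sin.
    have h1 : sin (c / 2) < c / 2 by apply: sin_lt_x; lra.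
    have h2 : 0 <= sin (c / 2) by apply: sin_ge_0; lra.
    nra.
  nra.
move=> h; split; apply: (Rmult_le_reg_r (sin x)) => //.
  by rewrite /Rdiv Rmult_assoc Rinv_l; lra.
rewrite /Rdiv Rmult_assoc Rinv_l; last lra.
nra.
Qed.

(** Beyond some N0 the error is O(log n), harmless against n^(-2). For n <= N0 take dl so small that
    dl log n is tiny, then K so large that [Tf_lim] applies. *)
Lemma kerr_sum H eta : / 2 <= H -> 0 < eta -> exists dl K, 0 < dl /\ dl * H < 1 /\
  forall N, sum_n (fun n => pw 2 n * kerr dl H K n) N <= eta.
Proof.
move=> H0 e0.
set C1 := 1 + 864 / H. set K1 := C1 * (2 * exp 1).
have h864 : 0 < 864 / H by apply: Rdiv_lt_0_compat; lra.
have C10 : 0 < C1 by rewrite /C1; lra.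
have K10 : 0 < K1 by apply: Rmult_lt_0_compat => //; have := exp_pos 1; lra.
have es := @ex_series_pw (/ 2) (ltac:(lra)).
have ls : is_lim_seq (sum_n (pw (1 + / 2))) (Series (pw (1 + / 2))) := Series_correct _ es.
have t0 : 0 < eta / (2 * K1) by apply: Rdiv_lt_0_compat; lra.
have [N0 HN0] := proj2 (is_lim_seq_spec _ _) ls (mkposreal _ t0).
have tail : forall N, sum_n (pw (1 + / 2)) N - sum_n (pw (1 + / 2)) N0 <= eta / (2 * K1).
  move=> N; have := HN0 N0 (le_n _) => /Rabs_def2 /= [h1 h2].
  have : sum_n (pw (1 + / 2)) N <= Series (pw (1 + / 2)).
    apply: (is_lim_seq_incr_compare (sum_n (pw (1 + / 2)))) => // n.
    rewrite sum_Sn -[X in X <= _]Rplus_0_r; apply: Rplus_le_compat_l; exact: pw_ge0.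
  lra.
set th1 := Rmin (/ 2) (eta / 16).
have th0 : 0 < th1 by apply: Rmin_pos; lra.
have th2 : th1 <= / 2 := Rmin_l _ _. have th3 : th1 <= eta / 16 := Rmin_r _ _.
set LN := lnN N0.+1.
have LN0 : 0 <= LN by rewrite -ln_1; apply: ln_le; [lra | apply: (le_INR 1); lia].
(* The first bound gives dl H < 1, the second dl log n <= th1 for all n <= N0. *)
set dl := Rmin (/ (2 * H)) (th1 / (1 + LN)).
have d0 : 0 < dl by apply: Rmin_pos; [apply: Rinv_0_lt_compat; lra | apply: Rdiv_lt_0_compat; lra].
have d1 : dl * H <= / 2.
  have h : dl <= / (2 * H) := Rmin_l _ _.
  have -> : / 2 = / (2 * H) * H by field; lra.
  by apply: Rmult_le_compat_r; lra.
have d2 : dl * (1 + LN) <= th1.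
  have h : dl <= th1 / (1 + LN) := Rmin_r _ _.
  have -> : th1 = th1 / (1 + LN) * (1 + LN) by field; lra.
  by apply: Rmult_le_compat_r; lra.
set al := dl * H / 2.
have a0 : 0 < al by rewrite /al; nra.
have [K HK] := @Tf_lim al (eta / 16) a0 (ltac:(lra)).
exists dl, K; split=> //; split; first lra.
have PI1 := PI2_1.
have small : forall n, (n <= N0)%N -> (1 <= n)%N -> kerr dl H K n <= eta / 4.
  move=> n hn hn1; rewrite /kerr; set x := lnN n.
  have x0 : 0 <= x by have [] := ln_succ hn1.
  have xL : x <= LN by apply: ln_INR_le => //; lia.
  case: (Rle_lt_or_eq_dec 0 x x0) => [xp|<-]; last first.
    rewrite Rmult_0_l Rminus_0_r /Ff; case: Rle_dec => h /=; last by case: h; rewrite /Rdiv Rmult_0_l; lra.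
    rewrite /Rdiv Rmult_0_l; have -> : 1 - (1 - 0) * ((1 - 0) * 1) = 0 by ring.
    by rewrite Rabs_R0; lra.
  set th := dl * x.
  have tp : 0 < th by apply: Rmult_lt_0_compat.
  have tl : th <= th1 by rewrite /th; nra.
  have [s0 [q1 q2]] := @theta_sin th (ltac:(lra)).
  have e1 : x * kap dl al K x = (th / sin th) * Tf al K th.
    have := kap_Tf dl al K x; rewrite -/th => h.
    have -> : kap dl al K x = dl * Tf al K th / sin th by rewrite -h; field; lra.
    have gen : forall T s, 0 < s -> x * (dl * T / s) = th / s * T by move=> T s hs; rewrite /th; field; lra.
    exact: gen.
  rewrite -/al e1.
  have e2 : x / H = th / (2 * al) by rewrite /th /al; field; lra.
  rewrite e2.
  have F01 := @Ff_01 (th / (2 * al)) (ltac:(apply: Rdiv_le_0_compat; lra)).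
  have := HK K (leqnn _) th (ltac:(lra)) (ltac:(rewrite /al; lra)).
  move/Rabs_le_between => h; apply: Rabs_le.
  set r := th / sin th in q1 q2 *; set F := Ff _ in F01 h *; set T := Tf _ _ _ in h *.
  have -> : F - r * T = (F - r * F) - r * (T - F) by ring.
  split; nra.
have big : forall n, (1 <= n)%N -> pw 2 n * kerr dl H K n <= K1 * pw (1 + / 2) n.
  move=> n hn; set x := lnN n.
  have x0 : 0 <= x by have [] := ln_succ hn.
  have [_ [x1 _]] := ln_succ hn; rewrite -/x in x1.
  have F01 := @Ff_01 (x / H) (ltac:(apply: Rdiv_le_0_compat; lra)).
  have kb := @kap_bound dl H K x d0 H0 (ltac:(lra)).
  have eb : kerr dl H K n <= C1 * (1 + lnN n.+1).
    rewrite /kerr -/x; apply: Rle_trans (Rabs_triang _ _) _; rewrite Rabs_Ropp Rabs_mult.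
    rewrite (Rabs_pos_eq (Ff _)) ?(Rabs_pos_eq x); try lra.
    have h := Rmult_le_compat_l _ _ _ x0 kb.
    have h2 : 0 < 864 / H by apply: Rdiv_lt_0_compat; lra.
    rewrite /C1; nra.
  have := @log_pow_le 1 n (/ 2) (ltac:(lra)) hn; rewrite pow_1 -/x => lp.
  have e2 : INR (fact 1) * (/ / 2) ^ 1 * exp (2 * / 2) = 2 * exp 1.
    rewrite /= Rinv_inv (_ : 2 * / 2 = 1); [ring | field].
  rewrite e2 in lp.
  apply: (Rle_trans _ (pw 2 n * (C1 * (2 * exp 1 * exp (/ 2 * x))))).
    apply: Rmult_le_compat_l; first exact: pw_ge0.
    by apply: Rle_trans eb _; apply: Rmult_le_compat_l; lra.
  case: n hn @x x0 x1 F01 kb eb lp => // n hn x x0 x1 F01 kb eb lp.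
  rewrite /pw -/x.
  have -> : exp (- (1 + / 2) * x) = exp (- (2) * x) * exp (/ 2 * x) by rewrite -exp_plus; congr exp; field.
  rewrite /K1; right; ring.
have part1 : forall N, (N <= N0)%N -> sum_n (fun n => pw 2 n * kerr dl H K n) N <= eta / 2.
  move=> N hN; apply: (Rle_trans _ (sum_n (fun n => eta / 4 * pw (1 + 1) n) N)).
    elim: N hN => [|N IH] hN; first by rewrite !sum_O /=; lra.
    rewrite !sum_Sn; apply: Rplus_le_compat; first by apply: IH; lia.
    rewrite Rmult_comm; apply: Rmult_le_compat_r; first exact: pw_ge0.
    exact: small.
  have -> : sum_n (fun n => eta / 4 * pw (1 + 1) n) N = eta / 4 * sum_n (pw (1 + 1)) N.
    exact: (sum_n_mult_l (K := R_Ring)).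
  have := @pw_sum_le 1 N (ltac:(lra)); nra.
move=> N; case: (leqP N N0) => hN; first by have := part1 N hN; lra.
have -> : N = (N0 + (N - N0))%N by lia.
move: (N - N0)%N => d.
have : sum_n (fun n => pw 2 n * kerr dl H K n) (N0 + d) <=
   sum_n (fun n => pw 2 n * kerr dl H K n) N0 + K1 * (sum_n (pw (1 + / 2)) (N0 + d) - sum_n (pw (1 + / 2)) N0).
  elim: d => [|d IH]; first by rewrite addn0; lra.
  rewrite addnS !sum_Sn.
  have := big (N0 + d).+1 isT => h.
  have pE : forall u v : R, plus u v = u + v by [].
  rewrite !pE; lra.
have := part1 N0 (leqnn _); have := tail (N0 + d)%N => h1 h2 h3.
have : K1 * (sum_n (pw (1 + / 2)) (N0 + d) - sum_n (pw (1 + / 2)) N0) <= K1 * (eta / (2 * K1)) by apply: Rmult_le_compat_l; lra.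
have -> : K1 * (eta / (2 * K1)) = eta / 2 by field; lra.
lra.
Qed.

(** * Limits of complex sequences *)

Definition limC (u : nat -> C) (l : C) :=
  forall eps, 0 < eps -> exists N0, forall N, (N0 <= N)%N -> Cmod (u N - l)%C < eps.

Lemma limC_const l : limC (fun _ => l) l.
Proof. move=> e e0; exists 0%N => N _; have -> : (l - l = 0)%C by ring. by rewrite Cmod_0. Qed.
Lemma limC_plus u v l m : limC u l -> limC v m -> limC (fun n => u n + v n)%C (l + m)%C.
Proof.
move=> hu hv e e0; have [N1 h1] := hu (e / 2) (ltac:(lra)); have [N2 h2] := hv (e / 2) (ltac:(lra)).
exists (N1 + N2)%N => N hN; have {}h1 := h1 N (ltac:(lia)); have {}h2 := h2 N (ltac:(lia)).
have -> : (u N + v N - (l + m) = (u N - l) + (v N - m))%C by ring.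
apply: Rle_lt_trans (Cmod_triangle _ _) _; lra.
Qed.
Lemma limC_scal k u l : limC u l -> limC (fun n => k * u n)%C (k * l)%C.
Proof.
move=> hu e e0; have k0 := Cmod_ge_0 k.
have [N1 h1] := hu (e / (Cmod k + 1)) (ltac:(apply: Rdiv_lt_0_compat; lra)).
exists N1 => N hN; have {}h1 := h1 N hN.
have -> : (k * u N - k * l = k * (u N - l))%C by ring.
rewrite Cmod_mult.
have : (Cmod k + 1) * Cmod (u N - l)%C < e.
  have := Rmult_lt_compat_l (Cmod k + 1) _ _ (ltac:(lra)) h1.
  by have -> : (Cmod k + 1) * (e / (Cmod k + 1)) = e by field; lra.
have := Cmod_ge_0 (u N - l)%C; nra.
Qed.
Lemma limC_sumC (u : nat -> nat -> C) l n : (forall i, limC (fun N => u N i) (l i)) -> limC (fun N => sumC (u N) n) (sumC l n).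
Proof. by move=> h; elim: n => /= [|n IH]; [exact: limC_const | apply: limC_plus]. Qed.
Lemma limC_ext u v l : (forall n, u n = v n) -> limC u l -> limC v l.
Proof. by move=> h H e /H [N hN]; exists N => n hn; rewrite -h; apply: hN. Qed.
Lemma limC_bound u l B : limC u l -> (exists N0, forall N, (N0 <= N)%N -> Cmod (u N) <= B) -> Cmod l <= B.
Proof.
move=> hu [N0 hB]; apply: Rnot_lt_le => lt.
have [N1 h1] := hu (Cmod l - B) (ltac:(lra)).
have := h1 (N0 + N1)%N (ltac:(lia)); have := hB (N0 + N1)%N (ltac:(lia)).
have := Cmod_triangle_inv l (u (N0 + N1)%N); rewrite Cmod_minus_sym; lra.
Qed.

Lemma limC_Wop dl al K (F : nat -> C -> C) f s : (forall z, Re z = Re s -> limC (fun N => F N z) (f z)) ->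
  limC (fun N => Wop dl al K (F N) s) (Wop dl al K f s).
Proof.
move=> h; apply: limC_sumC => i; apply: limC_scal; apply: limC_plus; first exact: h.
apply: limC_sumC => j; apply: limC_plus; apply: h; rewrite Re_plus /=; ring.
Qed.

Lemma dps_S a j s N : dps a j s N.+1 = (dps a j s N + a N.+1 * fj j N.+1 s)%C.
Proof. by rewrite /dps sum_Sn. Qed.
Lemma dps_0 a j s : dps a j s 0 = 0.
Proof. by rewrite /dps sum_O. Qed.

Lemma fj1 n s : fj 1 n s = (RtoC (- lnN n) * fj 0 n s)%C.
Proof. by rewrite /fj pow_1 pow_O; ring. Qed.

Lemma Cmod_fj0 n s : Cmod (fj 0 n s) = exp (- Re s * lnN n).
Proof.
rewrite /fj pow_O Cmult_1_l Cmod_cexp; congr exp; rewrite !CRI; ring.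
Qed.

Lemma tw_fj a b j n : tw a b (fj j n).
Proof.
apply: tw_scal; apply: tw_cexp; apply: (tw_ext (f := fun s => (RtoC (- lnN n) * s)%C)).
  by move=> z; rewrite RtoC_opp; ring.
by apply: tw_scal; exact: tw_id.
Qed.
Lemma tw_dps a b c j N : tw a b (fun s => dps c j s N).
Proof.
elim: N => [|N IH].
  by apply: (tw_ext (f := fun _ => RtoC 0)); [move=> z; rewrite dps_0 | exact: tw_const].
apply: (tw_ext (f := fun z => (dps c j z N + c N.+1 * fj j N.+1 z)%C)); first by move=> z; rewrite dps_S.
by apply: tw_plus => //; apply: tw_scal; exact: tw_fj.
Qed.

Lemma cexp_m1 z : Cmod z <= / 2 -> Cmod (cexp z - 1)%C <= 2 * Cmod z.
Proof.
move=> hz; have := @mvt_cd cexp cexp 0 z 2; rewrite Cplus_0_l cexp_0; apply.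
  by move=> t _; exact: cd_cexp.
move=> t ht; rewrite Cplus_0_l Cmod_cexp !CRI Rmult_0_l Rminus_0_r.
have h1 := re_le_Cmod z; have h2 := Rle_abs (Re z).
have : exp (t * Re z) <= exp (/ 2) by apply: exp_le; nra.
have : exp (/ 2) * exp (/ 2) <= 3 by rewrite -exp_plus (_ : / 2 + / 2 = 1); [exact: exp_le_3 | field].
have := exp_pos (/ 2); nra.
Qed.

Lemma sumR_opp f n : sumR (fun i => - f i) n = - sumR f n.
Proof. by elim: n => /= [|n ->]; ring. Qed.
Lemma wsum_opp dl al K f : wsum dl al K (fun y => - f y) = - wsum dl al K f.
Proof.
rewrite /wsum -sumR_opp; apply: sumR_ext => i _.
rewrite (_ : sumR _ i = - sumR (fun j => f (2 * (INR j + 1) * dl) + f (- (2 * (INR j + 1) * dl))) i); first ring.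
by rewrite -sumR_opp; apply: sumR_ext => j _; ring.
Qed.

Lemma abs_sq y : y * y = Rabs y * Rabs y.
Proof. by rewrite /Rabs; case: Rcase_abs => _; ring. Qed.

(** * Bounding |L(1/2+it)| by a short sum over prime powers *)

Definition cw (c : nat -> R) (H : R) (n : nat) : R := c n * (1 - Ff (lnN n / H)).

Lemma dps_cw_bound c H s N : 0 < H -> 0 <= Re s -> (forall n, Rabs (c n) <= 1) -> Cmod (dps (cw c H) 0 s N) <= INR N.
Proof.
move=> H0 hs hc; elim: N => [|N IH]; first by rewrite dps_0 Cmod_0 /=; lra.
rewrite dps_S S_INR; apply: Rle_trans (Cmod_triangle _ _) _; apply: Rplus_le_compat => //.
have [l0 _] := @ln_succ N.+1 isT.
rewrite Cmod_mult Cmod_R Cmod_fj0 /cw Rabs_mult.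
have F01 := @Ff_01 (lnN N.+1 / H) (ltac:(apply: Rdiv_le_0_compat; lra)).
rewrite (Rabs_pos_eq (1 - _)); last lra.
have e1 : exp (- Re s * lnN N.+1) <= 1 by apply: exp_le1; nra.
have := hc N.+1; have := exp_pos (- Re s * lnN N.+1); have := Rabs_pos (c N.+1) => a1 a2 a3.
have : Rabs (c N.+1) * (1 - Ff (lnN N.+1 / H)) <= 1 by nra.
have : 0 <= Rabs (c N.+1) * (1 - Ff (lnN N.+1 / H)) by apply: Rmult_le_pos; lra.
nra.
Qed.

Section Kernel.
Variables (L : nat -> C -> C) (lq G : R).
Hypothesis lq0 : 0 <= lq.
Hypothesis G1 : 1 <= G.
Hypothesis Lcd : forall j s, 0 < Re s -> cderiv (L j) s (L j.+1 s).
Hypothesis L0 : forall s, / 2 < Re s -> L 0 s <> 0.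
Hypothesis Lconj : forall s, L 0 (Cconj s) = Cconj (L 0 s).
Hypothesis Lup : forall s, / 4 <= Re s <= 4 -> Cmod (L 0 s) < exp (G * ell lq (Im s)).
Hypothesis Llow : forall t, exp (- (G * ell lq t)) <= Cmod (L 0 (2, t)).
Variable c : nat -> R.
Hypothesis c1 : forall n, Rabs (c n) <= 1.
Hypothesis csg : sum_growth c 1 1.
Hypothesis Lexp : forall s, Re s = 2 -> L 0 s = cexp (DS c 0 s).
Hypothesis Llog : forall s, Re s = 2 -> (L 1 s / L 0 s)%C = DS c 1 s.

Let D (z : C) : C := (L 1 z / L 0 z)%C.

(** On Re s = 2 the series converge and the difference has n-th term c(n) n^(-s) (Ff(log n / H) -
    log n kap(log n)), controlled by [kerr]. The finite sum up to N carries every n at which 1 - Ff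
    does not vanish. *)
Lemma line_two dl H K N s eta : 0 < dl -> / 2 <= H -> dl * H < 1 ->
  (forall n, (N < n)%N -> H < lnN n) -> Re s = 2 ->
  (forall M, sum_n (fun n => pw 2 n * kerr dl H K n) M <= eta) ->
  Cmod (DS c 0 s + Wop dl (dl * H / 2) K D s - dps (cw c H) 0 s N)%C <= eta.
Proof.
move=> d0 H0 dH hN hs he; set al := dl * H / 2.
pose En M := (dps c 0 s M + Wop dl al K (fun z => dps c 1 z M) s - dps (cw c H) 0 s M)%C.
have EB : forall M, Cmod (En M) <= sum_n (fun n => pw 2 n * kerr dl H K n) M.
  elim=> [|M IH].
    rewrite /En !dps_0 sum_O /=.
    have -> : Wop dl al K (fun z => dps c 1 z 0) s = 0.
      rewrite (Wop_ext _ _ _ (g := fun z => (RtoC 0 * fj 0 1 z)%C)); last by move=> z; rewrite dps_0; ring.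
      have h : forall k f z, Wop dl al K (fun z => k * f z)%C z = (k * Wop dl al K f z)%C.
        move=> k f z; rewrite /Wop -sumC_scal; apply: sumC_ext => i _; rewrite /box.
        have -> : sumC (fun j => k * f (z + iy dl j) + k * f (z + - iy dl j))%C i = (k * sumC (fun j => f (z + iy dl j) + f (z + - iy dl j)) i)%C.
          by rewrite -sumC_scal; apply: sumC_ext => j _; ring.
        ring.
      by rewrite h Cmult_0_l.
    have -> : (0 + 0 - 0 = 0)%C by ring.
    by rewrite Cmod_0; lra.
  set n := M.+1.
  have st : En n = (En M + RtoC (c n * (Ff (lnN n / H) - lnN n * kap dl al K (lnN n))) * fj 0 n s)%C.
    rewrite /En !dps_S -/n.
    have -> : Wop dl al K (fun z => dps c 1 z n) s = (Wop dl al K (fun z => dps c 1 z M) s + RtoC (c n * - lnN n) * Wop dl al K (fj 0 n) s)%C.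
      rewrite (Wop_ext _ _ _ (g := fun z => (dps c 1 z M + RtoC (c n * - lnN n) * fj 0 n z)%C)); last first.
        by move=> z; rewrite dps_S fj1 RtoC_mult -/n; ring.
      rewrite Wop_plus; congr (_ + _)%C.
      rewrite /Wop -sumC_scal; apply: sumC_ext => i _; rewrite /box.
      have -> : forall k, sumC (fun j => k * fj 0 n (s + iy dl j) + k * fj 0 n (s + - iy dl j))%C i = (k * sumC (fun j => fj 0 n (s + iy dl j) + fj 0 n (s + - iy dl j)) i)%C.
        by move=> k; rewrite -sumC_scal; apply: sumC_ext => j _; ring.
      ring.
    rewrite Wop_fj /cw !RtoC_mult RtoC_opp !RtoC_minus !RtoC_mult; ring.
  rewrite st sum_Sn; apply: Rle_trans (Cmod_triangle _ _) _; apply: Rplus_le_compat => //.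
  rewrite Cmod_mult Cmod_R Cmod_fj0 hs Rabs_mult Rmult_comm -/(kerr dl H K n).
  have -> : exp (- (2) * lnN n) = pw 2 n by [].
  apply: Rmult_le_compat_l; first exact: pw_ge0.
  rewrite -[X in _ <= X]Rmult_1_l; apply: Rmult_le_compat_r; [exact: Rabs_pos | exact: c1].
have lim : limC En (DS c 0 s + Wop dl al K D s - dps (cw c H) 0 s N)%C.
  have B01 : 0 <= 1 by lra.
  apply: limC_plus.
    apply: limC_plus; first by apply: (DS_lim B01 csg B01); lra.
    apply: limC_Wop => z hz; rewrite /D Llog; last by rewrite hz.
    by apply: (DS_lim B01 csg B01); rewrite hz hs; lra.
  move=> e e0; exists N => M hM.
  have -> : dps (cw c H) 0 s M = dps (cw c H) 0 s N.
    elim: M hM => [|M IH]; first by rewrite leqn0 => /eqP ->.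
    rewrite leq_eqVlt => /orP [/eqP <- //|hM].
    rewrite dps_S IH; last by lia.
    have h := hN M.+1 (ltac:(lia)).
    have -> : cw c H M.+1 = 0; last by ring.
    rewrite /cw /Ff; case: Rle_dec => hl /=; last ring.
    exfalso; have := Rmult_le_compat_r H _ _ (ltac:(lra)) hl; rewrite /Rdiv Rmult_assoc Rinv_l; lra.
  have -> : (- dps (cw c H) 0 s N - - dps (cw c H) 0 s N = 0)%C by ring.
  by rewrite Cmod_0.
by apply: (limC_bound lim); exists 0%N => M _; apply: Rle_trans (EB M) (he M).
Qed.

(** L exp(W - P) is close to 1 on Re z = 2 by [line_two]. Its difference from 1, multiplied by a
    Gaussian and by e^(k(z - s0)) with k large, is small on the left side as well, hence at s0 by
    the maximum principle. So log|L| is nearly Re P - Re W, and Re W >= -O(ell/H) by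
    [Re_logder_lower]. *)
Lemma kernel_right H N x t : / 2 <= H -> (forall n, (N < n)%N -> H < lnN n) -> / 2 < x <= 3 / 4 ->
  ln (Cmod (L 0 (x, t))) <= Re (dps (cw c H) 0 (x, t) N) + 432 * Dpos_const G * ell lq t / H.
Proof.
move=> H0 hN hx; apply: Rle_plus_epsilon => tol tol0.
set s0 : C := (x, t).
set e := (x - / 2) / 2. have e0 : 0 < e <= / 8 by rewrite /e; lra.
set lt := ell lq t. have lt0 : / 2 < lt := ell_ge t lq0.
set B1 := G + 432 * (100 * G / (e * e)) / H.
have B10 : 0 <= B1.
  have : 0 <= 432 * (100 * G / (e * e)) / H by apply: Rdiv_le_0_compat; [|lra]; apply: Rmult_le_pos; [lra|]; apply: Rdiv_le_0_compat; nra.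
  by rewrite /B1; lra.
set B2 := B1 * lt + INR N.
have B20 : 0 <= B2 by have := pos_INR N; rewrite /B2; nra.
set to := Rmin tol 1 / 4. have to0 : 0 < to <= / 4.
  have h1 : 0 < Rmin tol 1 by apply: Rmin_pos; lra.
  have h2 : Rmin tol 1 <= 1 := Rmin_r _ _. by rewrite /to; lra.
have to1 : 4 * to <= tol by have h1 : Rmin tol 1 <= tol := Rmin_l _ _; rewrite /to; lra.
set B3 := B2 + 6 + B1 * B1.
(* The left side of the strip is at distance e from s0; there e^(-ke) has to bring the growth e^(B3)
   down to [to]. *)
set k := (B3 - ln to) / e.
have lto : ln to < 0 by rewrite -ln_1; apply: ln_increasing; lra.
have k0 : 0 < k by apply: Rdiv_lt_0_compat; [rewrite /B3; nra | lra].
(* On Re z = 2 the auxiliary factors are at most e^(4 + 2k), so the error on that side must be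
   smaller than [to] by this much. *)
set eta := Rmin (/ 4) (to / (2 * exp (4 + 2 * k))).
have eta0 : 0 < eta.
  by apply: Rmin_pos; [lra | apply: Rdiv_lt_0_compat; [lra | have := exp_pos (4 + 2 * k); lra]].
have eta1 : eta <= / 4 := Rmin_l _ _.
have eta2 : 2 * eta * exp (4 + 2 * k) <= to.
  have h : eta <= to / (2 * exp (4 + 2 * k)) := Rmin_r _ _.
  have p := exp_pos (4 + 2 * k).
  have := Rmult_le_compat_r (2 * exp (4 + 2 * k)) _ _ (ltac:(lra)) h.
  have -> : to / (2 * exp (4 + 2 * k)) * (2 * exp (4 + 2 * k)) = to by field; lra.
  lra.
have [dl [K [d0 [dH hs]]]] := kerr_sum H0 eta0.
set al := dl * H / 2.
pose W := Wop dl al K D. pose P z := dps (cw c H) 0 z N.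
pose Hf z := (L 0 z * cexp (W z - P z))%C.
pose f z := ((Hf z - 1) * cexp ((z - s0) * (z - s0) + k * (z - s0)))%C.
set a := / 2 + e.
have twL : tw a 2 (L 0) by exists (L 1), (L 2) => z hz; split; apply: Lcd; rewrite /a in hz; lra.
have twL1 : tw a 2 (L 1) by exists (L 2), (L 3) => z hz; split; apply: Lcd; rewrite /a in hz; lra.
have twD : tw a 2 D.
  by apply: tw_mult => //; apply: tw_inv => // z hz; apply: L0; rewrite /a in hz; lra.
have twf : tw a 2 f.
  apply: tw_mult.
    apply: tw_minus; last exact: tw_const.
    apply: tw_mult => //; apply: tw_cexp; apply: tw_minus; [exact: tw_Wop | exact: tw_dps].
  have t1 : tw a 2 (fun z => z - s0)%C by apply: tw_minus; [exact: tw_id | exact: tw_const].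
  by apply: tw_cexp; apply: tw_plus; [apply: tw_mult | apply: tw_scal].
have exE z : Cmod (cexp ((z - s0) * (z - s0) + k * (z - s0))%C) =
   exp ((Re z - x) * (Re z - x) - (Im z - t) * (Im z - t) + k * (Re z - x)).
  rewrite Cmod_cexp; congr exp; case: (z) => u v; rewrite /s0 /=; ring.
have Hb z : a <= Re z <= 2 -> Cmod (Hf z) <= exp (B2 + B1 * Rabs (Im z - t)).
  move=> hz; rewrite /Hf Cmod_mult Cmod_cexp.
  have u1 := Lup (s := z) (ltac:(rewrite /a in hz; lra)).
  have Dz y : Cmod (D (z + (0, y))%C) <= 100 * G / (e * e) * ell lq (Im z + y).
    have -> : (z + (0, y))%C = (Re z, Im z + y) by apply: C_eq => /=; rewrite /Re /Im; ring.
    have [_] := growth_rect lq0 G1 Lcd L0 Lup Llow (x := Re z) (Im z + y) (e := e) (ltac:(lra)) (ltac:(rewrite /a in hz; lra)).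
    move=> h; apply: Rle_trans h _; right; field; lra.
  have wb : Cmod (W z) <= 432 * (100 * G / (e * e)) * ell lq (Im z) / H.
    apply: Rle_trans (Cmod_Wop _ _ _ _ (Rlt_le _ _ d0)) _.
    by apply: (@wsum_le dl H K _ lq (Im z)) => //; apply: Rdiv_le_0_compat; nra.
  have pb : Cmod (P z) <= INR N by apply: dps_cw_bound => //; rewrite /a in hz; lra.
  apply: (Rle_trans _ (exp (G * ell lq (Im z)) * exp (432 * (100 * G / (e * e)) * ell lq (Im z) / H + INR N))).
    apply: Rmult_le_compat; [exact: Cmod_ge_0 | exact/exp_ge0 | lra |].
    apply: exp_le; rewrite Re_minus.
    have := re_le_Cmod (W z); have := re_le_Cmod (P z); have := Rle_abs (Re (W z)); have := Rle_abs (- Re (P z)); rewrite Rabs_Ropp; lra.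
  rewrite -exp_plus; apply: exp_le.
  have -> : G * ell lq (Im z) + (432 * (100 * G / (e * e)) * ell lq (Im z) / H + INR N) = B1 * ell lq (Im z) + INR N by rewrite /B1; field; lra.
  have sh := ell_shift lq t (Im z); rewrite -/lt in sh.
  have ab := Rabs_pos (Im z - t).
  have := Rmult_le_compat_l _ _ _ B10 sh; rewrite /B2; nra.
have fb z : a <= Re z <= 2 -> Cmod (f z) <= exp (B2 + B1 * Rabs (Im z - t) + 5 - (Im z - t) * (Im z - t) + k * (Re z - x)).
  move=> hz; rewrite /f Cmod_mult exE.
  have h1 : Cmod (Hf z - 1)%C <= exp (B2 + B1 * Rabs (Im z - t) + 1).
    apply: Rle_trans (Cmod_minus_le _ _) _; rewrite Cmod_1.
    have h := Hb z hz.
    have h2 : 1 <= exp (B2 + B1 * Rabs (Im z - t)).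
      by rewrite -exp_0; apply: exp_le; have := Rabs_pos (Im z - t); nra.
    rewrite exp_plus; have := exp_ineq1_le 1; have := exp_pos (B2 + B1 * Rabs (Im z - t)); nra.
  apply: Rle_trans (Rmult_le_compat_r _ _ _ (Rlt_le _ _ (exp_pos _)) h1) _.
  rewrite -exp_plus; apply: exp_le; rewrite /a in hz; nra.
have fmax : Cmod (f s0) <= to.
  apply: (@tw_max a 2 f to (Rabs t + B1 + B2 + 5 + 2 * k + - ln to + 1)) => //; try (rewrite /a; lra).
  - move=> z [hz|hz].
      have h := fb z (ltac:(rewrite /a in hz *; lra)); apply: Rle_trans h _.
      rewrite -[X in _ <= X]exp_ln; last lra.
      apply: exp_le; rewrite hz /a.
      have -> : / 2 + e - x = - e by rewrite /e; field.
      rewrite (abs_sq (Im z - t)).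
      have -> : k * - e = - (B3 - ln to) by rewrite /k; field; lra.
      rewrite /B3; have := Rle_0_sqr (Rabs (Im z - t) - B1 / 2); rewrite /Rsqr; have := Rle_0_sqr B1; rewrite /Rsqr; nra.
    rewrite /f Cmod_mult exE hz.
    have E := line_two d0 H0 dH hN hz hs; rewrite -/al -/(W z) -/(P z) in E.
    have h1 : Cmod (Hf z - 1)%C <= 2 * eta.
      have -> : Hf z = cexp (DS c 0 z + W z - P z)%C.
        by rewrite /Hf Lexp // -cexp_plus; congr cexp; ring.
      by apply: Rle_trans (cexp_m1 _) _; lra.
    apply: Rle_trans eta2; apply: Rmult_le_compat => //; [exact: Cmod_ge_0 | exact/exp_ge0 |].
    apply: exp_le; have := Rle_0_sqr (Im z - t); rewrite /Rsqr => sq.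
    have : k * (2 - x) <= k * 2 by apply: Rmult_le_compat_l; lra.
    nra.
  - move=> z hz hT; have h := fb z hz; apply: Rle_trans h _.
    rewrite -[X in _ <= X]exp_ln; last lra.
    apply: exp_le.
    rewrite (abs_sq (Im z - t)).
    have hy : B1 + B2 + 5 + 2 * k + - ln to + 1 <= Rabs (Im z - t).
      have := Rabs_triang (Im z - t) t; have -> : Im z - t + t = Im z by ring.
      lra.
    move: (Rabs (Im z - t)) hy => y hy.
    have : k * (Re z - x) <= 2 * k by rewrite /a in hz; nra.
    have : (B1 + 1 + (B2 + 5 + 2 * k - ln to)) * y <= y * y by apply: Rmult_le_compat_r; nra.
    have : B2 + 5 + 2 * k - ln to <= (B2 + 5 + 2 * k - ln to) * y by nra.
    nra.
  - by rewrite /s0 /a /e /=; lra.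
have fs : f s0 = (Hf s0 - 1)%C.
  by rewrite /f (_ : ((s0 - s0) * (s0 - s0) + k * (s0 - s0) = 0)%C) ?cexp_0; ring.
rewrite fs in fmax.
have n0 : L 0 s0 <> 0 by apply: L0; rewrite /s0 /=; lra.
have p0 := proj1 (Cmod_gt_0 _) n0.
have H2 : Cmod (Hf s0) <= 1 + to.
  have := Cmod_triangle (Hf s0 - 1)%C 1; have -> : (Hf s0 - 1 + 1 = Hf s0)%C by ring.
  rewrite Cmod_1; lra.
have : ln (Cmod (Hf s0)) <= to.
  rewrite /Hf Cmod_mult Cmod_cexp in H2 *.
  have pp : 0 < Cmod (L 0 s0) * exp (Re (W s0 - P s0)%C) by apply: Rmult_lt_0_compat => //; exact: exp_pos.
  have := ln_le _ _ pp H2; have := @ln_le_sub1 (1 + to) (ltac:(lra)); lra.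
rewrite /Hf Cmod_mult Cmod_cexp ln_mult //; last exact: exp_pos.
rewrite ln_exp Re_minus -/(P s0).
have : - (432 * Dpos_const G * lt / H) <= Re (W s0).
  rewrite Re_Wop.
  have -> : forall f, wsum dl al K f = - wsum dl al K (fun y => - f y).
    by move=> g; rewrite wsum_opp; ring.
  apply: Ropp_le_contravar; apply: (@wsum_le dl H K _ lq t) => //.
    by rewrite /Dpos_const; nra.
  move=> y; have -> : (s0 + (0, y))%C = (x, t + y) by apply: C_eq => /=; rewrite /s0 /=; ring.
  have := Re_logder_lower lq0 G1 Lcd L0 Lconj Lup Llow (s0 := (x, t + y)) (ltac:(rewrite /=; lra)).
  rewrite /D /=; lra.
rewrite -/lt; lra.
Qed.

(** Both sides are continuous up to Re s = 1/2, so [kernel_right] passes to the limit. L may vanish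
    there, hence a statement on the modulus instead of its logarithm. *)
Theorem kernel_half H N t : / 2 <= H -> (forall n, (N < n)%N -> H < lnN n) ->
  Cmod (L 0 (/ 2, t)) <= exp (Re (dps (cw c H) 0 (/ 2, t) N) + 432 * Dpos_const G * ell lq t / H).
Proof.
move=> H0 hN; set s : C := (/ 2, t).
apply: Rle_plus_epsilon => tol tol0.
have h1 : cderiv (L 0) s (L 1 s) by apply: Lcd; rewrite /s /=; lra.
have [d2 h2] : exists d, cderiv (fun z => cexp (dps (cw c H) 0 z N)) s d.
  have [g1 [g2 hg]] := tw_cexp (tw_dps 0 1 (cw c H) 0 N).
  by exists (g1 s); have [] := hg s (ltac:(rewrite /s /=; lra)).
set E := 432 * Dpos_const G * ell lq t / H.
have [r1 [r10 hr1]] := cd_small h1 (ltac:(lra) : 0 < tol / 2).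
have [r2 [r20 hr2]] := cd_small h2 (ltac:(apply: Rdiv_lt_0_compat; [exact: tol0 | have := exp_pos E; lra]) : 0 < tol / (2 * exp E)).
set r := Rmin (Rmin r1 r2) (/ 2) / 2.
have r0 : 0 < Rmin (Rmin r1 r2) (/ 2) by repeat apply: Rmin_pos; lra.
have ra : Rmin (Rmin r1 r2) (/ 2) <= r1 := Rle_trans _ _ _ (Rmin_l _ _) (Rmin_l _ _).
have rb : Rmin (Rmin r1 r2) (/ 2) <= r2 := Rle_trans _ _ _ (Rmin_l _ _) (Rmin_r _ _).
have rc : Rmin (Rmin r1 r2) (/ 2) <= / 2 := Rmin_r _ _.
have cr : Cmod (RtoC r) = r by rewrite Cmod_R Rabs_pos_eq // /r; lra.
have q1 := hr1 (RtoC r) (ltac:(rewrite cr /r; lra)).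
have q2 := hr2 (RtoC r) (ltac:(rewrite cr /r; lra)).
have sr : (s + RtoC r)%C = (/ 2 + r, t) by apply: C_eq => /=; rewrite /s /=; ring.
rewrite sr in q1 q2.
have K := @kernel_right H N (/ 2 + r) t H0 hN (ltac:(rewrite /r; lra)).
rewrite -/E in K.
have p0 : 0 < Cmod (L 0 (/ 2 + r, t)) by apply/Cmod_gt_0; apply: L0; rewrite /= /r; lra.
have K2 : Cmod (L 0 (/ 2 + r, t)) <= exp (Re (dps (cw c H) 0 (/ 2 + r, t) N)) * exp E.
  rewrite -[Cmod _]exp_ln // -exp_plus; exact: exp_le.
rewrite exp_plus -Cmod_cexp; rewrite -Cmod_cexp in K2.
have q3 := Cmod_triangle_inv (L 0 s) (L 0 (/ 2 + r, t)); rewrite Cmod_minus_sym in q3.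
have q4 := Cmod_triangle_inv (cexp (dps (cw c H) 0 (/ 2 + r, t) N)) (cexp (dps (cw c H) 0 s N)).
have pE := exp_pos E.
have q5 : Cmod (cexp (dps (cw c H) 0 (/ 2 + r, t) N)) * exp E <= Cmod (cexp (dps (cw c H) 0 s N)) * exp E + tol / 2.
  have -> : tol / 2 = tol / (2 * exp E) * exp E by field; lra.
  rewrite -Rmult_plus_distr_r; apply: Rmult_le_compat_r; lra.
lra.
Qed.

End Kernel.

(** * Big operators over the reals and the complex numbers *)

Lemma Rplus_A : associative Rplus. Proof. by move=> *; ring. Qed.
Lemma Rplus_C : commutative Rplus. Proof. by move=> *; ring. Qed.
Lemma Rplus_0 : left_id 0 Rplus. Proof. by move=> *; ring. Qed.
Lemma Rmult_A : associative Rmult. Proof. by move=> *; ring. Qed.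
Lemma Rmult_C : commutative Rmult. Proof. by move=> *; ring. Qed.
Lemma Rmult_1 : left_id 1 Rmult. Proof. by move=> *; ring. Qed.
Lemma Rmult_0l : left_zero 0 Rmult. Proof. by move=> *; ring. Qed.
Lemma Rmult_0r : right_zero 0 Rmult. Proof. by move=> *; ring. Qed.
Lemma Rmult_Dl : left_distributive Rmult Rplus. Proof. by move=> *; ring. Qed.
Lemma Rmult_Dr : right_distributive Rmult Rplus. Proof. by move=> *; ring. Qed.
HB.instance Definition _ := Monoid.isComLaw.Build R 0 Rplus Rplus_A Rplus_C Rplus_0.
HB.instance Definition _ := Monoid.isComLaw.Build R 1 Rmult Rmult_A Rmult_C Rmult_1.
HB.instance Definition _ := Monoid.isMulLaw.Build R 0 Rmult Rmult_0l Rmult_0r.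
HB.instance Definition _ := Monoid.isAddLaw.Build R Rmult Rplus Rmult_Dl Rmult_Dr.

Lemma Cplus_A : associative Cplus. Proof. by move=> *; ring. Qed.
Lemma Cplus_C : commutative Cplus. Proof. by move=> *; ring. Qed.
Lemma Cplus_0 : left_id (RtoC 0) Cplus. Proof. by move=> *; ring. Qed.
Lemma Cmult_A : associative Cmult. Proof. by move=> *; ring. Qed.
Lemma Cmult_C : commutative Cmult. Proof. by move=> *; ring. Qed.
Lemma Cmult_1 : left_id (RtoC 1) Cmult. Proof. by move=> *; ring. Qed.
Lemma Cmult_0l : left_zero (RtoC 0) Cmult. Proof. by move=> *; ring. Qed.
Lemma Cmult_0r : right_zero (RtoC 0) Cmult. Proof. by move=> *; ring. Qed.
Lemma Cmult_Dl : left_distributive Cmult Cplus. Proof. by move=> *; ring. Qed.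
Lemma Cmult_Dr : right_distributive Cmult Cplus. Proof. by move=> *; ring. Qed.
HB.instance Definition _ := Monoid.isComLaw.Build C (RtoC 0) Cplus Cplus_A Cplus_C Cplus_0.
HB.instance Definition _ := Monoid.isComLaw.Build C (RtoC 1) Cmult Cmult_A Cmult_C Cmult_1.
HB.instance Definition _ := Monoid.isMulLaw.Build C (RtoC 0) Cmult Cmult_0l Cmult_0r.
HB.instance Definition _ := Monoid.isAddLaw.Build C Cmult Cplus Cmult_Dl Cmult_Dr.

Lemma rsum_le (I : eqType) (r : seq I) (P : pred I) (F G : I -> R) : (forall i, i \in r -> P i -> F i <= G i) ->
  \rsum_(i <- r | P i) F i <= \rsum_(i <- r | P i) G i.
Proof.
move=> h; rewrite big_seq_cond [X in _ <= X]big_seq_cond.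
elim/big_rec2: _ => [|i y1 y2 /andP [hi hp] h2]; first lra.
by apply: Rplus_le_compat => //; exact: h.
Qed.

Lemma rsum_ge0 (I : eqType) (r : seq I) (P : pred I) (F : I -> R) : (forall i, i \in r -> P i -> 0 <= F i) ->
  0 <= \rsum_(i <- r | P i) F i.
Proof.
move=> h; rewrite big_seq_cond; elim/big_rec: _ => [|i y /andP [hi hp] h2]; first lra.
have := h i hi hp; lra.
Qed.

Lemma rsum_abs (I : Type) (r : seq I) (P : pred I) (F : I -> R) :
  Rabs (\rsum_(i <- r | P i) F i) <= \rsum_(i <- r | P i) Rabs (F i).
Proof.
elim/big_rec2: _ => [|i y1 y2 hp h2]; first by rewrite Rabs_R0; lra.
apply: Rle_trans (Rabs_triang _ _) _; lra.
Qed.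

Lemma csum_abs (I : Type) (r : seq I) (P : pred I) (F : I -> C) :
  Cmod (\big[Cplus/RtoC 0]_(i <- r | P i) F i) <= \rsum_(i <- r | P i) Cmod (F i).
Proof.
elim/big_rec2: _ => [|i y1 y2 hp h2]; first by rewrite Cmod_0; lra.
apply: Rle_trans (Cmod_triangle _ _) _; lra.
Qed.

(* Enlarging the index set of a sum of nonnegative terms. *)
Lemma rsum_mask (I : eqType) (r : seq I) (P Q : pred I) (F : I -> R) : (forall i, i \in r -> P i -> Q i) ->
  (forall i, i \in r -> Q i -> 0 <= F i) ->
  \rsum_(i <- r | P i) F i <= \rsum_(i <- r | Q i) F i.
Proof.
move=> h h0; rewrite big_mkcond [X in _ <= X]big_mkcond; apply: rsum_le => i hi _.
case: ifP => hp; first by rewrite h //; lra.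
by case: ifP => hq; [apply: h0 | lra].
Qed.

Lemma INR_gt0 n : (0 < n)%N -> 0 < INR n.
Proof. by move=> h; apply: lt_0_INR; lia. Qed.
Lemma INR_ge1 n : (0 < n)%N -> 1 <= INR n.
Proof. by move=> h; apply: (le_INR 1); lia. Qed.
Lemma INR_mul m n : INR (m * n)%N = INR m * INR n. Proof. exact: mult_INR. Qed.
Lemma INR_exp m n : INR (m ^ n)%N = INR m ^ n.
Proof. by elim: n => [|n IH] //; rewrite expnS INR_mul IH. Qed.
Lemma ln_mulN m n : (0 < m)%N -> (0 < n)%N -> ln (INR (m * n)%N) = lnN m + lnN n.
Proof. by move=> h1 h2; rewrite INR_mul ln_mult //; apply: INR_gt0. Qed.
Lemma ln_expN m n : (0 < m)%N -> ln (INR (m ^ n)%N) = INR n * lnN m.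
Proof.
move=> h; elim: n => [|n IH]; first by rewrite expn0 /= ln_1; ring.
by rewrite expnS ln_mulN ?expn_gt0 ?h // IH S_INR; ring.
Qed.

(** * Prime powers and the von Mangoldt function *)

Definition ppow (n : nat) : bool := size (primes n) == 1%N.
(** Lambda(n)/log n: the value is 1/k at p^k and 0 elsewhere. Accordingly [vM] is the von Mangoldt
    function. *)
Definition cc (n : nat) : R := if ppow n then / INR (logn (pdiv n) n) else 0.
Definition vM (n : nat) : R := cc n * lnN n.

Lemma primes_pow p k : prime p -> (0 < k)%N -> primes (p ^ k) = [:: p].
Proof. by move=> hp hk; rewrite primesX // primes_prime. Qed.

Lemma ppow_pow p k : prime p -> (0 < k)%N -> ppow (p ^ k).
Proof. by move=> hp hk; rewrite /ppow primes_pow. Qed.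

Lemma pdiv_pow p k : prime p -> (0 < k)%N -> pdiv (p ^ k) = p.
Proof.
by move=> hp; case: k => // k _; rewrite /pdiv primes_pow.
Qed.

Lemma cc_pow p k : prime p -> (0 < k)%N -> cc (p ^ k) = / INR k.
Proof. by move=> hp hk; rewrite /cc ppow_pow // pdiv_pow // pfactorK. Qed.

Lemma ppowE n : ppow n -> prime (pdiv n) /\ (0 < logn (pdiv n) n)%N /\ n = (pdiv n ^ logn (pdiv n) n)%N.
Proof.
rewrite /ppow => h; case e : (primes n) h => [|p []] // _.
have n0 : (0 < n)%N by case: (n) e.
have pn : p \in primes n by rewrite e inE.
have hp : prime p by move: pn; rewrite mem_primes => /andP [].
have pd : pdiv n = p by rewrite /pdiv e.
rewrite pd; split=> //; split; first by rewrite logn_gt0.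
by rewrite {1}(prod_prime_decomp n0) prime_decompE e /= big_cons big_nil muln1.
Qed.

Lemma cc_01 n : 0 <= cc n <= 1.
Proof.
rewrite /cc; case: ifP => [h|_]; last lra.
have [_ [h2 _]] := ppowE h; have h3 := INR_ge1 h2.
split; first by apply/Rinv_ge0; lra.
by rewrite -Rinv_1; apply: Rinv_le_contravar; lra.
Qed.

(* Sums over prime powers as double sums over a prime and an exponent. *)
Lemma ppow_reindex N (F : nat -> R) :
  \rsum_(1 <= m < N.+1 | ppow m) F m =
  \psum_(p <= N) \rsum_(1 <= k < N.+1 | (p ^ k <= N)%N) F (p ^ k)%N.
Proof.
have per : forall m, (1 <= m < N.+1)%N ->
   (if ppow m then F m else 0) = \psum_(p <= N) \rsum_(1 <= k < N.+1 | (p ^ k == m)%N) F m.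
  move=> m hm; case: ifP => h.
    have [h1 [h2 h3]] := ppowE h.
    set p0 := pdiv m in h1 h2 h3; set k0 := logn p0 m in h2 h3.
    have p0m : (p0 < N.+1)%N.
      by apply: leq_ltn_trans (_ : (m < N.+1)%N); [apply: pdiv_leq; lia | lia].
    have k0m : (1 <= k0 < N.+1)%N.
      rewrite h2 /=; have : (k0 < p0 ^ k0)%N by apply: ltn_expl; apply: prime_gt1.
      by rewrite -h3; lia.
    rewrite [RHS]big_mkcond (bigD1_seq p0) ?mem_index_iota ?iota_uniq //= h1.
    rewrite (eq_bigl (fun k => k == k0)); last first.
      move=> k; apply/eqP/eqP => [hk|->]; last by rewrite -h3.
      by apply: (@expnI p0 (prime_gt1 h1)); rewrite hk.
    rewrite big_nat1_eq k0m big1 ?Rplus_0_r // => p pn; case: ifP => // hp.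
    rewrite big_nat_cond big1 // => k /andP [/andP [hk _] /eqP hpk].
    case/negP: pn; apply/eqP; rewrite /p0 -hpk pdiv_pow //.
  rewrite big1 // => p hp; rewrite big_nat_cond big1 // => k /andP [/andP [hk _] /eqP hpk].
  by move: h; rewrite -hpk ppow_pow.
rewrite big_mkcond (eq_big_nat _ _ per).
rewrite exchange_big; apply: eq_bigr => p hp.
rewrite (exchange_big_dep_nat xpredT) //=.
rewrite [RHS]big_mkcond; apply: eq_big_nat => k hk.
rewrite (eq_bigl (fun m => m == (p ^ k)%N)); last by move=> m; rewrite eq_sym.
by rewrite big_nat1_eq expn_gt0 prime_gt0 //= ltnS.
Qed.

Lemma sum_ln_primes N k : (1 <= k <= N)%N ->
  \psum_(p <= N) (INR (logn p k) * lnN p) = lnN k.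
Proof.
move=> /andP [k1 kN].
have e : k = (\prod_(0 <= p < N.+1 | prime p) p ^ logn p k)%N.
  rewrite -{1}(partnT k1) (widen_partn _ kN) big_mkcond [RHS]big_mkcond.
  apply: eq_bigr => p _ /=; case: ifP => // hp.
  by rewrite lognE hp.
rewrite {2}e.
suff [] : (0 < \prod_(0 <= p < N.+1 | prime p) p ^ logn p k)%N /\
  \psum_(p <= N) (INR (logn p k) * lnN p) = ln (INR (\prod_(0 <= p < N.+1 | prime p) p ^ logn p k)%N) by [].
elim/big_rec2: _ => [|p y x hp [y0 ->]].
  by rewrite /= ln_1.
have p0 := prime_gt0 hp. have pe : (0 < p ^ logn p k)%N by rewrite expn_gt0 p0.
split; first by rewrite muln_gt0 pe.
by rewrite ln_mulN // ln_expN.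
Qed.

(** Each power of p that divides k contributes log p, once for every exponent up to the
    valuation. *)
Lemma sum_vM N k : (1 <= k <= N)%N -> \rsum_(1 <= m < N.+1 | (m %| k)%N) vM m = lnN k.
Proof.
move=> hk; rewrite -(sum_ln_primes hk).
have -> : \rsum_(1 <= m < N.+1 | (m %| k)%N) vM m = \rsum_(1 <= m < N.+1 | ppow m) (if (m %| k)%N then vM m else 0).
  rewrite big_mkcond [RHS]big_mkcond; apply: eq_bigr => m _.
  by case: ifP => h1; case: ifP => h2 //; rewrite /vM /cc h2 Rmult_0_l.
rewrite ppow_reindex; apply: eq_bigr => p hp.
have p0 := prime_gt0 hp. have p1 := prime_gt1 hp.
have -> : \rsum_(1 <= i < N.+1 | (p ^ i <= N)%N) (if (p ^ i %| k)%N then vM (p ^ i) else 0) =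
   \rsum_(1 <= i < N.+1 | (i < (logn p k).+1)%N) lnN p.
  rewrite big_mkcond [RHS]big_mkcond; apply: eq_big_nat => i hi.
  rewrite ltnS -pfactor_dvdn //; last by lia.
  case: (boolP (p ^ i %| k)%N) => hd; last by case: ifP.
  have -> : (p ^ i <= N)%N by apply: leq_trans (dvdn_leq _ hd) _; lia.
  rewrite /vM cc_pow // ?ln_expN //; last by lia.
  have i0 : 0 < INR i by apply: INR_gt0; lia.
  by field; lra.
have lk : (logn p k < N.+1)%N.
  have h1 : (p ^ logn p k <= k)%N by apply: dvdn_leq; [lia | exact: pfactor_dvdnn].
  have h2 : (logn p k < p ^ logn p k)%N by exact: ltn_expl.
  lia.
have -> : \rsum_(1 <= i < N.+1 | (i < (logn p k).+1)%N) lnN p = \rsum_(1 <= i < (logn p k).+1) lnN p.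
  by rewrite (big_nat_widen _ (logn p k).+1 N.+1).
elim: (logn p k) => [|j IH]; first by rewrite big_geq //=; ring.
by rewrite big_nat_recr // IH S_INR [LHS]/= ; ring.
Qed.

(** * The logarithm of a Dirichlet series with completely multiplicative coefficients *)

Lemma Rle01 : 0 <= 1. Proof. lra. Qed.

Lemma sum_growth_1 a : (forall n, Rabs (a n) <= 1) -> sum_growth a 1 1.
Proof.
move=> h n hn; rewrite !Rmult_1_l exp_ln; last exact: INR_gt0.
elim: n {hn} => [|n IH]; first by rewrite /= Rabs_R0; lra.
rewrite S_INR [Sp _ _]/=; apply: Rle_trans (Rabs_triang _ _) _; have := h n.+1; lra.
Qed.

Lemma dps_big a j s N : dps a j s N = \big[Cplus/RtoC 0]_(1 <= n < N.+1) (a n * fj j n s)%C.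
Proof.
elim: N => [|N IH]; first by rewrite dps_0 big_geq.
by rewrite dps_S IH [RHS]big_nat_recr //=.
Qed.

Lemma sum_n_big (f : nat -> R) N : f 0%N = 0 -> sum_n f N = \rsum_(1 <= n < N.+1) f n.
Proof.
move=> f0; elim: N => [|N IH]; first by rewrite sum_O big_geq.
by rewrite sum_Sn IH [RHS]big_nat_recr //=.
Qed.

Lemma fj0_mul m n s : (0 < m)%N -> (0 < n)%N -> fj 0 (m * n) s = (fj 0 m s * fj 0 n s)%C.
Proof.
move=> h1 h2; rewrite /fj !pow_O ln_mulN // RtoC_plus Cmult_plus_distr_l cexp_plus; ring.
Qed.

Lemma Cmod_fj0_pw n s : (0 < n)%N -> Cmod (fj 0 n s) = pw (Re s) n.
Proof. by case: n => // n _; rewrite Cmod_fj0. Qed.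

Lemma limC_unique u l m : limC u l -> limC u m -> l = m.
Proof.
move=> h1 h2; apply: NNPP => ne.
have d0 : 0 < Cmod (l - m)%C.
  apply/Cmod_gt_0 => e; apply: ne; have -> : l = ((l - m) + m)%C by ring. rewrite e; ring.
have [N1 H1] := h1 (Cmod (l - m)%C / 2) (ltac:(lra)); have [N2 H2] := h2 (Cmod (l - m)%C / 2) (ltac:(lra)).
have := H1 (N1 + N2)%N (ltac:(lia)); have := H2 (N1 + N2)%N (ltac:(lia)).
have := Cmod_triangle (l - u (N1 + N2)%N)%C (u (N1 + N2)%N - m)%C.
have -> : (l - u (N1 + N2)%N + (u (N1 + N2)%N - m) = l - m)%C by ring.
rewrite (Cmod_minus_sym l (u _)); lra.
Qed.

Lemma limC_mult u v l m : limC u l -> limC v m -> limC (fun n => u n * v n)%C (l * m)%C.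
Proof.
move=> hu hv.
have h : limC (fun n => (u n - l) * (v n - m))%C 0.
  move=> e e0; have [N1 h1] := hu (Rmin e 1) (ltac:(apply: Rmin_pos; lra)); have [N2 h2] := hv 1 (ltac:(lra)).
  exists (N1 + N2)%N => N hN; have {}h1 := h1 N (ltac:(lia)); have {}h2 := h2 N (ltac:(lia)).
  have -> : ((u N - l) * (v N - m) - 0 = (u N - l) * (v N - m))%C by ring.
  rewrite Cmod_mult; have := Rmin_l e 1; have := Cmod_ge_0 (u N - l)%C; have := Cmod_ge_0 (v N - m)%C; nra.
have -> : (l * m = (0 + l * m) + (m * l + l * m) - (m * l + l * m))%C by ring.
apply: (limC_ext (u := fun n => ((((u n - l) * (v n - m)) + l * v n) + (m * u n)) - (l * m))%C).
  by move=> n; ring.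
have -> : ((0 + l * m) + (m * l + l * m) - (m * l + l * m) = ((0 + l * m) + m * l) + - (l * m))%C by ring.
apply: limC_plus; last exact: limC_const.
by apply: limC_plus; [apply: limC_plus => //; exact: limC_scal | exact: limC_scal].
Qed.

Lemma csumN (I : Type) (r : seq I) (P : pred I) (F : I -> C) :
  \big[Cplus/RtoC 0]_(i <- r | P i) (- F i)%C = (- (\big[Cplus/RtoC 0]_(i <- r | P i) F i))%C.
Proof. by elim/big_rec2: _ => [|i x y _ ->]; ring. Qed.

Section Euler.
Variable chi : nat -> R.
Hypothesis chi1 : chi 1%N = 1.
Hypothesis chiM : forall m n, (0 < m)%N -> (0 < n)%N -> chi (m * n)%N = chi m * chi n.
Hypothesis chib : forall n, Rabs (chi n) <= 1.

Definition lc (n : nat) : R := cc n * chi n.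

Lemma lc_b n : Rabs (lc n) <= 1.
Proof.
rewrite /lc Rabs_mult; have [h1 h2] := cc_01 n; rewrite (Rabs_pos_eq (cc n)) //.
have := chib n; have := Rabs_pos (chi n); nra.
Qed.

(** Since log is the convolution of Lambda with 1 and chi is completely multiplicative, -L' = (sum
    of Lambda(n) chi(n) n^(-s)) L. For partial sums the two sides differ by the pairs m, n <= N with
    mn > N; once N >= M^2 one factor exceeds M, and absolute convergence makes this tail small. *)
Lemma Euler_mul s : 1 < Re s -> DS chi 1 s = (DS lc 1 s * DS chi 0 s)%C.
Proof.
move=> hs.
have g1 := sum_growth_1 chib. have g2 := sum_growth_1 lc_b.
have l1 := DS_lim Rle01 g1 Rle01 1 hs. have l2 := DS_lim Rle01 g2 Rle01 1 hs. have l3 := DS_lim Rle01 g1 Rle01 0 hs.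
have lp := limC_mult l2 l3.
apply: (limC_unique l1).
set k := (Re s - 1) / 2. have k0 : 0 < k by rewrite /k; lra.
set p := pw (1 + k). have p0 : forall n, 0 <= p n by move=> n; exact: pw_ge0.
pose A m := (RtoC (vM m * chi m) * fj 0 m s)%C. pose B n := (RtoC (chi n) * fj 0 n s)%C.
set K := 1 + / k * exp (2 * k).
have ik : 0 < / k by apply: Rinv_0_lt_compat.
have K1 : 1 <= K by have := exp_pos (2 * k); rewrite /K; nra.
have e1 : forall n, (0 < n)%N -> pw (Re s) n = p n * exp (- k * lnN n).
  move=> [//|n] _; rewrite /p /pw -exp_plus; congr exp; rewrite /k; field.
have Bb : forall n, (0 < n)%N -> Cmod (B n) <= K * p n.
  move=> n hn; rewrite /B Cmod_mult Cmod_R Cmod_fj0_pw // e1 //.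
  have [l0 _] := ln_succ hn.
  have h : exp (- k * lnN n) <= 1 by apply: exp_le1; nra.
  have := chib n; have := Rabs_pos (chi n); have := p0 n; have := exp_pos (- k * lnN n) => a1 a2 a3 a4.
  have : p n * exp (- k * lnN n) <= p n by nra.
  have : 0 <= p n * exp (- k * lnN n) by nra.
  nra.
have Ab : forall n, (0 < n)%N -> Cmod (A n) <= K * p n.
  move=> n hn; rewrite /A Cmod_mult Cmod_R Cmod_fj0_pw // e1 //.
  have [l0 [l4 _]] := ln_succ hn.
  have [c0 c1] := cc_01 n.
  have h := @log_pow_le 1 n k k0 hn; rewrite !pow_1 (_ : INR (fact 1) = 1) // Rmult_1_l in h.
  have v1 : Rabs (vM n * chi n) <= lnN n.
    rewrite /vM !Rabs_mult (Rabs_pos_eq (cc n)) // (Rabs_pos_eq (ln _)) //.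
    have := chib n; have := Rabs_pos (chi n) => a1 a2.
    have : cc n * lnN n <= lnN n by nra.
    have : 0 <= cc n * lnN n by nra.
    nra.
  have E : exp (k * lnN n) * exp (- k * lnN n) = 1.
    by rewrite -exp_plus -exp_0; congr exp; ring.
  have E2 := exp_pos (- k * lnN n).
  have h2 : lnN n * exp (- k * lnN n) <= K.
    apply: (Rle_trans _ (/ k * exp (2 * k) * exp (k * lnN n) * exp (- k * lnN n))); first by apply: Rmult_le_compat_r; lra.
    by rewrite Rmult_assoc E /K; lra.
  have -> : Rabs (vM n * chi n) * (p n * exp (- k * lnN n)) = p n * (Rabs (vM n * chi n) * exp (- k * lnN n)) by ring.
  rewrite Rmult_comm; apply: Rmult_le_compat_r => //; nra.
have diff : forall N, (dps chi 1 s N - dps lc 1 s N * dps chi 0 s N)%C =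
   \big[Cplus/RtoC 0]_(1 <= m < N.+1) \big[Cplus/RtoC 0]_(1 <= n < N.+1 | (N < m * n)%N) (A m * B n)%C.
  move=> N; rewrite !dps_big.
  have -> : (\big[Cplus/RtoC 0]_(1 <= n < N.+1) (lc n * fj 1 n s))%C = (- \big[Cplus/RtoC 0]_(1 <= n < N.+1) A n)%C.
    rewrite -csumN; apply: eq_bigr => n _.
    by rewrite fj1 /A /vM /lc !RtoC_mult RtoC_opp; ring.
  have -> : (\big[Cplus/RtoC 0]_(1 <= n < N.+1) (chi n * fj 1 n s))%C =
     (- \big[Cplus/RtoC 0]_(1 <= m < N.+1) \big[Cplus/RtoC 0]_(1 <= n < N.+1 | (m * n <= N)%N) (A m * B n))%C.
    have -> : \big[Cplus/RtoC 0]_(1 <= m < N.+1) \big[Cplus/RtoC 0]_(1 <= n < N.+1 | (m * n <= N)%N) (A m * B n)%C =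
      \big[Cplus/RtoC 0]_(1 <= q < N.+1) \big[Cplus/RtoC 0]_(1 <= m < N.+1) \big[Cplus/RtoC 0]_(1 <= n < N.+1 | (m * n == q)%N) (A m * B n)%C.
      rewrite exchange_big /=; apply: eq_big_nat => m hm.
      rewrite (exchange_big_dep_nat xpredT) //= big_mkcond /=; apply: eq_big_nat => n hn.
      rewrite (eq_bigl (fun q => q == (m * n)%N)); last by move=> q; rewrite eq_sym.
      by rewrite big_nat1_eq muln_gt0 ltnS; have -> : (0 < m)%N && (0 < n)%N by lia.
    rewrite -csumN; apply: eq_big_nat => q hq.
    have -> : \big[Cplus/RtoC 0]_(1 <= m < N.+1) \big[Cplus/RtoC 0]_(1 <= n < N.+1 | (m * n == q)%N) (A m * B n)%C =
      \big[Cplus/RtoC 0]_(1 <= m < N.+1 | (m %| q)%N) (RtoC (vM m) * (chi q * fj 0 q s))%C.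
      rewrite [RHS]big_mkcond; apply: eq_big_nat => m hm.
      case: ifP => hd.
        rewrite (eq_bigl (fun n => n == (q %/ m)%N)); last first.
          by move=> n; apply/eqP/eqP => [<-|->]; [rewrite mulKn //; lia | rewrite mulnC divnK].
        have qm : (1 <= q %/ m < N.+1)%N.
          by rewrite divn_gt0; [have := dvdn_leq (ltac:(lia) : (0 < q)%N) hd; have := leq_div q m; lia | lia].
        rewrite big_nat1_eq qm /A /B.
        have {3 4}-> : q = (m * (q %/ m))%N by rewrite mulnC divnK.
        by rewrite fj0_mul ?chiM ?RtoC_mult; try lia; ring.
      rewrite big1 // => n /eqP hmn; case/negP: hd; apply/dvdnP; exists n; lia.
    rewrite -big_distrl /= fj1.
    have RC : forall r P (F : nat -> R), \big[Cplus/RtoC 0]_(i <- r | P i) RtoC (F i) = RtoC (\rsum_(i <- r | P i) F i).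
      by move=> r P F; elim/big_rec2: _ => // i x y _ ->; rewrite RtoC_plus.
    by rewrite RC sum_vM; [rewrite RtoC_opp; ring | lia].
  have -> : forall x y z, (- x - - y * z = y * z - x)%C by move=> x y z; ring.
  rewrite big_distrl /=.
  have -> : \big[Cplus/RtoC 0]_(1 <= m < N.+1) (A m * \big[Cplus/RtoC 0]_(1 <= n < N.+1) (chi n * fj 0 n s))%C =
    (\big[Cplus/RtoC 0]_(1 <= m < N.+1) (\big[Cplus/RtoC 0]_(1 <= n < N.+1 | (m * n <= N)%N) (A m * B n)) +
     \big[Cplus/RtoC 0]_(1 <= m < N.+1) \big[Cplus/RtoC 0]_(1 <= n < N.+1 | (N < m * n)%N) (A m * B n))%C.
    rewrite -big_split /=; apply: eq_big_nat => m hm.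
    rewrite big_distrr /= (bigID (fun n => (m * n <= N)%N)) /=; congr (_ + _)%C.
    by apply: eq_bigl => n; rewrite ltnNge.
  ring.
have small : limC (fun N => dps chi 1 s N - dps lc 1 s N * dps chi 0 s N)%C 0.
  move=> e e0.
  have es := ex_series_pw k0.
  have ls : is_lim_seq (sum_n p) (Series p) := Series_correct _ es.
  set S := 1 + / k. have S1 : 1 <= S by rewrite /S; lra.
  set e2 := e / (4 * K * K * S).
  have den : 0 < 4 * K * K * S by repeat apply: Rmult_lt_0_compat; lra.
  have e20 : 0 < e2 by apply: Rdiv_lt_0_compat.
  have [M HM] := proj2 (is_lim_seq_spec _ _) ls (mkposreal _ e20).
  exists (M * M)%N => N hN.
  have -> : forall x, (x - 0 = x)%C by move=> x; ring.
  have pn0 : p 0%N = 0 by [].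
  have SN : \rsum_(1 <= n < N.+1) p n <= S by rewrite -sum_n_big //; exact: pw_sum_le.
  have SN0 : 0 <= \rsum_(1 <= n < N.+1) p n by apply: rsum_ge0.
  have tail : \rsum_(1 <= n < N.+1 | (M < n)%N) p n <= e2.
    case: (leqP N M) => hNM.
      rewrite big_nat_cond big1; first lra.
      by move=> n; lia.
    have : sum_n p M + \rsum_(1 <= n < N.+1 | (M < n)%N) p n = sum_n p N.
      rewrite !sum_n_big // [RHS](bigID (fun n => (n <= M)%N)) /=; congr (_ + _).
        rewrite (big_nat_widen 1 M.+1 N.+1) //; last by lia.
      by apply: eq_bigl => n; rewrite ltnNge.
    have := HM M (le_n _) => /Rabs_def2 /= [_ h2].
    have : sum_n p N <= Series p.
      apply: (is_lim_seq_incr_compare (sum_n p)) => // n.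
      rewrite sum_Sn -[X in X <= _]Rplus_0_r; apply: Rplus_le_compat_l; exact: p0.
    lra.
  rewrite diff; apply: Rle_lt_trans (csum_abs _ _ _) _.
  apply: (Rle_lt_trans _ (\rsum_(1 <= m < N.+1) \rsum_(1 <= n < N.+1) (K * K * ((if (M < m)%N then p m else 0) * p n + p m * (if (M < n)%N then p n else 0))))).
    apply: rsum_le => m; rewrite mem_index_iota => hm _.
    apply: Rle_trans (csum_abs _ _ _) _.
    rewrite big_mkcond /=; apply: rsum_le => n; rewrite mem_index_iota => hn _.
    have pm := p0 m; have pn := p0 n.
    have KK : 0 <= K * K by nra.
    case: ifP => hmn; last first.
      apply: Rmult_le_pos => //; case: ifP => _; case: ifP => _; nra.
    rewrite Cmod_mult.
    have h1 : Cmod (A m) * Cmod (B n) <= (K * p m) * (K * p n).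
      apply: Rmult_le_compat; [exact: Cmod_ge_0 | exact: Cmod_ge_0 | apply: Ab; lia | apply: Bb; lia].
    apply: Rle_trans h1 _.
    have -> : K * p m * (K * p n) = K * K * (p m * p n) by ring.
    apply: Rmult_le_compat_l => //.
    have : (M < m)%N || (M < n)%N.
      case: (leqP m M) => //= h1; case: (leqP n M) => // h2.
      have : (m * n <= M * M)%N by apply: leq_mul.
      by lia.
    by case/orP => ->; case: ifP => _; nra.
  have -> : \rsum_(1 <= m < N.+1) \rsum_(1 <= n < N.+1) (K * K * ((if (M < m)%N then p m else 0) * p n + p m * (if (M < n)%N then p n else 0))) =
    2 * (K * K) * ((\rsum_(1 <= n < N.+1 | (M < n)%N) p n) * (\rsum_(1 <= n < N.+1) p n)).
    rewrite (eq_bigr (fun m => K * K * ((if (M < m)%N then p m else 0) * (\rsum_(1 <= n < N.+1) p n) + p m * \rsum_(1 <= n < N.+1 | (M < n)%N) p n))); last first.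
      move=> m _; rewrite -big_distrr /= big_split /= -!big_distrr /= [in X in _ + p m * X]big_mkcond.
      by congr (_ * (_ + _ * _)); rewrite [RHS]big_mkcond.
    have mk : \rsum_(1 <= i < N.+1) (if (M < i)%N then p i else 0) = \rsum_(1 <= i < N.+1 | (M < i)%N) p i by rewrite [RHS]big_mkcond.
    rewrite -big_distrr /= big_split /= -!big_distrl /= mk; ring.
  set T := \rsum_(1 <= n < N.+1 | (M < n)%N) p n in tail *.
  set U := \rsum_(1 <= n < N.+1) p n in SN SN0 *.
  have h : T * U <= e2 * S by apply: (Rle_trans _ (e2 * U)); [apply: Rmult_le_compat_r | apply: Rmult_le_compat_l; lra].
  have kk : 0 <= 2 * (K * K) by nra.
  apply: Rle_lt_trans (Rmult_le_compat_l _ _ _ kk h) _.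
  have -> : 2 * (K * K) * (e2 * S) = e / 2 by rewrite /e2; field; lra.
  lra.
have := limC_plus small lp; rewrite Cplus_0_l; apply: limC_ext => n; ring.
Qed.

(** The terms n >= 2 decay like 2^(-Re s): far to the right the series is its first coefficient. *)
Lemma DS_tail a s N : (forall n, Rabs (a n) <= 1) -> 2 <= Re s ->
  Cmod (dps a 0 s N - (if N is 0 then 0 else a 1%N))%C <= 2 * exp (- (Re s - 2) * ln 2).
Proof.
move=> ha hs.
have e0 := exp_pos (- (Re s - 2) * ln 2).
case: N => [|N]; first by rewrite dps_0 (_ : (0 - 0 = 0)%C) ?Cmod_0; [lra | ring].
rewrite dps_big big_ltn //=.
have -> : (a 1%N * fj 0 1 s + \big[Cplus/RtoC 0]_(2 <= i < N.+2) (a i * fj 0 i s) - a 1%N = \big[Cplus/RtoC 0]_(2 <= i < N.+2) (a i * fj 0 i s))%C.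
  have -> : fj 0 1 s = 1 by rewrite /fj pow_O /= ln_1 Cmult_0_r cexp_0 Cmult_1_l.
  ring.
apply: Rle_trans (csum_abs _ _ _) _.
apply: (Rle_trans _ (\rsum_(2 <= i < N.+2) (exp (- (Re s - 2) * ln 2) * pw (1 + 1) i))).
  apply: rsum_le => n; rewrite mem_index_iota => hn _.
  rewrite Cmod_mult Cmod_R Cmod_fj0_pw; last by lia.
  have l2 : ln 2 <= lnN n by have := @ln_INR_le 2 n isT (ltac:(lia)).
  have h : pw (Re s) n <= exp (- (Re s - 2) * ln 2) * pw (1 + 1) n.
    have -> : pw (1 + 1) n = exp (- (1 + 1) * lnN n) by case: (n) hn.
    have -> : pw (Re s) n = exp (- Re s * lnN n) by case: (n) hn.
    by rewrite -exp_plus; apply: exp_le; nra.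
  have := ha n; have := Rabs_pos (a n); have := pw_ge0 (Re s) n; nra.
rewrite -big_distrr /= Rmult_comm; apply: Rmult_le_compat_r; first lra.
have := @pw_sum_le 1 N.+1 Rlt_0_1; rewrite sum_n_big // (big_ltn (m := 1)) //.
have := pw_ge0 (1 + 1) 1; have -> : 1 + / 1 = 2 by field.
by move=> h1 h2; apply: Rle_trans h2; rewrite -[X in X <= _]Rplus_0_l; apply: Rplus_le_compat_r.
Qed.

Lemma DS_far a s : (forall n, Rabs (a n) <= 1) -> 2 <= Re s -> Cmod (DS a 0 s - a 1%N)%C <= 2 * exp (- (Re s - 2) * ln 2).
Proof.
move=> ha hs.
have l := DS_lim Rle01 (sum_growth_1 ha) Rle01 0 (ltac:(lra) : 1 < Re s).
apply: (limC_bound (u := fun N => (dps a 0 s N + - a 1%N)%C)).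
  by apply: limC_plus => //; exact: limC_const.
exists 1%N => -[//|N] _; exact: (@DS_tail a s N.+1 ha hs).
Qed.

(** L times the exponential of minus the logarithmic series has derivative 0 by [Euler_mul], and
    tends to 1 as Re s goes to infinity. *)
Lemma DS_exp s : 1 < Re s -> DS chi 0 s = cexp (DS lc 0 s).
Proof.
move=> hs.
have g1 := sum_growth_1 chib. have g2 := sum_growth_1 lc_b.
pose F z := (DS chi 0 z * cexp (- DS lc 0 z))%C.
have dF : forall z, 1 < Re z -> cderiv F z 0.
  move=> z hz; have h1 := DS_cd Rle01 g1 Rle01 0 hz. have h2 := DS_cd Rle01 g2 Rle01 0 hz.
  have h3 : cderiv (fun z => cexp (- DS lc 0 z)%C) z (cexp (- DS lc 0 z) * - DS lc 1 z)%C.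
    by apply: (cderiv_subst (f' := cexp) (g := fun z => (- DS lc 0 z)%C)); [exact: cd_cexp | exact: cd_opp].
  apply: cd_eq (cd_mult h1 h3) _; rewrite Euler_mul //; ring.
have cst : forall (x : R), 0 <= x -> F (s + RtoC x)%C = F s.
  move=> x x0.
  have := @mvt_cd F (fun _ => RtoC 0) s (RtoC x) 0 _ _; rewrite Rmult_0_l => h.
  have {}h : Cmod (F (s + RtoC x) - F s)%C <= 0.
    apply: h => t ht; last by rewrite Cmod_0; lra.
    by apply: dF; rewrite !CRI; nra.
  have /Cmod_eq_0 e : Cmod (F (s + RtoC x) - F s)%C = 0 by have := Cmod_ge_0 (F (s + RtoC x) - F s)%C; lra.
  have -> : F (s + RtoC x)%C = ((F (s + RtoC x) - F s) + F s)%C by ring.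
  by rewrite e Cplus_0_l.
have F1 : F s = 1.
  suff : Cmod (F s - 1)%C <= 0.
    move=> h; have /Cmod_eq_0 e : Cmod (F s - 1)%C = 0 by have := Cmod_ge_0 (F s - 1)%C; lra.
    have -> : F s = ((F s - 1) + 1)%C by ring.
    by rewrite e Cplus_0_l.
  apply: le_epsilon => eps e0; rewrite Rplus_0_l.
  set d := Rmin (/ 4) (eps / 16). have d0 : 0 < d by apply: Rmin_pos; lra.
  have d1 : d <= / 4 := Rmin_l _ _. have d2 : d <= eps / 16 := Rmin_r _ _.
  have l2 := ln_lt_2.
  (* So far to the right that both series are within d of their first coefficients, 1 and 0. *)
  set x := 2 + (- ln (d / 2)) / ln 2.
  have ld : ln (d / 2) < 0 by rewrite -ln_1; apply: ln_increasing; lra.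
  have dv : 0 <= - ln (d / 2) / ln 2 by apply: Rdiv_le_0_compat; lra.
  have x0 : 0 <= x by rewrite /x; lra.
  set z := (s + RtoC x)%C.
  have rz : Re z = Re s + x by rewrite /z !CRI.
  have ex : 2 * exp (- (Re z - 2) * ln 2) <= d.
    have h : exp (- (Re z - 2) * ln 2) <= exp (ln (d / 2)).
      apply: exp_le; rewrite rz /x.
      have -> : - (Re s + (2 + - ln (d / 2) / ln 2) - 2) * ln 2 = - Re s * ln 2 + ln (d / 2) by field; lra.
      nra.
    rewrite exp_ln in h; lra.
  have hz : 2 <= Re z by rewrite rz /x; lra.
  have b1 := DS_far chib hz; rewrite chi1 in b1.
  have b2 := DS_far lc_b hz.
  have lc1 : lc 1 = 0 by rewrite /lc /cc /ppow /=; ring.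
  rewrite lc1 (_ : forall y, (y - RtoC 0 = y)%C) in b2; last by move=> y; ring.
  rewrite -(cst x x0) -/z /F.
  have b3 : Cmod (cexp (- DS lc 0 z) - 1)%C <= 2 * d.
    by apply: Rle_trans (cexp_m1 _) _; rewrite Cmod_opp; lra.
  have -> : (DS chi 0 z * cexp (- DS lc 0 z) - 1 = (DS chi 0 z - 1) * (cexp (- DS lc 0 z) - 1) + (DS chi 0 z - 1) + (cexp (- DS lc 0 z) - 1))%C by ring.
  apply: Rle_trans (Cmod_triangle _ _) _; apply: Rle_trans (Rplus_le_compat_r _ _ _ (Cmod_triangle _ _)) _.
  rewrite Cmod_mult; have := Cmod_ge_0 (DS chi 0 z - 1)%C; have := Cmod_ge_0 (cexp (- DS lc 0 z) - 1)%C; nra.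
have n0 := @cexp_neq0 (DS lc 0 s).
have : (F s * cexp (DS lc 0 s) = cexp (DS lc 0 s))%C by rewrite F1 Cmult_1_l.
rewrite /F -Cmult_assoc -cexp_plus (_ : (- DS lc 0 s + DS lc 0 s = 0)%C) ?cexp_0 ?Cmult_1_r //; ring.
Qed.

Lemma DS_neq0 s : 1 < Re s -> DS chi 0 s <> 0.
Proof. by move=> /DS_exp ->; exact: cexp_neq0. Qed.

Lemma DS_log s : 1 < Re s -> (DS chi 1 s / DS chi 0 s)%C = DS lc 1 s.
Proof. by move=> hs; rewrite Euler_mul //; field; exact: DS_neq0. Qed.

End Euler.

(** * Zeta to the right of the line Re s = 1 *)

Definition one (n : nat) : R := 1.
Lemma one_M m n : (0 < m)%N -> (0 < n)%N -> one (m * n)%N = one m * one n. Proof. by rewrite /one; lra. Qed.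
Lemma one_b n : Rabs (one n) <= 1. Proof. by rewrite /one Rabs_R1; lra. Qed.

(** The quotient is the integral of x^(-s) over [n, n+1]; n^(-s) differs from it by the variation of
    x^(-s), which is O(|s|/n^2). *)
Lemma zeta_term n s : (0 < n)%N -> 1 < Re s ->
  Cmod (fj 0 n s - (cexp ((1 - s) * lnN n) - cexp ((1 - s) * lnN n.+1)) / (s - 1))%C <= 2 * Cmod s * pw (1 + 1) n.
Proof.
move=> hn hs; have [l0 [l1 l2]] := ln_succ hn.
have n0 := INR_gt0 hn. have n1 := INR_ge1 hn.
have s1 : (s - 1)%C <> 0.
  by move=> e; have := Re_minus s 1; rewrite e /=; lra.
set u := lnN n in l0 l1 l2 *; set v := lnN n.+1 in l1 l2 *.
pose G (w : C) := (fj 0 n s * cexp w + / (s - 1) * cexp ((1 - s) * w))%C.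
pose G' (w : C) := (fj 0 n s * cexp w - cexp ((1 - s) * w))%C.
have eu : cexp u = RtoC (INR n) by rewrite cexp_R /u exp_ln.
have ev : cexp v = RtoC (INR n + 1) by rewrite cexp_R /v exp_ln; [rewrite S_INR | exact: INR_gt0].
have fE : fj 0 n s = cexp (- s * u) by rewrite /fj pow_O Cmult_1_l.
have -> : (fj 0 n s - (cexp ((1 - s) * u) - cexp ((1 - s) * v)) / (s - 1) = G (RtoC u + RtoC (v - u)) - G u)%C.
  rewrite (_ : (RtoC u + RtoC (v - u))%C = RtoC v); last by rewrite RtoC_minus; ring.
  by rewrite /G eu ev RtoC_plus; field.
have dG : forall w, cderiv G w (G' w).
  move=> w; have h1 : cderiv (fun w => cexp ((1 - s) * w)%C) w (cexp ((1 - s) * w) * (1 - s))%C.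
    apply: (cderiv_subst (f' := cexp) (g := fun w => ((1 - s) * w)%C)); first exact: cd_cexp.
    by apply: cd_eq (cd_scal _ (cd_id w)) _; ring.
  apply: cd_eq (cd_plus (cd_scal _ (cd_cexp w)) (cd_scal _ h1)) _.
  by rewrite /G'; field.
have m0 := Cmod_ge_0 s.
have i1 : / INR n <= 1 by rewrite -Rinv_1; apply: Rinv_le_contravar; lra.
have i0 : 0 < / INR n by apply: Rinv_0_lt_compat.
set K := Cmod s * exp (- Re s * u).
have K0 : 0 <= K by apply: Rmult_le_pos => //; apply/exp_ge0.
have inner : forall x, u <= x <= v -> Cmod (cexp (- s * u) - cexp (- s * x))%C <= K * / INR n.
  move=> x hx; rewrite Cmod_minus_sym.
  have -> : RtoC x = (RtoC u + RtoC (x - u))%C by rewrite RtoC_minus; ring.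
  apply: Rle_trans (mvt_cd (f := fun w => cexp (- s * w)%C) (f' := fun w => (cexp (- s * w) * - s)%C) (B := K) _ _) _.
  - move=> t _; apply: (cderiv_subst (f' := cexp) (g := fun w => (- s * w)%C)); first exact: cd_cexp.
    by apply: cd_eq (cd_scal _ (cd_id _)) _; ring.
  - move=> t ht; rewrite Cmod_mult Cmod_opp Cmod_cexp Rmult_comm; apply: Rmult_le_compat_l => //.
    have y0 : 0 <= t * (x - u) by nra.
    apply: exp_le; rewrite !CRI; nra.
  - rewrite Cmod_R Rabs_pos_eq; last lra.
    by apply: Rmult_le_compat_l => //; lra.
apply: Rle_trans (mvt_cd (f' := G') (B := 2 * INR n * (K * / INR n)) _ _) _.
- by move=> t _.
- move=> t ht.
  have -> : (u + t * RtoC (v - u))%C = RtoC (u + t * (v - u)) by rewrite RtoC_plus RtoC_mult.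
  set x := u + t * (v - u). have hx : u <= x <= v by rewrite /x; nra.
  have -> : G' x = (cexp x * (cexp (- s * u) - cexp (- s * x)))%C.
    by rewrite /G' fE (_ : ((1 - s) * x = x + - s * x)%C) ?cexp_plus; ring.
  rewrite Cmod_mult; apply: Rmult_le_compat; [exact: Cmod_ge_0 | exact: Cmod_ge_0 | | exact: inner].
  rewrite Cmod_cexp Re_RtoC.
  have : exp x <= exp v by apply: exp_le; lra.
  by rewrite /v exp_ln ?S_INR; [lra | rewrite -S_INR; exact: INR_gt0].
- rewrite Cmod_R Rabs_pos_eq; last lra.
  have e1 : 2 * INR n * (K * / INR n) = 2 * K by field; lra.
  rewrite e1.
  have pE : K * / INR n <= Cmod s * pw (1 + 1) n.
    have -> : pw (1 + 1) n = exp (- (1 + 1) * u) by rewrite /u; case: (n) hn.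
    have -> : / INR n = exp (- u) by rewrite exp_Ropp /u exp_ln.
    rewrite /K Rmult_assoc -exp_plus; apply: Rmult_le_compat_l => //; apply: exp_le; nra.
  apply: (Rle_trans _ (2 * K * / INR n)); last lra.
  by apply: Rmult_le_compat_l; lra.
Qed.

(** The integrals telescope to a multiple of the pole 1/(s - 1), and the errors of [zeta_term]
    converge absolutely. *)
Lemma zeta_bound s : 1 < Re s -> Cmod (DS one 0 s) <= 4 * Cmod s + 2 / Cmod (s - 1)%C.
Proof.
move=> hs.
have s1 : (s - 1)%C <> 0.
  by move=> e; have := Re_minus s 1; rewrite e /=; lra.
have p1 := proj1 (Cmod_gt_0 _) s1.
have l := DS_lim Rle01 (sum_growth_1 one_b) Rle01 0 hs.
apply: (limC_bound l); exists 0%N => N _.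
pose E n := cexp ((1 - s) * lnN n)%C.
have T : (dps one 0 s N = \big[Cplus/RtoC 0]_(1 <= n < N.+1) (fj 0 n s - (E n - E n.+1) / (s - 1)) + (E 1%N - E N.+1) / (s - 1))%C.
  elim: N => [|N IH]; first by rewrite dps_0 big_geq //=; rewrite /Cdiv; ring.
  rewrite dps_S IH [X in _ = (X + _)%C]big_nat_recr //= /one /Cdiv; ring.
rewrite T; apply: Rle_trans (Cmod_triangle _ _) _; apply: Rplus_le_compat.
  apply: Rle_trans (csum_abs _ _ _) _.
  apply: (Rle_trans _ (\rsum_(1 <= n < N.+1) (2 * Cmod s * pw (1 + 1) n))).
    by apply: rsum_le => n; rewrite mem_index_iota => hn _; apply: zeta_term => //; lia.
  rewrite -big_distrr /= -sum_n_big //.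
  have := @pw_sum_le 1 N Rlt_0_1; have := Cmod_ge_0 s; have -> : 1 + / 1 = 2 by field.
  nra.
rewrite Cmod_div //; apply: Rmult_le_compat_r; first by apply/Rinv_ge0.
have Eb : forall n, (0 < n)%N -> Cmod (E n) <= 1.
  move=> n hn; rewrite /E Cmod_cexp; apply: exp_le1; rewrite !CRI; have [] := ln_succ hn; nra.
apply: Rle_trans (Cmod_minus_le _ _) _; have := Eb 1%N isT; have := Eb N.+1 isT; lra.
Qed.

Lemma zeta_real_bound x : 0 < x -> Cmod (DS one 0 (1 + x, 0)) <= 1 + / x.
Proof.
move=> x0.
have l := DS_lim Rle01 (sum_growth_1 one_b) Rle01 0 (ltac:(rewrite /=; lra) : 1 < Re (1 + x, 0)).
apply: (limC_bound l); exists 0%N => N _.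
rewrite dps_big; apply: Rle_trans (csum_abs _ _ _) _.
apply: Rle_trans (@pw_sum_le x N x0); rewrite sum_n_big //.
apply: rsum_le => n; rewrite mem_index_iota => hn _.
by rewrite Cmod_mult Cmod_R /one Rabs_R1 Cmod_fj0_pw ?Rmult_1_l; [exact: Rle_refl | lia].
Qed.

Lemma Re_fj0 n x t : Re (fj 0 n (x, t)) = exp (- x * lnN n) * cos (t * lnN n).
Proof.
rewrite /fj pow_O Cmult_1_l /cexp /=.
have -> : - x * lnN n - - t * 0 = - x * lnN n by ring.
have -> : - x * 0 + - t * lnN n = - (t * lnN n) by ring.
by rewrite cos_neg.
Qed.

Lemma limC_Re u l : limC u l -> forall e, 0 < e -> exists N0, forall N, (N0 <= N)%N -> Rabs (Re (u N) - Re l) < e.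
Proof.
move=> h e /h [N0 H]; exists N0 => N /H hn; rewrite -Re_minus; exact: Rle_lt_trans (re_le_Cmod _) hn.
Qed.

(* A function with period [q] on the positive integers grows linearly along the mean over a period. *)
Lemma Sp_periodic f q : (0 < q)%N -> (forall n, (0 < n)%N -> f (n + q)%N = f n) -> (forall n, Rabs (f n) <= 1) ->
  forall n, Rabs (Sp (fun n => f n - Sp f q / INR q) n) <= 2 * INR q.
Proof.
move=> q0 per fb; set mu := Sp f q / INR q.
have qp := INR_gt0 q0.
have lin : forall n, Sp (fun n => f n - mu) n = Sp f n - INR n * mu.
  elim=> [|n IH]; first by rewrite /=; ring.
  by rewrite [LHS]/= IH S_INR [Sp f _.+1]/=; ring.
have sh : forall n, Sp f (n + q) = Sp f n + Sp f q.
  elim=> [|n IH]; first by rewrite add0n /=; ring.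
  by rewrite addSn [LHS]/= IH -addSn per //=; ring.
have bd : forall n, Rabs (Sp f n) <= INR n.
  elim=> [|n IH]; first by rewrite /= Rabs_R0; lra.
  rewrite S_INR [Sp _ _]/=; apply: Rle_trans (Rabs_triang _ _) _; have := fb n.+1; lra.
have mub : Rabs mu <= 1.
  rewrite /mu Rabs_div; last lra.
  rewrite (Rabs_pos_eq (INR q)); last lra.
  have := bd q => h; apply: (Rmult_le_reg_r (INR q)) => //.
  rewrite /Rdiv Rmult_assoc Rinv_l; lra.
move=> n; rewrite lin.
elim/ltn_ind: n => n IH.
case: (ltnP n q) => hn.
  have nq : INR n <= INR q by apply: le_INR; lia.
  have n0 := pos_INR n.
  have h := bd n.
  apply: Rle_trans (Rabs_triang _ _) _; rewrite Rabs_Ropp Rabs_mult (Rabs_pos_eq (INR n)) //.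
  have : INR n * Rabs mu <= INR n * 1 by apply: Rmult_le_compat_l.
  lra.
have e : n = ((n - q) + q)%N by lia.
have := IH (n - q)%N (ltac:(lia)).
rewrite [in X in _ -> X]e sh plus_INR.
have -> : Sp f (n - q) + Sp f q - (INR (n - q) + INR q) * mu = Sp f (n - q) - INR (n - q) * mu; last by [].
have : INR q * mu = Sp f q by rewrite /mu; field; lra.
lra.
Qed.

(** * Non-vanishing on the line Re s = 1 away from s = 1 *)

Section Line1.
Variable chi : nat -> R.
Variable q : nat.
Hypothesis q0 : (0 < q)%N.
Hypothesis chi1 : chi 1%N = 1.
Hypothesis chiM : forall m n, (0 < m)%N -> (0 < n)%N -> chi (m * n)%N = chi m * chi n.
Hypothesis chiV : forall n, chi n = 0 \/ chi n = 1 \/ chi n = -1.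
Hypothesis chiP : forall n, (0 < n)%N -> chi (n + q)%N = chi n.
Hypothesis chiS : Sp chi q = 0.

Lemma chi_b n : Rabs (chi n) <= 1.
Proof. case: (chiV n) => [->|[->|->]]; rewrite ?Rabs_R0 ?Rabs_R1 ?Rabs_m1; lra. Qed.

Lemma chi_growth : sum_growth chi (2 * INR q) 0.
Proof.
move=> n hn; rewrite Rmult_0_l exp_0 Rmult_1_r.
have := Sp_periodic q0 chiP chi_b n.
rewrite chiS /Rdiv Rmult_0_l.
have -> : Sp (fun n => chi n - 0) n = Sp chi n by elim: (n) => //= m ->; ring.
by [].
Qed.

Let chi2 n := chi n * chi n.

Lemma chi2_b n : Rabs (chi2 n) <= 1.
Proof. rewrite /chi2 Rabs_mult; have := chi_b n; have := Rabs_pos (chi n); nra. Qed.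
Lemma chi2_1 : chi2 1 = 1. Proof. by rewrite /chi2 chi1; ring. Qed.
Lemma chi2_M m n : (0 < m)%N -> (0 < n)%N -> chi2 (m * n)%N = chi2 m * chi2 n.
Proof. by move=> h1 h2; rewrite /chi2 chiM //; ring. Qed.

(** On each coefficient 3 + 4 chi cos y + chi^2 cos(2y) >= 0 for chi in {0, 1, -1}: for chi = 1 or
    -1 it is 2(1 + chi cos y)^2. The claim is the exponential of the inequality obtained by
    summing. *)
Lemma three_four_one x t : 0 < x ->
  1 <= (1 + / x) ^ 3 * Cmod (DS chi 0 (1 + x, t)) ^ 4 * Cmod (DS chi2 0 (1 + x, 2 * t)).
Proof.
move=> x0; have hx : 1 < 1 + x by lra.
have ix : 0 < / x by apply: Rinv_0_lt_compat.
have E1 := DS_exp (chi := one) erefl one_M one_b (s := (1 + x, 0)) hx.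
have E2 := DS_exp chi1 chiM chi_b (s := (1 + x, t)) hx.
have E3 := DS_exp chi2_1 chi2_M chi2_b (s := (1 + x, 2 * t)) hx.
have key : 0 <= 3 * Re (DS (lc one) 0 (1 + x, 0)) + 4 * Re (DS (lc chi) 0 (1 + x, t)) + Re (DS (lc chi2) 0 (1 + x, 2 * t)).
  have l1 := limC_Re (DS_lim Rle01 (sum_growth_1 (lc_b one_b)) Rle01 0 (hx : 1 < Re (1 + x, 0))).
  have l2 := limC_Re (DS_lim Rle01 (sum_growth_1 (lc_b chi_b)) Rle01 0 (hx : 1 < Re (1 + x, t))).
  have l3 := limC_Re (DS_lim Rle01 (sum_growth_1 (lc_b chi2_b)) Rle01 0 (hx : 1 < Re (1 + x, 2 * t))).
  apply: Rnot_lt_le => lt.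
  set S := _ + _ + _ in lt.
  have [N1 h1] := l1 (- S / 16) (ltac:(lra)). have [N2 h2] := l2 (- S / 16) (ltac:(lra)). have [N3 h3] := l3 (- S / 16) (ltac:(lra)).
  set N := (N1 + N2 + N3)%N.
  have := h1 N (ltac:(lia)); have := h2 N (ltac:(lia)); have := h3 N (ltac:(lia)).
  have pos : forall M, 0 <= 3 * Re (dps (lc one) 0 (1 + x, 0) M) + 4 * Re (dps (lc chi) 0 (1 + x, t) M) + Re (dps (lc chi2) 0 (1 + x, 2 * t) M).
    elim=> [|M IH]; first by rewrite !dps_0 /=; lra.
    have tm : forall (a : R) m y u, Re (RtoC a * fj 0 m (y, u))%C = a * (exp (- y * lnN m) * cos (u * lnN m)).
      by move=> a m y u; rewrite Re_mult Re_fj0 Re_RtoC Im_RtoC; ring.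
    rewrite !dps_S.
    move: (dps (lc one) 0 _ M) (dps (lc chi) 0 _ M) (dps (lc chi2) 0 _ M) IH => u v w IH.
    rewrite (Re_plus u) (Re_plus v) (Re_plus w) !tm !Rmult_0_l cos_0.
    set n := M.+1; set e := exp _; have e0 : 0 < e := exp_pos _.
    have -> : 2 * t * lnN n = 2 * (t * lnN n) by ring.
    rewrite cos_2a_cos; set cs := cos _.
    have [c0 c1] := cc_01 n.
    have ec : 0 <= cc n * e by nra.
    rewrite /lc /one /chi2.
    have cb := COS_bound (t * lnN n); rewrite -/cs in cb.
    have : 0 <= (cc n * e) * (3 + 4 * chi n * cs + chi n * chi n * (2 * cs * cs - 1)).
      apply: Rmult_le_pos => //; case: (chiV n) => [->|[->|->]]; nra.
    lra.
  have := pos N; move=> p /Rabs_def2 [a1 a2] /Rabs_def2 [a3 a4] /Rabs_def2 [a5 a6].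
  rewrite /S in lt a1 a2 a3 a4 a5 a6; lra.
have := @zeta_real_bound x x0; rewrite E1 E2 E3 !Cmod_cexp.
set A := Re _ in key *; set B := Re _ in key *; set D := Re _ in key *.
move=> hz.
have eA := exp_pos A. have eB := exp_pos B. have eD := exp_pos D.
have : 1 <= exp (3 * A + 4 * B + D) by rewrite -exp_0; exact: exp_le.
have -> : exp (3 * A + 4 * B + D) = exp A ^ 3 * exp B ^ 4 * exp D.
  have -> : 3 * A + 4 * B + D = A + A + A + (B + B + B + B) + D by ring.
  by rewrite !exp_plus; ring.
move=> h; apply: Rle_trans h _; apply: Rmult_le_compat_r; first lra.
apply: Rmult_le_compat_r; first by apply: pow_le; lra.
by apply: pow_incr; lra.
Qed.

(** A zero at 1 + it gives |L(1+x+it)| <= Bx. The series of chi^2 stays bounded at 1 + x + 2it, its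
    only pole being at 1, and zeta contributes at most (2/x)^3. The product in [three_four_one]
    would then be O(x). *)
Lemma nonvanish_line1 t : t <> 0 -> DS chi 0 (1, t) <> 0.
Proof.
move=> t0 e0.
have q2 : 0 <= 2 * INR q by have := pos_INR q; lra.
have dL : cderiv (DS chi 0) (1, t) (DS chi 1 (1, t)).
  by apply: (DS_cd q2 chi_growth (Rle_refl 0)); rewrite /=; lra.
set d := DS chi 1 (1, t) in dL.
(* [|L(1+x+it)| <= B x] for small [x] *)
have [B [r [r0 [B0 hB]]]] : exists B r, 0 < r /\ 0 < B /\ forall x, 0 < x < r -> Cmod (DS chi 0 (1 + x, t)) <= B * x.
  have d1 : cderiv (DS chi 1) (1, t) (DS chi 2 (1, t)).
    by apply: (DS_cd q2 chi_growth (Rle_refl 0)); rewrite /=; lra.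
  have [r [r0 hr]] := cd_small d1 Rlt_0_1.
  exists (Cmod d + 1), r; split=> //; split; first by have := Cmod_ge_0 d; lra.
  move=> x hx.
  have e1 : ((1 + x, t) : C) = ((1, t) + RtoC x)%C by apply: C_eq => /=; ring.
  have e2 : DS chi 0 (1 + x, t) = (DS chi 0 ((1, t) + RtoC x) - DS chi 0 (1, t))%C by rewrite e1 e0; ring.
  rewrite e2.
  apply: Rle_trans (mvt_cd (f := DS chi 0) (f' := DS chi 1) (B := Cmod d + 1) _ _) _.
  - by move=> u hu; apply: (DS_cd q2 chi_growth (Rle_refl 0)); rewrite /=; nra.
  - move=> u hu; have hs : Cmod (u * RtoC x)%C < r.
      by rewrite -RtoC_mult Cmod_R Rabs_pos_eq; nra.
    have := hr _ hs; rewrite -/d; set w := DS chi 1 _ => h.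
    have := Cmod_triangle (w - d)%C d; rewrite (_ : (w - d + d)%C = w); [lra | ring].
  - by rewrite Cmod_R Rabs_pos_eq; lra.
(* [L(1+x+2it, chi^2)] stays bounded *)
have [K [r2 [r20 [K0 hK]]]] : exists K r, 0 < r /\ 0 < K /\ forall x, 0 < x < r -> Cmod (DS chi2 0 (1 + x, 2 * t)) <= K.
  set mu := Sp chi2 q / INR q.
  pose g n := chi2 n - mu.
  have gS : sum_growth g (2 * INR q) 0.
    move=> n hn; rewrite Rmult_0_l exp_0 Rmult_1_r.
    by apply: Sp_periodic => //; [move=> m hm; rewrite /chi2 chiP | exact: chi2_b].
  have gc : cderiv (DS g 0) (1, 2 * t) (DS g 1 (1, 2 * t)).
    by apply: (DS_cd q2 gS (Rle_refl 0)); rewrite /=; lra.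
  have [r3 [r31 hr]] := cd_small gc Rlt_0_1.
  set Z := 4 * (2 + Rabs (2 * t)) + 2 / Rabs (2 * t).
  have t2 : 0 < Rabs (2 * t) by apply: Rabs_pos_lt; lra.
  have Z0 : 0 < Z.
    have := Rdiv_lt_0_compat 2 _ Rlt_0_2 t2; rewrite /Z; lra.
  have m0 := Rabs_pos mu. have c0 := Cmod_ge_0 (DS g 0 (1, 2 * t)).
  exists (Cmod (DS g 0 (1, 2 * t)) + 1 + Rabs mu * Z), (Rmin r3 1); split; first by apply: Rmin_pos; lra.
  split; first by nra.
  move=> x hx; have xr : x < r3 by have := Rmin_l r3 1; lra. have x1 : x < 1 by have := Rmin_r r3 1; lra.
  have y1 : Re ((1 + x, 2 * t) : C) = 1 + x by [].
  pose y := ((1 + x, 2 * t) : C); rewrite -/y in y1 *.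
  have -> : DS chi2 0 y = (DS g 0 y + RtoC mu * DS one 0 y)%C.
    have l1 := DS_lim Rle01 (sum_growth_1 chi2_b) Rle01 0 (ltac:(rewrite y1; lra) : 1 < Re y).
    have l2 := DS_lim q2 gS (Rle_refl 0) 0 (ltac:(rewrite y1; lra) : 0 < Re y).
    have l3 := DS_lim Rle01 (sum_growth_1 one_b) Rle01 0 (ltac:(rewrite y1; lra) : 1 < Re y).
    apply: (limC_unique l1); apply: (limC_ext _ (limC_plus l2 (limC_scal (RtoC mu) l3))) => N.
    elim: N => [|N IH]; first by rewrite !dps_0; ring.
    by rewrite !dps_S -IH /g /one RtoC_minus; ring.
  apply: Rle_trans (Cmod_triangle _ _) _; apply: Rplus_le_compat.
    have := hr (RtoC x) (ltac:(rewrite Cmod_R Rabs_pos_eq; lra)).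
    rewrite (_ : Cplus (1, 2 * t) (RtoC x) = y); last by rewrite /y; apply: C_eq => /=; ring.
    have := Cmod_triangle (Cminus (DS g 0 y) (DS g 0 (1, 2 * t))) (DS g 0 (1, 2 * t)).
    rewrite (_ : Cplus (Cminus (DS g 0 y) (DS g 0 (1, 2 * t))) (DS g 0 (1, 2 * t)) = DS g 0 y); last by ring.
    lra.
  rewrite Cmod_mult Cmod_R; apply: Rmult_le_compat_l => //.
  apply: Rle_trans (zeta_bound _) _; first by rewrite y1; lra.
  apply: Rplus_le_compat.
    apply: Rmult_le_compat_l; first lra.
    by apply: Rle_trans (Cmod_le_ReIm _) _ => /=; rewrite (Rabs_pos_eq (1 + x)); lra.
  apply: Rmult_le_compat_l; first lra.
  apply: Rinv_le_contravar => //.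
  by have := im_le_Cmod (y - 1)%C; rewrite Im_minus /= Rminus_0_r.
set x := Rmin (Rmin (r / 2) (r2 / 2)) (Rmin (/ 2) (/ (16 * B ^ 4 * K))).
have den : 0 < 16 * B ^ 4 * K by repeat apply: Rmult_lt_0_compat; try lra; apply: pow_lt.
have x0 : 0 < x by repeat apply: Rmin_pos; try lra; apply: Rinv_0_lt_compat.
have x1 : x <= r / 2 := Rle_trans _ _ _ (Rmin_l _ _) (Rmin_l _ _).
have x2 : x <= r2 / 2 := Rle_trans _ _ _ (Rmin_l _ _) (Rmin_r _ _).
have x3 : x <= / 2 := Rle_trans _ _ _ (Rmin_r _ _) (Rmin_l _ _).
have x4 : x <= / (16 * B ^ 4 * K) := Rle_trans _ _ _ (Rmin_r _ _) (Rmin_r _ _).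
have T := three_four_one t x0.
have hb := hB x (ltac:(lra)). have hk := hK x (ltac:(lra)).
have : (1 + / x) ^ 3 * Cmod (DS chi 0 (1 + x, t)) ^ 4 * Cmod (DS chi2 0 (1 + x, 2 * t)) <= (2 / x) ^ 3 * (B * x) ^ 4 * K.
  have ix : 0 < / x by apply: Rinv_0_lt_compat.
  have i1 : 1 <= / x by rewrite -Rinv_1; apply: Rinv_le_contravar; lra.
  have c0 := Cmod_ge_0 (DS chi 0 (1 + x, t)).
  apply: Rmult_le_compat; [ | exact: Cmod_ge_0 | | exact: hk].
    by apply: Rmult_le_pos; apply: pow_le; lra.
  apply: Rmult_le_compat; try (apply: pow_le; lra).
    by apply: pow_incr; rewrite /Rdiv; lra.
  by apply: pow_incr; lra.
have -> : (2 / x) ^ 3 * (B * x) ^ 4 * K = (8 * B ^ 4 * K) * x by field; lra.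
have : (8 * B ^ 4 * K) * x <= / 2.
  have -> : / 2 = (8 * B ^ 4 * K) * / (16 * B ^ 4 * K) by field; repeat split; lra.
  by apply: Rmult_le_compat_l; lra.
lra.
Qed.

End Line1.

(** * Non-vanishing at s = 1 *)

Section Monsky.
Variable chi : nat -> R.
Variable q : nat.
Hypothesis q0 : (0 < q)%N.
Hypothesis chi1 : chi 1%N = 1.
Hypothesis chiM : forall m n, (0 < m)%N -> (0 < n)%N -> chi (m * n)%N = chi m * chi n.
Hypothesis chiV : forall n, chi n = 0 \/ chi n = 1 \/ chi n = -1.
Hypothesis chiP : forall n, (0 < n)%N -> chi (n + q)%N = chi n.
Hypothesis chiS : Sp chi q = 0.

Let r k := \rsum_(d <- divisors k) chi d.

(** The divisors of p^(v+1) m are those of p^v m and p^(v+1) times those of m. *)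
Lemma divisors_step p v m : prime p -> (0 < m)%N -> coprime p m ->
  r (p ^ v.+1 * m) = r (p ^ v * m) + chi (p ^ v.+1)%N * r m.
Proof.
move=> pp m0 cpm; have p0 := prime_gt0 pp.
have pv n : (0 < p ^ n)%N by rewrite expn_gt0 p0.
have npm n : ~~ (p ^ n.+1 %| p ^ n * m)%N.
  rewrite expnS mulnC dvdn_pmul2l //; by rewrite prime_coprime in cpm.
rewrite /r (perm_big (divisors (p ^ v * m) ++ [seq (p ^ v.+1 * e)%N | e <- divisors m])); last first.
  apply: uniq_perm; first exact: divisors_uniq.
    rewrite cat_uniq divisors_uniq map_inj_uniq ?divisors_uniq ?andbT /=; last first.
      by move=> x y /eqP; rewrite eqn_pmul2l // => /eqP.
    apply/hasPn => d /mapP [e he ->]; rewrite -dvdn_divisors ?muln_gt0 ?pv //.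
    apply/negP => h; move: (npm v); rewrite (dvdn_trans _ h) //; exact: dvdn_mulr.
  move=> d; rewrite mem_cat -!dvdn_divisors ?muln_gt0 ?pv //.
  apply/idP/orP.
    move=> h; have d0 : (0 < d)%N by apply: dvdn_gt0 h; rewrite muln_gt0 pv.
    case: (boolP (p ^ v.+1 %| d)%N) => [/dvdnP [e ed]|nd].
      right; apply/mapP; exists e; last by rewrite mulnC.
      by rewrite -dvdn_divisors // -(dvdn_pmul2l (pv v.+1)) mulnC -ed.
    left; have [b cb eb] := pfactor_coprime pp d0.
    have av : (logn p d <= v)%N by rewrite pfactor_dvdn // -ltnNge in nd.
    rewrite eb mulnC; apply: dvdn_mul; first exact: dvdn_exp2l.
    have bm : (b %| p ^ v.+1 * m)%N by apply: dvdn_trans h; rewrite [in X in (_ %| X)%N]eb dvdn_mulr.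
    by rewrite Gauss_dvdr // in bm; rewrite coprime_sym coprimeXl.
  case=> [h|/mapP [e he ->]].
    apply: dvdn_trans h _; rewrite expnS -mulnA; exact: dvdn_mull.
  by rewrite dvdn_pmul2l // dvdn_divisors.
rewrite big_cat big_map /= big_distrr /=; congr (_ + _).
rewrite big_seq_cond [RHS]big_seq_cond; apply: eq_bigr => e; rewrite andbT => he.
by rewrite chiM //; rewrite -dvdn_divisors // in he; apply: dvdn_gt0 he.
Qed.

(** The prime p contributes the factor 1 + chi(p) + ... + chi(p)^v, which is at least 0, and at
    least 1 when v is even. *)
Lemma r_pow p v m : prime p -> (0 < m)%N -> coprime p m -> 0 <= r m ->
  0 <= r (p ^ v * m) /\ (~~ odd v -> r m <= r (p ^ v * m)).
Proof.
move=> pp m0 cpm rm; have p0 := prime_gt0 pp.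
have chipow n : chi (p ^ n)%N = chi p ^ n.
  by elim: n => [|n IH]; rewrite ?expn0 // expnS chiM ?expn_gt0 ?p0 // IH.
have st v' : r (p ^ v'.+1 * m) = r (p ^ v' * m) + chi p ^ v'.+1 * r m by rewrite divisors_step // chipow.
case: (chiV p) => [c|[c|c]].
- have -> : r (p ^ v * m) = r m.
    elim: (v) => [|u IH]; first by rewrite expn0 mul1n.
    by rewrite st c IH /=; ring.
  by split=> // _; exact: Rle_refl.
- have h : r m <= r (p ^ v * m).
    elim: (v) => [|u IH]; first by rewrite expn0 mul1n; exact: Rle_refl.
    by rewrite st c pow1; lra.
  by split=> //; lra.
- have -> : r (p ^ v * m) = if odd v then 0 else r m.
    elim: (v) => [|u IH]; first by rewrite expn0 mul1n.
    have sg : (-1) ^ u = if odd u then -1 else 1 by elim: (u) => //= w ->; case: (odd w) => /=; ring.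
    by rewrite st c IH /= sg; case: (odd u) => /=; ring.
  by case: (odd v); split=> // *; try exact: Rle_refl; lra.
Qed.

Lemma r_ge0 k : (0 < k)%N -> 0 <= r k.
Proof.
elim/ltn_ind: k => k IH k0.
case: (ltnP 1 k) => k1; last first.
  have -> : k = 1%N by lia.
  by rewrite /r big_cons big_nil chi1; lra.
have pp := pdiv_prime k1.
have [m cpm ek] := pfactor_coprime pp k0.
rewrite ek mulnC.
have m0 : (0 < m)%N by case: (m) ek k0 => // ->; rewrite mul0n.
have l0 : (0 < logn (pdiv k) k)%N by rewrite logn_gt0 mem_primes pp k0 pdiv_dvd.
have mk : (m < k)%N by rewrite [X in (_ < X)%N]ek ltn_Pmulr // -(exp1n (logn (pdiv k) k)) ltn_exp2r // prime_gt1.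
by have [] := r_pow (logn (pdiv k) k) pp m0 cpm (IH m mk m0).
Qed.

Lemma r_square k : (0 < k)%N -> 1 <= r (k ^ 2).
Proof.
elim/ltn_ind: k => k IH k0.
case: (ltnP 1 k) => k1; last first.
  have -> : k = 1%N by lia.
  by rewrite /r big_cons big_nil chi1; lra.
have pp := pdiv_prime k1.
have [m cpm ek] := pfactor_coprime pp k0.
have m0 : (0 < m)%N by case: (m) ek k0 => // ->; rewrite mul0n.
have l0 : (0 < logn (pdiv k) k)%N by rewrite logn_gt0 mem_primes pp k0 pdiv_dvd.
have mk : (m < k)%N by rewrite [X in (_ < X)%N]ek ltn_Pmulr // -(exp1n (logn (pdiv k) k)) ltn_exp2r // prime_gt1.
have h := IH m mk m0.
have [] := @r_pow (pdiv k) (logn (pdiv k) k * 2) (m ^ 2) pp _ _ (Rle_trans _ _ _ Rle01 h).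
- by rewrite expn_gt0 m0.
- by rewrite coprimeXr.
- move=> _; rewrite oddM andbF => /(_ isT).
  by rewrite [in r (k ^ 2)%N]ek expnMn -expnM mulnC; lra.
Qed.

Lemma mult_sum (t : R) n N : 0 < t < 1 -> (0 < n)%N ->
  (1 - t ^ n) * \rsum_(1 <= k < N.+1 | (n %| k)%N) t ^ k = t ^ n - t ^ (n + n * (N %/ n)).
Proof.
move=> ht n0; elim: N => [|N IH].
  by rewrite big_geq // div0n muln0 addn0; ring.
rewrite big_mkcond big_nat_recr //= -big_mkcond /= Rmult_plus_distr_l IH divnS //.
case: (boolP (n %| N.+1)%N) => h /=; last by rewrite add0n; ring.
have e : (n + n * (N %/ n) = N.+1)%N.
  by have := divnS N n0; rewrite h add1n -mulnS => <-; rewrite mulnC divnK.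
rewrite add1n mulnS e (_ : t ^ (n + N.+1) = t ^ n * t ^ N.+1); last by rewrite pow_add.
rewrite /=; ring.
Qed.


(* Monsky's argument: the Lambert series [sum chi(n) t^n / (1 - t^n)] has nonnegative coefficients,
   at least 1 at the squares, yet stays bounded as [t -> 1] if [L(1, chi) = 0]. *)
Lemma L_one_neq0 : DS chi 0 (1, 0) <> 0.
Proof.
move=> L0.
have q2 : 0 <= 2 * INR q by have := pos_INR q; lra.
have gr := chi_growth q0 chiV chiP chiS.
have lim := limC_Re (DS_lim q2 gr (Rle_refl 0) 0 (ltac:(rewrite /=; lra) : 0 < Re (1, 0))).
rewrite L0 Re_RtoC in lim.
have [M hM] : exists M : nat, 4 * INR q + 4 < INR M.
  have [a _] := archimed (4 * INR q + 4).
  exists (Z.to_nat (up (4 * INR q + 4))); rewrite (INR_IZR_INZ (Z.to_nat _)) Z2Nat.id //.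
  apply: le_IZR; have := pos_INR q; lra.
have M0 : (0 < M)%N by apply/ltP/INR_lt; rewrite /=; have := pos_INR q; lra.
have M1 := INR_ge1 M0.
(* With t = (1 - e)^2 this keeps t^(M^2) >= 1/2, so the first M squares contribute at least M/2 to
   the Lambert series. *)
pose e := / (4 * (INR M * INR M)).
have e0 : 0 < e by apply: Rinv_0_lt_compat; nra.
have e4 : e <= / 4 by apply: Rinv_le_contravar; nra.
pose u := 1 - e. pose t := u * u.
have u0 : 0 < u < 1 by rewrite /u; lra.
have t0 : 0 < t < 1 by rewrite /t; nra.
have tu n : t ^ n = u ^ n * u ^ n by rewrite /t Rpow_mult_distr.
have tn n : 0 < t ^ n by apply: pow_lt; lra.
have un n : 0 < u ^ n by apply: pow_lt; lra.
have tdec m n : (m <= n)%N -> t ^ n <= t ^ m.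
  move=> h; rewrite -(subnK h) pow_add; have := tn m.
  have : t ^ (n - m) <= 1 by rewrite -(pow1 (n - m)); apply: pow_incr; lra.
  nra.
have tM : / 2 <= t ^ (M ^ 2).
  have B : forall n, 1 - INR n * e <= u ^ n.
    elim=> [|n IH]; first by rewrite /=; lra.
    rewrite S_INR /=; have := pos_INR n; rewrite /u in IH *; nra.
  have eM : INR (M ^ 2) * e = / 4.
    rewrite expnS expn1 INR_mul /e; field; lra.
  have := B (M ^ 2)%N; rewrite eM => h; rewrite tu; nra.
pose T n := (1 - t ^ n) / (1 - t).
have T1 n : (1 - t) * T n = 1 - t ^ n by rewrite /T; field; lra.
(* T(n) = 1 + t + ... + t^(n-1) is at least n times the geometric mean t^((n-1)/2) of its terms, and
   u is the square root of t. The induction advances two steps at a time. *)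
have Tb n : INR n.+1 * u ^ n <= T n.+1 /\ INR n.+2 * u ^ n.+1 <= T n.+2.
  have st n' : T n'.+2 = 1 + t * T n' + t ^ n'.+1 by rewrite /T /=; field; lra.
  elim: n => [|n [IH1 IH2]].
    split; rewrite /T /=; first by right; field; lra.
    have -> : (1 - t * (t * 1)) / (1 - t) = 1 + t by field; lra.
    rewrite /t; nra.
  split=> //; rewrite st !S_INR tu /=.
  have a1 := un n; rewrite !S_INR /= in IH1.
  have : t * ((INR n + 1) * u ^ n) <= t * T n.+1 by apply: Rmult_le_compat_l; lra.
  rewrite /t.
  have := pow2_ge_0 (1 - u * (u * u ^ n)); rewrite /=; nra.
have Tp n : (0 < n)%N -> 0 < T n.
  by case: n => // n _; have [h _] := Tb n; apply: Rlt_le_trans h; apply: Rmult_lt_0_compat; [exact: INR_gt0 | exact: un].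
(* The gap between 1/n and the Lambert term (1 - t) t^n/(1 - t^n). It is nonnegative, decreasing and
   equal to 1 - t at n = 1, so partial summation against the bounded sums of chi costs only O(1 -
   t). *)
pose B n := / INR n - t ^ n / T n.
have Bdec n : (0 < n)%N -> B n.+1 <= B n.
  case: n => // n _; have [h1 h2] := Tb n.
  have p1 := Tp n.+1 isT. have p2 := Tp n.+2 isT.
  have i1 := INR_gt0 (isT : (0 < n.+1)%N). have i2 := INR_gt0 (isT : (0 < n.+2)%N).
  have E : T n.+2 = 1 + t * T n.+1 by rewrite /T /=; field; lra.
  have : 0 <= / (INR n.+1 * INR n.+2) - t ^ n.+1 / (T n.+1 * T n.+2).
    have : t ^ n.+1 * (INR n.+1 * INR n.+2) <= T n.+1 * T n.+2.
      apply: (Rle_trans _ ((INR n.+1 * u ^ n) * (INR n.+2 * u ^ n.+1))).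
        rewrite tu /=; have := un n => a1.
        have -> : INR n.+1 * u ^ n * (INR n.+2 * (u * u ^ n)) = (INR n.+1 * INR n.+2 * (u ^ n * u ^ n)) * u by ring.
        have -> : u * u ^ n * (u * u ^ n) * (INR n.+1 * INR n.+2) = (INR n.+1 * INR n.+2 * (u ^ n * u ^ n)) * (u * u) by ring.
        apply: Rmult_le_compat_l; last nra.
        apply/Rlt_le; repeat apply: Rmult_lt_0_compat => //.
      have := un n; have := un n.+1 => a1 a2.
      by apply: Rmult_le_compat => //; apply: Rmult_le_pos; lra.
    move=> h; have d1 : 0 < T n.+1 * T n.+2 by nra.
    have d2 : 0 < INR n.+1 * INR n.+2 by nra.
    have -> : / (INR n.+1 * INR n.+2) - t ^ n.+1 / (T n.+1 * T n.+2) = (T n.+1 * T n.+2 - t ^ n.+1 * (INR n.+1 * INR n.+2)) * / ((INR n.+1 * INR n.+2) * (T n.+1 * T n.+2)) by field; lra.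
    apply: Rmult_le_pos; first lra.
    by apply/Rinv_ge0; nra.
  have -> : / (INR n.+1 * INR n.+2) = / INR n.+1 - / INR n.+2.
    by rewrite (S_INR n.+1); rewrite S_INR in i2; field; lra.
  have -> : t ^ n.+1 / (T n.+1 * T n.+2) = t ^ n.+1 / T n.+1 - t ^ n.+2 / T n.+2.
    have -> : t ^ n.+2 = t * t ^ n.+1 by [].
    rewrite E in p2 *; field; lra.
  rewrite /B; lra.
have Bpos n : (0 < n)%N -> 0 <= B n.
  case: n => // n _; have [h1 h2] := Tb n.
  have p1 := Tp n.+1 isT. have i1 := INR_gt0 (isT : (0 < n.+1)%N).
  have -> : B n.+1 = (T n.+1 - INR n.+1 * t ^ n.+1) * / (INR n.+1 * T n.+1) by rewrite /B; field; lra.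
  apply: Rmult_le_pos; last by apply/Rinv_ge0; nra.
  have : INR n.+1 * t ^ n.+1 <= INR n.+1 * u ^ n.
    apply: Rmult_le_compat_l; first lra.
    rewrite tu /=; have := un n => a1.
    have : u ^ n <= 1 by rewrite -(pow1 n); apply: pow_incr; lra.
    move=> a2; have : u * u <= 1 by nra.
    have : u ^ n * u ^ n <= u ^ n by nra.
    have : 0 < u ^ n * u ^ n by nra.
    nra.
  lra.
have B1 : B 1%N = 1 - t by rewrite /B /T /=; field; lra.
have abel N : Rabs (\rsum_(1 <= n < N.+1) (chi n * B n)) <= 2 * INR q * (1 - t).
  have gb n : Rabs (Sp chi n) <= 2 * INR q.
    case: n => [|n]; first by rewrite /= Rabs_R0.
    by have := gr n.+1 isT; rewrite Rmult_0_l exp_0 Rmult_1_r.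
  have : Rabs (\rsum_(1 <= n < N.+1) (chi n * B n) - Sp chi N * B N.+1) <= 2 * INR q * (B 1%N - B N.+1).
    elim: N => [|N IH].
      rewrite big_geq //= (_ : 0 - 0 * _ = 0) ?Rabs_R0; [nra | ring].
    rewrite big_nat_recr //=.
    have -> : \rsum_(1 <= n < N.+1) (chi n * B n) + chi N.+1 * B N.+1 - (Sp chi N + chi N.+1) * B N.+2
       = (\rsum_(1 <= n < N.+1) (chi n * B n) - Sp chi N * B N.+1) + Sp chi N.+1 * (B N.+1 - B N.+2) by rewrite /=; ring.
    apply: Rle_trans (Rabs_triang _ _) _; rewrite Rabs_mult.
    have d := Bdec N.+1 isT; rewrite (Rabs_pos_eq (B N.+1 - B N.+2)); last lra.
    have := Rmult_le_compat_r (B N.+1 - B N.+2) _ _ (ltac:(lra)) (gb N.+1); lra.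
  have bp := Bpos N.+1 isT; have := Rmult_le_compat_r _ _ _ bp (gb N).
  rewrite B1; set S := \big[_/_]_(_ <= _ < _) _ => h1 h2.
  have := Rabs_triang (S - Sp chi N * B N.+1) (Sp chi N * B N.+1).
  rewrite Rabs_mult (Rabs_pos_eq (B N.+1)) //.
  have -> : S - Sp chi N * B N.+1 + Sp chi N * B N.+1 = S by ring.
  lra.
have lower N : (M ^ 2 <= N)%N -> INR M * / 2 <= \rsum_(1 <= k < N.+1) (t ^ k * r k).
  have nn m n : (0 < m)%N -> 0 <= \rsum_(m <= k < n) (t ^ k * r k).
    move=> m0; apply: rsum_ge0 => k; rewrite mem_index_iota => hk _; apply: Rmult_le_pos; first by apply/Rlt_le.
    by apply: r_ge0; lia.
  have sq m : INR m * t ^ (m ^ 2) <= \rsum_(1 <= k < (m ^ 2).+1) (t ^ k * r k).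
    elim: m => [|m IH]; first by rewrite Rmult_0_l big_geq //; exact: Rle_refl.
    have lt : (m ^ 2 < m.+1 ^ 2)%N by rewrite ltn_exp2r.
    rewrite S_INR (@big_cat_nat _ _ _ (m ^ 2).+1) //; last by lia.
    rewrite (@big_cat_nat _ _ _ (m.+1 ^ 2)%N (m ^ 2).+1) //.
    rewrite big_nat1.
    have := nn (m ^ 2).+1 (m.+1 ^ 2)%N isT.
    have := r_square (isT : (0 < m.+1)%N).
    have := tn (m.+1 ^ 2)%N; have := tdec _ _ (ltnW lt); have := pos_INR m.
    move: (t ^ (m.+1 ^ 2)) (t ^ (m ^ 2)) (r (m.+1 ^ 2)) IH => x y z IH m0 xy x0 z1 w0.
    have := Rmult_le_compat_l _ _ _ m0 xy; have := Rmult_le_compat_l _ _ _ (Rlt_le _ _ x0) z1.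
    rewrite /=; move: IH w0; rewrite /=; lra.
  move=> hN; rewrite (@big_cat_nat _ _ _ (M ^ 2).+1) //=.
  have := nn (M ^ 2).+1 N.+1 isT; have := sq M; nra.
(* The terms chi(n)/n sum to nearly L(1, chi), assumed 0; the gaps [B] cost 2q(1 - t), and the
   truncation at N costs N t^N. *)
have upper N : (1 - t) * \rsum_(1 <= k < N.+1) (t ^ k * r k) <=
    Rabs (\rsum_(1 <= n < N.+1) (chi n * / INR n)) + 2 * INR q * (1 - t) + INR N * t ^ N.
  have -> : \rsum_(1 <= k < N.+1) (t ^ k * r k) =
      \rsum_(1 <= n < N.+1) (chi n * \rsum_(1 <= k < N.+1 | (n %| k)%N) t ^ k).
    under [RHS]eq_bigr => n _ do rewrite big_distrr /= big_mkcond /=.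
    rewrite exchange_big /=; apply: eq_big_nat => k hk.
    rewrite -big_mkcond /= /r big_distrr /=.
    rewrite [RHS](eq_bigr (fun i => t ^ k * chi i)); last by move=> *; ring.
    rewrite -[RHS]big_filter; apply: perm_big.
    apply: uniq_perm; [exact: divisors_uniq | by rewrite filter_uniq // iota_uniq | ].
    move=> d; rewrite mem_filter mem_index_iota -dvdn_divisors; last by lia.
    apply/idP/andP => [h|[]] //; split=> //.
    by have := dvdn_leq (ltac:(lia) : (0 < k)%N) h; have := dvdn_gt0 (ltac:(lia) : (0 < k)%N) h; lia.
  rewrite big_distrr /=.
  pose E n := (1 - t) * \rsum_(1 <= k < N.+1 | (n %| k)%N) t ^ k - t ^ n / T n.
  have Eb n : (0 < n)%N -> Rabs (E n) <= t ^ N.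
    move=> n0; have m := mult_sum N t0 n0; rewrite -T1 in m.
    have p := Tp n n0.
    have T1' : 1 <= T n.
      case: n n0 {m p} => // n _; apply: (Rmult_le_reg_l (1 - t)); first lra.
      by rewrite T1; have := tdec 1%N n.+1 isT; rewrite /=; lra.
    have -> : E n = - (t ^ (n + n * (N %/ n)) / T n).
      apply: (Rmult_eq_reg_l (T n)); last lra.
      rewrite /E Rmult_minus_distr_l -Rmult_assoc (Rmult_comm (T n)) m; field; lra.
    rewrite Rabs_Ropp Rabs_pos_eq; last by apply/Rlt_le/Rdiv_lt_0_compat.
    have : t ^ (n + n * (N %/ n)) <= t ^ N.
      apply: tdec; have := divn_eq N n; have := ltn_pmod N n0; lia.
    have iT : / T n <= 1 by rewrite -Rinv_1; apply: Rinv_le_contravar; lra.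
    have := tn (n + n * (N %/ n))%N; have : 0 < / T n by apply: Rinv_0_lt_compat.
    rewrite /Rdiv; nra.
  have -> : \rsum_(1 <= i < N.+1) ((1 - t) * (chi i * \rsum_(1 <= k < N.+1 | (i %| k)%N) t ^ k)) =
    \rsum_(1 <= n < N.+1) (chi n * / INR n) + - (\rsum_(1 <= n < N.+1) (chi n * B n)) + \rsum_(1 <= n < N.+1) (chi n * E n).
    set S2 := \big[_/_]_(_ <= n < _) (chi n * B n); set S1 := \big[_/_]_(_ <= n < _) (chi n * / INR n).
    set S3 := \big[_/_]_(_ <= n < _) (chi n * E n).
    set S := (X in X = _).
    have : S + S2 = S1 + S3 by rewrite -!big_split /=; apply: eq_bigr => n _; rewrite /E /B; ring.
    lra.
  have := Rle_abs (\rsum_(1 <= n < N.+1) (chi n * / INR n)).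
  have := abel N; have := Rle_abs (- (\rsum_(1 <= n < N.+1) (chi n * B n))); rewrite Rabs_Ropp.
  have : \rsum_(1 <= n < N.+1) (chi n * E n) <= INR N * t ^ N.
    have : forall K, \rsum_(1 <= n < K.+1) (chi n * E n) <= INR K * t ^ N; last by [].
    elim=> [|n IH]; first by rewrite big_geq //= Rmult_0_l; exact: Rle_refl.
    rewrite S_INR big_nat_recr //=.
    have := Eb n.+1 isT; have := Rle_abs (chi n.+1 * E n.+1); rewrite Rabs_mult.
    have := chi_b chiV n.+1; have := Rabs_pos (E n.+1); have := Rabs_pos (chi n.+1); nra.
  lra.
have [N1 h1] := lim (1 - t) (ltac:(lra)).
have [N2 h2] := @pow_lt_1_zero u (ltac:(rewrite Rabs_pos_eq; lra)) ((1 - t) * (1 - u)) (ltac:(nra)).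
pose N := (N1 + N2 + M ^ 2)%N.
have l := lower N (ltac:(lia)); have up := upper N.
have {}h1 := h1 N (ltac:(lia)); have {}h2 := h2 N (ltac:(lia)).
have s0 : Re (dps chi 0 (1, 0) N) = \rsum_(1 <= n < N.+1) (chi n * / INR n).
  elim: (N) => [|n IH]; first by rewrite dps_0 big_geq.
  rewrite dps_S (Re_plus (dps _ _ _ _)) IH [RHS]big_nat_recr //.
  have tm : forall (a : R) m y u, Re (RtoC a * fj 0 m (y, u))%C = a * (exp (- y * lnN m) * cos (u * lnN m)).
    by move=> a m y v; rewrite Re_mult Re_fj0 Re_RtoC Im_RtoC; ring.
  rewrite tm Rmult_0_l cos_0; apply: (f_equal2 Rplus); first by [].
  rewrite (_ : - (1) * lnN n.+1 = - lnN n.+1); last ring.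
  rewrite exp_Ropp exp_ln; last exact: INR_gt0.
  by rewrite Rmult_1_r.
rewrite s0 Rminus_0_r in h1.
have Nt : INR N * t ^ N <= 1 - t.
  have b n : INR n * u ^ n * (1 - u) <= 1 - u ^ n.
    elim: n => [|n IH]; first by rewrite /=; lra.
    rewrite S_INR /=; have := un n; have := pos_INR n => n0 a1.
    have b1 : u ^ n <= 1 by rewrite -(pow1 n); apply: pow_incr; lra.
    have := Rmult_le_compat_l u _ _ (ltac:(lra)) IH.
    have : u * u ^ n * (1 - u) <= 1 * (1 - u) by apply: Rmult_le_compat_r; nra.
    lra.
  have b1 := b N; have a1 := un N.
  rewrite Rabs_pos_eq in h2; last lra.
  rewrite tu; have n0 := pos_INR N.
  apply: (Rmult_le_reg_r (1 - u)); first lra.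
  have : (INR N * u ^ N * (1 - u)) * u ^ N <= 1 * u ^ N by apply: Rmult_le_compat_r; lra.
  lra.
(* Division by 1 - t yields M/2 <= 2 + 2q, against 4q + 4 < M. *)
have : (1 - t) * (INR M * / 2) <= (1 - t) * (2 + 2 * INR q).
  apply: Rle_trans (Rle_trans _ _ _ (Rmult_le_compat_l (1 - t) _ _ (ltac:(lra)) l) up) _; lra.
move=> /(Rmult_le_reg_l (1 - t) _ _ (ltac:(lra))); lra.
Qed.

End Monsky.

(** * The upper bound on the critical line for a real character *)

Lemma DS_conj a s : DS a 0 (Cconj s) = Cconj (DS a 0 s).
Proof.
have E n : Tn 0 n (Cconj s) = Cconj (Tn 0 n s).
  have F m : fj 0 m (Cconj s) = Cconj (fj 0 m s).
    rewrite /fj !pow_O !Cmult_1_l /cexp; case: s => x y; apply: C_eq => /=.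
      have -> : - x * 0 + - - y * lnN m = - (- x * 0 + - y * lnN m) by ring.
      by rewrite cos_neg; congr (exp _ * _); ring.
    have -> : - x * 0 + - - y * lnN m = - (- x * 0 + - y * lnN m) by ring.
    rewrite sin_neg -Ropp_mult_distr_r; congr (- (exp _ * _)); ring.
  by rewrite /Tn !F; apply: C_eq => /=; ring.
rewrite /DS (CSer_ext (v := fun n => Cconj (Sp a n * Tn 0 n s)%C)); last first.
  by move=> n; rewrite E; apply: C_eq => /=; ring.
by rewrite /CSer; apply: C_eq => //=; rewrite -Series_opp.
Qed.

Section LogBound.
Variable chi : nat -> R.
Variable q : nat.
Hypothesis q0 : (0 < q)%N.
Hypothesis chi1 : chi 1%N = 1.
Hypothesis chiM : forall m n, (0 < m)%N -> (0 < n)%N -> chi (m * n)%N = chi m * chi n.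
Hypothesis chiV : forall n, chi n = 0 \/ chi n = 1 \/ chi n = -1.
Hypothesis chiP : forall n, (0 < n)%N -> chi (n + q)%N = chi n.
Hypothesis chiS : Sp chi q = 0.
Hypothesis NV : forall s : C, / 2 < Re s < 1 -> DS chi 0 s <> 0.

Definition C0 : R := 432 * Dpos_const 200.

(** Supplies the hypotheses of [kernel_half]. Zeros are excluded for Re s > 1 by the Euler product,
    on Re s = 1 by [nonvanish_line1] and [L_one_neq0], and inside the strip by [NV], which GRH will
    provide. *)
Lemma DS_half_bound H N t : / 2 <= H -> (forall n, (N < n)%N -> H < lnN n) ->
  Cmod (DS chi 0 (/ 2, t)) <= exp (Re (dps (cw (lc chi) H) 0 (/ 2, t) N) + C0 * (lnN q + ln (2 + Rabs t)) / H).
Proof.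
move=> H0 hN.
have q2 : 0 <= 2 * INR q by have := pos_INR q; lra.
have q1 := INR_ge1 q0.
have gr := chi_growth q0 chiV chiP chiS.
have cb := chi_b chiV.
have lq0 : 0 <= lnN q by rewrite -ln_1; case: q1 => [h|<-]; [apply/Rlt_le/ln_increasing; lra | lra].
have G1 : 1 <= 200 by lra.
apply: (kernel_half (L := DS chi) (lq := lnN q) (G := 200) lq0 G1) => //.
- by move=> j s hs; apply: (DS_cd q2 gr (Rle_refl 0)).
- move=> s hs; case: (Rlt_le_dec 1 (Re s)) => h1; first exact: DS_neq0.
  case: (Rle_lt_or_eq_dec _ _ h1) => h2; first by apply: NV.
  have -> : s = (1, Im s) by case: (s) h2 => a b /= ->.
  case: (Req_dec (Im s) 0) => [->|nz]; first exact: (L_one_neq0 q0 chi1 chiM chiV chiP chiS).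
  exact: (nonvanish_line1 q0 chi1 chiM chiV chiP chiS nz).
- by move=> s; exact: DS_conj.
- move=> s hs.
  (* Partial sums bounded by 2q give |L(s)| = O(q |s|) in the strip, well below e^(200 ell). *)
  have := DS_bound q2 gr (Rle_refl 0) 0 (k := / 8) (s := s) (ltac:(lra)) (ltac:(lra)).
  rewrite /DSK /=.
  have e1 : exp (2 * / 8) <= 2.
    have := exp_ineq1_le (- (2 * / 8)); rewrite exp_Ropp => h.
    have ep := exp_pos (2 * / 8).
    have : / exp (2 * / 8) * exp (2 * / 8) = 1 by field; lra.
    nra.
  have mb : Cmod s <= 2 * (2 + Rabs (Im s)).
    apply: Rle_trans (Cmod_le_ReIm s) _; rewrite (Rabs_pos_eq (Re s)); have := Rabs_pos (Im s); lra.
  have e2 : 200 * ell (lnN q) (Im s) = 199 * ell (lnN q) (Im s) + lnN q + ln (2 + Rabs (Im s)) by rewrite /ell; ring.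
  have el := ell_ge (Im s) lq0.
  have a0 := Rabs_pos (Im s).
  rewrite e2 !exp_plus !exp_ln; try lra.
  have := exp_ineq1_le (199 * ell (lnN q) (Im s)).
  set E := exp (199 * _) => hE h; apply: Rle_lt_trans h _.
  have -> : 1 + / / 8 = 9 by field.
  have m0 := Cmod_ge_0 s; have ep := exp_pos (2 * / 8).
  have : (0 + Cmod s) * (1 * 1 * exp (2 * / 8)) <= (2 * (2 + Rabs (Im s))) * 2.
    by apply: Rmult_le_compat; nra.
  set Y := (0 + _) * _ => hY.
  have : 2 * INR q * Y <= 2 * INR q * ((2 * (2 + Rabs (Im s))) * 2) by apply: Rmult_le_compat_l.
  have -> : 2 * INR q * (0 + Cmod s) * (1 * 1 * exp (2 * / 8)) = 2 * INR q * Y by rewrite /Y; ring.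
  have : 0 < INR q * (2 + Rabs (Im s)) by apply: Rmult_lt_0_compat; lra.
  move: (2 * INR q * Y) => Z; set W := INR q * _ => W0; rewrite /= -/W => hZ.
  have : (199 * ell (lnN q) (Im s)) > 199 / 2 by lra.
  have -> : E * INR q * (2 + Rabs (Im s)) = E * W by rewrite /W; ring.
  have : Z <= 8 * W by rewrite /W; lra.
  nra.
- move=> t'; rewrite DS_exp //; last by rewrite /=; lra.
  rewrite Cmod_cexp; apply: exp_le.
  have := DS_far (lc_b cb) (s := (2, t')) (ltac:(rewrite /=; lra)).
  rewrite (_ : Re (2, t') = 2) // Rminus_diag Ropp_0 Rmult_0_l exp_0 => h.
  have := Cmod_triangle (DS (lc chi) 0 (2, t') - lc chi 1%N)%C (lc chi 1%N).
  have -> : (DS (lc chi) 0 (2, t') - lc chi 1 + lc chi 1)%C = DS (lc chi) 0 (2, t') by ring.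
  rewrite Cmod_R; have := lc_b cb 1%N; have := re_le_Cmod (DS (lc chi) 0 (2, t')).
  have := Rle_abs (- Re (DS (lc chi) 0 (2, t'))); rewrite Rabs_Ropp.
  have := ell_ge t' lq0; lra.
- exact: lc_b.
- exact/sum_growth_1/lc_b.
- by move=> s hs; apply: DS_exp => //; lra.
- by move=> s hs; apply: DS_log => //; lra.
Qed.

End LogBound.

(** * From prime powers to primes and their squares *)

Lemma rsum_minus (I : Type) (r : seq I) (P : pred I) (F G : I -> R) :
  \rsum_(i <- r | P i) (F i - G i) = \rsum_(i <- r | P i) F i - \rsum_(i <- r | P i) G i.
Proof.
have : \rsum_(i <- r | P i) (F i - G i) + \rsum_(i <- r | P i) G i = \rsum_(i <- r | P i) F i.
  by rewrite -big_split /=; apply: eq_bigr => i _; ring.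
lra.
Qed.

Lemma rsum_plus (I : Type) (r : seq I) (P : pred I) (F G : I -> R) :
  \rsum_(i <- r | P i) (F i + G i) = \rsum_(i <- r | P i) F i + \rsum_(i <- r | P i) G i.
Proof. exact: big_split. Qed.

Lemma rsum_scal (I : Type) (r : seq I) (P : pred I) (F : I -> R) c :
  \rsum_(i <- r | P i) (c * F i) = c * \rsum_(i <- r | P i) F i.
Proof. by rewrite big_distrr. Qed.

Lemma geom_sum_le x m n : 0 <= x < 1 -> \rsum_(m <= k < n) x ^ k <= x ^ m / (1 - x).
Proof.
move=> hx; case: (leqP m n) => h; last first.
  rewrite big_geq; last by lia.
  by apply: Rmult_le_pos; [apply: pow_le; lra | apply/Rinv_ge0; lra].
have : \rsum_(m <= k < n) x ^ k = (x ^ m - x ^ n) / (1 - x).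
  rewrite -(subnK h) addnC; elim: (n - m)%N => [|j IH].
    by rewrite addn0 big_geq //; field; lra.
  by rewrite addnS big_nat_recr ?leq_addr // IH /=; field; lra.
move=> ->; apply: Rmult_le_compat_r; first by apply/Rinv_ge0; lra.
have := pow_le x n (ltac:(lra)); lra.
Qed.

Lemma ln2_INR p : (2 <= p)%N -> ln 2 <= lnN p.
Proof. by move=> h; have := @ln_INR_le 2 p isT h. Qed.

Lemma prime_sum_le N (F : nat -> R) : (forall p, (0 < p)%N -> 0 <= F p) ->
  \psum_(p <= N) F p <= \rsum_(1 <= p < N.+1) F p.
Proof.
move=> h.
have -> : \psum_(p <= N) F p = \rsum_(1 <= p < N.+1 | prime p) F p.
  by rewrite big_mkcond big_ltn // -big_mkcond; exact: Rplus_0_l.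
by apply: rsum_mask => // p; rewrite mem_index_iota => hp _; apply: h; lia.
Qed.

Section PrimePowers.
Variable chi : nat -> R.
Hypothesis chi1 : chi 1%N = 1.
Hypothesis chiM : forall m n, (0 < m)%N -> (0 < n)%N -> chi (m * n)%N = chi m * chi n.
Hypothesis chib : forall n, Rabs (chi n) <= 1.
Variable w : nat -> R.
Hypothesis w01 : forall n, 0 <= w n <= 1.

Definition pterm (x t : R) (p : nat) : R := w p * exp (- x * lnN p) * cos (t * lnN p).
Definition pterm2 (x t : R) (p : nat) : R := w (p ^ 2) * exp (- (2 * x) * lnN p) * cos (2 * t * lnN p).

Lemma chi_pow p k : (0 < p)%N -> chi (p ^ k)%N = chi p ^ k.
Proof. by move=> p0; elim: k => [|k IH]; rewrite ?expn0 // expnS chiM ?expn_gt0 ?p0 // IH. Qed.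

(** With y = p^(-x) <= 3/4, the powers p^k with k >= 3 add up to at most (1/3) y^3/(1 - y) <= 4
    p^(-3/2), and these sum over p to at most 12. *)
Lemma prime_power_sum x t N : / 2 <= x ->
  Rabs (Re (dps (fun n => lc chi n * w n) 0 (x, t) N)
    - (\psum_(p <= N) (chi p * pterm x t p))
    - (\psum_(p <= N | (p ^ 2 <= N)%N) (/ 2 * chi p ^ 2 * pterm2 x t p))) <= 12.
Proof.
move=> hx.
pose F n := cc n * chi n * w n * (exp (- x * lnN n) * cos (t * lnN n)).
have e1 : Re (dps (fun n => lc chi n * w n) 0 (x, t) N) = \rsum_(1 <= n < N.+1 | ppow n) F n.
  rewrite big_mkcond; elim: (N) => [|n IH]; first by rewrite dps_0 big_geq.
  rewrite dps_S (Re_plus (dps _ _ _ _)) IH [RHS]big_nat_recr //.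
  have tm : forall (a : R) m y u, Re (RtoC a * fj 0 m (y, u))%C = a * (exp (- y * lnN m) * cos (u * lnN m)).
    by move=> a m y v; rewrite Re_mult Re_fj0 Re_RtoC Im_RtoC; ring.
  rewrite tm; apply: (f_equal2 Rplus); first by [].
  rewrite /F /lc /cc; case: ifP => _; ring.
rewrite e1 ppow_reindex [X in _ - X](_ : _ = \psum_(p <= N) (if (p ^ 2 <= N)%N then / 2 * chi p ^ 2 * pterm2 x t p else 0)); last first.
  by rewrite -big_mkcondr.
rewrite -!rsum_minus; apply: Rle_trans (rsum_abs _ _ _) _.
apply: (Rle_trans _ (\rsum_(1 <= p < N.+1) (4 * pw (1 + / 2) p))); last first.
  rewrite rsum_scal -sum_n_big //.
  have := @pw_sum_le (/ 2) N (ltac:(lra)); rewrite (_ : 1 + / / 2 = 3); [lra | field].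
apply: (Rle_trans _ (\psum_(p <= N) (4 * pw (1 + / 2) p))); last first.
  by apply: prime_sum_le => p hp; have := pw_ge0 (1 + / 2) p; lra.
apply: rsum_le => p; rewrite mem_index_iota => hp pp.
have p1 := prime_gt1 pp. have p0 := prime_gt0 pp.
have Fk k : (0 < k)%N -> F (p ^ k)%N = / INR k * chi p ^ k * w (p ^ k)%N * (exp (- x * (INR k * lnN p)) * cos (t * (INR k * lnN p))).
  by move=> k0; rewrite /F cc_pow // chi_pow // ln_expN.
have l2 := ln2_INR p1. have l2' := ln_lt_2.
set l := lnN p in Fk l2 *.
set y := exp (- x * l).
have y0 : 0 < y := exp_pos _.
have ey : y <= exp (- / 2 * l) by apply: exp_le; nra.
have e2 : exp (- / 2 * l) * exp (- / 2 * l) <= / 2.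
  rewrite -exp_plus; have -> : - / 2 * l + - / 2 * l = - l by field.
  rewrite exp_Ropp; apply: Rinv_le_contravar; first lra.
  rewrite -(exp_ln 2); last lra. exact: exp_le.
have y3 : y <= 3 / 4 by have := exp_pos (- / 2 * l); nra.
have cb k : Rabs (chi p ^ k) <= 1.
  by rewrite -RPow_abs -(pow1 k); apply: pow_incr; split; [exact: Rabs_pos | exact: chib].
have Fb k : (2 < k)%N -> Rabs (F (p ^ k)%N) <= / 3 * y ^ k.
  move=> k0; rewrite Fk; last by lia.
  have -> : exp (- x * (INR k * l)) = y ^ k.
    elim: (k) => [|j IH]; first by rewrite /= Rmult_0_l Rmult_0_r exp_0.
    rewrite S_INR /= -IH /y -exp_plus; congr exp; ring.
  have k3 : 3 <= INR k by have := le_INR 3 k (ltac:(lia)); rewrite /=; lra.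
  have ik : / INR k <= / 3 by apply: Rinv_le_contravar; lra.
  have ik0 : 0 < / INR k by apply: Rinv_0_lt_compat; lra.
  have yk : 0 < y ^ k by apply: pow_lt.
  rewrite !Rabs_mult (Rabs_pos_eq (/ INR k)) ?(Rabs_pos_eq (y ^ k)); try lra.
  have [w0 w1] := w01 (p ^ k); rewrite (Rabs_pos_eq (w _)) //.
  have c0 : Rabs (cos (t * (INR k * l))) <= 1.
    by apply: Rabs_le; have := COS_bound (t * (INR k * l)); lra.
  have a1 := cb k; have a2 := Rabs_pos (chi p ^ k); have a3 := Rabs_pos (cos (t * (INR k * l))).
  have b1 : / INR k * Rabs (chi p ^ k) <= / 3 * 1 by apply: Rmult_le_compat; lra.
  have b2 : / INR k * Rabs (chi p ^ k) * w (p ^ k)%N <= / 3 * 1 * 1 by apply: Rmult_le_compat => //; nra.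
  have b3 : y ^ k * Rabs (cos (t * (INR k * l))) <= y ^ k * 1 by apply: Rmult_le_compat_l; lra.
  have := Rmult_le_compat _ _ _ _ (ltac:(repeat apply: Rmult_le_pos; lra) : 0 <= / INR k * Rabs (chi p ^ k) * w (p ^ k)%N) (ltac:(apply: Rmult_le_pos; lra) : 0 <= y ^ k * Rabs (cos (t * (INR k * l)))) b2 b3.
  lra.
have pN : (p <= N)%N by lia.
have N2 : (2 <= N)%N by lia.
have F1 : F (p ^ 1)%N = chi p * pterm x t p.
  by rewrite Fk // /pterm !Rmult_1_l expn1 -/l /= Rinv_1; ring.
have F2 : F (p ^ 2)%N = / 2 * chi p ^ 2 * pterm2 x t p.
  rewrite Fk // /pterm2 -/l (_ : INR 2 = 2) //.
  have -> : - x * (2 * l) = - (2 * x) * l by ring.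
  have -> : t * (2 * l) = 2 * t * l by ring.
  ring.
rewrite big_mkcond big_ltn; last by lia.
rewrite big_ltn; last by lia.
rewrite expn1 pN -{1}(expn1 p) F1 F2.
set S := \big[_/_]_(3 <= i < _) _.
have -> : chi p * pterm x t p + ((if (p ^ 2 <= N)%N then / 2 * chi p ^ 2 * pterm2 x t p else 0) + S) - chi p * pterm x t p - (if (p ^ 2 <= N)%N then / 2 * chi p ^ 2 * pterm2 x t p else 0) = S by ring.
apply: Rle_trans (rsum_abs _ _ _) _.
apply: (Rle_trans _ (\rsum_(3 <= k < N.+1) (/ 3 * y ^ k))).
  apply: rsum_le => k; rewrite mem_index_iota => hk _.
  case: ifP => _; first by apply: Fb; lia.
  by rewrite Rabs_R0; have := pow_lt y k y0; lra.
rewrite rsum_scal.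
have g := @geom_sum_le y 3 N.+1 (ltac:(lra)).
have iy : / (1 - y) <= 4 by rewrite -(Rinv_inv 4); apply: Rinv_le_contravar; lra.
have y3p : 0 < y ^ 3 by apply: pow_lt.
have : y ^ 3 / (1 - y) <= y ^ 3 * 4 by apply: Rmult_le_compat_l; lra.
have : y ^ 3 <= pw (1 + / 2) p.
  have -> : pw (1 + / 2) p = exp (- / 2 * l) ^ 3.
    have -> : pw (1 + / 2) p = exp (- (1 + / 2) * l) by rewrite /l; case: (p) p0.
    by rewrite /= Rmult_1_r -!exp_plus; congr exp; field.
  by apply: pow_incr; lra.
have := pw_ge0 (1 + / 2) p; lra.
Qed.

End PrimePowers.

(** * The family chi^(8p) under GRH *)

Definition chi8 (p n : nat) : R := IZR (psi p n).

Lemma ln_INR_ge0 n : 0 <= lnN n.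
Proof.
case: n => [|n]; last by have [] := @ln_succ n.+1 isT.
rewrite /= /ln; case: Rlt_dec => h; last exact: Rle_refl.
by case: (Rlt_irrefl 0).
Qed.

(** The cutoff left by [Ff]: (1 - log n / H)^2 for log n <= H and 0 beyond. *)
Definition smooth (H : R) (n : nat) : R := 1 - Ff (lnN n / H).

Lemma smooth_01 H n : 0 < H -> 0 <= smooth H n <= 1.
Proof.
move=> h; rewrite /smooth; have l := ln_INR_ge0 n.
have := @Ff_01 (lnN n / H) (ltac:(apply: Rmult_le_pos => //; exact/Rinv_ge0)); lra.
Qed.

Lemma smooth_0 H n : 0 < H -> H <= lnN n -> smooth H n = 0.
Proof.
move=> h hn; rewrite /smooth /Ff; case: Rle_dec => hl /=; last by ring.
have e : lnN n / H = 1.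
  apply: Rle_antisym => //; apply: (Rmult_le_reg_r H) => //; rewrite /Rdiv Rmult_assoc Rinv_l; lra.
by rewrite e; ring.
Qed.

Lemma smooth_ge H n : 0 < H -> 1 - 2 * lnN n / H <= smooth H n.
Proof.
move=> h; have l := ln_INR_ge0 n; rewrite /smooth /Ff.
have e : 0 <= lnN n / H by apply: Rmult_le_pos => //; exact/Rinv_ge0.
have -> : 2 * lnN n / H = 2 * (lnN n / H) by rewrite /Rdiv; ring.
by case: Rle_dec => hl /=; nra.
Qed.

Section Modulus.
Variable p : nat.
Hypothesis pp : prime p.
Hypothesis op : odd p.

Lemma chi8_1 : chi8 p 1 = 1. Proof. by rewrite /chi8 psi_1. Qed.
Lemma chi8_M m n : chi8 p (m * n)%N = chi8 p m * chi8 p n. Proof. by rewrite /chi8 psi_M // mult_IZR. Qed.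
Lemma chi8_V n : chi8 p n = 0 \/ chi8 p n = 1 \/ chi8 p n = -1.
Proof. by rewrite /chi8; case: (psi_V pp op n) => [->|[->|->]]; [left | right; left | right; right]. Qed.
Lemma chi8_b n : Rabs (chi8 p n) <= 1.
Proof. exact: (chi_b chi8_V). Qed.
Lemma chi8_P n : chi8 p (n + 8 * p)%N = chi8 p n. Proof. by rewrite /chi8 psi_per. Qed.

(** The second half of the period cancels the first, by [psi_half]. *)
Lemma chi8_S : Sp (chi8 p) (8 * p) = 0.
Proof.
have h n : Sp (chi8 p) (4 * p + n) = Sp (chi8 p) (4 * p) - Sp (chi8 p) n.
  elim: n => [|n IH]; first by rewrite addn0 /=; ring.
  rewrite addnS [LHS]/= IH (_ : chi8 p (4 * p + n).+1 = - chi8 p n.+1) /=; first by ring.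
  by rewrite /chi8 -addnS addnC psi_half // opp_IZR.
rewrite (_ : 8 * p = 4 * p + 4 * p)%N; last by lia.
by rewrite h; ring.
Qed.

Lemma Lkron_DS t : Lkron (8 * Z.of_nat p) (1 / 2, t) = DS (chi8 p) 0 (/ 2, t).
Proof.
have q2 : 0 <= 2 * INR (8 * p) by have := pos_INR (8 * p); lra.
have q0 : (0 < 8 * p)%N by rewrite muln_gt0 /= prime_gt0.
have gr := chi_growth q0 chi8_V (fun n _ => chi8_P n) chi8_S.
rewrite -(DS_dseries q2 gr (Rle_refl 0)); last by rewrite /=; lra.
rewrite /Lkron (_ : 1 / 2 = / 2); last by field.
have E N : dpsum (kron_char (8 * Z.of_nat p)) (/ 2, t) N = dpsum (fun n => RtoC (chi8 p n)) (/ 2, t) N.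
  apply: sum_n_ext => n; case: n => [|n]; first by rewrite /= !Cmult_0_r.
  by rewrite /kron_char kronecker_psi.
rewrite /dseries; congr (real _, real _); apply: Lim_seq_ext => n; by rewrite E.
Qed.

(** GRH applied to the character modulo 8p; 1 + 4p, where it equals -1, witnesses that it is
    non-principal. *)
Lemma chi8_nonvanishing s : GRH -> / 2 < Re s < 1 -> DS (chi8 p) 0 s <> 0.
Proof.
move=> [_ G] hs e0.
have q2 : 0 <= 2 * INR (8 * p) by have := pos_INR (8 * p); lra.
have q0 : (0 < 8 * p)%N by rewrite muln_gt0 /= prime_gt0.
have gr := chi_growth q0 chi8_V (fun n _ => chi8_P n) chi8_S.
have dc : dirichlet_char (8 * p) (fun n => RtoC (chi8 p n)).
  split; first by apply/leP.
  split; first by move=> m n; rewrite chi8_M RtoC_mult.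
  split; first by move=> n; rewrite chi8_P.
  move=> n; rewrite -psi_gcd //; split.
    by move=> h1 h2; apply: h1; rewrite /chi8 h2.
  by move=> h1 /RtoC_inj h2; apply: h1; apply: eq_IZR.
have np : nonprincipal (8 * p) (fun n => RtoC (chi8 p n)).
  exists (1 + 4 * p)%N; have e : psi p (1 + 4 * p)%N = (-1)%Z by rewrite psi_half // psi_1.
  split; first by rewrite -psi_gcd // e.
  by rewrite /chi8 e => /RtoC_inj; lra.
have := G _ _ dc np s (ltac:(lra)).
rewrite (DS_dseries q2 gr (Rle_refl 0)); last by lra.
move=> /(_ e0); lra.
Qed.

(** In the terms at squares chi(q)^2 = 1 except for q = 2 and q = p, and each exception changes the
    sum by at most 1/2. With the 12 of [prime_power_sum] this makes 13. *)
Lemma Lkron_bound H N t : GRH -> / 2 <= H -> (forall n, (N < n)%N -> H < lnN n) ->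
  Cmod (Lkron (8 * Z.of_nat p) (1 / 2, t)) <=
  exp (\psum_(q <= N) (chi8 p q * pterm (smooth H) (/ 2) t q)
    + / 2 * \psum_(q <= N | (q ^ 2 <= N)%N) pterm2 (smooth H) (/ 2) t q
    + 13 + C0 * (ln (INR (8 * p)) + ln (2 + Rabs t)) / H).
Proof.
move=> G H0 hN.
have q0 : (0 < 8 * p)%N by rewrite muln_gt0 /= prime_gt0.
have Hp : 0 < H by lra.
rewrite Lkron_DS.
apply: Rle_trans (DS_half_bound q0 chi8_1 (fun m n _ _ => chi8_M m n) chi8_V (fun n _ => chi8_P n) chi8_S (fun s => chi8_nonvanishing G) t H0 hN) _.
apply: exp_le; apply: Rplus_le_compat_r.
have P := prime_power_sum chi8_1 (fun m n _ _ => chi8_M m n) chi8_b (fun n => smooth_01 n Hp) t N (Rle_refl (/ 2)).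
have e : dps (cw (lc (chi8 p)) H) 0 (/ 2, t) N = dps (fun n => lc (chi8 p) n * smooth H n) 0 (/ 2, t) N by [].
rewrite e; move/Rabs_le_between: P => P; move: P; set D := Re _; set S1 := \big[_/_]_(_ <= _ < _ | _) (chi8 p _ * _).
set S2 := \big[_/_]_(_ <= _ < _ | _) (_ * _ * _); set S3 := \big[_/_]_(_ <= _ < _ | _) _.
suff : S2 <= / 2 * S3 + 1 by move=> hS [P1 P2]; lra.
rewrite /S3 -rsum_scal.
pose E q := (if q == 2%N then / 2 else 0) + (if q == p then / 2 else 0).
apply: (Rle_trans _ (\psum_(q <= N | (q ^ 2 <= N)%N) (/ 2 * pterm2 (smooth H) (/ 2) t q + E q))).
  apply: rsum_le => q _ /andP [pq _].
  have T : Rabs (pterm2 (smooth H) (/ 2) t q) <= 1.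
    rewrite /pterm2 !Rabs_mult.
    have [w0 w1] := smooth_01 (q ^ 2) Hp; rewrite (Rabs_pos_eq (smooth _ _)) //.
    have e0 := exp_pos (- (2 * / 2) * lnN q); rewrite (Rabs_pos_eq (exp _)); last lra.
    have e1 : exp (- (2 * / 2) * lnN q) <= 1 by apply: exp_le1; have := ln_INR_ge0 q; lra.
    have c0 : Rabs (cos (2 * t * lnN q)) <= 1 by apply: Rabs_le; have := COS_bound (2 * t * lnN q); lra.
    have a3 := Rabs_pos (cos (2 * t * lnN q)).
    apply: (Rle_trans _ (1 * 1 * 1)); last lra.
    apply: Rmult_le_compat => //; last by apply: Rmult_le_compat; lra.
    by apply: Rmult_le_pos; lra.
  move/Rabs_le_between: T; set x := pterm2 _ _ _ _ => T.
  case: (chi8_V q) => [c0|c1]; last first.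
    have -> : chi8 p q ^ 2 = 1 by case: c1 => ->; ring.
    by rewrite Rmult_1_r /E; case: eqP; case: eqP; lra.
  rewrite c0 /E.
  have := c0; rewrite /chi8 => /(eq_IZR _ 0) /(proj1 (psi_0 pp op q)) /orP [h|h].
    have -> : q == 2%N by case: (even_prime pq) h => [->|->].
    by case: eqP; lra.
  have -> : q == p by rewrite eq_sym -(dvdn_prime2 pp pq).
  by case: eqP; lra.
rewrite rsum_plus; apply: Rplus_le_compat_l.
have one_le a : \psum_(q <= N | (q ^ 2 <= N)%N) (if q == a then / 2 else 0) <= / 2.
  apply: (Rle_trans _ (\rsum_(0 <= q < N.+1) (if q == a then / 2 else 0))).
    by apply: rsum_mask => // q _ _; case: eqP; lra.
  rewrite -big_mkcond big_nat1_eq; case: ifP; lra.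
rewrite /E rsum_plus; have := one_le 2%N; have := one_le p; lra.
Qed.

End Modulus.

(** * Chebyshev and Mertens type sums over primes *)

Definition rle (x y : R) : bool := if Rle_dec x y then true else false.
Lemma rleP x y : reflect (x <= y) (rle x y).
Proof. by rewrite /rle; case: Rle_dec => h; constructor. Qed.

Lemma nat_floor x : 0 <= x -> exists n, INR n <= x < INR n + 1.
Proof.
move=> h; exists (Z.to_nat (up x - 1)); have [a b] := archimed x.
have p : (0 < up x)%Z by apply: lt_IZR; lra.
rewrite INR_IZR_INZ Z2Nat.id; last by lia.
rewrite minus_IZR; lra.
Qed.

Lemma cnt_multiples d N : (0 < d)%N -> (\sum_(1 <= k < N.+1) (d %| k) = N %/ d)%N.
Proof.
move=> d0; elim: N => [|N IH]; first by rewrite big_geq // div0n.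
by rewrite big_nat_recr //= IH divnS // addnC.
Qed.

Lemma rsum_le_index N M (P : pred nat) (F : nat -> R) : (N <= M)%N -> (forall q, P q -> 0 <= F q) ->
  \rsum_(0 <= q < N.+1 | P q) F q <= \rsum_(0 <= q < M.+1 | P q) F q.
Proof.
move=> h f0; rewrite (@big_cat_nat _ _ _ N.+1 0 M.+1) //=.
have : 0 <= \rsum_(N.+1 <= q < M.+1 | P q) F q by apply: rsum_ge0 => i _; exact: f0.
lra.
Qed.

(** log N! is at most N log N, and at least the sum of floor(N/p) log p, with floor(N/p) >= N/(2p)
    for p <= N. *)
Lemma sum_ln_over_p N : (0 < N)%N ->
  \psum_(p <= N) (lnN p / INR p) <= 2 * lnN N.
Proof.
move=> N0; have n0 := INR_gt0 N0.
have up : \rsum_(1 <= k < N.+1) lnN k <= INR N * lnN N.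
  have : forall M, (M <= N)%N -> \rsum_(1 <= k < M.+1) lnN k <= INR M * lnN N; last by apply.
  elim=> [|M IH] h; first by rewrite big_geq // Rmult_0_l; exact: Rle_refl.
  rewrite big_nat_recr //; have := @ln_INR_le M.+1 N isT h; have := IH (ltac:(lia)).
  set l := lnN M.+1; rewrite S_INR; move: l => l /=; lra.
have low : \psum_(p <= N) (INR (N %/ p) * lnN p) <= \rsum_(1 <= k < N.+1) lnN k.
  rewrite [X in _ <= X](eq_big_nat _ _ (F2 := fun k => \psum_(p <= N) (INR (logn p k) * lnN p))); last first.
    by move=> k hk; rewrite sum_ln_primes; [| lia].
  rewrite exchange_big /=; apply: rsum_le => p _ pp.
  rewrite -cnt_multiples ?prime_gt0 //.
  rewrite (big_morph INR plus_INR (erefl (INR 0))) big_distrl /=.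
  apply: rsum_le => k; rewrite mem_index_iota => hk _; apply: Rmult_le_compat_r; first exact: ln_INR_ge0.
  apply: le_INR; case: (boolP (p %| k)%N) => h; last exact/leP.
  by apply/leP; rewrite /= logn_gt0 mem_primes pp h; lia.
have : \psum_(p <= N) (INR N / 2 * (lnN p / INR p)) <= \psum_(p <= N) (INR (N %/ p) * lnN p).
  apply: rsum_le => p; rewrite mem_index_iota => hp pp.
  have p0 := INR_gt0 (prime_gt0 pp).
  have -> : INR N / 2 * (lnN p / INR p) = (INR N / (2 * INR p)) * lnN p by field; lra.
  apply: Rmult_le_compat_r; first exact: ln_INR_ge0.
  apply: (Rmult_le_reg_r (2 * INR p)); first lra.
  rewrite /Rdiv Rmult_assoc Rinv_l; last lra.
  have : (N <= N %/ p * (2 * p))%N.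
    have := divn_eq N p; have := ltn_pmod N (prime_gt0 pp).
    have : (0 < N %/ p)%N by rewrite divn_gt0 ?prime_gt0 //; lia.
    move: (N %/ p)%N (N %% p)%N => a b; nia.
  by move/leP/le_INR; rewrite mult_INR mult_INR /=; lra.
rewrite rsum_scal => h.
apply: (Rmult_le_reg_l (INR N / 2)); first lra.
lra.
Qed.

Lemma sum_ln_over_p_le L N : 0 <= L ->
  \psum_(p <= N | rle (lnN p) L) (lnN p / INR p) <= 2 * L.
Proof.
move=> L0; have [n [n1 n2]] := nat_floor (Rlt_le _ _ (exp_pos L)).
have e1 : 1 <= exp L by have := exp_ineq1_le L; lra.
have n0 : (0 < n)%N by case: (n) n2 => // /=; lra.
apply: (Rle_trans _ (2 * lnN n)); last first.
  by have := ln_le _ _ (INR_gt0 n0) n1; rewrite ln_exp; lra.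
apply: Rle_trans (sum_ln_over_p n0).
have t0 p : 0 <= lnN p / INR p.
  case: p => [|p]; first by rewrite /Rdiv /= Rinv_0; lra.
  by apply: Rmult_le_pos; [exact: ln_INR_ge0 | apply/Rinv_ge0/INR_gt0].
apply: (Rle_trans _ (\rsum_(0 <= p < (maxn N n).+1 | prime p && rle (lnN p) L) (lnN p / INR p))).
  by apply: rsum_le_index => //; exact: leq_maxl.
rewrite (@big_cat_nat _ _ _ n.+1 0 (maxn N n).+1) //=; last by rewrite ltnS leq_maxr.
rewrite [X in _ + X]big_nat_cond [X in _ + X]big1 ?Rplus_0_r; last first.
  move=> p /andP [hp /andP [pp /rleP h]].
  have p0 := INR_gt0 (prime_gt0 pp).
  have : INR p <= exp L by rewrite -(exp_ln (INR p)) //; exact: exp_le.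
  have : INR n + 1 <= INR p by rewrite -S_INR; apply: le_INR; lia.
  lra.
by apply: rsum_mask => // p _ /andP [].
Qed.

(** In this range 1/p <= (log p / p)/L, and the sum of log p / p is at most 4L. *)
Lemma sum_dyadic L N : 0 < L ->
  \psum_(p <= N | (rle L (lnN p) && rle (lnN p) (2 * L))) (/ INR p) <= 4.
Proof.
move=> L0.
apply: (Rle_trans _ (/ L * \psum_(p <= N | rle (lnN p) (2 * L)) (lnN p / INR p))).
  rewrite -rsum_scal.
  apply: (Rle_trans _ (\psum_(p <= N | (rle L (lnN p) && rle (lnN p) (2 * L))) (/ L * (lnN p / INR p)))).
    apply: rsum_le => p _ /andP [pp /andP [/rleP h1 _]].
    have p0 := INR_gt0 (prime_gt0 pp).
    have -> : / L * (lnN p / INR p) = lnN p * / L * / INR p by rewrite /Rdiv; ring.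
    rewrite -{1}(Rmult_1_l (/ INR p)); apply: Rmult_le_compat_r; first by apply/Rinv_ge0.
    by apply: (Rmult_le_reg_r L) => //; rewrite Rmult_assoc Rinv_l; lra.
  apply: rsum_mask => [p _ /andP [-> /andP [_ ->]] // | p _ /andP [pp _]].
  have p0 := INR_gt0 (prime_gt0 pp).
  by repeat apply: Rmult_le_pos; try exact: ln_INR_ge0; apply/Rinv_ge0.
have := @sum_ln_over_p_le (2 * L) N (ltac:(lra)) => h.
apply: (Rle_trans _ (/ L * (2 * (2 * L)))); last by right; field; lra.
by apply: Rmult_le_compat_l => //; apply/Rinv_ge0.
Qed.

(** Cut into the ranges L 2^I < log p <= L 2^(I+1), each of mass at most 4. The first r ranges give
    4r; after them log p exceeds La and the exponential makes the contributions decay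
    geometrically. *)
Lemma sum_tail L La r N : 0 < L -> 0 < La -> La <= L * 2 ^ r ->
  \psum_(p <= N | ~~ rle (lnN p) L) (exp (- lnN p / La) / INR p) <= 4 * INR r + 8.
Proof.
move=> L0 La0 hr.
pose S I := \psum_(p <= N | (~~ rle (lnN p) L && rle (lnN p) (L * 2 ^ I))) (exp (- lnN p / La) / INR p).
have tp I : 0 < 2 ^ I by apply: pow_lt; lra.
have step I : S I.+1 <= S I + 4 * exp (- (L * 2 ^ I / La)).
  have pl : L <= L * 2 ^ I by have := pow_R1_Rle 2 I (ltac:(lra)); nra.
  apply: (Rle_trans _ (S I + \psum_(p <= N | (rle (L * 2 ^ I) (lnN p) && rle (lnN p) (2 * (L * 2 ^ I)))) (exp (- (L * 2 ^ I / La)) * / INR p))).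
    rewrite /S big_mkcond [X in _ <= X + _]big_mkcond [X in _ <= _ + X]big_mkcond -rsum_plus.
    apply: rsum_le => p _ _; case: (boolP (prime p)) => pp /=; last lra.
    have ip : 0 < / INR p by apply/Rinv_0_lt_compat/INR_gt0/prime_gt0.
    have -> : 2 * (L * 2 ^ I) = L * 2 ^ I.+1 by rewrite /=; ring.
    have e0 := exp_pos (- lnN p / La); have e1 := exp_pos (- (L * 2 ^ I / La)).
    have m0 : 0 < exp (- lnN p / La) / INR p by apply: Rmult_lt_0_compat.
    have m1 : 0 < exp (- (L * 2 ^ I / La)) * / INR p by apply: Rmult_lt_0_compat.
    case: (rleP (lnN p) L) => h1 /=.
      by case: ifP => _; lra.
    case: (rleP (lnN p) (L * 2 ^ I)) => h2 /=.
      by case: ifP => _; case: ifP => _; lra.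
    case: (rleP (lnN p) (L * 2 ^ I.+1)) => h3 /=; last by rewrite andbF; lra.
    rewrite andbT; case: rleP => h4; last lra.
    rewrite Rplus_0_l; apply: Rmult_le_compat_r; first lra.
    apply: exp_le; have : L * 2 ^ I / La <= lnN p / La by apply: Rmult_le_compat_r; [apply/Rinv_ge0 | lra].
    by rewrite /Rdiv; lra.
  apply: Rplus_le_compat_l; rewrite rsum_scal Rmult_comm; apply: Rmult_le_compat_r; first by apply/exp_ge0.
  by apply: sum_dyadic; apply: Rmult_lt_0_compat.
have S0 : S 0%N <= 0.
  rewrite /S big1; first exact: Rle_refl.
  by move=> p /andP [_ /andP [/negP h1]]; rewrite /= Rmult_1_r.
have S1 I : S I <= 4 * INR I.
  elim: I => [|I IH]; first by rewrite /=; lra.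
  rewrite S_INR; have := step I.
  have : exp (- (L * 2 ^ I / La)) <= 1.
    have : 0 < L * 2 ^ I / La by apply: Rdiv_lt_0_compat => //; apply: Rmult_lt_0_compat.
    by move=> h; apply: exp_le1; lra.
  lra.
have S2 k : S (r + k)%N <= 4 * INR r + 8 * (1 - (/ 2) ^ k).
  elim: k => [|k IH]; first by rewrite addn0 /=; have := S1 r; lra.
  rewrite addnS; have := step (r + k)%N.
  have : exp (- (L * 2 ^ (r + k) / La)) <= (/ 2) ^ k.+1.
    have h : INR k.+1 <= L * 2 ^ (r + k) / La.
      apply: (Rmult_le_reg_r La) => //; rewrite /Rdiv Rmult_assoc Rinv_l ?Rmult_1_r; last lra.
      rewrite pow_add -Rmult_assoc.
      have a : INR k.+1 <= 2 ^ k.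
        elim: (k) => [|j IHj]; first by rewrite /=; lra.
        rewrite S_INR [2 ^ _]/=; have : 1 <= 2 ^ j by apply: pow_R1_Rle; lra.
        lra.
      rewrite Rmult_comm; apply: Rmult_le_compat => //; [lra | exact: pos_INR].
    apply: (Rle_trans _ (exp (- INR k.+1))); first by apply: exp_le; lra.
    have : forall n, exp (- INR n) <= (/ 2) ^ n; last by apply.
    elim=> [|n IHn]; first by rewrite /= Ropp_0 exp_0; lra.
    have -> : - INR n.+1 = Ropp 1 + - INR n by rewrite S_INR; ring.
    rewrite exp_plus [_ ^ _]/=; apply: Rmult_le_compat => //; try exact/exp_ge0.
    rewrite exp_Ropp; apply: Rinv_le_contravar; first lra.
    have := exp_ineq1_le 1; lra.
  rewrite [(/ 2) ^ k.+1]/=; have := pow_lt (/ 2) k (ltac:(lra)); lra.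
have [n [_ hn]] := nat_floor (Rlt_le _ _ (Rdiv_lt_0_compat _ _ (ltac:(have := ln_INR_ge0 N; lra) : 0 < lnN N + 1) L0)).
apply: (Rle_trans _ (S (r + n)%N)); last first.
  have := S2 n; have := pow_lt (/ 2) n (ltac:(lra)); lra.
apply: rsum_mask => [p hp /andP [pp -> /=]|p _ /andP [pp _]]; last first.
  by apply/Rlt_le/Rmult_lt_0_compat; [exact: exp_pos | apply/Rinv_0_lt_compat/INR_gt0/prime_gt0].
rewrite pp /=; apply/rleP.
rewrite mem_index_iota in hp.
have l1 : lnN p <= lnN N by apply: ln_INR_le; [exact: prime_gt0 | lia].
have l2 : lnN N + 1 < (INR n + 1) * L.
  have := Rmult_lt_compat_r L _ _ L0 hn; rewrite {1}/Rdiv Rmult_assoc Rinv_l; lra.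
have a : INR n + 1 <= 2 ^ (r + n).
  have : INR n + 1 <= 2 ^ n.
    elim: (n) => [|j IHj]; first by rewrite /=; lra.
    rewrite S_INR [2 ^ _]/=; have : 1 <= 2 ^ j by apply: pow_R1_Rle; lra.
    lra.
  rewrite pow_add; have : 1 <= 2 ^ r by apply: pow_R1_Rle; lra.
  have := tp n; nra.
have := Rmult_le_compat_r L _ _ (Rlt_le _ _ L0) a; lra.
Qed.

(** * Prime sums compared with log|zeta(1 + 1/La + i tau)|, which is [lz] *)

Definition lz (La tau : R) : R := Re (DS (lc one) 0 (1 + / La, tau)).

Lemma zeta_exp La tau : 0 < La -> Cmod (zeta (1 + / La, tau)) = exp (lz La tau).
Proof.
move=> h; have i0 : 0 < / La by apply: Rinv_0_lt_compat.
have hs : 1 < Re ((1 + / La, tau) : C) by rewrite /=; lra.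
have -> : zeta (1 + / La, tau) = DS one 0 (1 + / La, tau).
  exact: (DS_dseries Rle01 (sum_growth_1 one_b) Rle01 hs).
by rewrite (DS_exp (chi := one) erefl one_M one_b hs) Cmod_cexp.
Qed.

Lemma lz_upper La : 0 < La -> lz La 0 <= ln (1 + La).
Proof.
move=> h; have i0 : 0 < / La by apply: Rinv_0_lt_compat.
rewrite -(ln_exp (lz La 0)) -zeta_exp //; apply: ln_le; first by rewrite zeta_exp //; exact: exp_pos.
have -> : zeta (1 + / La, 0) = DS one 0 (1 + / La, 0).
  by apply: (DS_dseries Rle01 (sum_growth_1 one_b) Rle01); rewrite /=; lra.
by have := zeta_real_bound i0; rewrite Rinv_inv.
Qed.

(** The coefficients of log zeta are nonnegative, and 1 + cos >= 0 in each term. *)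
Lemma lz_lower La tau : 0 < La -> - lz La 0 <= lz La tau.
Proof.
move=> h; have i0 : 0 < / La by apply: Rinv_0_lt_compat.
have h1 : 1 < Re ((1 + / La, tau) : C) by rewrite /=; lra.
have h2 : 1 < Re ((1 + / La, 0) : C) by rewrite /=; lra.
have l1 := limC_Re (DS_lim Rle01 (sum_growth_1 (lc_b one_b)) Rle01 0 h1).
have l2 := limC_Re (DS_lim Rle01 (sum_growth_1 (lc_b one_b)) Rle01 0 h2).
have pos M : 0 <= Re (dps (lc one) 0 (1 + / La, tau) M) + Re (dps (lc one) 0 (1 + / La, 0) M).
  elim: M => [|M IH]; first by rewrite !dps_0 /=; lra.
  have tm : forall (a : R) m y u, Re (RtoC a * fj 0 m (y, u))%C = a * (exp (- y * lnN m) * cos (u * lnN m)).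
    by move=> a m y u; rewrite Re_mult Re_fj0 Re_RtoC Im_RtoC; ring.
  rewrite !dps_S; move: (dps (lc one) 0 _ M) (dps (lc one) 0 _ M) IH => u v IH.
  rewrite (Re_plus u) (Re_plus v) !tm !Rmult_0_l cos_0.
  set e := exp _; have e0 : 0 < e := exp_pos _.
  have [c0 c1] := cc_01 M.+1; rewrite /lc /one Rmult_1_r.
  have cb := COS_bound (tau * lnN M.+1).
  have : 0 <= cc M.+1 * e * (1 + cos (tau * lnN M.+1)) by repeat apply: Rmult_le_pos; lra.
  lra.
apply: Rnot_lt_le => lt; set S := - lz La 0 - lz La tau.
have S0 : 0 < S by rewrite /S; lra.
have [N1 n1] := l1 (S / 2) (ltac:(lra)). have [N2 n2] := l2 (S / 2) (ltac:(lra)).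
have := n1 (N1 + N2)%N (ltac:(lia)); have := n2 (N1 + N2)%N (ltac:(lia)); have := pos (N1 + N2)%N.
rewrite -/(lz La tau) -/(lz La 0) => p /Rabs_def2 [a1 a2] /Rabs_def2 [a3 a4]; rewrite /S in a1 a2 a3 a4; lra.
Qed.

Lemma prime_inv_sq_sum N : \psum_(p <= N) exp (- 2 * lnN p) <= 2.
Proof.
apply: (Rle_trans _ (\psum_(p <= N) pw (1 + 1) p)).
  apply: rsum_le => p _ pp; have := prime_gt0 pp; case: (p) => // n _.
  by rewrite /pw; right; congr exp; ring.
apply: Rle_trans (prime_sum_le _ (fun p _ => pw_ge0 (1 + 1) p)) _.
by rewrite -sum_n_big //; have := @pw_sum_le 1 N Rlt_0_1; rewrite Rinv_1; lra.
Qed.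

(** [prime_power_sum] discards cubes and higher powers at a cost of 12; on this line the squares add
    up to at most 1. *)
Lemma zeta_prime_sum La tau N : 0 < La ->
  Rabs (Re (dps (lc one) 0 (1 + / La, tau) N)
    - \psum_(p <= N) (exp (- (1 + / La) * lnN p) * cos (tau * lnN p))) <= 13.
Proof.
move=> h; have i0 : 0 < / La by apply: Rinv_0_lt_compat.
have w01 (n : nat) : 0 <= 1 <= 1 by lra.
have := prime_power_sum (chi := one) erefl one_M one_b w01 (x := 1 + / La) tau N (ltac:(lra)).
have -> : dps (fun n => lc one n * 1) 0 (1 + / La, tau) N = dps (lc one) 0 (1 + / La, tau) N.
  by rewrite !dps_big; apply: eq_bigr => n _; rewrite Rmult_1_r.
have -> : \psum_(p <= N) (one p * pterm (fun _ => 1) (1 + / La) tau p) =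
   \psum_(p <= N) (exp (- (1 + / La) * lnN p) * cos (tau * lnN p)).
  by apply: eq_bigr => p _; rewrite /one /pterm; ring.
set A := Re _; set B := \big[_/_]_(_ <= _ < _ | _) (exp _ * _); set D := \big[_/_]_(_ <= _ < _ | _) _.
suff : Rabs D <= 1.
  move=> hd hb; have -> : A - B = (A - B - D) + D by ring.
  by apply: Rle_trans (Rabs_triang _ _) _; lra.
apply: Rle_trans (rsum_abs _ _ _) _.
apply: (Rle_trans _ (/ 2 * \psum_(p <= N) exp (- 2 * lnN p))); last first.
  have := prime_inv_sq_sum N; lra.
rewrite -rsum_scal; apply: (Rle_trans _ (\psum_(p <= N | (p ^ 2 <= N)%N) (/ 2 * exp (- 2 * lnN p)))); last first.
  by apply: rsum_mask => [p _ /andP [] // | p _ _]; have := exp_pos (- 2 * lnN p); lra.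
apply: rsum_le => p _ _; rewrite /one /pterm2 pow1 Rmult_1_r Rmult_1_l !Rabs_mult (Rabs_pos_eq (/ 2)); last lra.
have e0 := exp_pos (- (2 * (1 + / La)) * lnN p); rewrite (Rabs_pos_eq (exp _)); last lra.
have e1 : exp (- (2 * (1 + / La)) * lnN p) <= exp (- 2 * lnN p).
  by apply: exp_le; have := ln_INR_ge0 p; nra.
have c0 : Rabs (cos (2 * tau * lnN p)) <= 1 by apply: Rabs_le; have := COS_bound (2 * tau * lnN p); lra.
have c1 := Rabs_pos (cos (2 * tau * lnN p)); nra.
Qed.

(** Compares a cutoff [omega] at log q = L with the factor q^(-1/La) coming from zeta. For log q <=
    L the two differ by at most (1 + c) log q / L, which sums to 2 + 2c by [sum_ln_over_p_le]. For
    log q > L only q^(-1/La) is left, and [sum_tail] bounds it at the price 4r + 8. *)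
Lemma zeta_compare La L r c omega tau N : 1 <= La -> 0 < L <= La -> La <= L * 2 ^ r -> 0 <= c ->
  (forall q, prime q -> 0 <= omega q <= 1) -> (forall q, prime q -> L < lnN q -> omega q = 0) ->
  (forall q, prime q -> lnN q <= L -> 1 - omega q <= c * lnN q / L) ->
  (forall q, (N < q)%N -> prime q -> omega q = 0) ->
  \psum_(q <= N) (omega q / INR q * cos (tau * lnN q)) <= lz La tau + (4 * INR r + 2 * c + 24).
Proof.
move=> La1 [L0 LLa] hr c0 o01 oL oc oN.
have i0 : 0 < / La by apply: Rinv_0_lt_compat; lra.
have h1 : 1 < Re ((1 + / La, tau) : C) by rewrite /=; lra.
have l1 := limC_Re (DS_lim Rle01 (sum_growth_1 (lc_b one_b)) Rle01 0 h1).
have [N1 n1] := l1 1 (ltac:(lra)).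
set M := (N + N1)%N.
have : Re (dps (lc one) 0 (1 + / La, tau) M) < lz La tau + 1.
  by have := n1 M (ltac:(lia)); rewrite -/(lz La tau) => /Rabs_def2; lra.
have := @zeta_prime_sum La tau M (ltac:(lra)); move=> /Rabs_le_between.
have -> : \psum_(q <= N) (omega q / INR q * cos (tau * lnN q)) =
    \psum_(q <= M) (omega q / INR q * cos (tau * lnN q)).
  rewrite [RHS](@big_cat_nat _ _ _ N.+1 0 M.+1) //=; last by rewrite ltnS leq_addr.
  rewrite [X in _ + X]big_nat_cond [X in _ + X]big1 ?Rplus_0_r // => q /andP [hq pq].
  by rewrite oN //; [rewrite /Rdiv; ring | lia].
set A := \big[_/_]_(_ <= _ < _ | _) _; set B := \big[_/_]_(_ <= _ < _ | _) (_ * _).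
suff : B - A <= 4 * INR r + 2 * c + 10 by lra.
rewrite -rsum_minus.
pose G q := (if rle (lnN q) L then (1 + c) / L * (lnN q / INR q) else 0) +
            (if ~~ rle (lnN q) L then exp (- lnN q / La) / INR q else 0).
apply: (Rle_trans _ (\psum_(q <= M) G q)); last first.
  rewrite /G rsum_plus -!big_mkcondr rsum_scal.
  have b1 := @sum_ln_over_p_le L M (ltac:(lra)). have b2 := sum_tail M L0 (ltac:(lra) : 0 < La) hr.
  have : (1 + c) / L * \psum_(p <= M | rle (lnN p) L) (lnN p / INR p) <= (1 + c) / L * (2 * L).
    by apply: Rmult_le_compat_l => //; apply/Rlt_le/Rdiv_lt_0_compat; lra.
  have -> : (1 + c) / L * (2 * L) = 2 + 2 * c by field; lra.
  move=> b3; apply: (Rle_trans _ ((2 + 2 * c) + (4 * INR r + 8))); last lra.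
  by apply: Rplus_le_compat; [exact: b3 | exact: b2].
apply: rsum_le => q _ pq.
have q0 := INR_gt0 (prime_gt0 pq). have l0 := ln_INR_ge0 q. have [w0 w1] := o01 q pq.
have iq : 0 < / INR q by apply: Rinv_0_lt_compat.
have -> : exp (- (1 + / La) * lnN q) = exp (- lnN q / La) / INR q.
  rewrite (_ : - (1 + / La) * lnN q = - lnN q / La + - lnN q); last by rewrite /Rdiv; ring.
  by rewrite exp_plus (exp_Ropp (ln _)) exp_ln.
set e := exp (- lnN q / La).
have e0 : 0 < e := exp_pos _.
have cb := COS_bound (tau * lnN q); set cs := cos _ in cb *.
have -> : omega q / INR q * cs - e / INR q * cs = (omega q - e) * cs / INR q by rewrite /Rdiv; ring.
have key : (omega q - e) * cs <= Rabs (omega q - e).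
  by have := Rle_abs (omega q - e); have := Rle_abs (- (omega q - e)); rewrite Rabs_Ropp; have := Rabs_pos (omega q - e); nra.
rewrite /G; case: (rleP (lnN q) L) => hl /=.
  rewrite Rplus_0_r (_ : (1 + c) / L * (lnN q / INR q) = ((1 + c) / L * lnN q) / INR q); last by rewrite /Rdiv; ring.
  apply: Rmult_le_compat_r; first lra.
  apply: Rle_trans key _; apply: Rabs_le.
  have e1 : 1 - lnN q / La <= e by have := exp_ineq1_le (- lnN q / La); rewrite -/e /Rdiv; lra.
  have e2 : e <= 1.
    apply: exp_le1; rewrite /Rdiv; nra.
  have b1 : lnN q / La <= lnN q / L by apply: Rmult_le_compat_l => //; apply: Rinv_le_contravar; lra.
  have b2 := oc q pq hl.
  have -> : (1 + c) / L * lnN q = lnN q / L + c * lnN q / L by field; lra.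
  have : 0 <= lnN q / L by apply: Rmult_le_pos => //; apply/Rinv_ge0.
  have : 0 <= c * lnN q / L by apply: Rmult_le_pos; [apply: Rmult_le_pos | apply/Rinv_ge0].
  lra.
rewrite Rplus_0_l oL //; last lra.
apply: Rmult_le_compat_r; first lra.
by rewrite -/e; nra.
Qed.

(** * Periodic functions, Ramanujan sums and products of Legendre symbols *)

Definition per (f : nat -> R) (Q : nat) := forall n, f (n + Q)%N = f n.

Lemma rsum_mkcond (I : Type) (r : seq I) (P : pred I) (F : I -> R) :
  \rsum_(i <- r | P i) F i = \rsum_(i <- r) (if P i then F i else 0).
Proof. exact: big_mkcond. Qed.

Lemma per_mul f Q k : per f Q -> per f (k * Q)%N.
Proof. by move=> h; elim: k => [|k IH] n; rewrite ?addn0 // mulSn addnA IH h. Qed.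

Lemma per_mod f Q n : per f Q -> f (n %% Q)%N = f n.
Proof. by move=> h; rewrite {2}(divn_eq n Q) addnC per_mul. Qed.

Lemma per_prod f g Q : per f Q -> per g Q -> per (fun n => f n * g n) Q.
Proof. by move=> hf hg n; rewrite hf hg. Qed.

(** Multiplication by a unit permutes the residues modulo Q. *)
Lemma per_reindex f Q b : (0 < Q)%N -> per f Q -> coprime b Q ->
  \rsum_(0 <= n < Q) f (b * n)%N = \rsum_(0 <= n < Q) f n.
Proof.
move=> Q0 hf cb.
rewrite (eq_bigr (fun n => f ((b * n) %% Q)%N)); last by move=> n _; rewrite per_mod.
rewrite -(big_map (fun n => (b * n) %% Q)%N xpredT f); apply: perm_big.
have un : uniq [seq (b * n) %% Q | n <- index_iota 0 Q]%N.
  rewrite map_inj_in_uniq ?iota_uniq // => x y; rewrite !mem_index_iota /= => hx hy e.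
  have key u v : (u <= v < Q)%N -> ((b * u) %% Q = (b * v) %% Q)%N -> u = v.
    move=> huv /eqP; rewrite eq_sym eqn_mod_dvd; last by rewrite leq_mul2l; lia.
    rewrite -mulnBr Gauss_dvdr 1?coprime_sym //.
    case: (ltnP u v) => ?; last by lia.
    by move=> /dvdn_leq; lia.
  by case: (leqP x y) => h; [apply: key | apply/esym/key]; rewrite ?e //; lia.
apply: uniq_perm => //; first exact: iota_uniq.
have [] // := @uniq_min_size _ [seq (b * n) %% Q | n <- index_iota 0 Q]%N (index_iota 0 Q) un; last first.
  by rewrite size_map.
by move=> x /mapP [n _ ->]; rewrite mem_index_iota ltn_pmod.
Qed.

Lemma per_sum_mul f Q k : per f Q ->
  \rsum_(0 <= n < k * Q) f n = INR k * \rsum_(0 <= n < Q) f n.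
Proof.
move=> hf; elim: k => [|k IH]; first by rewrite mul0n big_geq // Rmult_0_l.
rewrite S_INR Rmult_plus_distr_r Rmult_1_l -IH (@big_cat_nat _ _ _ (k * Q)%N) //; last by rewrite mulSn leq_addl.
apply: (f_equal2 Rplus) => //.
rewrite mulSn -{1}(add0n (k * Q)%N) big_addn addnK; apply: eq_bigr => n _.
exact: per_mul.
Qed.

Lemma sum_multiples (f : nat -> R) p Q : (0 < p)%N ->
  \rsum_(0 <= n < Q * p | (p %| n)%N) f n = \rsum_(0 <= n < Q) f (p * n)%N.
Proof.
move=> p0; elim: Q => [|Q IH]; first by rewrite mul0n !big_geq.
rewrite (@big_cat_nat _ _ _ (Q * p)%N) //; last by rewrite mulSn leq_addl.
rewrite [RHS]big_nat_recr // -IH; apply: (f_equal2 Rplus) => //.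
rewrite mulSn -{1}(add0n (Q * p)%N) big_addn addnK.
rewrite (eq_bigl (fun n => (p %| n)%N)); last by move=> n; rewrite dvdn_addl // dvdn_mull.
rewrite big_mkcond big_ltn // dvdn0 add0n (big_nat_cond) big1 /=; last first.
  by move=> n /andP [hn _]; case: ifP => // /dvdn_leq; lia.
by rewrite mulnC; ring.
Qed.

Lemma Sp_shift f Q : (0 < Q)%N -> per f Q -> Sp f Q = \rsum_(0 <= n < Q) f n.
Proof.
move=> Q0 hf.
have -> : Sp f Q = \rsum_(1 <= n < Q.+1) f n.
  by elim: (Q) => [|n IH]; [rewrite big_geq | rewrite /= IH [RHS]big_nat_recr].
rewrite big_nat_recr // [RHS]big_ltn // -[f Q]/(f (0 + Q)%N) hf; exact: Rplus_comm.
Qed.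

Lemma per_mean_bound f Q K mu n : (0 < Q)%N -> per f Q -> 0 < K -> (forall n, Rabs (f n) <= K) ->
  \rsum_(0 <= n < Q) f n = mu * INR Q -> Rabs (Sp f n - INR n * mu) <= 2 * K * INR Q.
Proof.
move=> Q0 hf K0 hK hmu.
have qp := INR_gt0 Q0.
have lin c m : Sp (fun n => f n / K - c) m = Sp f m / K - INR m * c.
  elim: m => [|m IH]; first by rewrite /=; field; lra.
  by rewrite [LHS]/= IH S_INR [Sp f _.+1]/=; field; lra.
have := @Sp_periodic (fun n => f n / K) Q Q0 _ _ n.
have -> : Sp (fun n => f n / K) Q = Sp f Q / K.
  by elim: (Q) => [|m IH]; [rewrite /=; field; lra | rewrite /= IH; field; lra].
rewrite (Sp_shift Q0 hf) hmu lin => H.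
have {}H := H (fun m _ => ltac:(by rewrite hf)) (fun m => ltac:(rewrite Rabs_div ?(Rabs_pos_eq K); try lra; apply: (Rmult_le_reg_r K) => //; rewrite /Rdiv Rmult_assoc Rinv_l; [have := hK m; lra | lra])).
have -> : Sp f n - INR n * mu = (Sp f n / K - INR n * (mu * INR Q / K / INR Q)) * K by field; lra.
rewrite Rabs_mult (Rabs_pos_eq K); last lra.
have := Rmult_le_compat_r K _ _ (Rlt_le _ _ K0) H; lra.
Qed.

(* [g p m] is [mu(p)] times the Ramanujan sum [c_p(m)]; as a function of [m] it has mean zero. *)
Definition g (p m : nat) : R := if (p %| m)%N then 1 - INR p else 1.
Definition gs (l : seq nat) (m : nat) : R := \big[Rmult/1]_(p <- l) g p m.
Definition pr (l : seq nat) : nat := (\prod_(p <- l) p)%N.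
(** A word of primes, repetitions allowed, codes the product of the symbols (8m/q) over its
    letters. *)
Definition eps (w : seq nat) (m : nat) : R := \big[Rmult/1]_(q <- w) IZR (leg q (8 * m)).

Lemma pr_cat l1 l2 : pr (l1 ++ l2) = (pr l1 * pr l2)%N. Proof. by rewrite /pr big_cat. Qed.
Lemma pr_gt0 l : all prime l -> (0 < pr l)%N.
Proof.
elim: l => [|p l IH] /=; first by rewrite /pr big_nil.
by move=> /andP [pp /IH h]; rewrite /pr big_cons muln_gt0 prime_gt0.
Qed.

Lemma dvdn_pr q l : all prime l -> prime q -> (q %| pr l)%N = (q \in l).
Proof.
move=> + pq; elim: l => [|p l IH] /=; first by rewrite /pr big_nil Euclid_dvd1.
by move=> /andP [pp /IH h]; rewrite /pr big_cons -/(pr l) Euclid_dvdM // dvdn_prime2 // h inE.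
Qed.

Lemma coprime_pr b l : all prime l -> (forall q, q \in l -> ~~ (q %| b)%N) -> coprime b (pr l).
Proof.
elim: l => [|p l IH] /=; first by rewrite /pr big_nil coprimen1.
move=> /andP [pp hl] h; rewrite /pr big_cons -/(pr l) coprimeMr IH // ?andbT; last by move=> q hq; apply: h; rewrite inE hq orbT.
by rewrite coprime_sym prime_coprime // h // inE eqxx.
Qed.

Lemma g_per p Q : (p %| Q)%N -> per (g p) Q.
Proof. by move=> h n; rewrite /g dvdn_addl. Qed.

Lemma gs_per l Q : (forall p, p \in l -> (p %| Q)%N) -> per (gs l) Q.
Proof. by move=> h n; rewrite /gs big_seq [RHS]big_seq; apply: eq_bigr => p hp; rewrite (g_per (h p hp)). Qed.

Lemma eps_per w Q : (forall q, q \in w -> [&& prime q, odd q & (q %| Q)%N]) -> per (eps w) Q.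
Proof.
move=> h n; rewrite /eps big_seq [RHS]big_seq; apply: eq_bigr => q /h /and3P [pq oq /dvdnP [k ->]].
congr IZR; apply: leg_mod => //.
by rewrite mulnDr mulnCA mulnA addnC modnMDl.
Qed.

Lemma eps_abs w n : all prime w -> all odd w -> Rabs (eps w n) <= 1.
Proof.
rewrite /eps; elim: w => [|q w IH] /=; first by rewrite big_nil Rabs_R1; lra.
move=> /andP [pq aw] /andP [oq ow]; rewrite big_cons Rabs_mult.
have h : Rabs (IZR (leg q (8 * n))) <= 1.
  case: (boolP (q %| 8 * n)%N) => d; first by rewrite leg0 // Rabs_R0; lra.
  by case: (legP pq oq d) => [[_ ->]|[_ ->]]; rewrite ?Rabs_R1 ?Rabs_m1; lra.
have := IH aw ow; have := Rabs_pos (IZR (leg q (8 * n))); set E := \big[_/_]_(_ <- _) _; have := Rabs_pos E; nra.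
Qed.

Lemma gs_abs l n : all prime l -> Rabs (gs l n) <= INR (pr l).
Proof.
rewrite /gs /pr; elim: l => [|q w IH] /=; first by rewrite !big_nil /= Rabs_R1; lra.
move=> /andP [pq aw]; rewrite !big_cons Rabs_mult INR_mul.
apply: Rmult_le_compat; try exact: Rabs_pos; last exact: IH.
have := INR_ge1 (prime_gt0 pq) => q1; rewrite /g; case: ifP => _; last by rewrite Rabs_R1.
by apply: Rabs_le; lra.
Qed.

Lemma gs_unit l b n : (forall p, p \in l -> coprime p b) -> gs l (b * n)%N = gs l n.
Proof.
move=> h; rewrite /gs big_seq [RHS]big_seq; apply: eq_bigr => p /h cb.
by rewrite /g Gauss_dvdr.
Qed.

Definition even_word (w : seq nat) : bool := all (fun q => ~~ odd (count_mem q w)) w.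

(** Let q0 have odd multiplicity, and by the Chinese remainder theorem let b be a nonresidue modulo
    q0 and 1 modulo every other prime involved. Replacing n by bn permutes the residues, preserves
    [gs] and changes the sign of [eps]. *)
Lemma mean0_word w l : all prime w -> all odd w -> all prime l -> ~~ even_word w ->
  \rsum_(0 <= n < pr (w ++ l)) (gs l n * eps w n) = 0.
Proof.
move=> pw ow pl /allPn [q0 qw]; rewrite negbK => oc.
have pq0 : prime q0 := allP pw q0 qw. have oq0 : odd q0 := allP ow q0 qw.
pose L := [seq x <- w ++ l | x != q0].
have pL : all prime L.
  apply/allP => x; rewrite mem_filter mem_cat => /andP [_ /orP [h|h]]; [exact: (allP pw) | exact: (allP pl)].
have cL : coprime q0 (pr L).
  by rewrite prime_coprime // dvdn_pr // mem_filter eqxx.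
have [r [nr lr]] := leg_nonres pq0 oq0.
pose b := chinese q0 (pr L) r 1.
have b1 : (b = r %[mod q0])%N := chinese_modl cL r 1.
have b2 : (b = 1 %[mod pr L])%N := chinese_modr cL r 1.
have bx x : x \in L -> (b = 1 %[mod x])%N.
  move=> hx; have d : (x %| pr L)%N by rewrite dvdn_pr //; exact: (allP pL).
  by rewrite -(modn_dvdm b d) b2 modn_dvdm.
have lb0 : leg q0 b = (-1)%Z by rewrite (leg_mod pq0 oq0 b1).
have cb x : x \in w ++ l -> coprime x b.
  move=> hx; have px : prime x by move: hx; rewrite mem_cat => /orP [h|h]; [exact: (allP pw) | exact: (allP pl)].
  rewrite prime_coprime //; case: (eqVneq x q0) => [->|ne].
    by apply/negP => /(leg0 pq0 oq0) e; rewrite e in lb0.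
  have e := bx x; rewrite mem_filter ne hx in e.
  by rewrite /dvdn e // modn_small ?prime_gt1.
have pwl : all prime (w ++ l) by rewrite all_cat pw pl.
have dv x : x \in w ++ l -> (x %| pr (w ++ l))%N.
  by move=> hx; rewrite dvdn_pr //; exact: (allP pwl).
have P : per (fun n => gs l n * eps w n) (pr (w ++ l)).
  apply: per_prod; first by apply: gs_per => p hp; apply: dv; rewrite mem_cat hp orbT.
  by apply: eps_per => q hq; rewrite (allP pw) // (allP ow) // dv // mem_cat hq.
have cB : coprime b (pr (w ++ l)).
  apply: coprime_pr => // q hq; have := cb q hq; rewrite prime_coprime //; exact: (allP pwl).
have E n : eps w (b * n)%N = - eps w n.
  have -> : eps w (b * n)%N = \big[Rmult/1]_(q <- w) IZR (leg q b) * eps w n.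
    rewrite /eps -big_split /= big_seq [RHS]big_seq; apply: eq_bigr => q hq.
    by rewrite -mult_IZR -leg_M ?(allP pw) ?(allP ow) // mulnCA.
  have -> : \big[Rmult/1]_(q <- w) IZR (leg q b) = \big[Rmult/1]_(q <- w) (if q == q0 then -1 else 1).
    rewrite big_seq [RHS]big_seq; apply: eq_bigr => q hq; case: eqVneq => [->|ne]; first by rewrite lb0.
    have pq : prime q := allP pw q hq. have oq : odd q := allP ow q hq.
    rewrite (leg_mod pq oq (bx q _)); last by rewrite mem_filter ne mem_cat hq.
    have := leg_M pq oq 1 1; have : ~~ (q %| 1)%N by rewrite dvdn1 neq_ltn prime_gt1 ?orbT.
    by move=> /(legP pq oq) [[_ ->]|[_ ->]].
  have -> : \big[Rmult/1]_(q <- w) (if q == q0 then -1 else 1) = if odd (count_mem q0 w) then -1 else 1.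
    elim: (w) => [|x s IH]; first by rewrite big_nil.
    by rewrite big_cons IH /= oddD; case: eqP => _ /=; case: (odd _) => /=; ring.
  by rewrite oc; ring.
have := per_reindex (pr_gt0 pwl) P cB.
rewrite (eq_bigr (fun n => (-1) * (gs l n * eps w n))); last first.
  by move=> n _; rewrite E gs_unit; [ring | move=> p hp; apply: cb; rewrite mem_cat hp orbT].
rewrite rsum_scal; lra.
Qed.

(** As p is prime to pr(l), the multiples of p run through one full period of [gs l] while all n run
    through p of them; the weight -p at the multiples cancels the rest. *)
Lemma mean0_gs p l : prime p -> all prime l -> p \notin l ->
  \rsum_(0 <= n < pr (p :: l)) (g p n * gs l n) = 0.
Proof.
move=> pp pl np; have p0 := prime_gt0 pp; have Q0 := pr_gt0 pl.
have P : per (gs l) (pr l) by apply: gs_per => q hq; rewrite dvdn_pr //; exact: (allP pl).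
have -> : pr (p :: l) = (p * pr l)%N by rewrite /pr big_cons.
have -> : \rsum_(0 <= n < p * pr l) (g p n * gs l n) =
   \rsum_(0 <= n < p * pr l) gs l n - INR p * \rsum_(0 <= n < p * pr l | (p %| n)%N) gs l n.
  rewrite (rsum_mkcond _ (fun n => (p %| n)%N)) -rsum_scal -rsum_minus; apply: eq_bigr => n _; rewrite /g; case: ifP => _; ring.
rewrite (per_sum_mul p P) mulnC sum_multiples // per_reindex //; first by ring.
by rewrite prime_coprime // dvdn_pr.
Qed.

(** At one prime the mean of g^2 is (1 - 1/p) + (p - 1)^2/p = p - 1, and distinct primes are
    independent. *)
Lemma mean_gs_sq l : all prime l -> uniq l ->
  \rsum_(0 <= n < pr l) (gs l n * gs l n) = \big[Rmult/1]_(p <- l) (INR p - 1) * INR (pr l).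
Proof.
elim: l => [|p l IH].
  by move=> _ _; rewrite /pr !big_nil big_nat1 /gs !big_nil /=; ring.
move=> /= /andP [pp pl] /andP [np ul]; have p0 := prime_gt0 pp; have Q0 := pr_gt0 pl.
have P : per (fun n => gs l n * gs l n) (pr l) by apply: per_prod; apply: gs_per => q hq; rewrite dvdn_pr //; exact: (allP pl).
have -> : pr (p :: l) = (p * pr l)%N by rewrite /pr big_cons.
have -> : \rsum_(0 <= n < p * pr l) (gs (p :: l) n * gs (p :: l) n) =
   \rsum_(0 <= n < p * pr l) (gs l n * gs l n) + (INR p ^ 2 - 2 * INR p) * \rsum_(0 <= n < p * pr l | (p %| n)%N) (gs l n * gs l n).
  rewrite (rsum_mkcond _ (fun n => (p %| n)%N)) -rsum_scal -rsum_plus; apply: eq_bigr => n _; rewrite /gs big_cons /g; case: ifP => _; ring.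
rewrite (per_sum_mul p P) mulnC sum_multiples // (per_reindex Q0 P) ?IH //; last by rewrite prime_coprime // dvdn_pr.
rewrite big_cons INR_mul; ring.
Qed.

(** * A sieve weight of Selberg's type *)

Definition sqfree (d : nat) : bool := d == pr (primes d).
Definition Ds (D : nat) : seq nat := [seq d <- seq.iota 1 D | sqfree d].
Definition Sd (D : nat) : R := \rsum_(d <- Ds D) / INR d.
(** Selberg's weight in dual form: an average of the orthogonal functions [gs] with weights 1/d.
    They are all 1 at a prime exceeding D, so the square [nu] is a nonnegative majorant of such
    primes; by orthogonality its mean is at most about 1/Sd(D). *)
Definition Fw (D m : nat) : R := / Sd D * \rsum_(d <- Ds D) (gs (primes d) m / INR d).
Definition nu (D m : nat) : R := Fw D m * Fw D m.

Lemma primes_prime_all n : all prime (primes n).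
Proof. by apply/allP => p; rewrite mem_primes => /andP []. Qed.

Lemma mem_Ds D d : (d \in Ds D) = [&& (0 < d)%N, (d <= D)%N & sqfree d].
Proof. by rewrite mem_filter mem_iota andbC add1n ltnS -andbA. Qed.

Lemma Ds_INR D d : d \in Ds D -> 1 <= INR d.
Proof. by rewrite mem_Ds => /andP [h _]; exact: INR_ge1. Qed.

Lemma Sd_ge1 D : (0 < D)%N -> 1 <= Sd D.
Proof.
move=> D0; rewrite /Sd /Ds -(prednK D0) /= /sqfree /pr big_nil eqxx big_cons Rinv_1.
rewrite -{1}(Rplus_0_r 1); apply: Rplus_le_compat_l; apply: rsum_ge0 => d.
by rewrite mem_filter mem_iota => h _; apply/Rinv_ge0/INR_gt0; lia.
Qed.

Lemma sqfree_decomp n : (0 < n)%N -> exists d k, sqfree d /\ (0 < d)%N /\ (0 < k)%N /\ n = (d * k ^ 2)%N.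
Proof.
elim/ltn_ind: n => n IH n0.
case: (boolP (all (fun p => logn p n == 1)%N (primes n))) => [/allP h|/allPn [p hp lp]].
  exists n, 1%N; rewrite muln1; do !split => //.
  rewrite /sqfree {1}(prod_prime_decomp n0) prime_decompE big_map /= /pr big_seq [X in _ == X]big_seq.
  by apply/eqP; apply: eq_bigr => p /h /eqP ->; rewrite expn1.
have pp : prime p by move: hp; rewrite mem_primes => /andP [].
have p2 : (p ^ 2 %| n)%N.
  by rewrite pfactor_dvdn //; move: hp; rewrite -logn_gt0; move: lp; case: (logn p n) => [|[|]].
have [m e] := dvdnP p2.
have m0 : (0 < m)%N by case: (m) e n0 => // ->.
have mn : (m < n)%N by rewrite e -{1}(muln1 m) ltn_pmul2l // (ltn_exp2l 0) // prime_gt1.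
have [d [k [sd [d0 [k0 ek]]]]] := IH m mn m0.
exists d, (k * p)%N; split=> //; split=> //; split; first by rewrite muln_gt0 k0 prime_gt0.
by rewrite e ek expnMn mulnA.
Qed.

Lemma harmonic_lower N : lnN N.+1 <= \rsum_(1 <= n < N.+1) / INR n.
Proof.
elim: N => [|N IH]; first by rewrite big_geq //= ln_1; lra.
rewrite big_nat_recr //.
have [_ [_ h]] := @ln_succ N.+1 isT.
by apply: (Rle_trans _ (lnN N.+1 + / INR N.+1)) => //; exact: Rplus_le_compat_r.
Qed.

(** Every n <= D is d k^2 with d squarefree, so the harmonic sum, which is at least log D, is at
    most Sd(D) times the sum of 1/k^2, itself at most 2. *)
Lemma Sd_lower D : (0 < D)%N -> lnN D <= 2 * Sd D.
Proof.
move=> D0; have S1 := Sd_ge1 D0.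
have h1 : lnN D <= \rsum_(1 <= n < D.+1) / INR n.
  by apply: Rle_trans (harmonic_lower D); apply: ln_INR_le.
apply: Rle_trans h1 _.
have h2 : \rsum_(1 <= k < D.+1) (/ INR k * / INR k) <= 2.
  have := @pw_sum_le 1 D Rlt_0_1; rewrite Rinv_1 sum_n_big // (_ : 1 + 1 = 2); last ring.
  apply: Rle_trans; apply: rsum_le => k; rewrite mem_index_iota => hk _; right.
  have k0 : 0 < INR k by apply: INR_gt0; lia.
  have -> : pw 2 k = exp (- 2 * lnN k) by case: (k) hk.
  have -> : - 2 * lnN k = - lnN k + - lnN k by ring.
  by rewrite exp_plus exp_Ropp exp_ln.
apply: (Rle_trans _ (\rsum_(d <- Ds D) \rsum_(1 <= k < D.+1) (/ INR d * (/ INR k * / INR k)))); last first.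
  under eq_bigr => d _ do rewrite rsum_scal.
  rewrite -big_distrl /= -/(Sd D) Rmult_comm; apply: Rmult_le_compat_r => //; lra.
apply: (Rle_trans _ (\rsum_(1 <= n < D.+1) \rsum_(d <- Ds D) \rsum_(1 <= k < D.+1) (if (d * k ^ 2 == n)%N then / INR d * (/ INR k * / INR k) else 0))).
  apply: rsum_le => n; rewrite mem_index_iota => hn _.
  have [d [k [sd [d0 [k0 e]]]]] := sqfree_decomp (ltac:(lia) : (0 < n)%N).
  have dD : d \in Ds D by rewrite mem_Ds d0 sd andbT /=; apply: leq_trans (_ : (n <= D)%N); [rewrite e leq_pmulr // expn_gt0 k0 | lia].
  have kD : k \in index_iota 1 D.+1.
    rewrite mem_index_iota k0 /= ltnS; apply: leq_trans (_ : (n <= D)%N); last lia.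
    by rewrite e; apply: leq_trans (leq_pmull _ d0); rewrite expnS expn1 leq_pmulr.
  have nn d' k' : d' \in Ds D -> k' \in index_iota 1 D.+1 -> 0 <= (if (d' * k' ^ 2 == n)%N then / INR d' * (/ INR k' * / INR k') else 0).
    move=> h; rewrite mem_index_iota => hk'; case: ifP => _; last lra.
    have a1 := Ds_INR h. have a2 : 0 < INR k' by apply: INR_gt0; lia.
    by apply/Rlt_le; repeat apply: Rmult_lt_0_compat; apply: Rinv_0_lt_compat; lra.
  rewrite (bigD1_seq d) //=; last by rewrite filter_uniq // iota_uniq.
  rewrite (bigD1_seq k) //=; last by rewrite iota_uniq.
  rewrite -e eqxx.
  have d1 := INR_gt0 d0. have k1 := INR_gt0 k0.
  have -> : / INR n = / INR d * (/ INR k * / INR k) by rewrite e INR_mul INR_exp /=; field; lra.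
  rewrite Rplus_assoc -{1}(Rplus_0_r (_ * _)); apply: Rplus_le_compat_l; apply: Rplus_le_le_0_compat.
    by apply: rsum_ge0 => k' hk' _; exact: nn.
  by apply: rsum_ge0 => d' hd' _; apply: rsum_ge0 => k' hk' _; exact: nn.
rewrite exchange_big /=; apply: rsum_le => d hd _.
rewrite exchange_big /=; apply: rsum_le => k; rewrite mem_index_iota => hk _.
have a1 := Ds_INR hd. have a2 : 0 < INR k by apply: INR_gt0; lia.
have pos : 0 < / INR d * (/ INR k * / INR k) by repeat apply: Rmult_lt_0_compat; apply: Rinv_0_lt_compat; lra.
rewrite -big_mkcond /= (eq_bigl (fun n => n == (d * k ^ 2)%N)); last by move=> n; rewrite eq_sym.
rewrite big_nat1_eq; case: ifP => _; lra.
Qed.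

Lemma nu_prime D p : (0 < D)%N -> prime p -> (D < p)%N -> nu D p = 1.
Proof.
move=> D0 pp hp; have S1 := Sd_ge1 D0.
rewrite /nu (_ : Fw D p = 1); first ring.
rewrite /Fw (_ : \rsum_(d <- Ds D) _ = Sd D); first by field; lra.
rewrite /Sd big_seq [RHS]big_seq; apply: eq_bigr => d; rewrite mem_Ds => /and3P [d0 dD _].
rewrite /gs big_seq big1 ?/Rdiv ?Rmult_1_l // => q; rewrite mem_primes => /and3P [pq _ hq].
rewrite /g; case: ifP => //; rewrite dvdn_prime2 // => /eqP e.
by have := dvdn_leq d0 hq; rewrite e; lia.
Qed.

Lemma nu_ge0 D m : 0 <= nu D m.
Proof. by rewrite /nu; exact: Rle_0_sqr. Qed.

Lemma Sp_big f n : Sp f n = \rsum_(1 <= m < n.+1) f m.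
Proof. by elim: n => [|n IH]; [rewrite big_geq | rewrite [RHS]big_nat_recr //= IH]. Qed.

Lemma nu_expand D e X : 
  \rsum_(1 <= m < X.+1) (nu D m * e m) =
  / Sd D * / Sd D * \rsum_(d <- Ds D) \rsum_(d' <- Ds D)
    (/ INR d * / INR d' * Sp (fun m => gs (primes d) m * gs (primes d') m * e m) X).
Proof.
under [in RHS]eq_bigr => d _ do under eq_bigr => d' _ do rewrite Sp_big -rsum_scal.
under [in RHS]eq_bigr => d _ do rewrite exchange_big /=.
rewrite exchange_big /= -rsum_scal; apply: eq_bigr => m _.
rewrite /nu /Fw.
have -> : forall a b c d : R, a * b * (c * d) * e m = a * c * (b * d * e m) by move=> *; ring.
congr (_ * _).
rewrite big_distrl /= big_distrl /=; apply: eq_bigr => d _.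
rewrite big_distrr /= big_distrl /=; apply: eq_bigr => d' _.
rewrite /Rdiv; ring.
Qed.

Lemma sum_Ds D : \rsum_(d <- Ds D) INR d <= INR D ^ 2.
Proof.
apply: (Rle_trans _ (\rsum_(1 <= d < D.+1) INR D)).
  rewrite /Ds big_filter /index_iota subn1; apply: (Rle_trans _ (\rsum_(d <- seq.iota 1 D) INR d)).
    by apply: rsum_mask => // d _ _; exact: pos_INR.
  by apply: rsum_le => d; rewrite mem_iota => h _; apply: le_INR; lia.
have : forall n, \rsum_(1 <= d < n.+1) INR D = INR n * INR D; last by move=> ->; rewrite /=; lra.
by elim=> [|n IH]; [rewrite big_geq //= Rmult_0_l | rewrite S_INR Rmult_plus_distr_r -IH big_nat_recr // Rmult_1_l].
Qed.

Lemma sum_Ds_sq D W : 0 <= W -> (0 < D)%N ->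
  / Sd D * / Sd D * \rsum_(d <- Ds D) \rsum_(d' <- Ds D) (W * (INR d * INR d')) <= W * INR D ^ 4.
Proof.
move=> W0 D0; have S1 := Sd_ge1 D0.
have -> : \rsum_(d <- Ds D) \rsum_(d' <- Ds D) (W * (INR d * INR d')) =
   W * (\rsum_(d <- Ds D) INR d * \rsum_(d <- Ds D) INR d).
  by rewrite big_distrl /= -rsum_scal; apply: eq_bigr => d _; rewrite rsum_scal rsum_scal.
have i0 : 0 < / Sd D by apply: Rinv_0_lt_compat; lra.
have i1 : / Sd D <= 1 by rewrite -Rinv_1; apply: Rinv_le_contravar; lra.
have s0 : 0 <= \rsum_(d <- Ds D) INR d by apply: rsum_ge0 => d _ _; exact: pos_INR.
have := sum_Ds D; set s := \big[_/_]_(_ <- _) _ in s0 * => hs.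
have ss : s * s <= INR D ^ 2 * INR D ^ 2 by apply: Rmult_le_compat.
have ii : / Sd D * / Sd D <= 1 * 1 by apply: Rmult_le_compat; lra.
have -> : W * INR D ^ 4 = (1 * 1) * (W * (INR D ^ 2 * INR D ^ 2)) by ring.
apply: Rmult_le_compat => //; try nra.
Qed.

Lemma pr_primes D d : d \in Ds D -> pr (primes d) = d.
Proof. by rewrite mem_Ds => /and3P [_ _ /eqP <-]. Qed.

Lemma gs_cat l1 l2 n : gs (l1 ++ l2) n = gs l1 n * gs l2 n.
Proof. by rewrite /gs big_cat. Qed.

(** Opening the square, each pair (d, d') gives a periodic function of mean zero by [mean0_word];
    its sum is at most 2 d d' times the period d d' pr(w). With the weights 1/(d d') these total
    O(pr(w) D^4). *)
Lemma nu_eps D X w : (0 < D)%N -> all prime w -> all odd w -> ~~ even_word w ->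
  Rabs (\rsum_(1 <= m < X.+1) (nu D m * eps w m)) <= 2 * INR (pr w) * INR D ^ 4.
Proof.
move=> D0 pw ow ew; have S1 := Sd_ge1 D0.
have i0 : 0 < / Sd D by apply: Rinv_0_lt_compat; lra.
rewrite nu_expand Rabs_mult (Rabs_pos_eq (_ * _)); last nra.
apply: Rle_trans (sum_Ds_sq (_ : 0 <= 2 * INR (pr w)) D0); last by have := pos_INR (pr w); lra.
apply: Rmult_le_compat_l; first nra.
apply: Rle_trans (rsum_abs _ _ _) _; apply: rsum_le => d hd _.
apply: Rle_trans (rsum_abs _ _ _) _; apply: rsum_le => d' hd' _.
have d1 := Ds_INR hd. have d1' := Ds_INR hd'.
set l := primes d ++ primes d'.
have pl : all prime l by rewrite all_cat !primes_prime_all.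
have el : pr l = (d * d')%N by rewrite pr_cat (pr_primes hd) (pr_primes hd').
have pwl : all prime (w ++ l) by rewrite all_cat pw pl.
have P : per (fun m => gs (primes d) m * gs (primes d') m * eps w m) (pr (w ++ l)).
  have dv x : x \in w ++ l -> (x %| pr (w ++ l))%N by move=> hx; rewrite dvdn_pr //; exact: (allP pwl).
  apply: per_prod; first by move=> n; rewrite -!gs_cat; apply: gs_per => x hx; apply: dv; rewrite mem_cat hx orbT.
  by apply: eps_per => x hx; rewrite (allP pw) // (allP ow) // dv // mem_cat hx.
have K0 : 0 < INR (d * d') by rewrite INR_mul; nra.
have B n : Rabs (gs (primes d) n * gs (primes d') n * eps w n) <= INR (d * d').
  rewrite -gs_cat Rabs_mult -el; have := gs_abs n pl; have := eps_abs n pw ow; rewrite -/l.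
  have := Rabs_pos (gs l n); have := Rabs_pos (eps w n); nra.
have M : \rsum_(0 <= n < pr (w ++ l)) (gs (primes d) n * gs (primes d') n * eps w n) = 0 * INR (pr (w ++ l)).
  rewrite Rmult_0_l; apply: etrans (mean0_word pw ow pl ew); apply: eq_bigr => n _; by rewrite gs_cat.
have := per_mean_bound X (pr_gt0 pwl) P K0 B M.
rewrite Rmult_0_r Rminus_0_r pr_cat el !INR_mul => h.
rewrite Rabs_mult Rabs_pos_eq; last by apply: Rmult_le_pos; apply/Rinv_ge0; lra.
apply: (Rmult_le_reg_l (INR d * INR d')); first nra.
have -> : INR d * INR d' * (/ INR d * / INR d' * Rabs (Sp (fun m => gs (primes d) m * gs (primes d') m * eps w m) X)) = Rabs (Sp (fun m => gs (primes d) m * gs (primes d') m * eps w m) X) by field; lra.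
lra.
Qed.

Lemma Sp_ext f h n : (forall m, f m = h m) -> Sp f n = Sp h n.
Proof. by move=> e; elim: n => //= n ->; rewrite e. Qed.

(** For d <> d' some prime divides only one of them and the mean vanishes by [mean0_gs]; for d = d'
    the mean is the product of p - 1 over the primes of d, at most d. *)
Lemma gs_gs_bound D d d' X : d \in Ds D -> d' \in Ds D ->
  Sp (fun m => gs (primes d) m * gs (primes d') m * 1) X <=
  (if d == d' then INR X * INR d else 0) + 2 * (INR d * INR d') * (INR d * INR d').
Proof.
move=> hd hd'; have d1 := Ds_INR hd; have d1' := Ds_INR hd'.
rewrite (Sp_ext (h := fun m => gs (primes d) m * gs (primes d') m)); last by move=> m; ring.
have pd := primes_prime_all d. have pd' := primes_prime_all d'.
have K0 : 0 < INR d * INR d' by nra.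
have B n : Rabs (gs (primes d) n * gs (primes d') n) <= INR d * INR d'.
  rewrite Rabs_mult; apply: Rmult_le_compat; try exact: Rabs_pos.
    by have := gs_abs n pd; rewrite (pr_primes hd).
  by have := gs_abs n pd'; rewrite (pr_primes hd').
case: eqVneq => [e|ne].
  subst d'.
  have P : per (fun m => gs (primes d) m * gs (primes d) m) (pr (primes d)).
    by apply: per_prod; apply: gs_per => x hx; rewrite dvdn_pr //; exact: (allP pd).
  have := per_mean_bound X (pr_gt0 pd) P K0 B (mean_gs_sq pd (primes_uniq d)).
  rewrite (pr_primes hd); set mu := \big[_/_]_(_ <- _) _.
  have mb : mu <= INR d.
    rewrite -[in X in _ <= X](pr_primes hd) /mu; elim: (primes d) pd => [|p l IH] /=; first by rewrite /pr !big_nil /=; lra.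
    move=> /andP [pp pl]; rewrite /pr !big_cons INR_mul -/(pr l).
    have := IH pl; have := INR_ge1 (prime_gt0 pp).
    have : 0 <= \big[Rmult/1]_(j <- l) (INR j - 1).
      elim: (l) pl => [|x s IHs] /=; first by rewrite big_nil; lra.
      by move=> /andP [px ps]; rewrite big_cons; apply: Rmult_le_pos; [have := INR_ge1 (prime_gt0 px); lra | exact: IHs].
    set m := \big[_/_]_(_ <- _) _ => m0 p1 hm; apply: Rmult_le_compat; lra.
  move/Rabs_le_between => [_ h].
  have : INR X * mu <= INR X * INR d by apply: Rmult_le_compat_l => //; exact: pos_INR.
  have : INR d * INR d * INR d <= INR d * INR d * (INR d * INR d) by nra.
  lra.
rewrite Rplus_0_l.
have sep a b : a \in Ds D -> b \in Ds D -> (exists p, p \in primes a /\ p \notin primes b) ->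
   \rsum_(0 <= n < a * b) (gs (primes a) n * gs (primes b) n) = 0.
  move=> ha hb [p [pa pb]].
  have pp : prime p := allP (primes_prime_all a) p pa.
  set l := rem p (primes a) ++ primes b.
  have pl : all prime l by rewrite all_cat primes_prime_all andbT; apply/allP => x /mem_rem; exact: (allP (primes_prime_all a)).
  have npl : p \notin l by rewrite mem_cat negb_or pb andbT mem_rem_uniq ?primes_uniq // !inE eqxx.
  have prm := perm_to_rem pa.
  have <- : pr (p :: l) = (a * b)%N.
    by rewrite -[in RHS](pr_primes ha) -[in RHS](pr_primes hb) -pr_cat /pr; apply: perm_big; rewrite perm_sym -cat_cons perm_cat2r.
  apply: etrans (mean0_gs pp pl npl); apply: eq_bigr => n _.
  by rewrite gs_cat /gs (perm_big _ prm) big_cons /=; ring.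
have M : \rsum_(0 <= n < d * d') (gs (primes d) n * gs (primes d') n) = 0 * INR (d * d').
  rewrite Rmult_0_l.
  case: (boolP (all (fun p => p \in primes d') (primes d))) => [/allP s1|/allPn [p h1 h2]]; last by apply: sep => //; exists p.
  case: (boolP (all (fun p => p \in primes d) (primes d'))) => [/allP s2|/allPn [p h1 h2]]; last first.
    rewrite mulnC; under eq_bigr => n _ do rewrite Rmult_comm.
    by apply: sep => //; exists p.
  case/eqP: ne; rewrite -(pr_primes hd) -(pr_primes hd'); apply: perm_big; apply: uniq_perm; try exact: primes_uniq.
  by move=> x; apply/idP/idP; [exact: s1 | exact: s2].
have P : per (fun m => gs (primes d) m * gs (primes d') m) (d * d').
  apply: per_prod; apply: gs_per => x hx.
    by apply: dvdn_mulr; rewrite -(pr_primes hd) dvdn_pr //; exact: (allP pd).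
  by apply: dvdn_mull; rewrite -(pr_primes hd') dvdn_pr //; exact: (allP pd').
have dd0 : (0 < d * d')%N by move: hd hd'; rewrite !mem_Ds muln_gt0 => /andP [-> _] /andP [-> _].
have := per_mean_bound X dd0 P K0 B M.
rewrite Rmult_0_r Rminus_0_r INR_mul => /Rabs_le_between; lra.
Qed.

Lemma nu_sum D X : (0 < D)%N -> \rsum_(1 <= m < X.+1) nu D m <= INR X / Sd D + 2 * INR D ^ 4.
Proof.
move=> D0; have S1 := Sd_ge1 D0.
have i0 : 0 < / Sd D by apply: Rinv_0_lt_compat; lra.
rewrite (eq_bigr (fun m => nu D m * 1)); last by move=> m _; rewrite Rmult_1_r.
rewrite nu_expand.
apply: (Rle_trans _ (/ Sd D * / Sd D * \rsum_(d <- Ds D) \rsum_(d' <- Ds D) ((if d' == d then INR X * / INR d else 0) + 2 * (INR d * INR d')))).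
  apply: Rmult_le_compat_l; first nra.
  apply: rsum_le => d hd _; apply: rsum_le => d' hd' _.
  have d1 := Ds_INR hd. have d1' := Ds_INR hd'.
  have h := gs_gs_bound X hd hd'.
  have p0 : 0 <= / INR d * / INR d' by apply: Rmult_le_pos; apply/Rinv_ge0; lra.
  apply: Rle_trans (Rmult_le_compat_l _ _ _ p0 h) _; right.
  by rewrite eq_sym; case: eqP => [->|_]; field; lra.
have -> : \rsum_(d <- Ds D) \rsum_(d' <- Ds D) ((if d' == d then INR X * / INR d else 0) + 2 * (INR d * INR d')) =
  INR X * Sd D + \rsum_(d <- Ds D) \rsum_(d' <- Ds D) (2 * (INR d * INR d')).
  rewrite /Sd -rsum_scal -rsum_plus big_seq [RHS]big_seq; apply: eq_bigr => d hd.
  rewrite rsum_plus; apply: (f_equal2 Rplus) => //.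
  rewrite (bigD1_seq d) //=; last by rewrite filter_uniq // iota_uniq.
  rewrite eqxx big1 ?Rplus_0_r // => x /negbTE ->; done.
have := sum_Ds_sq (ltac:(lra) : 0 <= 2) D0.
set Y := \big[_/_]_(_ <- _) _ => h.
have -> : / Sd D * / Sd D * (INR X * Sd D + Y) = INR X / Sd D + / Sd D * / Sd D * Y by field; lra.
lra.
Qed.

(** * Polynomials in signs and their averages over independent signs *)

Definition pol := seq (R * seq nat).
Definition mon (z : nat -> R) (w : seq nat) : R := \big[Rmult/1]_(q <- w) z q.
Definition ev (P : pol) (z : nat -> R) : R := \rsum_(m <- P) (m.1 * mon z m.2).
(** Mean of [ev P] when the variable q is c(q) times an independent random sign: only words with all
    multiplicities even survive ([Ex_ev]). *)
Definition Av (c : nat -> R) (P : pol) : R := \rsum_(m <- P | even_word m.2) (m.1 * mon c m.2).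
Definition wf (S : pred nat) (P : pol) : bool := all (fun m => rle 0 m.1 && all S m.2) P.

Definition pmul (P Q : pol) : pol := [seq (a.1 * b.1, a.2 ++ b.2) | a <- P, b <- Q].
Definition pone : pol := [:: (1, [::])].
Fixpoint pol_pow (P : pol) (n : nat) : pol := if n is n'.+1 then pmul P (pol_pow P n') else pone.
Definition pscale (a : R) (P : pol) : pol := [seq (a * m.1, m.2) | m <- P].
Definition plin (a : R) (I : seq nat) : pol := [seq (a, [:: q]) | q <- I].
(** Taylor polynomial of exp of degree N, composed with P; [EN] is its scalar version. *)
Definition pexp (N : nat) (P : pol) : pol := flatten [seq pscale (/ INR n`!) (pol_pow P n) | n <- seq.iota 0 N.+1].
Definition EN (N : nat) (y : R) : R := \rsum_(0 <= n < N.+1) (/ INR n`! * y ^ n).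

Lemma mon_cat z w1 w2 : mon z (w1 ++ w2) = mon z w1 * mon z w2.
Proof. by rewrite /mon big_cat. Qed.

Lemma ev_cons m P z : ev (m :: P) z = m.1 * mon z m.2 + ev P z.
Proof. by rewrite /ev big_cons. Qed.

Lemma ev_cat P Q z : ev (P ++ Q) z = ev P z + ev Q z.
Proof. by rewrite /ev big_cat. Qed.

Lemma ev_mul P Q z : ev (pmul P Q) z = ev P z * ev Q z.
Proof.
rewrite /ev /pmul big_allpairs_dep /= big_distrl /=; apply: eq_bigr => a _.
by rewrite big_distrr /=; apply: eq_bigr => b _; rewrite mon_cat; ring.
Qed.

Lemma ev_one z : ev pone z = 1.
Proof. by rewrite /ev /pone big_cons big_nil /mon big_nil /=; ring. Qed.

Lemma ev_pow P n z : ev (pol_pow P n) z = ev P z ^ n.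
Proof. by elim: n => [|n IH] /=; rewrite ?ev_one // ev_mul IH. Qed.

Lemma ev_scale a P z : ev (pscale a P) z = a * ev P z.
Proof. by rewrite /ev /pscale big_map -rsum_scal; apply: eq_bigr => m _ /=; ring. Qed.

Lemma ev_lin a I z : ev (plin a I) z = a * \rsum_(q <- I) z q.
Proof. by rewrite /ev /plin big_map -rsum_scal; apply: eq_bigr => q _; rewrite /mon big_cons big_nil /= Rmult_1_r. Qed.

Lemma ev_exp N P z : ev (pexp N P) z = EN N (ev P z).
Proof.
rewrite /EN /pexp /index_iota subn0; elim: (seq.iota 0 N.+1) => [|n s IH]; first by rewrite /ev !big_nil.
by rewrite /= ev_cat IH big_cons ev_scale ev_pow.
Qed.

Lemma wf_cat S P Q : wf S (P ++ Q) = wf S P && wf S Q.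
Proof. exact: all_cat. Qed.

Lemma wf_mul S P Q : wf S P -> wf S Q -> wf S (pmul P Q).
Proof.
elim: P => [|a P IH] //= /andP [/andP [a0 aS] hP] hQ; rewrite /pmul /= -/(pmul P Q) wf_cat IH // andbT.
elim: Q hQ {IH} => [|b Q IHQ] //= /andP [/andP [b0 bS] hQ]; rewrite IHQ // andbT all_cat aS bS !andbT.
by apply/rleP; apply: Rmult_le_pos; apply/rleP.
Qed.

Lemma wf_one S : wf S pone.
Proof. by rewrite /wf /= !andbT; apply/rleP; lra. Qed.

Lemma wf_pow S P n : wf S P -> wf S (pol_pow P n).
Proof. by move=> h; elim: n => [|n IH] /=; [exact: wf_one | exact: wf_mul]. Qed.

Lemma wf_scale S a P : 0 <= a -> wf S P -> wf S (pscale a P).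
Proof.
move=> a0; elim: P => [|m P IH] //= /andP [/andP [m0 mS] hP]; rewrite IH // mS !andbT.
by apply/rleP; apply: Rmult_le_pos => //; apply/rleP.
Qed.

Lemma wf_lin (S : pred nat) a I : 0 <= a -> all S I -> wf S (plin a I).
Proof. by move=> a0; elim: I => [|q I IH] //= /andP [qS hI]; rewrite qS IH // !andbT; exact/rleP. Qed.

Lemma wf_exp S N P : wf S P -> wf S (pexp N P).
Proof.
move=> h; rewrite /pexp; elim: (seq.iota 0 N.+1) => [|n s IH] //=; rewrite wf_cat IH andbT.
by apply: wf_scale; [apply/Rinv_ge0/INR_gt0/fact_gt0 | exact: wf_pow].
Qed.

Lemma wf_sub (S1 S2 : pred nat) P : (forall q, S1 q -> S2 q) -> wf S1 P -> wf S2 P.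
Proof.
move=> h; apply: sub_all => m /andP [-> hm] /=; exact: sub_all hm.
Qed.

Lemma ev_abs_le S P y z : wf S P -> (forall q, Rabs (y q) <= z q) -> Rabs (ev P y) <= ev P z.
Proof.
move=> + h; have M w : Rabs (mon y w) <= mon z w.
  elim: w => [|q w IH]; first by rewrite /mon !big_nil Rabs_R1; lra.
  by rewrite /mon !big_cons Rabs_mult; apply: Rmult_le_compat => //; exact: Rabs_pos.
elim: P => [|m P IH] /=; first by rewrite /ev !big_nil Rabs_R0; lra.
move=> /andP [/andP [/rleP m0 _] hP]; rewrite !ev_cons; apply: Rle_trans (Rabs_triang _ _) _.
apply: Rplus_le_compat; last exact: IH.
by rewrite Rabs_mult Rabs_pos_eq //; apply: Rmult_le_compat_l.
Qed.

(** Grouped by letter, the monomial is a product of even powers. *)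
Lemma mon_even_ge0 z w : even_word w -> 0 <= mon z w.
Proof.
move=> /allP ew; rewrite /mon -big_undup_iterop_count /=.
rewrite big_seq; elim/big_rec: _ => [|q x hq x0]; first lra.
apply: Rmult_le_pos => //.
have itE n (y : R) : iterop n Rmult y 1 = y ^ n.
  by case: n => // n; rewrite iteropS; elim: n => [|n IH]; [rewrite /=; ring | rewrite iterS IH].
rewrite itE; have := ew q; rewrite -mem_undup => /(_ hq) e.
have -> : count_mem q w = (2 * (count_mem q w)./2)%N by lia.
by rewrite pow_mult; apply: pow_le; apply: pow2_ge_0.
Qed.

Lemma even_word_cat S1 S2 w1 w2 : all S1 w1 -> all S2 w2 -> (forall q, S1 q -> S2 q -> False) ->
  even_word (w1 ++ w2) = even_word w1 && even_word w2.
Proof.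
move=> /allP h1 /allP h2 d; rewrite /even_word all_cat; congr (_ && _).
  apply: eq_in_all => q hq; rewrite count_cat.
  have -> : count_mem q w2 = 0%N by apply/count_memPn/negP => h; apply: (d q); [exact: h1 | exact: h2].
  by rewrite addn0.
apply: eq_in_all => q hq; rewrite count_cat.
have -> : count_mem q w1 = 0%N by apply/count_memPn/negP => h; apply: (d q); [exact: h1 | exact: h2].
by rewrite add0n.
Qed.

Lemma Av_cons c m P : Av c (m :: P) = (if even_word m.2 then m.1 * mon c m.2 else 0) + Av c P.
Proof. by rewrite /Av big_cons; case: ifP => _ //; rewrite Rplus_0_l. Qed.

Lemma Av_cat c P Q : Av c (P ++ Q) = Av c P + Av c Q.
Proof. by rewrite /Av big_cat. Qed.

Lemma Av_ge0 c S P : wf S P -> 0 <= Av c P.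
Proof.
elim: P => [|m P IH] /=; first by rewrite /Av big_nil; lra.
move=> /andP [/andP [/rleP m0 _] hP]; rewrite Av_cons.
have := IH hP; case: ifP => // e; last lra.
have := Rmult_le_pos _ _ m0 (mon_even_ge0 c e); lra.
Qed.

(** Independence: over disjoint alphabets a concatenated word is even exactly when both parts
    are. *)
Lemma Av_mul c S1 S2 P Q : wf S1 P -> wf S2 Q -> (forall q, S1 q -> S2 q -> False) ->
  Av c (pmul P Q) = Av c P * Av c Q.
Proof.
move=> hP hQ d; elim: P hP => [|a P IH] /=; first by rewrite /Av !big_nil Rmult_0_l.
move=> /andP [/andP [a0 aS] hP]; rewrite /pmul /= -/(pmul P Q) Av_cat IH // Av_cons Rmult_plus_distr_r; congr (_ + _).
elim: Q hQ {IH} => [|b Q IHQ] /=; first by rewrite /Av !big_nil Rmult_0_r.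
move=> /andP [/andP [b0 bS] hQ]; rewrite !Av_cons IHQ //= (even_word_cat aS bS d).
by case: (even_word a.2); case: (even_word b.2) => //=; rewrite ?mon_cat; ring.
Qed.

(* Orthogonality: on average over [m], against the sieve weight, only the words in which
   every prime has even multiplicity contribute. *)
Lemma nu_pol D X c P : (0 < D)%N -> wf (fun q => prime q && odd q) P ->
  \rsum_(1 <= m < X.+1) (nu D m * ev P (fun q => c q * IZR (leg q (8 * m)))) <=
  Av c P * \rsum_(1 <= m < X.+1) nu D m + 2 * INR D ^ 4 * ev P (fun q => Rabs (c q) * INR q).
Proof.
move=> D0; have D4 : 0 <= INR D ^ 4 by apply: pow_le; exact: pos_INR.
elim: P => [|[k w] P IH] /=.
  move=> _; rewrite /Av /ev !big_nil (eq_bigr (fun => 0)); last by move=> m _; rewrite big_nil Rmult_0_r.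
  by rewrite big1 //; lra.
move=> /andP [/andP [/rleP k0 hw] hP]; have {}IH := IH hP.
have pw : all prime w by apply: sub_all hw => q /andP [].
have ow : all odd w by apply: sub_all hw => q /andP [].
rewrite (eq_bigr (fun m => k * mon c w * (nu D m * eps w m) + nu D m * ev P (fun q => c q * IZR (leg q (8 * m))))); last first.
  move=> m _; rewrite ev_cons /= (_ : mon (fun q => c q * IZR (leg q (8 * m))) w = mon c w * eps w m); first by ring.
  by rewrite /mon big_split.
rewrite rsum_plus rsum_scal ev_cons Av_cons /=.
have wt : mon (fun q => Rabs (c q) * INR q) w = Rabs (mon c w) * INR (pr w).
  rewrite /mon /pr; elim: (w) => [|q s IHs]; first by rewrite !big_nil Rabs_R1 /=; ring.
  by rewrite !big_cons IHs Rabs_mult INR_mul; ring.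
rewrite wt.
have N0 : 0 <= \rsum_(1 <= m < X.+1) nu D m by apply: rsum_ge0 => m _ _; exact: nu_ge0.
suff : k * mon c w * \rsum_(1 <= m < X.+1) (nu D m * eps w m) <=
   (if even_word w then k * mon c w else 0) * \rsum_(1 <= m < X.+1) nu D m + 2 * INR D ^ 4 * (k * (Rabs (mon c w) * INR (pr w))) by lra.
have e0 : 0 <= 2 * INR D ^ 4 * (k * (Rabs (mon c w) * INR (pr w))).
  by repeat apply: Rmult_le_pos => //; try lra; [exact: Rabs_pos | exact: pos_INR].
case: (boolP (even_word w)) => ew.
  have : k * mon c w * \rsum_(1 <= m < X.+1) (nu D m * eps w m) <= k * mon c w * \rsum_(1 <= m < X.+1) nu D m.
    apply: Rmult_le_compat_l; first by apply: Rmult_le_pos => //; exact: mon_even_ge0.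
    apply: rsum_le => m _ _; have := nu_ge0 D m; have := Rle_abs (eps w m); have := eps_abs m pw ow; nra.
  lra.
have h := nu_eps X D0 pw ow ew.
rewrite Rmult_0_l Rplus_0_l; apply: Rle_trans (Rle_abs _) _; rewrite !Rabs_mult (Rabs_pos_eq k) //.
have -> : 2 * INR D ^ 4 * (k * (Rabs (mon c w) * INR (pr w))) = k * Rabs (mon c w) * (2 * INR (pr w) * INR D ^ 4) by ring.
by apply: Rmult_le_compat_l => //; apply: Rmult_le_pos => //; exact: Rabs_pos.
Qed.

Definition upd (e : nat -> R) (q : nat) (v : R) : nat -> R := fun x => if x == q then v else e x.
(** Expectation over independent uniform signs on the letters of S, taken one letter at a time. *)
Fixpoint Ex (S : seq nat) (F : (nat -> R) -> R) : R :=
  if S is q :: S' then (Ex S' (fun e => F (upd e q 1)) + Ex S' (fun e => F (upd e q (-1)))) / 2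
  else F (fun _ => 1).

Lemma Ex_le S F G : (forall e, F e <= G e) -> Ex S F <= Ex S G.
Proof.
elim: S F G => [|q S IH] F G h /=; first exact: h.
have := IH (fun e => F (upd e q 1)) (fun e => G (upd e q 1)) (fun e => h _).
have := IH (fun e => F (upd e q (-1))) (fun e => G (upd e q (-1))) (fun e => h _); lra.
Qed.

Lemma Ex_ext S F G : (forall e, F e = G e) -> Ex S F = Ex S G.
Proof. by move=> h; apply: Rle_antisym; apply: Ex_le => e; rewrite h; exact: Rle_refl. Qed.

Lemma Ex_lin S a b F G : Ex S (fun e => a * F e + b * G e) = a * Ex S F + b * Ex S G.
Proof. by elim: S F G => [|q S IH] F G //=; rewrite !IH; field. Qed.

Lemma Ex_scal S a F : Ex S (fun e => a * F e) = a * Ex S F.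
Proof. by have := Ex_lin S a 0 F F; rewrite Rmult_0_l Rplus_0_r => <-; apply: Ex_ext => e; ring. Qed.

Lemma Ex_plus S F G : Ex S (fun e => F e + G e) = Ex S F + Ex S G.
Proof. by have := Ex_lin S 1 1 F G; rewrite !Rmult_1_l => <-; apply: Ex_ext => e; ring. Qed.

Lemma Ex_sym S F : (forall e e', (forall q, q \in S -> e q = e' q) -> F e = F e') ->
  Ex S F = Ex S (fun e => F (fun q => - e q)).
Proof.
elim: S F => [|q S IH] F h /=; first by apply: h.
rewrite (IH (fun e => F (upd e q 1))); last first.
  move=> e e' he; apply: h => x hx; rewrite /upd; case: eqP => // /eqP ne; apply: he.
  by move: hx; rewrite inE (negbTE ne).
rewrite (IH (fun e => F (upd e q (-1)))); last first.
  move=> e e' he; apply: h => x hx; rewrite /upd; case: eqP => // /eqP ne; apply: he.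
  by move: hx; rewrite inE (negbTE ne).
rewrite Rplus_comm; congr (_ / 2); congr (_ + _); apply: Ex_ext => e; apply: h => x _; rewrite /upd; case: eqP => //= _; ring.
Qed.

Lemma Ex_mon S w : uniq S -> all (mem S) w -> Ex S (fun e => mon e w) = if even_word w then 1 else 0.
Proof.
elim: S w => [|q S IH] w /=.
  by move=> _; case: w => //= _; rewrite /mon big_nil.
move=> /andP [nq uS] aw.
pose w' := [seq x <- w | x != q].
have mw v e : mon (upd e q v) w = v ^ (count_mem q w) * mon e w'.
  rewrite /mon /w'; elim: (w) => [|x s IHs]; first by rewrite !big_nil /=; ring.
  rewrite big_cons IHs /= /upd; case: eqP => [_|_]; first by rewrite add1n /=; ring.
  by rewrite big_cons add0n; ring.
rewrite (Ex_ext S (G := fun e => 1 ^ (count_mem q w) * mon e w')); last by move=> e; rewrite mw.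
rewrite (Ex_ext S (F := fun e => mon (upd e q (-1)) w) (G := fun e => (-1) ^ (count_mem q w) * mon e w')); last by move=> e; rewrite mw.
rewrite !Ex_scal pow1 IH //; last first.
  apply/allP => x; rewrite mem_filter => /andP [nx hx]; have := allP aw x hx; rewrite !inE (negbTE nx); by [].
have -> : (-1) ^ (count_mem q w) = if odd (count_mem q w) then -1 else 1.
  by elim: (count_mem q w) => //= n ->; case: (odd n) => /=; ring.
have cw x : x != q -> count_mem x w' = count_mem x w.
  move=> nx; rewrite /w' count_filter; apply: eq_count => y /=.
  by case: eqP => // ->; rewrite nx.
have -> : even_word w = ~~ odd (count_mem q w) && even_word w'.
  apply/idP/andP => [/allP h|[h1 /allP h2]].
    split; last by apply/allP => x; rewrite mem_filter => /andP [nx hx]; rewrite cw //; exact: h.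
    case: (boolP (q \in w)) => [/h //|]; by move/count_memPn => ->.
  apply/allP => x hx; case: (eqVneq x q) => [->//|nx]; rewrite -cw //; apply: h2; by rewrite mem_filter nx.
by case: (odd _); case: (even_word w') => /=; field.
Qed.

(** Turns [Av] into an expectation, so that pointwise inequalities in the signs become inequalities
    of averages. *)
Lemma Ex_ev S c P : uniq S -> wf (mem S) P -> Ex S (fun e => ev P (fun q => c q * e q)) = Av c P.
Proof.
move=> uS; elim: P => [|[k w] P IH] /=.
  move=> _; rewrite /Av big_nil (Ex_ext S (G := fun e => 0 * 1)); last by move=> e; rewrite /ev big_nil; ring.
  by rewrite Ex_scal Rmult_0_l.
move=> /andP [/andP [_ hw] hP]; rewrite Av_cons /= -(IH hP).
rewrite (Ex_ext S (G := fun e => k * mon c w * mon e w + ev P (fun q => c q * e q))); last first.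
  by move=> e; rewrite ev_cons /= (_ : mon (fun q => c q * e q) w = mon c w * mon e w) /mon ?big_split //; ring.
rewrite Ex_plus Ex_scal Ex_mon //; case: ifP => _; ring.
Qed.

(** * Truncated exponential series *)

Lemma fact_factorial n : Factorial.fact n = n`!.
Proof. by elim: n => // n IH; rewrite factS -IH. Qed.

Lemma INR_fact_gt0 n : 0 < INR n`!.
Proof. by apply: INR_gt0; exact: fact_gt0. Qed.

Lemma EN_lim y : is_lim_seq (fun N => EN N y) (exp y).
Proof.
have h : is_lim_seq (sum_n (fun k => scal (pow_n y k) (/ INR (Factorial.fact k)))) (exp y) := is_exp_Reals y.
apply: (is_lim_seq_ext _ _ _ _ h) => N; rewrite /EN.
elim: N => [|N IH]; first by rewrite sum_O big_nat1; transitivity (1 * / 1); [by [] | rewrite fact0 /=; field].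
rewrite sum_Sn IH [RHS]big_nat_recr //; apply: (f_equal2 Rplus) => //.
by rewrite -fact_factorial pow_n_pow /scal /= /mult /= Rmult_comm.
Qed.

Arguments EN_lim : clear implicits.

Lemma EN_S N y : EN N.+1 y = EN N y + / INR N.+1`! * y ^ N.+1.
Proof. by rewrite /EN big_nat_recr. Qed.

Lemma lim_seq_ub (u : nat -> R) l N : is_lim_seq u (Finite l) -> (forall M, (N <= M)%N -> u M <= u M.+1) -> u N <= l.
Proof.
move=> h mono.
have m2 k : u N <= u (k + N)%N.
  elim: k => [|k IH]; first exact: Rle_refl.
  by apply: Rle_trans IH _; apply: mono; rewrite leq_addl.
have h2 := proj1 (is_lim_seq_incr_n u N _) h.
exact: (is_lim_seq_le (fun _ => u N) (fun k => u (k + N)%N) _ _ m2 (is_lim_seq_const _) h2).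
Qed.

Lemma pow_opp y n : (- y) ^ n = (if odd n then -1 else 1) * y ^ n.
Proof. by elim: n => [|n IH] /=; [ring | rewrite IH; case: (odd n) => /=; ring]. Qed.

Lemma EN_even N y : 0 <= EN N y + EN N (- y) <= exp y + exp (- y).
Proof.
have st M : EN M y + EN M (- y) <= EN M.+1 y + EN M.+1 (- y).
  rewrite !EN_S (pow_opp y M.+1).
  suff : 0 <= / INR M.+1`! * y ^ M.+1 + / INR M.+1`! * ((if odd M.+1 then -1 else 1) * y ^ M.+1) by lra.
  have i0 := Rinv_0_lt_compat _ (INR_fact_gt0 M.+1).
  case: (boolP (odd M.+1)) => o; first by lra.
  have : 0 <= y ^ M.+1.
    have -> : M.+1 = (2 * M.+1./2)%N by lia.
    by rewrite pow_mult; apply: pow_le; apply: pow2_ge_0.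
  nra.
split.
  elim: N => [|N IH]; last exact: Rle_trans IH (st N).
  by rewrite /EN !big_nat1 /=; lra.
apply: (lim_seq_ub (u := fun N => EN N y + EN N (- y))) => [|M _]; last exact: st.
by apply: is_lim_seq_plus'; exact: EN_lim.
Qed.

Lemma EN_odd N y : Rabs (EN N y - EN N (- y)) <= Rabs (exp y - exp (- y)).
Proof.
have key z : 0 <= z -> 0 <= EN N z - EN N (- z) <= exp z - exp (- z).
  move=> z0; have st M : EN M z - EN M (- z) <= EN M.+1 z - EN M.+1 (- z).
    rewrite !EN_S (pow_opp z M.+1).
    suff : 0 <= / INR M.+1`! * z ^ M.+1 - / INR M.+1`! * ((if odd M.+1 then -1 else 1) * z ^ M.+1) by lra.
    have i0 := Rinv_0_lt_compat _ (INR_fact_gt0 M.+1). have p0 := pow_le z M.+1 z0.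
    by case: (odd M.+1); nra.
  split.
    elim: (N) => [|M IH]; last exact: Rle_trans IH (st M).
    by rewrite /EN !big_nat1 /=; lra.
  apply: (lim_seq_ub (u := fun N => EN N z - EN N (- z))) => [|M _]; last exact: st.
  by apply: is_lim_seq_minus'; exact: EN_lim.
case: (Rle_lt_dec 0 y) => hy.
  by have := key y hy => h; rewrite !Rabs_pos_eq; lra.
have := key (- y) (ltac:(lra)); rewrite Ropp_involutive => h.
by rewrite Rabs_minus_sym (Rabs_minus_sym (exp y)) !Rabs_pos_eq; lra.
Qed.

(** x^2 + y^2 = ((x+y)^2 + (x-y)^2)/2, and the even and odd parts of [EN] are dominated by those of
    exp. Averaged over a sign, the square of the truncated exponential is thus at most the true
    exponential, however large y is. *)
Lemma EN_sq N y : EN N y * EN N y + EN N (- y) * EN N (- y) <= exp (2 * y) + exp (2 * - y).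
Proof.
have [a0 a1] := EN_even N y. have b := EN_odd N y.
have e1 : exp (2 * y) = exp y * exp y by rewrite -exp_plus; congr exp; ring.
have e2 : exp (2 * - y) = exp (- y) * exp (- y) by rewrite -exp_plus; congr exp; ring.
rewrite e1 e2.
have b2 := Rsqr_le_abs_1 _ _ b; rewrite /Rsqr in b2.
have a2 : (EN N y + EN N (- y)) * (EN N y + EN N (- y)) <= (exp y + exp (- y)) * (exp y + exp (- y)) by apply: Rmult_le_compat.
nra.
Qed.

Lemma even_term m y : / INR (2 * m)`! * y ^ (2 * m) <= (exp y + exp (- y)) / 2.
Proof.
have h := EN_even (2 * m) y.
suff : 2 * (/ INR (2 * m)`! * y ^ (2 * m)) <= EN (2 * m) y + EN (2 * m) (- y) by lra.
case: m {h} => [|m]; first by rewrite /EN !big_nat1 /=; lra.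
have e : (2 * m.+1 = (2 * m).+2)%N by lia.
rewrite e EN_S (EN_S _ (- y)) (pow_opp y (2 * m).+2) (_ : odd (2 * m).+2 = false); last by lia.
have := EN_even (2 * m).+1 y; lra.
Qed.

Lemma EN_ge0 N y : 0 <= y -> 0 <= EN N y.
Proof.
move=> h; rewrite /EN; apply: rsum_ge0 => n _ _; apply: Rmult_le_pos; last exact: pow_le.
exact/Rinv_ge0/INR_fact_gt0.
Qed.

Lemma EN_le_exp N y : 0 <= y -> EN N y <= exp y.
Proof.
move=> h; apply: (lim_seq_ub (u := fun N => EN N y)); first exact: EN_lim.
move=> M _; rewrite EN_S; have := pow_le y M.+1 h; have := Rinv_0_lt_compat _ (INR_fact_gt0 M.+1); nra.
Qed.

Lemma EN_le_pow N y : 0 <= y -> EN N y <= (1 + y) ^ N.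
Proof.
move=> h; elim: N => [|N IH]; first by rewrite /EN big_nat1 /=; lra.
rewrite EN_S.
have f1 : / INR N.+1`! <= 1 by rewrite -Rinv_1; apply: Rinv_le_contravar; [lra | exact/INR_ge1/fact_gt0].
have a : y ^ N <= (1 + y) ^ N by apply: pow_incr; lra.
have p0 := pow_le y N h.
have i0 := Rinv_0_lt_compat _ (INR_fact_gt0 N.+1).
rewrite /=; have : / INR N.+1`! * (y * y ^ N) <= 1 * (y * y ^ N) by apply: Rmult_le_compat_r; nra.
nra.
Qed.

(** (N+1+k)! >= (N+1)! k! lets the first omitted term be factored out of the tail. *)
Lemma EN_tail_pos N y : 0 <= y -> exp y - EN N y <= / INR N.+1`! * y ^ N.+1 * exp y.
Proof.
move=> h.
have f0 := Rinv_0_lt_compat _ (INR_fact_gt0 N.+1). have p0 := pow_le y N.+1 h.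
have fin k : EN (k + N.+1) y - EN N y <= / INR N.+1`! * y ^ N.+1 * EN k y.
  elim: k => [|k IH]; first by rewrite add0n EN_S /EN big_nat1 /=; right; field; apply: Rgt_not_eq; exact: INR_fact_gt0.
  rewrite addSn EN_S EN_S.
  have : / INR (k + N.+1).+1`! * y ^ (k + N.+1).+1 <= / INR N.+1`! * y ^ N.+1 * (/ INR k.+1`! * y ^ k.+1).
    have -> : / INR N.+1`! * y ^ N.+1 * (/ INR k.+1`! * y ^ k.+1) = / (INR N.+1`! * INR k.+1`!) * (y ^ (k + N.+1).+1).
      rewrite -addSn pow_add; field; split; apply: Rgt_not_eq; exact: INR_fact_gt0.
    apply: Rmult_le_compat_r; first exact: pow_le.
    apply: Rinv_le_contravar; first by apply: Rmult_lt_0_compat; exact: INR_fact_gt0.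
    rewrite -INR_mul; apply: le_INR; apply/leP.
    have := @bin_fact (k + N.+1).+1 N.+1 (ltac:(lia)).
    rewrite (_ : (k + N.+1).+1 - N.+1 = k.+1)%N; last by lia.
    by move=> <-; rewrite leq_pmull // bin_gt0; lia.
  lra.
have l1 := is_lim_seq_minus' _ _ _ _ (proj1 (is_lim_seq_incr_n _ N.+1 _) (EN_lim y)) (is_lim_seq_const (EN N y)).
have l2 := is_lim_seq_scal_l _ (/ INR N.+1`! * y ^ N.+1) _ (EN_lim y).
exact: (is_lim_seq_le _ _ _ _ fin l1 l2).
Qed.

Lemma EN_tail N y : Rabs (exp y - EN N y) <= exp (Rabs y) - EN N (Rabs y).
Proof.
have fin k : Rabs (EN (k + N) y - EN N y) <= EN (k + N) (Rabs y) - EN N (Rabs y).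
  elim: k => [|k IH]; first by rewrite add0n !Rminus_diag Rabs_R0; lra.
  rewrite addSn !EN_S.
  have -> : EN (k + N) y + / INR (k + N).+1`! * y ^ (k + N).+1 - EN N y = (EN (k + N) y - EN N y) + / INR (k + N).+1`! * y ^ (k + N).+1 by ring.
  apply: Rle_trans (Rabs_triang _ _) _.
  rewrite Rabs_mult -RPow_abs (Rabs_pos_eq (/ _)); last exact/Rinv_ge0/INR_fact_gt0.
  lra.
have lm z := is_lim_seq_minus' _ _ _ _ (proj1 (is_lim_seq_incr_n _ N _) (EN_lim z)) (is_lim_seq_const (EN N z)).
have l1 := is_lim_seq_abs _ _ (lm y).
exact: (is_lim_seq_le _ _ _ _ fin l1 (lm (Rabs y))).
Qed.

Lemma pow_le_fact_exp n : INR n ^ n <= INR n`! * exp (INR n).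
Proof.
have n0 := pos_INR n.
have h := EN_le_exp n n0.
have : / INR n`! * INR n ^ n <= EN n (INR n).
  case: n n0 {h} => [|n] n0; first by rewrite /EN big_nat1; lra.
  by rewrite EN_S; have := EN_ge0 n n0; lra.
have f0 := INR_fact_gt0 n => h2.
apply: (Rmult_le_reg_l (/ INR n`!)); first exact: Rinv_0_lt_compat.
rewrite -Rmult_assoc Rinv_l; lra.
Qed.

(** For |y| <= N/20 the relative error of the Taylor polynomial is at most d = 4^(-N-1), by n^n <=
    n! e^n at n = N + 1 and e^(11/10) <= 5. Then (1 - d)^2 e^(2^(-N)) >= 1. *)
Lemma EN_exp_bound N y : (1 <= N)%N -> 20 * Rabs y <= INR N -> exp (2 * y) <= exp ((/ 2) ^ N) * (EN N y * EN N y).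
Proof.
move=> N1 hy.
set n := N.+1; set z := Rabs y in hy *.
have z0 : 0 <= z := Rabs_pos y.
have nn : INR N <= INR n by apply: le_INR; rewrite /n; lia.
have n0 : 0 < INR n by apply: INR_gt0.
have zn : 20 * z <= INR n by lra.
have T1 := EN_tail N y. have T2 := EN_tail_pos N z0.
have e3 : exp 1 <= 3 := exp_le_3.
set d := (/ 4) ^ n.
have d0 : 0 < d by apply: pow_lt; lra.
have main : / INR n`! * z ^ n * exp z * exp z <= d.
  have a1 : z ^ n <= (/ 20) ^ n * INR n ^ n by rewrite -Rpow_mult_distr; apply: pow_incr; lra.
  have a2 : z ^ n <= (/ 20) ^ n * (INR n`! * exp (INR n)).
    apply: Rle_trans a1 _; apply: Rmult_le_compat_l; last exact: pow_le_fact_exp.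
    by apply: pow_le; lra.
  have a3 : exp z * exp z * exp (INR n) <= 5 ^ n.
    apply: (Rle_trans _ (exp (INR n * (11 / 10)))).
      by rewrite -!exp_plus; apply: exp_le; lra.
    have -> : exp (INR n * (11 / 10)) = exp (11 / 10) ^ n.
      elim: (n) => [|k IH]; first by rewrite /= Rmult_0_l exp_0.
      by rewrite S_INR Rmult_plus_distr_r exp_plus IH /= Rmult_1_l; ring.
    apply: pow_incr; split; first exact/exp_ge0.
    have -> : 11 / 10 = 1 + / 10 by field.
    rewrite exp_plus.
    have : exp (/ 10) <= 10 / 9.
      have := exp_ineq1_le (- / 10); rewrite exp_Ropp => h.
      have p := exp_pos (/ 10). have : / exp (/ 10) * exp (/ 10) = 1 by field; lra.
      nra.
    have := exp_pos (/ 10); have := exp_pos 1; nra.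
  have f0 := INR_fact_gt0 n.
  have ez := exp_pos z.
  apply: (Rle_trans _ (/ INR n`! * ((/ 20) ^ n * (INR n`! * exp (INR n))) * exp z * exp z)).
    have i0 := Rinv_0_lt_compat _ f0.
    by repeat apply: Rmult_le_compat_r; try lra; apply: Rmult_le_compat_l; lra.
  have -> : / INR n`! * ((/ 20) ^ n * (INR n`! * exp (INR n))) * exp z * exp z = (/ 20) ^ n * (exp z * exp z * exp (INR n)) by field; lra.
  have -> : d = (/ 20) ^ n * 5 ^ n by rewrite /d -Rpow_mult_distr; congr (_ ^ _); field.
  by apply: Rmult_le_compat_l => //; apply: pow_le; lra.
have ey : 1 <= exp y * exp z.
  rewrite -exp_plus; have := exp_ineq1_le (y + z); have := Rle_abs (- y); rewrite Rabs_Ropp -/z; lra.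
have eyp := exp_pos y. have ezp := exp_pos z.
have R1 : exp y - EN N y <= d * exp y.
  apply: (Rle_trans _ (/ INR n`! * z ^ n * exp z)).
    by apply: Rle_trans (Rle_abs _) (Rle_trans _ _ _ T1 T2).
  have w0 : 0 <= / INR n`! * z ^ n * exp z.
    by apply: Rmult_le_pos; [apply: Rmult_le_pos; [apply/Rinv_ge0/INR_fact_gt0 | exact: pow_le] | lra].
  have : / INR n`! * z ^ n * exp z * 1 <= / INR n`! * z ^ n * exp z * (exp y * exp z) by apply: Rmult_le_compat_l.
  have : (/ INR n`! * z ^ n * exp z * exp z) * exp y <= d * exp y by apply: Rmult_le_compat_r; lra.
  lra.
have dN : 4 * d <= (/ 2) ^ N.
  rewrite /d /n /=; have : (/ 4) ^ N <= (/ 2) ^ N by apply: pow_incr; lra.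
  lra.
have d4 : d <= / 16.
  have : (/ 2) ^ N <= / 2.
    rewrite -(subnK N1) pow_add pow_1; have : (/ 2) ^ (N - 1) <= 1 by rewrite -(pow1 (N - 1)); apply: pow_incr; lra.
    lra.
  have : d = / 4 * (/ 4 * (/ 4) ^ N.-1) by rewrite /d /n; case: (N) N1.
  have : (/ 4) ^ N.-1 <= 1 by rewrite -(pow1 N.-1); apply: pow_incr; lra.
  lra.
have L : exp y * (1 - d) <= EN N y by lra.
have sq : (exp y * (1 - d)) * (exp y * (1 - d)) <= EN N y * EN N y by apply: Rmult_le_compat => //; nra.
have -> : exp (2 * y) = exp y * exp y by rewrite -exp_plus; congr exp; ring.
have E : 1 <= exp ((/ 2) ^ N) * ((1 - d) * (1 - d)).
  have : 1 + 4 * d <= exp ((/ 2) ^ N) by have := exp_ineq1_le ((/ 2) ^ N); lra.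
  have : (1 + 4 * d) * ((1 - d) * (1 - d)) >= 1 by nra.
  have : 0 <= (1 - d) * (1 - d) by nra.
  nra.
have ep := exp_pos ((/ 2) ^ N).
apply: (Rle_trans _ (exp ((/ 2) ^ N) * ((exp y * (1 - d)) * (exp y * (1 - d))))); last by apply: Rmult_le_compat_l; lra.
have -> : exp ((/ 2) ^ N) * ((exp y * (1 - d)) * (exp y * (1 - d))) = (exp y * exp y) * (exp ((/ 2) ^ N) * ((1 - d) * (1 - d))) by ring.
have : 0 < exp y * exp y by nra.
nra.
Qed.

Lemma nonneg_by_derive (f f' : R -> R) y : 0 <= y -> 0 <= f 0 -> (forall t, 0 <= t <= y -> is_derive f t (f' t)) ->
  (forall t, 0 <= t <= y -> 0 <= f' t) -> 0 <= f y.
Proof.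
move=> y0 f0 h1 h2; have := MVT_gen f 0 y f'; rewrite Rmin_left // Rmax_right //; case.
- by move=> t ht; apply: h1; lra.
- by move=> t ht; apply/continuity_pt_filterlim/(ex_derive_continuous f); exists (f' t); apply: h1; lra.
- by move=> t [ht e]; have := h2 t ht; nra.
Qed.

(** e^(-y^2/2) cosh y is 1 at 0, and its derivative -e^(-y^2/2) (y cosh y - sinh y) is <= 0 for y >=
    0. *)
Lemma cosh_le y : (exp y + exp (- y)) / 2 <= exp (/ 2 * y ^ 2).
Proof.
wlog y0 : y / 0 <= y.
  move=> H; case: (Rle_lt_dec 0 y) => h; first exact: H.
  have := H (- y) (ltac:(lra)); rewrite Ropp_involutive (_ : (- y) ^ 2 = y ^ 2); [lra | ring].
have c1 t : 0 <= t -> 0 <= t * ((exp t + exp (- t)) / 2) - (exp t - exp (- t)) / 2.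
  move=> t0; apply: (@nonneg_by_derive (fun t => t * ((exp t + exp (- t)) / 2) - (exp t - exp (- t)) / 2) (fun t => t * ((exp t - exp (- t)) / 2))) => //.
  - by rewrite Ropp_0 exp_0; lra.
  - by move=> x _; auto_derive => //; field.
  - move=> x hx; apply: Rmult_le_pos; first lra.
    have : exp (- x) <= exp x by apply: exp_le; lra.
    lra.
have c2 : 0 <= 1 - exp (- (/ 2 * (y * y))) * ((exp y + exp (- y)) / 2).
  apply: (@nonneg_by_derive (fun y => 1 - exp (- (/ 2 * (y * y))) * ((exp y + exp (- y)) / 2))
     (fun y => exp (- (/ 2 * (y * y))) * (y * ((exp y + exp (- y)) / 2) - (exp y - exp (- y)) / 2))) => //.
  - by rewrite !Rmult_0_r Ropp_0 exp_0; lra.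
  - by move=> x _; auto_derive => //; field.
  - by move=> x [hx _]; apply: Rmult_le_pos; [exact/exp_ge0 | exact: c1].
have -> : y ^ 2 = y * y by ring.
have e := exp_pos (/ 2 * (y * y)).
have : exp (- (/ 2 * (y * y))) * exp (/ 2 * (y * y)) = 1 by rewrite -exp_plus Rplus_opp_l exp_0.
nra.
Qed.

(** The expectation factors over the letters, each factor is a cosh, and [cosh_le] applies. *)
Lemma Ex_exp S c : uniq S ->
  Ex S (fun e => exp (\rsum_(q <- S) (c q * e q))) <= exp (/ 2 * \rsum_(q <- S) c q ^ 2).
Proof.
elim: S => [|q S IH] /=; first by rewrite !big_nil Rmult_0_r; lra.
move=> /andP [nq uS].
have sh v : Ex S (fun e => exp (\rsum_(x <- q :: S) (c x * upd e q v x))) =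
    exp (c q * v) * Ex S (fun e => exp (\rsum_(x <- S) (c x * e x))).
  rewrite -Ex_scal; apply: Ex_ext => e; rewrite big_cons exp_plus /upd eqxx; congr (_ * exp _).
  rewrite big_seq [RHS]big_seq; apply: eq_bigr => x hx; case: eqP => // ex; by rewrite -ex hx in nq.
rewrite !sh big_cons Rmult_plus_distr_l exp_plus.
have := cosh_le (c q); have := IH uS; set A := Ex _ _; set B := exp (/ 2 * \big[_/_]_(_ <- _) _) => hA hc.
have A0 : 0 <= A.
  rewrite /A -(Rmult_0_l (Ex S (fun _ => 1))) -Ex_scal; apply: Ex_le => e; rewrite Rmult_0_l; exact/exp_ge0.
have -> : (exp (c q * 1) * A + exp (c q * -1) * A) / 2 = (exp (c q) + exp (- c q)) / 2 * A.
  by rewrite Rmult_1_r (_ : c q * -1 = - c q); [field | ring].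
apply: Rmult_le_compat => //; have := exp_pos (c q); have := exp_pos (- c q); lra.
Qed.

Lemma Ex_cosh S c : uniq S ->
  Ex S (fun e => (exp (\rsum_(q <- S) (c q * e q)) + exp (- (\rsum_(q <- S) (c q * e q)))) / 2) <= exp (/ 2 * \rsum_(q <- S) c q ^ 2).
Proof.
move=> uS; rewrite (Ex_ext S (G := fun e => / 2 * exp (\rsum_(q <- S) (c q * e q)) + / 2 * exp (\rsum_(q <- S) (- c q * e q)))); last first.
  move=> e; rewrite (_ : \rsum_(q <- S) (- c q * e q) = - (\rsum_(q <- S) (c q * e q))); first by field.
  have := rsum_scal S xpredT (fun q => c q * e q) (-1); rewrite (eq_bigr (fun q => - c q * e q)); last by move=> *; ring.
  by move=> ->; ring.
rewrite Ex_lin; have h1 := Ex_exp c uS; have := Ex_exp (fun q => - c q) uS.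
rewrite (eq_bigr (fun q => c q ^ 2)); last by move=> *; ring.
lra.
Qed.

(** Square of the truncated exponential of half a linear form: it takes nonnegative values and
    follows the exponential as long as the form is moderate. *)
Definition block (N : nat) (I : seq nat) : pol := pmul (pexp N (plin (/ 2) I)) (pexp N (plin (/ 2) I)).

Lemma ev_block N I z : ev (block N I) z = EN N (/ 2 * \rsum_(q <- I) z q) * EN N (/ 2 * \rsum_(q <- I) z q).
Proof. by rewrite /block ev_mul !ev_exp ev_lin. Qed.

Lemma wf_block (S : pred nat) N I : all S I -> wf S (block N I).
Proof. by move=> h; rewrite /block; apply: wf_mul; apply: wf_exp; apply: wf_lin => //; lra. Qed.

(** Symmetrize under e -> -e, then use [EN_sq] and the Gaussian bound [Ex_cosh]. Truncation thus
    costs nothing on average. *)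
Lemma Av_block c N I : uniq I -> Av c (block N I) <= exp (/ 2 * \rsum_(q <- I) c q ^ 2).
Proof.
move=> uI; have wI : wf (mem I) (block N I) by apply: wf_block; apply/allP.
rewrite -(Ex_ev c uI wI).
pose G e := \rsum_(q <- I) (c q * e q).
pose F e := EN N (/ 2 * G e) * EN N (/ 2 * G e).
rewrite (Ex_ext I (G := F)); last by move=> e; rewrite ev_block.
have sy : Ex I F = Ex I (fun e => F (fun q => - e q)).
  by apply: Ex_sym => e e' h; rewrite /F (_ : G e = G e') // /G big_seq [RHS]big_seq; apply: eq_bigr => q hq; rewrite h.
have -> : Ex I F = Ex I (fun e => / 2 * F e + / 2 * F (fun q => - e q)) by rewrite Ex_lin -sy; field.
apply: Rle_trans (Ex_cosh c uI); apply: Ex_le => e.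
have gn : G (fun q => - e q) = - G e.
  have := rsum_scal I xpredT (fun q => c q * e q) (-1); rewrite (eq_bigr (fun q => c q * - e q)); last by move=> *; ring.
  by rewrite -/(G (fun q => - e q)) => ->; rewrite /G; ring.
rewrite /F gn -/(G e); have := EN_sq N (/ 2 * G e).
rewrite (_ : 2 * (/ 2 * G e) = G e); last by field.
rewrite (_ : 2 * - (/ 2 * G e) = - G e); last by field.
rewrite (_ : / 2 * - G e = - (/ 2 * G e)); last by ring.
lra.
Qed.

(** With n = 2m and l = sqrt n, G^n <= (n!/l^n) cosh(l G), whose expectation is at most (n!/l^n)
    e^(mv), v being the sum of the c(q)^2; and n!/l^n <= n^m. *)
Lemma Av_pow c I m : uniq I -> (1 <= m)%N ->
  Av c (pol_pow (plin 1 I) (2 * m)) <= (INR (2 * m) * exp (\rsum_(q <- I) c q ^ 2)) ^ m.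
Proof.
move=> uI m1; have wI : wf (mem I) (pol_pow (plin 1 I) (2 * m)) by apply: wf_pow; apply: wf_lin; [lra | apply/allP].
rewrite -(Ex_ev c uI wI).
set n := (2 * m)%N. have n0 : 0 < INR n by apply: INR_gt0; rewrite /n; lia.
set l := sqrt (INR n). have l0 : 0 < l by apply: sqrt_lt_R0.
have ll : l * l = INR n by apply: sqrt_sqrt; lra.
have l2m : l ^ n = INR n ^ m by rewrite /n pow_mult /= Rmult_1_r ll.
have f0 := INR_fact_gt0 n.
have nm : 0 < INR n ^ m by apply: pow_lt.
set v := \big[_/_]_(_ <- _) _.
apply: (Rle_trans _ ((INR n`! / INR n ^ m) * exp (/ 2 * \rsum_(q <- I) (l * c q) ^ 2))).
  apply: Rle_trans (Rmult_le_compat_l _ _ _ _ (Ex_cosh (fun q => l * c q) uI)); last by apply/Rlt_le/Rdiv_lt_0_compat.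
  rewrite -Ex_scal; apply: Ex_le => e.
  rewrite ev_pow ev_lin Rmult_1_l.
  have -> : \rsum_(q <- I) (l * c q * e q) = l * \rsum_(q <- I) (c q * e q).
    by rewrite -rsum_scal; apply: eq_bigr => q _; ring.
  set G := \big[_/_]_(_ <- _) _.
  have := even_term m (l * G); rewrite -/n Rpow_mult_distr l2m => h.
  have -> : G ^ n = INR n`! / INR n ^ m * (/ INR n`! * (INR n ^ m * G ^ n)) by field; lra.
  by apply: Rmult_le_compat_l => //; apply/Rlt_le/Rdiv_lt_0_compat.
have -> : / 2 * \rsum_(q <- I) (l * c q) ^ 2 = INR m * v.
  rewrite (eq_bigr (fun q => (l * l) * c q ^ 2)); last by move=> *; ring.
  by rewrite rsum_scal ll /n INR_mul -/v /=; field.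
have -> : exp (INR m * v) = exp v ^ m.
  elim: (m) => [|k IH]; first by rewrite /= Rmult_0_l exp_0.
  by rewrite S_INR Rmult_plus_distr_r exp_plus IH /= Rmult_1_l; ring.
rewrite Rpow_mult_distr; apply: Rmult_le_compat_r; first by apply: pow_le; apply/exp_ge0.
have ff : INR n`! <= INR n ^ n.
  rewrite -INR_exp; apply: le_INR; apply/leP.
  elim: (n) => // k IH; rewrite factS expnS leq_mul2l; apply/orP; right.
  by apply: leq_trans IH _; case: (k) => // k'; rewrite leq_exp2r.
apply: (Rmult_le_reg_r (INR n ^ m)) => //.
have -> : INR n`! / INR n ^ m * INR n ^ m = INR n`! by field; lra.
by rewrite -pow_add (_ : (m + m)%coq_nat = n) //; rewrite /n; lia.
Qed.

(** * The exponent of the bound as a quadratic form in cosines *)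

Section Exponents.
Variables (k : nat) (a t : nat -> R).
Hypothesis apos : forall j, (j < k)%N -> 0 < a j.

Definition asum : R := sumR a k.
(** At u = log q, the coefficient of chi(q)/sqrt q in the sum of the a_j log|L(1/2 + i t_j)|. *)
Definition hh (u : R) : R := sumR (fun j => a j * cos (t j * u)) k.
(** Shape of hh^2/2 after the product formula for cosines, as a linear functional of a function Z of
    the frequency. Putting [lz] for Z gives zeta exponents. *)
Definition Qf (Z : R -> R) : R :=
  sumR (fun l => a l ^ 2 / 4 * (Z 0 + Z (2 * t l)) +
    sumR (fun m => a m * a l / 2 * (Z (t m - t l) + Z (t m + t l))) l) k.
(** Logarithm of the claimed bound divided by X, at La = log X ([moment_bound_exp]). *)
Definition TEx (La : R) : R :=
  sumR (fun j => a j ^ 2) k / 4 * ln La +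
  sumR (fun l => sumR (fun m => a m * a l / 2 * lz La (t m - t l) + a m * a l / 2 * lz La (t m + t l)) l) k +
  sumR (fun m => (a m ^ 2 / 4 + a m / 2) * lz La (2 * t m)) k.

Lemma asum_ge0 : 0 <= asum.
Proof. by apply: sumR_ge0 => j hj; apply/Rlt_le/apos. Qed.

Lemma hh_sq u : / 2 * hh u ^ 2 = Qf (fun tau => cos (tau * u)).
Proof.
rewrite /hh /Qf; elim: k => [|n IH]; first by rewrite /=; ring.
rewrite [sumR _ n.+1]/= [X in _ = X]/= -IH Rmult_0_l cos_0.
have -> : cos (2 * t n * u) = 2 * cos (t n * u) * cos (t n * u) - 1 by rewrite Rmult_assoc cos_2a_cos.
have -> : sumR (fun m => a m * a n / 2 * (cos ((t m - t n) * u) + cos ((t m + t n) * u))) n =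
   a n * cos (t n * u) * sumR (fun j => a j * cos (t j * u)) n.
  rewrite -sumR_scal; apply: sumR_ext => m _.
  rewrite Rmult_minus_distr_r Rmult_plus_distr_r cos_minus cos_plus; field.
by field.
Qed.

Lemma Qf_lin c Z Z' : Qf (fun x => c * Z x + Z' x) = c * Qf Z + Qf Z'.
Proof.
rewrite /Qf -sumR_scal -sumR_plus; apply: sumR_ext => l _.
rewrite (sumR_ext (g := fun m => c * (a m * a l / 2 * (Z (t m - t l) + Z (t m + t l))) + a m * a l / 2 * (Z' (t m - t l) + Z' (t m + t l)))); last by move=> m _; ring.
by rewrite sumR_plus sumR_scal; ring.
Qed.

Lemma Qf_0 : Qf (fun _ => 0) = 0.
Proof. by have := Qf_lin 1 (fun _ => 0) (fun _ => 0); rewrite Rmult_0_r Rplus_0_r; lra. Qed.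

Lemma Qf_le Z Z' : (forall x, Z x <= Z' x) -> Qf Z <= Qf Z'.
Proof.
move=> h; apply: sumR_le => l hl; have al := apos hl.
apply: Rplus_le_compat.
  have := h 0; have := h (2 * t l); have := pow2_ge_0 (a l); nra.
apply: sumR_le => m hm; have am := @apos m (ltac:(lia)).
apply: Rmult_le_compat_l; last by have := h (t m - t l); have := h (t m + t l); lra.
by have := Rmult_lt_0_compat _ _ am al; lra.
Qed.

Lemma Qf_const c : Qf (fun _ => c) = c * (/ 2 * asum ^ 2).
Proof.
have e := hh_sq 0; have := Qf_lin c (fun tau => cos (tau * 0)) (fun _ => 0).
rewrite -e Qf_0 (_ : hh 0 = asum); last by apply: sumR_ext => j _; rewrite Rmult_0_r cos_0; ring.
rewrite Rplus_0_r => <-; apply: Rle_antisym; apply: Qf_le => x; rewrite Rmult_0_r cos_0; lra.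
Qed.

Lemma Qf_sum (s : seq nat) (P : pred nat) (w : nat -> R) :
  \rsum_(q <- s | P q) (w q * (/ 2 * hh (lnN q) ^ 2)) =
  Qf (fun tau => \rsum_(q <- s | P q) (w q * cos (tau * lnN q))).
Proof.
elim: s => [|q s IH].
  rewrite big_nil -{1}Qf_0; apply: Rle_antisym; apply: Qf_le => x; rewrite big_nil; lra.
rewrite big_cons; case: (boolP (P q)) => h.
  rewrite IH hh_sq -Qf_lin; apply: Rle_antisym; apply: Qf_le => x; rewrite big_cons h; lra.
rewrite IH; apply: Rle_antisym; apply: Qf_le => x; rewrite big_cons (negbTE h); lra.
Qed.

Lemma hh_abs u : Rabs (hh u) <= asum.
Proof.
apply: Rle_trans (sumR_abs _ _) _; apply: sumR_le => j hj; have := apos hj => aj.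
rewrite Rabs_mult (Rabs_pos_eq (a j)); last lra.
have : Rabs (cos (t j * u)) <= 1 by apply: Rabs_le; have := COS_bound (t j * u); lra.
nra.
Qed.

(** Coefficient of chi(q) in the majorant of the logarithm of the product, cut off at log q = L.
    [Sx] collects the squares of primes, with chi(q)^2 replaced by 1. *)
Definition cq (L : R) (q : nat) : R := smooth L q * exp (- / 2 * lnN q) * hh (lnN q).

Definition Sx (L : R) (N : nat) : R := sumR (fun j => a j * (/ 2 *
  \psum_(q <= N | (q ^ 2 <= N)%N) pterm2 (smooth L) (/ 2) (t j) q)) k.

Lemma ln_sq q : ln (INR (q ^ 2)) = 2 * lnN q.
Proof.
case: q => [|q]; last by rewrite ln_expN.
rewrite /= (_ : ln 0 = 0); first by ring.
by rewrite /ln; case: Rlt_dec => // h; case: (Rlt_irrefl 0).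
Qed.

(** Squaring the cutoff at most doubles its deviation 2 log q / L from 1, hence c = 4 in
    [zeta_compare]. *)
Lemma omega1_sum La L r N tau : 1 <= La -> 0 < L <= La -> La <= L * 2 ^ r -> (forall n, (N < n)%N -> L < lnN n) ->
  \psum_(q <= N) (smooth L q ^ 2 / INR q * cos (tau * lnN q)) <= lz La tau + (4 * INR r + 32).
Proof.
move=> La1 [L0 LLa] hr hN.
have := @zeta_compare La L r 4 (fun q => smooth L q ^ 2) tau N La1 (conj L0 LLa) hr (ltac:(lra)).
rewrite (_ : 4 * INR r + 2 * 4 + 24 = 4 * INR r + 32); last ring.
apply.
- by move=> q _; have [s0 s1] := smooth_01 q L0; split; nra.
- by move=> q _ h; rewrite smooth_0; [ring | | lra].
- move=> q _ _; have [s0 s1] := smooth_01 q L0; have := smooth_ge q L0.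
  rewrite (_ : 4 * lnN q / L = 2 * (2 * lnN q / L)); last by rewrite /Rdiv; ring.
  nra.
- by move=> q h _; rewrite smooth_0; [ring | | apply/Rlt_le/hN].
Qed.

Lemma omega2_sum La L r N tau : 1 <= La -> 0 < L <= La -> La <= L * 2 ^ r -> (forall n, (N < n)%N -> L < lnN n) ->
  \psum_(q <= N | (q ^ 2 <= N)%N) pterm2 (smooth L) (/ 2) tau q <= lz La (2 * tau) + (4 * INR r + 32).
Proof.
move=> La1 [L0 LLa] hr hN.
have := @zeta_compare La L r 4 (fun q => smooth L (q ^ 2)) (2 * tau) N La1 (conj L0 LLa) hr (ltac:(lra)).
rewrite (_ : 4 * INR r + 2 * 4 + 24 = 4 * INR r + 32); last ring.
have -> : \psum_(q <= N | (q ^ 2 <= N)%N) pterm2 (smooth L) (/ 2) tau q =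
   \psum_(q <= N) (smooth L (q ^ 2) / INR q * cos (2 * tau * lnN q)).
  rewrite big_mkcondr; apply: eq_bigr => q pq; have q0 := INR_gt0 (prime_gt0 pq).
  rewrite /pterm2 (_ : - (2 * / 2) * lnN q = - lnN q); last by field.
  rewrite exp_Ropp exp_ln //; case: ifP => // /negbT; rewrite -ltnNge => /hN h.
  by rewrite smooth_0 //; [rewrite /Rdiv; ring | lra].
apply.
- by move=> q _; exact: smooth_01.
- by move=> q _ h; rewrite smooth_0 // ln_sq; lra.
- by move=> q _ _; have := smooth_ge (q ^ 2) L0; rewrite ln_sq (_ : 2 * (2 * lnN q) / L = 4 * lnN q / L); [lra | rewrite /Rdiv; ring].
- move=> q h pq; rewrite smooth_0 // ln_sq; have := hN q h; have := ln_INR_ge0 q; lra.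
Qed.

Lemma lz0_le La : 1 <= La -> lz La 0 <= ln La + 1.
Proof.
move=> h; have h0 : 0 < La by lra.
apply: Rle_trans (lz_upper h0) _.
have : ln (1 + La) <= ln (2 * La) by apply: ln_le; lra.
rewrite ln_mult; try lra. have := ln_le_sub1 Rlt_0_2; lra.
Qed.

Lemma sumR_sq_le : sumR (fun j => a j ^ 2) k <= asum ^ 2.
Proof.
rewrite /asum; elim: k apos => [|n IH] ap; first by rewrite /=; lra.
rewrite /=; have {}IH := IH (fun j hj => ap j (ltac:(lia))).
have an := ap n (ltac:(lia)); have s0 : 0 <= sumR a n by apply: sumR_ge0 => j hj; apply/Rlt_le/ap; lia.
rewrite /= in IH; nra.
Qed.

Lemma Qf_lz_TEx La : 1 <= La -> Qf (lz La) + sumR (fun j => a j * (/ 2 * lz La (2 * t j))) k <= TEx La + asum ^ 2.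
Proof.
move=> La1; have l0 := lz0_le La1.
have -> : Qf (lz La) + sumR (fun j => a j * (/ 2 * lz La (2 * t j))) k = TEx La + sumR (fun j => a j ^ 2) k / 4 * (lz La 0 - ln La).
  rewrite /Qf /TEx; elim: (k) => [|n IH]; first by rewrite /=; field.
  rewrite /=; rewrite /= in IH.
  have -> : sumR (fun m => a m * a n / 2 * (lz La (t m - t n) + lz La (t m + t n))) n = sumR (fun m => a m * a n / 2 * lz La (t m - t n) + a m * a n / 2 * lz La (t m + t n)) n.
    by apply: sumR_ext => m _; ring.
  lra.
have := sumR_sq_le; have : 0 <= sumR (fun j => a j ^ 2) k by apply: sumR_ge0 => j _; exact: pow2_ge_0.
nra.
Qed.

(** Half the variance is [Qf] of prime sums, each at most log|zeta| + O(r + 1) by [omega1_sum]; the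
    squares of primes give the additional a_m/2 in the exponent of zeta at 1 + 1/La + 2 i t_m.
    Stopping at L >= La/2^r instead of La accounts for the r. *)
Lemma expo_bound La L r N : 1 <= La -> 0 < L <= La -> La <= L * 2 ^ r -> (forall n, (N < n)%N -> L < lnN n) ->
  / 2 * \psum_(q <= N) cq L q ^ 2 + Sx L N <= TEx La + (asum ^ 2 + asum) * (4 * INR r + 33).
Proof.
move=> La1 hL hr hN; have as0 := asum_ge0.
have -> : / 2 * \psum_(q <= N) cq L q ^ 2 =
   \psum_(q <= N) (smooth L q ^ 2 / INR q * (/ 2 * hh (lnN q) ^ 2)).
  rewrite -rsum_scal; apply: eq_bigr => q pq; have q0 := INR_gt0 (prime_gt0 pq).
  rewrite /cq /Rdiv (_ : / INR q = exp (- / 2 * lnN q) ^ 2); first by ring.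
  rewrite /= Rmult_1_r -exp_plus (_ : - / 2 * lnN q + - / 2 * lnN q = - lnN q); last by field.
  by rewrite exp_Ropp exp_ln.
rewrite Qf_sum.
have h1 : Qf (fun tau => \psum_(q <= N) (smooth L q ^ 2 / INR q * cos (tau * lnN q))) <= Qf (lz La) + (4 * INR r + 32) * (/ 2 * asum ^ 2).
  rewrite -Qf_const; apply: (Rle_trans _ (Qf (fun x => 1 * lz La x + (4 * INR r + 32)))).
    by apply: Qf_le => tau; rewrite Rmult_1_l; exact: omega1_sum.
  by rewrite Qf_lin Rmult_1_l; exact: Rle_refl.
have h2 : Sx L N <= sumR (fun j => a j * (/ 2 * lz La (2 * t j))) k + (/ 2 * (4 * INR r + 32)) * asum.
  rewrite /asum -sumR_scal -sumR_plus; apply: sumR_le => j hj; have aj := apos hj.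
  have := omega2_sum (t j) La1 hL hr hN; nra.
have h3 := Qf_lz_TEx La1.
have r0 := pos_INR r. have q0 : 0 <= asum ^ 2 by apply: pow2_ge_0.
nra.
Qed.

(** Replaces all cosines by 1 and so loses powers of log X; meant for places where a power of X is
    saved. *)
Lemma Sx_crude La L r N : 1 <= La -> 0 < L <= La -> La <= L * 2 ^ r -> (forall n, (N < n)%N -> L < lnN n) ->
  Sx L N <= asum * (ln La + 33 + 4 * INR r).
Proof.
move=> La1 hL hr hN; have as0 := asum_ge0.
rewrite Rmult_comm /asum -sumR_scal; apply: sumR_le => j hj; have aj := apos hj.
have h : \psum_(q <= N | (q ^ 2 <= N)%N) pterm2 (smooth L) (/ 2) (t j) q <=
  \psum_(q <= N | (q ^ 2 <= N)%N) pterm2 (smooth L) (/ 2) 0 q.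
  apply: rsum_le => q _ _; rewrite /pterm2; apply: Rmult_le_compat_l.
    by apply: Rmult_le_pos; [have [] := smooth_01 (q ^ 2) (proj1 hL) | apply/exp_ge0].
  by rewrite Rmult_0_r Rmult_0_l cos_0; have := COS_bound (2 * t j * lnN q); lra.
have := omega2_sum 0 La1 hL hr hN; rewrite Rmult_0_r; have := lz0_le La1.
have : 0 <= ln La by rewrite -ln_1; apply: ln_le; lra.
have := pos_INR r; nra.
Qed.

(** As log|zeta| >= -log zeta(1 + 1/La), the claimed bound is at least X times a fixed negative
    power of log X, up to a constant; this is what absorbs the error terms. *)
Lemma TEx_lower La : 1 <= La -> - ((asum ^ 2 + asum) * (ln La + 1)) <= TEx La.
Proof.
move=> La1; have l0 := lz0_le La1; have as0 := asum_ge0.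
have lL : 0 <= ln La by rewrite -ln_1; apply: ln_le; lra.
have lw x : - (ln La + 1) <= lz La x by have := lz_lower x (ltac:(lra) : 0 < La); lra.
have a2 : 0 <= sumR (fun j => a j ^ 2) k by apply: sumR_ge0 => j _; exact: pow2_ge_0.
have -> : TEx La = sumR (fun j => a j ^ 2) k / 4 * (ln La - lz La 0) + (Qf (lz La) + sumR (fun j => a j * (/ 2 * lz La (2 * t j))) k).
  rewrite /Qf /TEx; elim: (k) => [|n IH]; first by rewrite /=; field.
  rewrite /=; rewrite /= in IH.
  have -> : sumR (fun m => a m * a n / 2 * (lz La (t m - t n) + lz La (t m + t n))) n = sumR (fun m => a m * a n / 2 * lz La (t m - t n) + a m * a n / 2 * lz La (t m + t n)) n.
    by apply: sumR_ext => m _; ring.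
  lra.
have h1 : - (ln La + 1) * (/ 2 * asum ^ 2) <= Qf (lz La) by rewrite -Qf_const; exact: Qf_le.
have h2 : - (ln La + 1) * / 2 * asum <= sumR (fun j => a j * (/ 2 * lz La (2 * t j))) k.
  rewrite /asum -sumR_scal; apply: sumR_le => j hj; have aj := apos hj; have := lw (2 * t j); nra.
have := sumR_sq_le; have : 0 <= asum ^ 2 by apply: pow2_ge_0.
nra.
Qed.

Lemma rpow_exp x y : 0 < y -> rpow (exp x) y = exp (y * x).
Proof.
move=> h; rewrite /rpow; case: Req_EM_T => e; first by have := exp_pos x; lra.
by rewrite /Rpower ln_exp.
Qed.

Lemma prodR_ext f g n : (forall i, (i < n)%N -> f i = g i) -> prodR f n = prodR g n.
Proof. by elim: n => //= n IH h; rewrite IH ?h // => i hi; apply: h; lia. Qed.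

Lemma prodR_exp f n : prodR (fun i => exp (f i)) n = exp (sumR f n).
Proof. by elim: n => /= [|n ->]; rewrite ?exp_0 ?exp_plus. Qed.

Lemma moment_bound_exp X : 1 < ln X -> (0 < k)%N -> moment_bound k a t X = X * exp (TEx (ln X)).
Proof.
move=> hX k0; rewrite /moment_bound.
have L0 : 0 < ln X by lra.
have c1 : 1 + 1 / ln X = 1 + / ln X by field; lra.
rewrite c1.
have z x : Cmod (zeta (1 + / ln X, x)) = exp (lz (ln X) x) by apply: zeta_exp.
have sq0 : 0 < sumR (fun j => a j ^ 2) k.
  case: (k) k0 apos => // n _ ap /=; have := ap n (ltac:(lia)) => an.
  have : 0 <= sumR (fun j => a j ^ 2) n by apply: sumR_ge0 => j _; exact: pow2_ge_0.
  rewrite /=; nra.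
have -> : rpow (ln X) (sumR (fun j => a j ^ 2) k / 4) = exp (sumR (fun j => a j ^ 2) k / 4 * ln (ln X)).
  by rewrite -{1}(exp_ln (ln X)) // rpow_exp //; lra.
rewrite (prodR_ext (g := fun l => exp (sumR (fun m => a m * a l / 2 * lz (ln X) (t m - t l) + a m * a l / 2 * lz (ln X) (t m + t l)) l))); last first.
  move=> l hl; rewrite -prodR_exp; apply: prodR_ext => m hm.
  have am := @apos m (ltac:(lia)). have al := apos hl. have p := Rmult_lt_0_compat _ _ am al.
  by rewrite !z !rpow_exp ?exp_plus //; lra.
have -> : prodR (fun m => rpow (Cmod (zeta (1 + / ln X, 2 * t m))) (a m ^ 2 / 4 + a m / 2)) k = exp (sumR (fun m => (a m ^ 2 / 4 + a m / 2) * lz (ln X) (2 * t m)) k).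
  rewrite -prodR_exp; apply: prodR_ext => m hm; have am := apos hm; rewrite z rpow_exp //; have := pow2_ge_0 (a m); lra.
rewrite !prodR_exp /TEx !exp_plus; ring.
Qed.

Definition Wp (p : nat) : R := prodR (fun j => rpow (Cmod (Lkron (8 * Z.of_nat p) (1 / 2, t j))) (a j)) k.

Lemma Wp_ge0 p : 0 <= Wp p.
Proof.
rewrite /Wp; elim: (k) => /= [|n IH]; first lra.
apply: Rmult_le_pos => //; rewrite /rpow; case: Req_EM_T => _; first lra.
exact/exp_ge0.
Qed.

(** [Lkron_bound] raised to the powers a_j and multiplied over j. *)
Lemma Wp_bound p L N B : GRH -> prime p -> odd p -> / 2 <= L -> (forall n, (N < n)%N -> L < lnN n) ->
  (forall j, (j < k)%N -> ln (INR (8 * p)) + ln (2 + Rabs (t j)) <= B) -> 0 <= C0 ->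
  Wp p <= exp (\psum_(q <= N) (chi8 p q * cq L q) + Sx L N + 13 * asum + C0 * asum * B / L).
Proof.
move=> G pp op L2 hN hB C00.
have -> : \psum_(q <= N) (chi8 p q * cq L q) =
   sumR (fun j => a j * \psum_(q <= N) (chi8 p q * pterm (smooth L) (/ 2) (t j) q)) k.
  rewrite /cq /hh; elim: (k) => [|n IH] /=.
    by rewrite big1 // => q _; ring.
  by rewrite -IH -rsum_scal -rsum_plus; apply: eq_bigr => q _; rewrite /pterm; ring.
have -> : sumR (fun j => a j * \psum_(q <= N) (chi8 p q * pterm (smooth L) (/ 2) (t j) q)) k + Sx L N + 13 * asum + C0 * asum * B / L =
  sumR (fun j => a j * (\psum_(q <= N) (chi8 p q * pterm (smooth L) (/ 2) (t j) q) + / 2 *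
  \psum_(q <= N | (q ^ 2 <= N)%N) pterm2 (smooth L) (/ 2) (t j) q + 13 + C0 * B / L)) k.
  by rewrite /Sx /asum; elim: (k) => [|n IH] /=; [rewrite /Rdiv; ring | rewrite -IH /Rdiv; ring].
pose E j := \psum_(q <= N) (chi8 p q * pterm (smooth L) (/ 2) (t j) q) + / 2 *
  \psum_(q <= N | (q ^ 2 <= N)%N) pterm2 (smooth L) (/ 2) (t j) q + 13 + C0 * B / L.
rewrite -prodR_exp /Wp.
have : forall n, (n <= k)%N -> 0 <= prodR (fun j => rpow (Cmod (Lkron (8 * Z.of_nat p) (1 / 2, t j))) (a j)) n <=
  prodR (fun j => exp (a j * E j)) n; last by move=> /(_ k (leqnn k)) [].
elim=> [|n IH] hn; first by rewrite /=; lra.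
have [i0 i1] := IH (ltac:(lia)). have an := @apos n hn.
have lb := Lkron_bound pp op (t n) G L2 hN.
have {}lb : Cmod (Lkron (8 * Z.of_nat p) (1 / 2, t n)) <= exp (E n).
  apply: Rle_trans lb _; apply: exp_le; rewrite /E; apply: Rplus_le_compat_l.
  apply: Rmult_le_compat_r; first by apply/Rinv_ge0; lra.
  by apply: Rmult_le_compat_l => //; exact: hB.
have m0 := Cmod_ge_0 (Lkron (8 * Z.of_nat p) (1 / 2, t n)).
have rb : 0 <= rpow (Cmod (Lkron (8 * Z.of_nat p) (1 / 2, t n))) (a n) <= exp (a n * E n).
  rewrite /rpow; case: Req_EM_T => e; first by have := exp_pos (a n * E n); lra.
  split; first exact/exp_ge0.
  apply: exp_le; apply: Rmult_le_compat_l; first lra.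
  by rewrite -(ln_exp (E n)); apply: ln_le => //; lra.
split; first exact: (Rmult_le_pos _ _ i0 (proj1 rb)).
exact: (Rmult_le_compat _ _ _ _ i0 (proj1 rb) i1 (proj2 rb)).
Qed.

End Exponents.

(** * Blocks of primes, the stopping level and polynomial majorants *)

Fixpoint pblocks (bs : seq (nat * seq nat)) : pol :=
  if bs is b :: bs' then pmul (block b.1 b.2) (pblocks bs') else pone.

Lemma Rlog_2 : / 2 < ln 2 <= 1.
Proof. by split; [exact: ln_lt_2 | have := ln_le_sub1 Rlt_0_2; lra]. Qed.

Section Levels.
Variables (k : nat) (a t : nat -> R).
Hypothesis apos : forall j, (j < k)%N -> 0 < a j.
Variables (La h0 V : R) (Kn Rr N M : nat) (Nn : nat -> nat).
Hypothesis La1 : 1 <= La.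
Hypothesis K1 : (0 < Kn)%N.
Hypothesis V1 : 1 <= V.
Hypothesis M1 : (0 < M)%N.
Hypothesis h01 : 1 <= h0.

(** Level r uses the primes with log q <= lev r. A larger r means shorter sums but a larger loss, C4
    Kn 2^r, from the term of size log X / H with H = lev r. *)
Definition lev (r : nat) : R := La / (INR Kn * 2 ^ r).
(** Threshold for block s. The base 3/2 lies below 2, so that the lengths Nn(s) lev(s) are summable,
    and above sqrt 2, so that moments of order 2 [mm s] beat the threshold. *)
Definition Vs (s : nat) : R := V * (3 / 2) ^ s.
Definition mm (s : nat) : nat := (M * 2 ^ s)%N.

Hypothesis levR : h0 <= lev Rr < 2 * h0.
Hypothesis hN : forall n, (N < n)%N -> lev 0 < lnN n.
Hypothesis NnV : forall s, 10 * Vs s <= INR (Nn s).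
Hypothesis Nns : forall s, (s < Nn s)%N.

Definition blk (s : nat) : seq nat :=
  [seq q <- seq.iota 0 N.+1 | prime q && (~~ rle (lnN q) (lev s.+1) && rle (lnN q) (lev s))].
Definition bs (r : nat) : seq (nat * seq nat) := [seq (Nn s, blk s) | s <- seq.iota r (Rr - r)].

Lemma two_pos r : 0 < 2 ^ r. Proof. by apply: pow_lt; lra. Qed.
Lemma K_ge1 : 1 <= INR Kn. Proof. exact: INR_ge1. Qed.

Lemma lev_S r : lev r = 2 * lev r.+1.
Proof. by rewrite /lev /=; field; have := two_pos r; have := K_ge1; lra. Qed.

Lemma lev_gt0 r : 0 < lev r.
Proof. by apply: Rdiv_lt_0_compat; [lra | apply: Rmult_lt_0_compat; [have := K_ge1; lra | exact: two_pos]]. Qed.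

Lemma lev_le r s : (r <= s)%N -> lev s <= lev r.
Proof.
move=> h; rewrite -(subnK h); elim: (s - r)%N => [|n IH]; first exact: Rle_refl.
by rewrite addSn; apply: Rle_trans IH; rewrite (lev_S (n + r)); have := lev_gt0 (n + r).+1; lra.
Qed.

Lemma lev_La r : lev r <= La.
Proof.
apply: Rle_trans (lev_le (leq0n r)) _; rewrite /lev /= Rmult_1_r.
apply: (Rmult_le_reg_r (INR Kn)); first by have := K_ge1; lra.
rewrite /Rdiv Rmult_assoc Rinv_l; have := K_ge1; nra.
Qed.

(** As Kn <= 2^Kn, level r is reached from La by at most Kn + r halvings; this is the count that
    [expo_bound] charges. *)
Lemma La_lev r : La <= lev r * 2 ^ (Kn + r).
Proof.
have k2 : INR Kn <= 2 ^ Kn.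
  elim: (Kn) => [|n IH]; first by rewrite /=; lra.
  rewrite S_INR [2 ^ _]/=; have : 1 <= 2 ^ n by apply: pow_R1_Rle; lra.
  lra.
rewrite pow_add; have -> : lev r * (2 ^ Kn * 2 ^ r) = La * (2 ^ Kn / INR Kn) by rewrite /lev; field; have := two_pos r; have := K_ge1; lra.
have K0 := K_ge1.
have : 1 <= 2 ^ Kn / INR Kn by apply: (Rmult_le_reg_r (INR Kn)); [lra | rewrite /Rdiv Rmult_assoc Rinv_l; lra].
nra.
Qed.

Lemma lev_h0 r : (r <= Rr)%N -> h0 <= lev r.
Proof. by move=> h; have := lev_le h; lra. Qed.

Lemma mem_blk s q : q \in blk s -> [/\ prime q, lev s.+1 < lnN q & lnN q <= lev s].
Proof.
rewrite mem_filter => /andP [/andP [pq /andP [/rleP h1 /rleP h2]] _]; split=> //; lra.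
Qed.

Lemma blk_odd s q : (s < Rr)%N -> q \in blk s -> prime q && odd q.
Proof.
move=> hs /mem_blk [pq h _]; rewrite pq /=; case: (even_prime pq) => // e.
have := lev_h0 hs; move: h; rewrite e (_ : INR 2 = 2) //; have := Rlog_2; lra.
Qed.

Lemma blk_uniq s : uniq (blk s).
Proof. by rewrite filter_uniq // iota_uniq. Qed.

Lemma blk_split f r : (r <= Rr)%N ->
  \psum_(q <= N | rle (lnN q) (lev r)) f q =
  \psum_(q <= N | rle (lnN q) (lev Rr)) f q +
  \rsum_(s <- seq.iota r (Rr - r)) \rsum_(q <- blk s) f q.
Proof.
move=> h; have [d e] : exists d, (Rr - r)%N = d by exists (Rr - r)%N.
elim: d r h e => [|d IH] r h e.
  by rewrite e big_nil (_ : r = Rr); [rewrite Rplus_0_r | lia].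
rewrite e /= big_cons (_ : d = Rr - r.+1)%N; last by lia.
have := IH r.+1 (ltac:(lia)) (ltac:(lia)).
have -> : \psum_(q <= N | rle (lnN q) (lev r)) f q =
   \psum_(q <= N | rle (lnN q) (lev r.+1)) f q + \rsum_(q <- blk r) f q.
  have -> : \rsum_(q <- blk r) f q = \psum_(q <= N | (~~ rle (lnN q) (lev r.+1) && rle (lnN q) (lev r))) f q.
    by rewrite /blk big_filter /index_iota subn0.
  rewrite [LHS]rsum_mkcond [X in _ = X + _]rsum_mkcond [X in _ = _ + X]rsum_mkcond -rsum_plus; apply: eq_bigr => q _.
  case: (prime q) => /=; last by lra.
  have l1 := lev_S r. have l2 := lev_gt0 r.+1.
  by case: (rleP (lnN q) (lev r.+1)) => h1 /=; case: (rleP (lnN q) (lev r)) => h2 /=; lra.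
by move=> ->; ring.
Qed.

Lemma cq_bound L q : 0 < L -> (0 < q)%N -> Rabs (cq k a t L q) <= asum k a.
Proof.
move=> L0 q0; have [s0 s1] := smooth_01 q L0; have as0 := asum_ge0 apos.
rewrite /cq !Rabs_mult (Rabs_pos_eq (smooth _ _)) // (Rabs_pos_eq (exp _)); last exact/exp_ge0.
have e1 : exp (- / 2 * lnN q) <= 1 by apply: exp_le1; have := ln_INR_ge0 q; lra.
have e0 := exp_pos (- / 2 * lnN q).
have := hh_abs t apos (lnN q); have := Rabs_pos (hh k a t (lnN q)).
set x := Rabs _ => x0 x1.
have : smooth L q * exp (- / 2 * lnN q) <= 1 * 1 by apply: Rmult_le_compat; lra.
have : 0 <= smooth L q * exp (- / 2 * lnN q) by apply: Rmult_le_pos; lra.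
nra.
Qed.

Lemma cq_sq_bound L q : 0 < L -> prime q -> cq k a t L q ^ 2 <= asum k a ^ 2 * / INR q.
Proof.
move=> L0 pq; have [s0 s1] := smooth_01 q L0; have as0 := asum_ge0 apos.
have q0 := INR_gt0 (prime_gt0 pq).
have -> : cq k a t L q ^ 2 = smooth L q ^ 2 * hh k a t (lnN q) ^ 2 * / INR q.
  rewrite /cq (_ : / INR q = exp (- / 2 * lnN q) ^ 2); first by ring.
  rewrite /= Rmult_1_r -exp_plus (_ : - / 2 * lnN q + - / 2 * lnN q = - lnN q); last by field.
  by rewrite exp_Ropp exp_ln.
apply: Rmult_le_compat_r; first exact/Rinv_ge0.
have h := hh_abs t apos (lnN q).
have h2 : hh k a t (lnN q) ^ 2 <= asum k a ^ 2.
  rewrite -(pow2_abs (hh _ _ _ _)); apply: pow_incr; split=> //; exact: Rabs_pos.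
have h3 : 0 <= hh k a t (lnN q) ^ 2 by exact: pow2_ge_0.
have : smooth L q ^ 2 <= 1 by nra.
have : 0 <= smooth L q ^ 2 by exact: pow2_ge_0.
nra.
Qed.

Definition B0 : R := asum k a * (8 * h0 * exp (2 * h0)).

(** The primes with log q <= lev Rr < 2 h0 contribute a bounded amount whatever their signs. *)
Lemma bottom_bound (x : nat -> R) L : 0 < L -> (forall q, Rabs (x q) <= 1) ->
  \psum_(q <= N | rle (lnN q) (lev Rr)) (x q * cq k a t L q) <= B0.
Proof.
move=> L0 hx; have as0 := asum_ge0 apos.
have hu := levR; set u := lev Rr in hu *.
apply: (Rle_trans _ (\psum_(q <= N | rle (lnN q) u) (asum k a * 2 * exp u * (lnN q / INR q)))).
  apply: rsum_le => q _ /andP [pq /rleP hq].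
  have q0 := INR_gt0 (prime_gt0 pq).
  apply: Rle_trans (Rle_abs _) _; rewrite Rabs_mult.
  have := cq_bound L0 (prime_gt0 pq); have := hx q; have := Rabs_pos (x q); have := Rabs_pos (cq k a t L q) => c0 x0 x1 c1.
  apply: (Rle_trans _ (1 * asum k a)); first by apply: Rmult_le_compat.
  have l2 := ln2_INR (prime_gt1 pq). have l3 := Rlog_2.
  have : 1 <= 2 * exp u * (lnN q / INR q).
    have : INR q <= exp u by rewrite -(exp_ln (INR q)) //; exact: exp_le.
    have -> : 2 * exp u * (lnN q / INR q) = (2 * lnN q) * (exp u / INR q) by rewrite /Rdiv; ring.
    move=> h; have : 1 <= exp u / INR q by apply: (Rmult_le_reg_r (INR q)) => //; rewrite /Rdiv Rmult_assoc Rinv_l; lra.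
    nra.
  have -> : asum k a * 2 * exp u * (lnN q / INR q) = asum k a * (2 * exp u * (lnN q / INR q)) by ring.
  nra.
rewrite rsum_scal.
have e0 := exp_pos u.
apply: (Rle_trans _ (asum k a * 2 * exp u * (2 * u))).
  apply: Rmult_le_compat_l; last by apply: sum_ln_over_p_le; lra.
  by apply: Rmult_le_pos; [apply: Rmult_le_pos | ]; lra.
have : exp u <= exp (2 * h0) by apply: exp_le; lra.
rewrite /B0 => e2.
have -> : asum k a * 2 * exp u * (2 * u) = asum k a * (exp u * (4 * u)) by ring.
have -> : asum k a * (8 * h0 * exp (2 * h0)) = asum k a * (exp (2 * h0) * (8 * h0)) by ring.
apply: Rmult_le_compat_l => //; apply: Rmult_le_compat; lra.
Qed.

(** Part of the level-r sum carried by block s; the coefficients depend on r through the cutoff. *)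
Definition GG (s r m : nat) : R := \rsum_(q <- blk s) (cq k a t (lev r) q * IZR (leg q (8 * m))).

Lemma total_split p r : prime p -> odd p -> (r <= Rr)%N ->
  \psum_(q <= N) (chi8 p q * cq k a t (lev r) q) <=
  B0 + \rsum_(s <- seq.iota r (Rr - r)) GG s r p.
Proof.
move=> pp op hr.
have -> : \psum_(q <= N) (chi8 p q * cq k a t (lev r) q) =
   \psum_(q <= N | rle (lnN q) (lev r)) (chi8 p q * cq k a t (lev r) q).
  rewrite rsum_mkcond [RHS]rsum_mkcond; apply: eq_bigr => q _; case: (boolP (prime q)) => //= pq.
  case: rleP => // h; rewrite /cq smooth_0; [ring | exact: lev_gt0 | lra].
rewrite blk_split //; apply: Rplus_le_compat.
  by apply: bottom_bound; [exact: lev_gt0 | exact: chi8_b].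
right; rewrite big_seq [RHS]big_seq; apply: eq_bigr => s; rewrite mem_iota => hs.
rewrite /GG big_seq [RHS]big_seq; apply: eq_bigr => q hq.
have /andP [pq oq] : prime q && odd q by apply: blk_odd hq; lia.
rewrite /chi8 -psi_prime // -/(leg q _) Rmult_comm; congr (_ * IZR _).
by rewrite /leg; congr kron_prime; lia.
Qed.

(** Block s enters the sums of all levels l <= s; every one of them is tested, since the level
    finally used is not known in advance. *)
Definition good (p s : nat) : Prop := forall l, (l <= s)%N -> Rabs (GG s l p) <= Vs s.

(** Search downwards from Rr for the first block that is not good. If there is none, r = 0;
    otherwise it is block r - 1, and its sum at some level exceeds the threshold. *)
Lemma stopping p : exists r, (r <= Rr)%N /\ (forall s, (r <= s < Rr)%N -> good p s) /\
  (r = 0%N \/ exists s l, r = s.+1 /\ (l <= s)%N /\ Vs s < Rabs (GG s l p)).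
Proof.
have H : forall d, (d <= Rr)%N -> (forall s, (Rr - d <= s < Rr)%N -> good p s) \/
   exists r, (r <= Rr)%N /\ (forall s, (r <= s < Rr)%N -> good p s) /\ exists s l, r = s.+1 /\ (l <= s)%N /\ Vs s < Rabs (GG s l p).
  elim=> [|d IH] hd; first by left=> s hs; lia.
  case: (IH (ltac:(lia))) => [h|h]; last by right.
  case: (classic (good p (Rr - d.+1))) => hg.
    left=> s hs; case: (eqVneq s (Rr - d.+1)%N) => [->//|ne]; apply: h; lia.
  right; exists (Rr - d)%N; split; first by lia.
  split=> //; move/not_all_ex_not: hg => [l hl].
  have [h1 h2] := imply_to_and _ _ hl.
  exists (Rr - d.+1)%N, l; split; first by lia.
  by split=> //; lra.
case: (H Rr (leqnn Rr)) => [h|[r [h1 [h2 h3]]]].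
  exists 0%N; split=> //; split; last by left.
  by move=> s hs; apply: h; lia.
by exists r; split=> //; split=> //; right.
Qed.

(** Majorant for the m stopped at level r: truncated exponentials on the blocks s >= r and, when r =
    s + 1, an even power of the sum over the failing block s. *)
Definition PP (r : nat) : pol :=
  if r is s.+1 then pmul (pol_pow (plin 1 (blk s)) (2 * mm s)) (pblocks (bs r)) else pblocks (bs r).
(** The failing block lies above level r and carries its coefficients of level l; the primes within
    level r carry those of level r. *)
Definition cf (r l q : nat) : R := if rle (lnN q) (lev r) then cq k a t (lev r) q else cq k a t (lev l) q.

Lemma ev_pblocks r l m : (r <= Rr)%N ->
  ev (pblocks (bs r)) (fun q => cf r l q * IZR (leg q (8 * m))) =
  \big[Rmult/1]_(s <- seq.iota r (Rr - r)) (EN (Nn s) (/ 2 * GG s r m) * EN (Nn s) (/ 2 * GG s r m)).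
Proof.
move=> hr; rewrite /bs.
have : forall s, s \in seq.iota r (Rr - r) -> (r <= s)%N by move=> s; rewrite mem_iota; lia.
elim: (seq.iota r (Rr - r)) => [|s l' IH] H /=; first by rewrite ev_one big_nil.
rewrite ev_mul ev_block IH ?big_cons; last by move=> x hx; apply: H; rewrite inE hx orbT.
have -> : \rsum_(q <- blk s) (cf r l q * IZR (leg q (8 * m))) = GG s r m; last by [].
rewrite /GG big_seq [RHS]big_seq; apply: eq_bigr => q /mem_blk [_ _ h].
rewrite /cf; case: rleP => //; have := lev_le (H s (mem_head _ _)); lra.
Qed.

Lemma ev_PP_S s l m : (s < Rr)%N ->
  ev (PP s.+1) (fun q => cf s.+1 l q * IZR (leg q (8 * m))) =
  GG s l m ^ (2 * mm s) * ev (pblocks (bs s.+1)) (fun q => cf s.+1 l q * IZR (leg q (8 * m))).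
Proof.
move=> hs; rewrite /PP ev_mul ev_pow ev_lin Rmult_1_l; congr (_ ^ _ * _).
rewrite /GG big_seq [RHS]big_seq; apply: eq_bigr => q /mem_blk [_ h _].
by rewrite /cf; case: rleP => //; lra.
Qed.

Lemma ev_pblocks_ge0 r l m : (r <= Rr)%N -> 0 <= ev (pblocks (bs r)) (fun q => cf r l q * IZR (leg q (8 * m))).
Proof.
move=> hr; rewrite ev_pblocks //; elim/big_rec: _ => [|s x _ h]; first lra.
by apply: Rmult_le_pos => //; exact: Rle_0_sqr.
Qed.

Lemma ev_PP_ge0 r l m : (r <= Rr)%N -> 0 <= ev (PP r) (fun q => cf r l q * IZR (leg q (8 * m))).
Proof.
case: r => [|s] hr; first exact: ev_pblocks_ge0.
rewrite ev_PP_S //; apply: Rmult_le_pos; last exact: ev_pblocks_ge0.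
by rewrite pow_mult; apply: pow_le; exact: pow2_ge_0.
Qed.

Lemma Vs_ge s : 1 <= Vs s.
Proof.
rewrite /Vs; have : 1 <= (3 / 2) ^ s by apply: pow_R1_Rle; lra.
nra.
Qed.

(** By [EN_exp_bound], valid because a good block has 10 |GG| <= Nn(s), block s costs a factor
    e^(2^(-Nn(s))) <= e^(2^(-s-1)); these multiply to at most e. *)
Lemma exp_blocks p r l : (r <= Rr)%N -> (forall s, (r <= s < Rr)%N -> good p s) ->
  exp (\rsum_(s <- seq.iota r (Rr - r)) GG s r p) <=
  exp 1 * ev (pblocks (bs r)) (fun q => cf r l q * IZR (leg q (8 * p))).
Proof.
move=> hr hg; rewrite ev_pblocks //.
have main : forall d r0, (r <= r0)%N -> (r0 + d = Rr)%N ->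
   exp (\rsum_(s <- seq.iota r0 d) GG s r p) <= exp ((/ 2) ^ r0) *
     \big[Rmult/1]_(s <- seq.iota r0 d) (EN (Nn s) (/ 2 * GG s r p) * EN (Nn s) (/ 2 * GG s r p)).
  elim=> [|d IH] r0 h1 h2.
    by rewrite /= !big_nil exp_0 Rmult_1_r; have := exp_ineq1_le ((/ 2) ^ r0); have := pow_lt (/ 2) r0 (ltac:(lra)); lra.
  rewrite /= !big_cons exp_plus.
  have g1 := hg r0 (ltac:(lia)) r h1.
  have b1 : exp (GG r0 r p) <= exp ((/ 2) ^ r0.+1) * (EN (Nn r0) (/ 2 * GG r0 r p) * EN (Nn r0) (/ 2 * GG r0 r p)).
    have := @EN_exp_bound (Nn r0) (/ 2 * GG r0 r p) (ltac:(have := Nns r0; lia)).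
    rewrite (_ : 2 * (/ 2 * GG r0 r p) = GG r0 r p); last by field.
    rewrite Rabs_mult (Rabs_pos_eq (/ 2)); last lra.
    move=> h; apply: Rle_trans (h _) _; first by have := NnV r0; lra.
    apply: Rmult_le_compat_r; first exact: Rle_0_sqr.
    apply: exp_le; have e := subnK (Nns r0); rewrite -e pow_add.
    have : (/ 2) ^ (Nn r0 - r0.+1) <= 1 by rewrite -(pow1 (Nn r0 - r0.+1)); apply: pow_incr; lra.
    have := pow_lt (/ 2) r0.+1 (ltac:(lra)); nra.
  have b2 := IH r0.+1 (ltac:(lia)) (ltac:(lia)).
  apply: Rle_trans (Rmult_le_compat _ _ _ _ (Rlt_le _ _ (exp_pos _)) (Rlt_le _ _ (exp_pos _)) b1 b2) _.
  right; have -> : (/ 2) ^ r0 = (/ 2) ^ r0.+1 + (/ 2) ^ r0.+1 by rewrite /=; field.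
  by rewrite exp_plus; ring.
apply: Rle_trans (main (Rr - r)%N r (leqnn r) (ltac:(lia))) _.
apply: Rmult_le_compat_r.
  by elim/big_rec: _ => [|s x _ h]; [lra | apply: Rmult_le_pos => //; exact: Rle_0_sqr].
by apply: exp_le; rewrite -(pow1 r); apply: pow_incr; lra.
Qed.

Variables (E0 C4 : R).
(** The part of the level-r bound independent of the signs; the power of [Vs] normalizes the moment
    of the failing block as in Markov's inequality. *)
Definition cst (r : nat) : R :=
  exp (B0 + 1 + Sx k a t (lev r) N + E0 + C4 * INR Kn * 2 ^ r) * (if r is s.+1 then / Vs s ^ (2 * mm s) else 1).

Lemma cst_gt0 r : 0 < cst r.
Proof.
apply: Rmult_lt_0_compat; first exact: exp_pos.
case: r => [|s]; first lra.
by apply/Rinv_0_lt_compat/pow_lt; have := Vs_ge s; lra.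
Qed.

(** At the level r given by [stopping], W is at most one term (r, l): the blocks from r on are good,
    and on the failing block the factor (|GG|/Vs)^(2 mm) exceeds 1 and may be inserted. All terms
    being nonnegative, summing over every (r, l) removes the dependence of the choice on p. *)
Lemma pointwise p (W : R) : prime p -> odd p ->
  (forall r, (r <= Rr)%N -> W <= exp (\psum_(q <= N) (chi8 p q * cq k a t (lev r) q) + Sx k a t (lev r) N + E0 + C4 * INR Kn * 2 ^ r)) ->
  W <= \rsum_(0 <= r < Rr.+1) \rsum_(0 <= l < maxn r 1) (cst r * ev (PP r) (fun q => cf r l q * IZR (leg q (8 * p)))).
Proof.
move=> pp op hW; have [r [hr [hg hs]]] := stopping p.
have pos r' l' : (r' <= Rr)%N -> 0 <= cst r' * ev (PP r') (fun q => cf r' l' q * IZR (leg q (8 * p))).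
  by move=> h; apply: Rmult_le_pos; [exact/Rlt_le/cst_gt0 | exact: ev_PP_ge0].
have [l [hl hle]] : exists l, (l < maxn r 1)%N /\ W <= cst r * ev (PP r) (fun q => cf r l q * IZR (leg q (8 * p))).
  have base l : W <= exp (B0 + 1 + Sx k a t (lev r) N + E0 + C4 * INR Kn * 2 ^ r) * ev (pblocks (bs r)) (fun q => cf r l q * IZR (leg q (8 * p))).
    apply: Rle_trans (hW r hr) _.
    have b := exp_blocks l hr hg.
    apply: (Rle_trans _ (exp (B0 + Sx k a t (lev r) N + E0 + C4 * INR Kn * 2 ^ r) * exp (\rsum_(s <- seq.iota r (Rr - r)) GG s r p))).
      by rewrite -exp_plus; apply: exp_le; have := total_split pp op hr; lra.
    have -> : B0 + 1 + Sx k a t (lev r) N + E0 + C4 * INR Kn * 2 ^ r = (B0 + Sx k a t (lev r) N + E0 + C4 * INR Kn * 2 ^ r) + 1 by ring.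
    rewrite (exp_plus _ 1) (Rmult_assoc (exp _)); apply: Rmult_le_compat_l => //; exact/exp_ge0.
  case: hs => [e|[s [l [e [hl hv]]]]].
    exists 0%N; split; first by rewrite leq_max orbT.
    have := base 0%N; rewrite e /cst Rmult_1_r; exact.
  exists l; split; first by rewrite leq_max e ltnS hl.
  apply: Rle_trans (base l) _.
  subst r; rewrite ev_PP_S // /cst.
  set A := exp _; set Y := ev _ _.
  have A0 : 0 < A := exp_pos _.
  have Y0 : 0 <= Y by exact: ev_pblocks_ge0.
  have v0 : 0 < Vs s ^ (2 * mm s) by apply: pow_lt; have := Vs_ge s; lra.
  have pw : Vs s ^ (2 * mm s) <= GG s l p ^ (2 * mm s).
    rewrite (pow_mult (Vs s) 2) (pow_mult (GG s l p) 2); apply: pow_incr; split; first exact: pow2_ge_0.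
    rewrite -(pow2_abs (GG s l p)); apply: pow_incr; have := Vs_ge s; lra.
  have -> : A * / Vs s ^ (2 * mm s) * (GG s l p ^ (2 * mm s) * Y) = (A * Y) * (GG s l p ^ (2 * mm s) / Vs s ^ (2 * mm s)) by rewrite /Rdiv; ring.
  have : 1 <= GG s l p ^ (2 * mm s) / Vs s ^ (2 * mm s) by apply: (Rmult_le_reg_r (Vs s ^ (2 * mm s))) => //; rewrite /Rdiv Rmult_assoc Rinv_l; lra.
  have : 0 <= A * Y by apply: Rmult_le_pos; lra.
  nra.
apply: Rle_trans hle _.
rewrite (bigD1_seq r) ?iota_uniq ?mem_index_iota //=.
rewrite (bigD1_seq l) ?iota_uniq ?mem_index_iota //=.
set A := cst r * _; set B := \big[_/_]_(_ <- _ | _) _; set D := \big[_/_]_(_ <- _ | _) _.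
have B1 : 0 <= B by apply: rsum_ge0 => l' _ _; exact: pos.
have D1 : 0 <= D.
  by apply: rsum_ge0 => r'; rewrite mem_index_iota => hr' _; apply: rsum_ge0 => l' _ _; apply: pos; lia.
by move: B1 D1; rewrite /=; lra.
Qed.

Definition bsd (r d : nat) : seq (nat * seq nat) := [seq (Nn s, blk s) | s <- seq.iota r d].

Lemma wf_bsd r d : (r + d <= Rr)%N ->
  wf (fun q => [&& prime q, odd q & rle (lnN q) (lev r)]) (pblocks (bsd r d)).
Proof.
elim: d r => [|d IH] r h; first exact: wf_one.
apply: wf_mul; last first.
  apply: wf_sub (IH r.+1 (ltac:(lia))) => q /and3P [-> -> /rleP h1] /=; apply/rleP.
  by have := lev_le (leqnSn r); lra.
apply: wf_block; apply/allP => q hq; have := blk_odd (ltac:(lia) : (r < Rr)%N) hq => /andP [-> ->] /=.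
by apply/rleP; case: (mem_blk hq).
Qed.

(** Blocks consist of disjoint sets of primes, so the averages multiply, and each obeys
    [Av_block]. *)
Lemma Av_bsd c r d : (r + d <= Rr)%N ->
  Av c (pblocks (bsd r d)) <= exp (/ 2 * \rsum_(s <- seq.iota r d) \rsum_(q <- blk s) c q ^ 2).
Proof.
elim: d r => [|d IH] r h.
  by rewrite /= big_nil Rmult_0_r exp_0 /Av /pone big_cons /= big_nil /mon big_nil; lra.
have w1 : wf (mem (blk r)) (block (Nn r) (blk r)) by apply: wf_block; apply/allP.
have w2 := wf_bsd (ltac:(lia) : (r.+1 + d <= Rr)%N).
rewrite [pblocks _]/= (Av_mul c w1 w2); last first.
  by move=> q /mem_blk [_ h1 _] /and3P [_ _ /rleP h2]; lra.
rewrite /= big_cons Rmult_plus_distr_l exp_plus; apply: Rmult_le_compat; try exact: Av_ge0 w1; try exact: Av_ge0 w2.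
  exact/Av_block/blk_uniq.
apply: IH; lia.
Qed.

Lemma blocks_le_total f r : (r <= Rr)%N -> (forall q, 0 <= f q) ->
  \rsum_(s <- seq.iota r (Rr - r)) \rsum_(q <- blk s) f q <= \psum_(q <= N) f q.
Proof.
move=> hr f0; have := blk_split f hr.
have : 0 <= \psum_(q <= N | rle (lnN q) (lev Rr)) f q by apply: rsum_ge0.
have : \psum_(q <= N | rle (lnN q) (lev r)) f q <= \psum_(q <= N) f q.
  by apply: rsum_mask => [q _ /andP [] // | q _ _].
lra.
Qed.

Lemma Av_blocks r l : (r <= Rr)%N ->
  Av (cf r l) (pblocks (bs r)) <= exp (/ 2 * \psum_(q <= N) cq k a t (lev r) q ^ 2).
Proof.
move=> hr; apply: Rle_trans (Av_bsd (cf r l) (ltac:(lia) : (r + (Rr - r) <= Rr)%N)) _.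
apply: exp_le; apply: Rmult_le_compat_l; first lra.
apply: Rle_trans (blocks_le_total hr (fun q => pow2_ge_0 (cq k a t (lev r) q))).
right; rewrite big_seq [RHS]big_seq; apply: eq_bigr => s; rewrite mem_iota => hs.
rewrite big_seq [RHS]big_seq; apply: eq_bigr => q /mem_blk [_ _ h].
by rewrite /cf; case: rleP => //; have := lev_le (ltac:(lia) : (r <= s)%N); lra.
Qed.

Lemma inv_blk s : \rsum_(q <- blk s) / INR q <= 4.
Proof.
apply: Rle_trans (sum_dyadic N (lev_gt0 s.+1)).
rewrite -lev_S /blk big_filter /index_iota subn0; apply: rsum_mask => [q _ /andP [-> /andP [/rleP h1 ->]] | q _ /andP [pq _]].
  by rewrite andbT; apply/rleP; lra.
exact/Rinv_ge0/INR_gt0/prime_gt0.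
Qed.

(** Bound for the variance of one block: asum^2 times the sum of 1/q, which is at most 4. *)
Definition v0 : R := 4 * asum k a ^ 2.

Lemma Av_PP_S s l : (s < Rr)%N ->
  Av (cf s.+1 l) (PP s.+1) <= (INR (2 * mm s) * exp v0) ^ mm s *
     exp (/ 2 * \psum_(q <= N) cq k a t (lev s.+1) q ^ 2).
Proof.
move=> hs; have w1 : wf (mem (blk s)) (pol_pow (plin 1 (blk s)) (2 * mm s)).
  by apply: wf_pow; apply: wf_lin; [lra | apply/allP].
have w2 := wf_bsd (ltac:(lia) : (s.+1 + (Rr - s.+1) <= Rr)%N).
rewrite /PP (Av_mul _ w1 w2); last first.
  by move=> q /mem_blk [_ h1 _] /and3P [_ _ /rleP h2]; lra.
apply: Rmult_le_compat; try exact: Av_ge0 w1; try exact: Av_ge0 w2; last exact: Av_blocks.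
have m1 : (1 <= mm s)%N by rewrite /mm muln_gt0 M1 expn_gt0.
apply: Rle_trans (Av_pow _ (blk_uniq s) m1) _.
have n0 : 0 <= INR (2 * mm s) := pos_INR _.
apply: pow_incr; split; first by apply: Rmult_le_pos => //; apply/exp_ge0.
apply: Rmult_le_compat_l => //; apply: exp_le.
apply: (Rle_trans _ (asum k a ^ 2 * \rsum_(q <- blk s) / INR q)); last first.
  rewrite /v0 Rmult_comm; apply: Rmult_le_compat_r; [exact: pow2_ge_0 | exact: inv_blk].
rewrite -rsum_scal; apply: rsum_le => q /mem_blk [pq _ _] _.
by rewrite /cf; case: rleP => _; apply: cq_sq_bound => //; exact: lev_gt0.
Qed.

Hypothesis h0a : 4 * asum k a <= exp h0.

Lemma cf_abs r l q : prime q -> Rabs (cf r l q) <= asum k a.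
Proof. by move=> pq; rewrite /cf; case: rleP => _; apply: cq_bound; try exact: lev_gt0; exact: prime_gt0. Qed.

(** Coefficients weighted by q govern the error in [nu_pol]. Here q = q^2/q with q^2 <= e^(2 lev s),
    the sum of 1/q is at most 4, and 4 asum <= e^(h0) <= e^(lev s). *)
Lemma blk_wt r l s : (s <= Rr)%N -> 0 <= \rsum_(q <- blk s) (Rabs (cf r l q) * INR q) <= exp (3 * lev s).
Proof.
move=> hs; have as0 := asum_ge0 apos; split.
  by apply: rsum_ge0 => q _ _; apply: Rmult_le_pos; [exact: Rabs_pos | exact: pos_INR].
apply: (Rle_trans _ (asum k a * exp (2 * lev s) * \rsum_(q <- blk s) / INR q)).
  rewrite -rsum_scal; apply: rsum_le => q /mem_blk [pq _ hq] _.
  have q0 := INR_gt0 (prime_gt0 pq).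
  rewrite Rmult_assoc; apply: Rmult_le_compat => //; try exact: Rabs_pos; first lra; first exact: cf_abs.
  apply: (Rmult_le_reg_r (INR q)) => //; rewrite Rmult_assoc Rinv_l ?Rmult_1_r; last lra.
  rewrite -{1 2}(exp_ln (INR q)) // -exp_plus; apply: exp_le; lra.
apply: (Rle_trans _ (asum k a * exp (2 * lev s) * 4)).
  apply: Rmult_le_compat_l; last exact: inv_blk.
  by apply: Rmult_le_pos => //; apply/exp_ge0.
have -> : 3 * lev s = lev s + 2 * lev s by ring.
rewrite exp_plus; have := exp_pos (2 * lev s) => e0.
have : exp h0 <= exp (lev s) by apply: exp_le; exact: lev_h0.
nra.
Qed.

Lemma wt_bsd r l r0 d : (r0 + d <= Rr)%N ->
  0 <= ev (pblocks (bsd r0 d)) (fun q => Rabs (cf r l q) * INR q) <=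
  exp (6 * \rsum_(s <- seq.iota r0 d) (INR (Nn s) * lev s)).
Proof.
elim: d r0 => [|d IH] r0 h.
  by rewrite /= big_nil Rmult_0_r exp_0 ev_one; lra.
have [i0 i1] := IH r0.+1 (ltac:(lia)).
rewrite [pblocks _]/= ev_mul ev_block /= big_cons Rmult_plus_distr_l exp_plus.
have [y0 y1] := blk_wt r l (ltac:(lia) : (r0 <= Rr)%N).
set Y := \big[_/_]_(_ <- blk r0) _ in y0 y1 *.
have e0 : 0 <= EN (Nn r0) (/ 2 * Y) by apply: EN_ge0; lra.
have e1 : EN (Nn r0) (/ 2 * Y) <= exp (INR (Nn r0) * (3 * lev r0)).
  apply: Rle_trans (EN_le_pow _ (ltac:(lra) : 0 <= / 2 * Y)) _.
  apply: (Rle_trans _ (exp (3 * lev r0) ^ Nn r0)).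
    apply: pow_incr; split; first lra.
    have := exp_ineq1_le (3 * lev r0); have := lev_h0 (ltac:(lia) : (r0 <= Rr)%N); lra.
  right; elim: (Nn r0) => [|n IHn]; first by rewrite /= Rmult_0_l exp_0.
  by rewrite S_INR Rmult_plus_distr_r exp_plus -IHn /= Rmult_1_l; ring.
split; first by apply: Rmult_le_pos => //; apply: Rmult_le_pos.
apply: Rmult_le_compat => //; first by apply: Rmult_le_pos.
have -> : 6 * (INR (Nn r0) * lev r0) = INR (Nn r0) * (3 * lev r0) + INR (Nn r0) * (3 * lev r0) by ring.
by rewrite exp_plus; apply: Rmult_le_compat.
Qed.

Hypothesis NnU : forall s, INR (Nn s) <= 11 * Vs s.
Hypothesis KV : 2640 * V <= INR Kn.
Hypothesis KM : 60 * INR M <= INR Kn.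

(** Thresholds grow by 3/2 and levels shrink by 1/2, so Nn(s) lev(s) decays like (3/4)^s. With 2640
    = 10 * 6 * 11 * 4, the bound on V/Kn makes the total at most La/10. *)
Lemma sum_N_lev r d : 6 * \rsum_(s <- seq.iota r d) (INR (Nn s) * lev s) <= La / 10.
Proof.
have K0 := K_ge1.
have t1 s : INR (Nn s) * lev s <= 11 * V * La / INR Kn * (3 / 4) ^ s.
  have -> : 11 * V * La / INR Kn * (3 / 4) ^ s = (11 * Vs s) * lev s.
    have -> : (3 / 4) ^ s = (3 / 2) ^ s * / 2 ^ s by rewrite -pow_inv -Rpow_mult_distr; congr (_ ^ _); field.
    by rewrite /Vs /lev; field; have := two_pos s; lra.
  by apply: Rmult_le_compat_r => //; apply/Rlt_le/lev_gt0.
have c0 : 0 <= 11 * V * La / INR Kn.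
  by apply: Rmult_le_pos; [apply: Rmult_le_pos; lra | apply/Rinv_ge0; lra].
have t2 : \rsum_(s <- seq.iota r d) (INR (Nn s) * lev s) <= 11 * V * La / INR Kn * (4 * (3 / 4) ^ r).
  apply: (Rle_trans _ (\rsum_(s <- seq.iota r d) (11 * V * La / INR Kn * (3 / 4) ^ s))); first exact: rsum_le.
  rewrite rsum_scal; apply: Rmult_le_compat_l => //.
  elim: d r => [|d IH] r; first by rewrite big_nil; have := pow_le (3 / 4) r (ltac:(lra)); lra.
  by rewrite /= big_cons; have := IH r.+1; rewrite /=; lra.
have p1 : (3 / 4) ^ r <= 1 by rewrite -(pow1 r); apply: pow_incr; lra.
have t3 : 11 * V * La / INR Kn * (4 * (3 / 4) ^ r) <= 11 * V * La / INR Kn * 4 by apply: Rmult_le_compat_l; lra.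
have : 2640 * (V / INR Kn) <= 1.
  apply: (Rmult_le_reg_r (INR Kn)); first lra.
  by rewrite /Rdiv -Rmult_assoc Rmult_assoc Rinv_l; lra.
move=> h; have : La * (2640 * (V / INR Kn)) <= La * 1 by apply: Rmult_le_compat_l; lra.
have := t3; have -> : 11 * V * La / INR Kn * 4 = 44 * La * (V / INR Kn) by field; lra.
lra.
Qed.

(** Every majorant has weight at most X^(1/5) with X = e^La, so after the factor D^4 in [nu_pol] the
    error still saves a power of X. *)
Lemma wt_PP r l : (r <= Rr)%N -> ev (PP r) (fun q => Rabs (cf r l q) * INR q) <= exp (La / 5).
Proof.
case: r => [|s] hs.
  have [_ h] := wt_bsd 0 l (ltac:(lia) : (0 + (Rr - 0) <= Rr)%N).
  by apply: Rle_trans h _; apply: exp_le; have := sum_N_lev 0 (Rr - 0); lra.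
rewrite /PP ev_mul ev_pow ev_lin Rmult_1_l.
have [w0 w1] := wt_bsd s.+1 l (ltac:(lia) : (s.+1 + (Rr - s.+1) <= Rr)%N).
have [y0 y1] := blk_wt s.+1 l (ltac:(lia) : (s <= Rr)%N).
have -> : La / 5 = La / 10 + La / 10 by field.
rewrite exp_plus; apply: Rmult_le_compat => //; first exact: pow_le.
  apply: (Rle_trans _ (exp (3 * lev s) ^ (2 * mm s))); first by apply: pow_incr.
  have -> : exp (3 * lev s) ^ (2 * mm s) = exp (INR (2 * mm s) * (3 * lev s)).
    elim: (2 * mm s)%N => [|n IH]; first by rewrite /= Rmult_0_l exp_0.
    by rewrite S_INR Rmult_plus_distr_r exp_plus -IH /= Rmult_1_l; ring.
  apply: exp_le; rewrite /mm !INR_mul INR_exp /lev (_ : INR 2 = 2) //.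
  have K0 := K_ge1. have t0 := two_pos s.
  have -> : 2 * (INR M * 2 ^ s) * (3 * (La / (INR Kn * 2 ^ s))) = 6 * La * (INR M / INR Kn) by field; lra.
  have : 60 * (INR M / INR Kn) <= 1.
    apply: (Rmult_le_reg_r (INR Kn)); first lra.
    by rewrite /Rdiv -Rmult_assoc Rmult_assoc Rinv_l; lra.
  move=> h; have : La * (60 * (INR M / INR Kn)) <= La * 1 by apply: Rmult_le_compat_l; lra.
  lra.
by apply: Rle_trans w1 _; apply: exp_le; exact: sum_N_lev.
Qed.

Lemma wf_PP r : (r <= Rr)%N -> wf (fun q => prime q && odd q) (PP r).
Proof.
move=> hr; have w r' : (r' <= Rr)%N -> wf (fun q => prime q && odd q) (pblocks (bs r')).
  move=> h; apply: wf_sub (wf_bsd (ltac:(lia) : (r' + (Rr - r') <= Rr)%N)) => q /and3P [-> -> _]; by [].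
case: r hr => [|s] hs; first exact: w.
apply: wf_mul; last exact: w.
by apply: wf_pow; apply: wf_lin; [lra | apply/allP => q; exact: blk_odd].
Qed.

Definition c3 : R := asum k a ^ 2 + asum k a.
Variable beta : R.
Hypothesis C40 : 0 <= C4.
Hypothesis rho : 2 * INR M * exp v0 <= exp (- beta) * V ^ 2.
Hypothesis betaM : 2 * (C4 * INR Kn + 4 * c3 + 2) <= beta * INR M.

Lemma levN r n : (N < n)%N -> lev r < lnN n.
Proof. by move=> /hN; have := lev_le (leq0n r); lra. Qed.

Definition main0 : R := exp (B0 + 1 + E0 + TEx k a t La + c3 * (4 * INR Kn + 33)).

Lemma main_term0 l : cst 0 * Av (cf 0 l) (PP 0) <= main0 * exp (C4 * INR Kn).
Proof.
have h := Av_blocks l (leq0n Rr).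
have eb := expo_bound t apos La1 (conj (lev_gt0 0) (lev_La 0)) (La_lev 0) (@levN 0).
rewrite /cst Rmult_1_r.
apply: Rle_trans (Rmult_le_compat_l _ _ _ (Rlt_le _ _ (exp_pos _)) h) _.
rewrite /main0 -!exp_plus; apply: exp_le.
rewrite addn0 in eb; rewrite /c3 [2 ^ 0]/= Rmult_1_r; lra.
Qed.

Lemma c3_ge0 : 0 <= c3.
Proof. by rewrite /c3; have := asum_ge0 apos; have := pow2_ge_0 (asum k a); lra. Qed.

Lemma INR_le_two r : INR r <= 2 ^ r.
Proof.
elim: r => [|r IH]; first by rewrite /=; lra.
rewrite S_INR [2 ^ _]/=; have : 1 <= 2 ^ r by apply: pow_R1_Rle; lra.
lra.
Qed.

(** Rarity against loss: by [rho] the normalized moment of the failing block is at most e^(-beta M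
    2^s), while level s + 1 loses e^((C4 Kn + O(1)) 2^(s+1)). [betaM] lets the first win with a
    factor e^(-2 * 2^(s+1)) to spare. *)
Lemma main_termS s l : (s < Rr)%N -> cst s.+1 * Av (cf s.+1 l) (PP s.+1) <= main0 * exp (- 2 * 2 ^ s.+1).
Proof.
move=> hs; have h := Av_PP_S l hs.
have eb := expo_bound t apos La1 (conj (lev_gt0 s.+1) (lev_La s.+1)) (La_lev s.+1) (@levN s.+1).
rewrite /cst; apply: Rle_trans (Rmult_le_compat_l _ _ _ _ h) _; first exact/Rlt_le/(cst_gt0 s.+1).
set S2 := / 2 * \big[_/_]_(_ <= _ < _ | _) _ in eb *.
have V0 : 0 < Vs s by have := Vs_ge s; lra.
have t0 := two_pos s.
have ratio : / Vs s ^ (2 * mm s) * (INR (2 * mm s) * exp v0) ^ mm s <= exp (- beta * INR (mm s)).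
  have -> : / Vs s ^ (2 * mm s) * (INR (2 * mm s) * exp v0) ^ mm s = (INR (2 * mm s) * exp v0 / Vs s ^ 2) ^ mm s.
    by rewrite (pow_mult _ 2) -pow_inv -Rpow_mult_distr; congr (_ ^ _); rewrite /Rdiv; ring.
  have -> : exp (- beta * INR (mm s)) = exp (- beta) ^ mm s.
    elim: (mm s) => [|n IH]; first by rewrite /= Rmult_0_r exp_0.
    by rewrite S_INR Rmult_plus_distr_l exp_plus IH Rmult_1_r /=; ring.
  have v2 : 0 < Vs s ^ 2 by apply: pow_lt.
  apply: pow_incr; split.
    by apply: Rmult_le_pos; [apply: Rmult_le_pos; [exact: pos_INR | exact/exp_ge0] | exact/Rinv_ge0].
  apply: (Rmult_le_reg_r (Vs s ^ 2)) => //; rewrite /Rdiv Rmult_assoc Rinv_l ?Rmult_1_r; last lra.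
  have -> : INR (2 * mm s) = 2 * INR M * 2 ^ s by rewrite /mm !INR_mul INR_exp (_ : INR 2 = 2) //; ring.
  have -> : Vs s ^ 2 = V ^ 2 * (9 / 4) ^ s.
    rewrite /Vs Rpow_mult_distr; congr (_ * _); rewrite [_ ^ 2]/= Rmult_1_r -Rpow_mult_distr; congr (_ ^ _); field.
  have p : 2 ^ s <= (9 / 4) ^ s by apply: pow_incr; lra.
  have -> : 2 * INR M * 2 ^ s * exp v0 = (2 * INR M * exp v0) * 2 ^ s by ring.
  rewrite -Rmult_assoc; apply: Rmult_le_compat => //; last exact/Rlt_le.
  by apply: Rmult_le_pos; [have := pos_INR M; lra | exact/exp_ge0].
set A := exp (B0 + 1 + _ + _ + _).
have A0 : 0 < A := exp_pos _.
have e2 := exp_pos S2.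
have -> : A * / Vs s ^ (2 * mm s) * ((INR (2 * mm s) * exp v0) ^ mm s * exp S2) = (A * exp S2) * (/ Vs s ^ (2 * mm s) * (INR (2 * mm s) * exp v0) ^ mm s) by ring.
apply: Rle_trans (Rmult_le_compat_l _ _ _ _ ratio) _; first by apply: Rmult_le_pos; lra.
rewrite /A /main0 -!exp_plus; apply: exp_le.
have m2 : INR (mm s) = INR M * 2 ^ s by rewrite /mm INR_mul INR_exp.
have bm : - beta * INR (mm s) <= - (C4 * INR Kn + 4 * c3 + 2) * 2 ^ s.+1.
  rewrite m2 (_ : 2 ^ s.+1 = 2 * 2 ^ s) //.
  have := Rmult_le_compat_r (2 ^ s) _ _ (Rlt_le _ _ t0) betaM; lra.
have c30 := c3_ge0.
have r2 := INR_le_two s.+1.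
have : c3 * INR s.+1 <= c3 * 2 ^ s.+1 by apply: Rmult_le_compat_l.
have eb' : S2 + Sx k a t (lev s.+1) N <= TEx k a t La + c3 * (4 * (INR Kn + INR s.+1) + 33) by rewrite plus_INR in eb.
move: bm eb'; set T := 2 ^ s.+1; set Z := INR s.+1; set KK := INR Kn.
move=> bm eb' hz.
lra.
Qed.

(** [nu_pol] summed over all (r, l). Level r >= 1 has r choices of l, and r e^(-2 * 2^r) <= 2^(-r),
    so these levels together add at most one further [main0]. *)
Lemma mean_sum D Xn SN : (0 < D)%N -> SN = \rsum_(1 <= m < Xn.+1) nu D m ->
  \rsum_(1 <= m < Xn.+1) (nu D m *
     \rsum_(0 <= r < Rr.+1) \rsum_(0 <= l < maxn r 1) (cst r * ev (PP r) (fun q => cf r l q * IZR (leg q (8 * m))))) <=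
  main0 * (exp (C4 * INR Kn) + 1) * SN +
  \rsum_(0 <= r < Rr.+1) \rsum_(0 <= l < maxn r 1) (cst r * (2 * INR D ^ 4 * exp (La / 5))).
Proof.
move=> D0 eS.
have SN0 : 0 <= SN by rewrite eS; apply: rsum_ge0 => m _ _; exact: nu_ge0.
have D4 : 0 <= INR D ^ 4 by apply: pow_le; exact: pos_INR.
apply: (Rle_trans _ (\rsum_(0 <= r < Rr.+1) \rsum_(0 <= l < maxn r 1)
   (cst r * \rsum_(1 <= m < Xn.+1) (nu D m * ev (PP r) (fun q => cf r l q * IZR (leg q (8 * m))))))).
  right; under eq_bigr => m _ do rewrite big_distrr /=.
  rewrite exchange_big /=; apply: eq_bigr => r _.
  under eq_bigr => m _ do rewrite big_distrr /=.
  rewrite exchange_big /=; apply: eq_bigr => l _.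
  by rewrite -rsum_scal; apply: eq_bigr => m _; ring.
apply: (Rle_trans _ (\rsum_(0 <= r < Rr.+1) \rsum_(0 <= l < maxn r 1)
   (cst r * Av (cf r l) (PP r) * SN + cst r * (2 * INR D ^ 4 * exp (La / 5))))).
  apply: rsum_le => r; rewrite mem_index_iota => hr _; apply: rsum_le => l _ _.
  rewrite Rmult_assoc -Rmult_plus_distr_l; apply: Rmult_le_compat_l; first exact/Rlt_le/cst_gt0.
  have hr' : (r <= Rr)%N by lia.
  apply: Rle_trans (nu_pol Xn (cf r l) D0 (wf_PP hr')) _.
  rewrite -eS; apply: Rplus_le_compat_l; apply: Rmult_le_compat_l; first lra.
  exact: wt_PP.
under eq_bigr => r _ do rewrite rsum_plus.
rewrite rsum_plus; apply: Rplus_le_compat_r.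
have m0 : 0 < main0 := exp_pos _.
rewrite big_ltn // /maxn /= big_nat1.
apply: (Rle_trans _ (main0 * exp (C4 * INR Kn) * SN + \rsum_(1 <= r < Rr.+1) (main0 * (/ 2) ^ r * SN))).
  apply: Rplus_le_compat; first by apply: Rmult_le_compat_r => //; exact: main_term0.
  apply: rsum_le => r; rewrite mem_index_iota => hr _.
  case: r hr => [|s] hs; first by lia.
  apply: (Rle_trans _ (\rsum_(0 <= l < s.+1) (main0 * exp (- 2 * 2 ^ s.+1) * SN))).
    have -> : (if (s.+1 < 1)%N then 1%N else s.+1) = s.+1 by [].
    by apply: rsum_le => l _ _; apply: Rmult_le_compat_r => //; apply: main_termS; lia.
  have cb n x : \rsum_(0 <= l < n) x = INR n * x.
    by elim: n => [|n IH]; [rewrite big_geq // Rmult_0_l | rewrite S_INR big_nat_recr // Rmult_plus_distr_r Rmult_1_l -IH].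
  rewrite cb.
  have : INR s.+1 * exp (- 2 * 2 ^ s.+1) <= (/ 2) ^ s.+1.
    have a1 := INR_le_two s.+1. have a2 := two_pos s.+1.
    set T := 2 ^ s.+1 in a1 a2 *.
    have e1 : exp (- 2 * T) = exp (- T) * exp (- T) by rewrite -exp_plus; congr exp; ring.
    have e0 := exp_pos (- T).
    have e2 : T * exp (- T) <= 1.
      rewrite exp_Ropp; apply: (Rmult_le_reg_r (exp T)); first exact: exp_pos.
      by rewrite Rmult_assoc Rinv_l; [have := exp_ineq1_le T; lra | apply: Rgt_not_eq; exact: exp_pos].
    have e3 : exp (- T) <= (/ 2) ^ s.+1.
      rewrite pow_inv -/T exp_Ropp; apply: Rinv_le_contravar => //.
      by have := exp_ineq1_le T; lra.
    rewrite e1; have s0 := pos_INR s.+1.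
    have : INR s.+1 * exp (- T) <= T * exp (- T) by apply: Rmult_le_compat_r; lra.
    nra.
  move=> h; have := Rmult_le_compat_l (main0 * SN) _ _ (Rmult_le_pos _ _ (Rlt_le _ _ m0) SN0) h; lra.
have g : \rsum_(1 <= r < Rr.+1) (main0 * (/ 2) ^ r * SN) <= main0 * SN.
  rewrite (eq_bigr (fun r => main0 * SN * (/ 2) ^ r)); last by move=> *; ring.
  rewrite rsum_scal; have := @geom_sum_le (/ 2) 1 Rr.+1 (ltac:(lra)).
  rewrite pow_1 (_ : / 2 / (1 - / 2) = 1); last by field.
  have : 0 <= main0 * SN by apply: Rmult_le_pos; lra.
  set G := \big[_/_]_(_ <= _ < _) _; nra.
lra.
Qed.

Hypothesis C4h : 20 * C4 <= h0.

Lemma two_le_La r : (r <= Rr)%N -> INR Kn * 2 ^ r * h0 <= La.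
Proof.
move=> hr; have := lev_h0 hr; rewrite /lev => h; have K0 := K_ge1; have t0 := two_pos r.
have d : 0 < INR Kn * 2 ^ r by apply: Rmult_lt_0_compat; lra.
have := Rmult_le_compat_l _ _ _ (Rlt_le _ _ d) h.
have -> : INR Kn * 2 ^ r * (La / (INR Kn * 2 ^ r)) = La by field; lra.
lra.
Qed.

Definition err0 : R := B0 + 1 + E0 + asum k a * (33 + 4 * INR Kn).

Lemma r_le_ln r : (r <= Rr)%N -> INR r <= 2 * ln La.
Proof.
move=> hr; have h := two_le_La hr; have K0 := K_ge1; have t0 := two_pos r.
have h2 : 2 ^ r <= La.
  have : 1 * 2 ^ r * 1 <= INR Kn * 2 ^ r * h0 by apply: Rmult_le_compat; nra.
  lra.
have : ln (2 ^ r) <= ln La by apply: ln_le.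
rewrite -Rpower_pow; last lra.
by rewrite /Rpower ln_exp; have := pos_INR r; have := Rlog_2; nra.
Qed.

(** Crude size of a level: X^(1/20) times a power of log X, because Kn 2^r h0 <= La and 20 C4 <=
    h0. *)
Lemma exponent_le r : (r <= Rr)%N ->
  B0 + 1 + Sx k a t (lev r) N + E0 + C4 * INR Kn * 2 ^ r <= err0 + 9 * asum k a * ln La + La / 20.
Proof.
move=> hr; have s := Sx_crude t apos La1 (conj (lev_gt0 r) (lev_La r)) (La_lev r) (@levN r).
rewrite plus_INR in s; have rl := r_le_ln hr; have as0 := asum_ge0 apos.
have : C4 * INR Kn * 2 ^ r <= La / 20.
  have := two_le_La hr; have K0 := K_ge1; have t0 := two_pos r.
  have : 0 <= INR Kn * 2 ^ r by apply: Rmult_le_pos; lra.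
  set y := INR Kn * 2 ^ r => y0 hy; rewrite Rmult_assoc -/y.
  have := Rmult_le_compat_l y _ _ y0 C4h; lra.
have : asum k a * INR r <= asum k a * (2 * ln La) by apply: Rmult_le_compat_l.
rewrite /err0; lra.
Qed.

Lemma error_sum D :
  \rsum_(0 <= r < Rr.+1) \rsum_(0 <= l < maxn r 1) (cst r * (2 * INR D ^ 4 * exp (La / 5))) <=
  (2 * ln La + 1) ^ 2 * (exp (err0 + 9 * asum k a * ln La + La / 20) * (2 * INR D ^ 4 * exp (La / 5))).
Proof.
have D4 : 0 <= INR D ^ 4 by apply: pow_le; exact: pos_INR.
set Y := 2 * INR D ^ 4 * exp (La / 5).
have Y0 : 0 <= Y by apply: Rmult_le_pos; [lra | exact/exp_ge0].
set Q := exp (err0 + _ + _).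
have Q0 : 0 < Q := exp_pos _.
have cQ r : (r <= Rr)%N -> cst r <= Q.
  move=> hr; have e := exp_le (exponent_le hr); rewrite -/Q in e; rewrite /cst.
  apply: Rle_trans e; rewrite -{2}(Rmult_1_r (exp _)); apply: Rmult_le_compat_l; first exact/exp_ge0.
  case: r {hr} => [|s]; first lra.
  rewrite -Rinv_1; apply: Rinv_le_contravar; first lra.
  by apply: pow_R1_Rle; exact: Vs_ge.
have cb n x : \rsum_(0 <= l < n) x = INR n * x.
  by elim: n => [|n IH]; [rewrite big_geq // Rmult_0_l | rewrite S_INR big_nat_recr // Rmult_plus_distr_r Rmult_1_l -IH].
have rl := r_le_ln (leqnn Rr).
apply: (Rle_trans _ (\rsum_(0 <= r < Rr.+1) (INR Rr.+1 * (Q * Y)))).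
  apply: rsum_le => r; rewrite mem_index_iota => hr _; rewrite cb.
  apply: Rmult_le_compat; first exact: pos_INR.
  - by apply: Rmult_le_pos => //; exact/Rlt_le/cst_gt0.
  - by apply: le_INR; rewrite /maxn; case: ifP; lia.
  - by apply: Rmult_le_compat_r => //; apply: cQ; lia.
rewrite cb S_INR; have R0 := pos_INR Rr.
have QY : 0 <= Q * Y by apply: Rmult_le_pos; lra.
have : (INR Rr + 1) * (INR Rr + 1) <= (2 * ln La + 1) * (2 * ln La + 1) by apply: Rmult_le_compat; lra.
have -> : (INR Rr + 1) * ((INR Rr + 1) * (Q * Y)) = ((INR Rr + 1) * (INR Rr + 1)) * (Q * Y) by ring.
by move=> h; rewrite /= Rmult_1_r; apply: Rmult_le_compat_r.
Qed.

(** At the last level no block remains, only the bottom primes. The resulting bound X^(1/20) times a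
    power of log X is enough for the few primes up to sqrt X. *)
Lemma small_p p (W : R) : prime p -> odd p ->
  W <= exp (\psum_(q <= N) (chi8 p q * cq k a t (lev Rr) q) + Sx k a t (lev Rr) N + E0 + C4 * INR Kn * 2 ^ Rr) ->
  W <= exp (err0 + 9 * asum k a * ln La + La / 20).
Proof.
move=> pp op h; apply: Rle_trans h _; apply: exp_le.
have := total_split pp op (leqnn Rr); rewrite subnn big_nil.
have := exponent_le (leqnn Rr); lra.
Qed.

End Levels.

(** * Choice of parameters and conclusion *)

Lemma C0_ge0 : 0 <= C0.
Proof. rewrite /C0 /Dpos_const; lra. Qed.

Lemma dyadic_level x h0 : 0 < h0 -> h0 <= x -> exists R, h0 <= x / 2 ^ R < 2 * h0.
Proof.
move=> h00.
have H : forall n y, h0 <= y -> y < 2 ^ n * h0 -> exists R, h0 <= y / 2 ^ R < 2 * h0.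
  elim=> [|n IH] y h1 h2; first by rewrite /= in h2; lra.
  case: (Rlt_le_dec y (2 * h0)) => h3; first by exists 0%N; rewrite /= Rdiv_1_r.
  have [R hR] := IH (y / 2) (ltac:(lra)) (ltac:(rewrite /= in h2; lra)).
  exists R.+1; have -> : y / 2 ^ R.+1 = y / 2 / 2 ^ R; last by [].
  by rewrite /=; field; have := two_pos R; lra.
move=> hx; have [n [_ hn]] := nat_floor (ltac:(apply: Rmult_le_pos; [lra | apply/Rinv_ge0; lra]) : 0 <= x / h0).
apply: (H n.+1) => //.
have : x < (INR n + 1) * h0 by have := Rmult_lt_compat_r h0 _ _ h00 hn; rewrite {1}/Rdiv Rmult_assoc Rinv_l; lra.
have := INR_le_two n.+1; rewrite S_INR => h; have := Rmult_le_compat_r h0 _ _ (Rlt_le _ _ h00) h; lra.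
Qed.

Lemma ln_le_lin c x : 1 <= c -> 0 < x -> c * ln x <= x / 5 + c * ln (5 * c).
Proof.
move=> c1 x0; have := @ln_le_sub1 (x / (5 * c)) (ltac:(apply: Rdiv_lt_0_compat; lra)).
rewrite ln_div; [ | exact: x0 | lra] => h.
have := Rmult_le_compat_l c _ _ (ltac:(lra)) h.
have -> : c * (x / (5 * c) - 1) = x / 5 - c by field; lra.
lra.
Qed.

Lemma sumR_big f n : sumR f n = \rsum_(0 <= i < n) f i.
Proof. by elim: n => [|n IH]; [rewrite big_geq | rewrite [RHS]big_nat_recr //= IH]. Qed.

Lemma sum_window (F : nat -> R) n T : (forall i, 0 <= F i) ->
  \rsum_(0 <= i < T) (if (0 < i <= n)%N then F i else 0) <= \rsum_(1 <= i < n.+1) F i.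
Proof.
move=> F0; set G := fun i => if (0 < i <= n)%N then F i else 0.
have G0 i : 0 <= G i by rewrite /G; case: ifP => _; [exact: F0 | lra].
apply: (Rle_trans _ (\rsum_(0 <= i < (maxn T n).+1) G i)).
  rewrite (@big_cat_nat _ _ _ T 0 (maxn T n).+1) //; last by rewrite ltnW // ltnS leq_maxl.
  have : 0 <= \rsum_(T <= i < (maxn T n).+1) G i by apply: rsum_ge0.
  move=> h; apply: (Rle_trans _ (\rsum_(0 <= i < T) G i + 0)); first by rewrite Rplus_0_r; exact: Rle_refl.
  exact: Rplus_le_compat_l.
right; rewrite big_ltn // (@big_cat_nat _ _ _ n.+1 1) //; last by rewrite ltnS leq_maxr.
have -> : \rsum_(n.+1 <= i < (maxn T n).+1) G i = 0.
  by rewrite big_nat big1 // => i hi; rewrite /G; case: ifP => //; lia.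
have -> : \rsum_(1 <= i < n.+1) F i = \rsum_(1 <= i < n.+1) G i.
  by apply: eq_big_nat => i hi; rewrite /G; case: ifP => //; lia.
rewrite -[X in _ = X]Rplus_0_r -[X in _ = X]Rplus_0_l.
by apply: (f_equal2 Rplus).
Qed.

Lemma sum_const n (x : R) : \rsum_(1 <= i < n.+1) x = INR n * x.
Proof. by elim: n => [|n IH]; [rewrite big_geq // Rmult_0_l | rewrite S_INR big_nat_recr // Rmult_plus_distr_r Rmult_1_l -IH]. Qed.

Lemma Bernoulli_32 s : 1 + INR s / 2 <= (3 / 2) ^ s.
Proof.
elim: s => [|s IH]; first by rewrite /=; lra.
by rewrite S_INR [_ ^ _]/=; have := pos_INR s; lra.
Qed.

(** Primes up to sqrt X are bounded one by one by U. The others exceed D, so [nu D p] = 1 there and,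
    the summands being nonnegative, the sum may be enlarged to all m <= X with weight [nu]. *)
Lemma moment_split k a t X : 0 < ln X -> 0 <= X -> forall (U : R) (Xn n2 D : nat) (Phi : nat -> R),
  INR Xn <= X < INR Xn + 1 -> exp (ln X / 2) < INR n2 + 1 -> 0 <= U -> INR D <= exp (ln X / 2) -> (0 < D)%N ->
  (forall m, 0 <= Phi m) ->
  (forall p, prime p -> odd p -> INR p <= X -> Wp k a t p <= U) ->
  (forall p, prime p -> odd p -> INR p <= X -> Wp k a t p <= Phi p) ->
  moment_sum k a t X <= INR n2 * (ln X * U) + ln X * \rsum_(1 <= m < Xn.+1) (nu D m * Phi m).
Proof.
move=> L0 X0 U Xn n2 D Phi hXn hn2 U0 hD D0 Phi0 hU hPhi.
rewrite /moment_sum sumR_big.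
rewrite -sum_const -rsum_scal.
apply: Rle_trans (Rplus_le_compat _ _ _ _ (@sum_window (fun _ => ln X * U) n2 (S (Z.to_nat (up X))) _) (@sum_window (fun m => ln X * (nu D m * Phi m)) Xn (S (Z.to_nat (up X))) _)); last first.
- by move=> m; apply: Rmult_le_pos; [lra | apply: Rmult_le_pos => //; exact: nu_ge0].
- by move=> _; apply: Rmult_le_pos; lra.
rewrite -rsum_plus; apply: rsum_le => p _ _.
have pos1 : 0 <= (if (0 < p <= n2)%N then ln X * U else 0) by case: ifP => _; [apply: Rmult_le_pos |]; lra.
have pos2 : 0 <= (if (0 < p <= Xn)%N then ln X * (nu D p * Phi p) else 0).
  by case: ifP => _; [apply: Rmult_le_pos; [lra | apply: Rmult_le_pos => //; exact: nu_ge0] | lra].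
case: andP => [[h1 h2]|_]; last by lra.
have {}h2 : INR p <= X by move: h2; case: Rle_dec.
have [pp op] : prime p /\ odd p.
  move: h1 => /andP [h3 h4]; split=> //.
  have -> : odd p = Nat.odd p by elim: (p) => // n IH; rewrite [LHS]/= Nat.odd_succ -Nat.negb_odd IH.
  by [].
have p0 := prime_gt0 pp. have pr0 := INR_gt0 p0.
have lp : 0 <= lnN p <= ln X by split; [exact: ln_INR_ge0 | apply: ln_le].
have W0 := Wp_ge0 k a t p.
have pX : (p <= Xn)%N.
  by have h : INR p < INR Xn.+1 by [rewrite S_INR; lra]; have := INR_lt _ _ h; lia.
rewrite -/(Wp k a t p).
case: (leqP p n2) => hp.
  rewrite p0 /= in pos2 *; have hw := hU p pp op h2.
  have : lnN p * Wp k a t p <= ln X * U by apply: Rmult_le_compat; lra.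
  lra.
rewrite p0 pX /=.
have hw := hPhi p pp op h2.
have Dp : (D < p)%N.
  have : INR n2 + 1 <= INR p by rewrite -S_INR; apply: le_INR; lia.
  move=> h; have h3 : INR D < INR p by lra.
  by have := INR_lt _ _ h3; lia.
rewrite (nu_prime D0 pp Dp) Rmult_1_l.
have : lnN p * Wp k a t p <= ln X * Phi p by apply: Rmult_le_compat; lra.
lra.
Qed.

(** The constants are fixed in the order C4, h0, beta, P, M, Kn, V, each requirement of the level
    argument then involving only constants already chosen; finally X is taken large in terms of all
    of them. *)
Lemma hybrid_moment (G : GRH) k a A (k0 : (0 < k)%N) (apos : forall j, (j < k)%N -> 0 < a j) (A0 : 0 < A) :
  exists Cst X0 : R, 0 < Cst /\ forall X t, X0 <= X -> (forall j, (j < k)%N -> Rabs (t j) <= Rpower X A) ->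
    moment_sum k a t X <= Cst * moment_bound k a t X.
Proof.
have as0 : 0 <= asum k a := asum_ge0 apos.
have C00 := C0_ge0.
set sa := asum k a in as0.
(* (10 + A) log X bounds log(8p) + log(2 + |t_j|); divided by lev r it becomes (10 + A) Kn 2^r. *)
pose C4 := C0 * sa * (10 + A).
have C40 : 0 <= C4 by apply: Rmult_le_pos; [exact: Rmult_le_pos | lra].
pose h0 := 1 + 20 * C4 + 4 * sa.
have h01 : 1 <= h0 by rewrite /h0; lra.
have C4h : 20 * C4 <= h0 by rewrite /h0; lra.
have h0a : 4 * sa <= exp h0 by have := exp_ineq1_le h0; rewrite /h0; lra.
have c30 : 0 <= c3 k a := c3_ge0 apos.
have v00 : 0 <= v0 k a by rewrite /v0; have := pow2_ge_0 (asum k a); lra.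
pose beta := 120 * C4 + 8 * c3 k a + 4.
pose P := exp (v0 k a + beta).
have P1 : 1 <= P by have := exp_ineq1_le (v0 k a + beta); rewrite /P /beta; lra.
(* 3872 = 2 * 44^2: with V^2 = 2MP this gives 44 V <= M, that is 2640 V <= Kn for Kn = 60 M. *)
have [M [M1 hM]] : exists M, (0 < M)%N /\ 3872 * P <= INR M.
  have [M0 [_ hM0]] := nat_floor (ltac:(lra) : 0 <= 3872 * P).
  by exists M0.+1; split=> //; rewrite S_INR; lra.
have IM1 : 1 <= INR M := INR_ge1 M1.
pose Kn := (60 * M)%N.
have K1 : (0 < Kn)%N by rewrite /Kn muln_gt0 M1.
have KE : INR Kn = 60 * INR M by rewrite /Kn INR_mul /=; ring.
have KM : 60 * INR M <= INR Kn by rewrite KE; lra.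
(* Makes [rho] an equality. *)
pose V := sqrt (2 * INR M * P).
have VV : V ^ 2 = 2 * INR M * P by apply: pow2_sqrt; apply: Rmult_le_pos; lra.
have V0 : 0 <= V := sqrt_pos _.
have V1 : 1 <= V by apply: Rnot_lt_le => lt; have : V ^ 2 < 1 by [rewrite /=; nra]; rewrite VV; nra.
have KV : 2640 * V <= INR Kn.
  rewrite KE; suff : 44 * V <= INR M by lra.
  apply: Rnot_lt_le => lt; have : INR M * INR M < (44 * V) * (44 * V) by apply: Rmult_le_0_lt_compat; lra.
  have -> : (44 * V) * (44 * V) = 1936 * V ^ 2 by ring.
  rewrite VV; nra.
have rho : 2 * INR M * exp (v0 k a) <= exp (- beta) * V ^ 2.
  rewrite VV /P exp_plus; right.
  have : exp (- beta) * exp beta = 1 by rewrite -exp_plus Rplus_opp_l exp_0.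
  move=> e; have -> : exp (- beta) * (2 * INR M * (exp (v0 k a) * exp beta)) = (exp (- beta) * exp beta) * (2 * INR M * exp (v0 k a)) by ring.
  by rewrite e Rmult_1_l.
have betaM : 2 * (C4 * INR Kn + 4 * c3 k a + 2) <= beta * INR M.
  rewrite KE /beta.
  have : 8 * c3 k a + 4 <= (8 * c3 k a + 4) * INR M by nra.
  lra.
pose Nn s := Z.to_nat (up (10 * Vs V s)).
have Vsp s : 1 <= Vs V s by exact: Vs_ge.
have NnE s : 10 * Vs V s <= INR (Nn s) <= 10 * Vs V s + 1.
  have [b1 b2] := archimed (10 * Vs V s); have := Vsp s => v1.
  rewrite /Nn INR_IZR_INZ Z2Nat.id; first lra.
  by apply: le_IZR; lra.
have NnV s : 10 * Vs V s <= INR (Nn s) by have [] := NnE s.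
have NnU s : INR (Nn s) <= 11 * Vs V s by have := NnE s; have := Vsp s; lra.
have Nns s : (s < Nn s)%N.
  apply/ltP/INR_lt; have := NnV s; have := Bernoulli_32 s; have := pos_INR s.
  rewrite /Vs; have := pow_lt (3 / 2) s (ltac:(lra)); nra.
pose E0 := 13 * sa.
pose er := err0 k a h0 Kn E0.
pose cM := B0 k a h0 + 1 + E0 + c3 k a * (4 * INR Kn + 33).
pose c10 := 3 + 9 * sa + c3 k a.
have c101 : 1 <= c10 by rewrite /c10; lra.
(* Lower bound for log X: level 0 must exceed h0, the sieve must be effective, and X^(11/20) times
   the powers of log X must fall below the bound that [TEx_lower] guarantees. *)
pose Lz := 40 + INR Kn * h0 + 4 * (c10 * ln (5 * c10) + Rabs er + 12 + c3 k a).
pose CC := 82 * exp cM * (exp (C4 * INR Kn) + 1) + 1.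
have lc0 : 0 <= c10 * ln (5 * c10).
  by apply: Rmult_le_pos; [lra | rewrite -ln_1; apply: ln_le; lra].
have era := Rabs_pos er.
have Kh : 0 <= INR Kn * h0 by apply: Rmult_le_pos; [exact: pos_INR | lra].
exists CC, (exp Lz); split.
  rewrite /CC; have := exp_pos cM; have := exp_pos (C4 * INR Kn) => e1 e2.
  have : 0 < 82 * exp cM * (exp (C4 * INR Kn) + 1) by apply: Rmult_lt_0_compat; lra.
  lra.
move=> X t hX ht.
have X0 : 0 < X by have := exp_pos Lz; lra.
set La := ln X.
have hL : Lz <= La by rewrite -(ln_exp Lz); apply: ln_le => //; exact: exp_pos.
have Lz40 : 40 <= Lz by rewrite /Lz; lra.
have La1 : 1 <= La by lra.
have eX : exp La = X by rewrite /La exp_ln.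
have [Rr] := @dyadic_level (La / INR Kn) h0 (ltac:(lra)) (ltac:(apply: (Rmult_le_reg_r (INR Kn)); [have := INR_ge1 K1; lra | rewrite /Rdiv Rmult_assoc Rinv_l; [rewrite /Lz in hL; lra | have := INR_ge1 K1; lra]])).
have -> : La / INR Kn / 2 ^ Rr = lev La Kn Rr by rewrite /lev; field; have := two_pos Rr; have := INR_ge1 K1; lra.
move=> levR.
have [N [_ hN0]] := nat_floor (Rlt_le _ _ (exp_pos (lev La Kn 0))).
have hN n : (N < n)%N -> lev La Kn 0 < lnN n.
  move=> h; rewrite -(ln_exp (lev La Kn 0)); apply: ln_increasing; first exact: exp_pos.
  by apply: Rlt_le_trans hN0 _; rewrite -S_INR; apply: le_INR; lia.
have [Xn hXn] := nat_floor (Rlt_le _ _ X0).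
have [n2 [hn2a hn2]] := nat_floor (Rlt_le _ _ (exp_pos (La / 2))).
(* D is about X^(1/20): D^4 <= X^(1/5) keeps the errors small, while log D >= La/40 still saves a
   factor of order log X in the sieve. *)
have [D [hDa hD]] := nat_floor (Rlt_le _ _ (exp_pos (La / 20))).
have D40 : exp (La / 40) <= INR D.
  have e : exp (La / 20) = exp (La / 40) * exp (La / 40) by rewrite -exp_plus; congr exp; field.
  have : 2 <= exp (La / 40) by have := exp_ineq1_le (La / 40); lra.
  rewrite e in hD; nra.
have D0 : (0 < D)%N.
  by apply/ltP/INR_lt; have := exp_pos (La / 40); rewrite /=; lra.
pose U := exp (er + 9 * sa * ln La + La / 20).
pose Phi m := \rsum_(0 <= r < Rr.+1) \rsum_(0 <= l < maxn r 1)
   (cst k a t La h0 V Kn N M E0 C4 r * ev (PP La Kn Rr N M Nn r) (fun q => cf k a t La Kn r l q * IZR (leg q (8 * m)))).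
have lvl p : prime p -> odd p -> INR p <= X -> forall r, (r <= Rr)%N ->
   Wp k a t p <= exp (\psum_(q <= N) (chi8 p q * cq k a t (lev La Kn r) q) + Sx k a t (lev La Kn r) N + E0 + C4 * INR Kn * 2 ^ r).
  move=> pp op pX r hr.
  have hB j : (j < k)%N -> ln (INR (8 * p)) + ln (2 + Rabs (t j)) <= (10 + A) * La.
    move=> hj; have p0 := INR_gt0 (prime_gt0 pp).
    have l1 : ln (INR (8 * p)) <= 7 + La.
      rewrite ln_mulN ?(prime_gt0 pp) //; have : lnN p <= La by apply: ln_le.
      have e8 : INR 8 = 8 by rewrite /=; ring.
      have := @ln_le_sub1 (INR 8) (ltac:(rewrite e8; lra)); rewrite e8; lra.
    have l2 : ln (2 + Rabs (t j)) <= 2 + A * La.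
      have AL : 0 <= A * La by apply: Rmult_le_pos; lra.
      have t1 : 2 + Rabs (t j) <= 3 * exp (A * La).
        by have := ht j hj; rewrite /Rpower -/La; have := exp_ineq1_le (A * La); lra.
      apply: (Rle_trans _ (ln (3 * exp (A * La)))); first by apply: ln_le => //; have := Rabs_pos (t j); lra.
      rewrite ln_mult; [ | lra | exact: exp_pos]; rewrite ln_exp; have := @ln_le_sub1 3 (ltac:(lra)); lra.
    by rewrite Rmult_plus_distr_r; lra.
  have lr := lev_le La1 K1 (leq0n r).
  have lh := lev_h0 La1 K1 levR hr.
  have W := Wp_bound apos (B := (10 + A) * La) G pp op (ltac:(lra) : / 2 <= lev La Kn r) (fun n hn => Rle_lt_trans _ _ _ lr (hN n hn)) hB C00.
  apply: Rle_trans W _; right; congr exp; rewrite /E0; congr (_ + _).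
  rewrite /C4 /lev -/sa; field; have := two_pos r; have := INR_ge1 K1; lra.
have ms : moment_sum k a t X <= INR n2 * (La * U) + La * \rsum_(1 <= m < Xn.+1) (nu D m * Phi m).
  apply: moment_split => //.
  - by rewrite -/La; lra.
  - lra.
  - exact/exp_ge0.
  - by apply: Rle_trans hDa _; apply: exp_le; rewrite -/La; lra.
  - move=> m; apply: rsum_ge0 => r; rewrite mem_index_iota => hr _; apply: rsum_ge0 => l _ _.
    apply: Rmult_le_pos; first exact/Rlt_le/cst_gt0.
    by apply: (ev_PP_ge0 k a t N Nn La1 K1 M1); lia.
  - move=> p pp op pX.
    exact: (small_p apos La1 K1 V1 M1 h01 levR hN KV C4h pp op (lvl p pp op pX Rr (leqnn Rr))).
  - move=> p pp op pX.
    exact: (pointwise apos La1 K1 V1 M1 h01 levR NnV Nns pp op (lvl p pp op pX)).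
apply: Rle_trans ms _.
set SN := \rsum_(1 <= m < Xn.+1) nu D m.
have mean := mean_sum t apos La1 K1 V1 M1 h01 levR hN E0 h0a NnU KV KM rho betaM D0 (erefl SN).
have err := error_sum t apos La1 K1 V1 M1 h01 levR hN E0 KV C4h D.
rewrite moment_bound_exp //; last by rewrite -/La; lra.
rewrite -/La.
set T := TEx k a t La in mean *.
have D4 : INR D ^ 4 <= exp (La / 5).
  have -> : exp (La / 5) = exp (La / 20) ^ 4 by rewrite /= Rmult_1_r -!exp_plus; congr exp; field.
  by apply: pow_incr; split; [exact: pos_INR | exact: hDa].
have D4p : 0 <= INR D ^ 4 by apply: pow_le; exact: pos_INR.
have S1 := Sd_ge1 D0.
have Sd80 : La / 80 <= Sd D.
  have := Sd_lower D0; have : La / 40 <= lnN D by rewrite -(ln_exp (La / 40)); apply: ln_le => //; exact: exp_pos.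
  lra.
(* The sieve saving 1/Sd(D) <= 80/La cancels the weight log p <= La. *)
have hSN : La * SN <= 82 * X.
  have := nu_sum Xn D0; rewrite -/SN => h.
  have x1 : INR Xn / Sd D <= X * (80 / La).
    apply: Rmult_le_compat; [exact: pos_INR | apply/Rinv_ge0; lra | lra |].
    have -> : 80 / La = / (La / 80) by field; lra.
    by apply: Rinv_le_contravar; lra.
  have x2 : La * exp (La / 5) <= X.
    rewrite -eX (_ : exp La = exp (La * (4 / 5)) * exp (La / 5)); last by rewrite -exp_plus; congr exp; field.
    apply: Rmult_le_compat_r; first exact/exp_ge0.
    have -> : La * (4 / 5) = La * (2 / 5) + La * (2 / 5) by field.
    rewrite exp_plus; have := exp_ineq1_le (La * (2 / 5)); nra.
  have : La * SN <= La * (X * (80 / La) + 2 * exp (La / 5)) by apply: Rmult_le_compat_l; lra.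
  have -> : La * (X * (80 / La) + 2 * exp (La / 5)) = 80 * X + 2 * (La * exp (La / 5)) by field; lra.
  lra.
have lnLa : 0 <= ln La <= La.
  by split; [rewrite -ln_1; apply: ln_le; lra | have := @ln_le_sub1 La (ltac:(lra)); lra].
have m0E : main0 k a t La h0 Kn E0 = exp cM * exp T.
  by rewrite /main0 -exp_plus; congr exp; rewrite /cM /T; ring.
set Mx := main0 k a t La h0 Kn E0 * (exp (C4 * INR Kn) + 1) in mean.
have eT := exp_pos T. have ecM := exp_pos cM. have eC := exp_pos (C4 * INR Kn).
have Mx0 : 0 <= Mx by rewrite /Mx m0E; repeat apply: Rmult_le_pos; lra.
have part1 : La * (Mx * SN) <= (82 * exp cM * (exp (C4 * INR Kn) + 1)) * (X * exp T).
  have -> : La * (Mx * SN) = Mx * (La * SN) by ring.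
  have -> : 82 * exp cM * (exp (C4 * INR Kn) + 1) * (X * exp T) = Mx * (82 * X) by rewrite /Mx m0E; ring.
  exact: Rmult_le_compat_l.
have U0 : 0 < U := exp_pos _.
have e5 := exp_pos (La / 5).
(* Common size of both error terms, X^(1/2) U times a constant and La^3; [Zb] places it below the
   claimed bound. *)
pose Z := exp (3 * ln La + 10 + er + 9 * sa * ln La + La * (11 / 20)).
have La2 : (2 * ln La + 1) ^ 2 <= 9 * La ^ 2.
  have -> : 9 * La ^ 2 = (3 * La) ^ 2 by ring.
  by apply: pow_incr; lra.
have ZE : Z = exp 10 * La ^ 3 * U * exp (La / 2).
  have l3 : La ^ 3 = exp (3 * ln La).
    by rewrite (_ : 3 * ln La = ln La + (ln La + ln La)); [rewrite !exp_plus exp_ln /=; [ring | lra] | ring].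
  rewrite l3 /U -!exp_plus /Z; congr exp; field.
have e10 : 40 <= exp 10.
  have -> : exp 10 = exp 5 * exp 5 by rewrite -exp_plus; congr exp; ring.
  have : 12 <= exp 5.
    have -> : exp 5 = exp (5 / 2) * exp (5 / 2) by rewrite -exp_plus; congr exp; field.
    by have := exp_ineq1_le (5 / 2); nra.
  nra.
have e2p := exp_pos (La / 2).
have UE : 0 < U * exp (La / 2) by apply: Rmult_lt_0_compat.
have La3 : La <= La ^ 3 by rewrite /=; nra.
have part2 : INR n2 * (La * U) <= Z / 40 * 1.
  apply: (Rle_trans _ (exp (La / 2) * (La * U))).
    by apply: Rmult_le_compat_r => //; apply: Rmult_le_pos; lra.
  rewrite ZE.
  have -> : exp (La / 2) * (La * U) = La * (U * exp (La / 2)) by ring.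
  have -> : exp 10 * La ^ 3 * U * exp (La / 2) / 40 * 1 = (exp 10 / 40 * La ^ 3) * (U * exp (La / 2)) by field.
  apply: Rmult_le_compat_r; first lra.
  have : 1 <= exp 10 / 40 by lra.
  have : 0 < La ^ 3 by apply: pow_lt; lra.
  nra.
have part3 : La * ((2 * ln La + 1) ^ 2 * (exp (er + 9 * sa * ln La + La / 20) * (2 * INR D ^ 4 * exp (La / 5)))) <= Z * (18 / 40).
  rewrite -/U.
  have d1 : 2 * INR D ^ 4 * exp (La / 5) <= 2 * exp (La / 2).
    apply: (Rle_trans _ (2 * (exp (La / 5) * exp (La / 5)))); first by nra.
    by rewrite -exp_plus; apply: Rmult_le_compat_l; [lra | apply: exp_le; lra].
  have d2 : U * (2 * INR D ^ 4 * exp (La / 5)) <= U * (2 * exp (La / 2)) by apply: Rmult_le_compat_l; lra.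
  have d0 : 0 <= U * (2 * INR D ^ 4 * exp (La / 5)) by apply: Rmult_le_pos; [lra | apply: Rmult_le_pos; lra].
  have d3 : (2 * ln La + 1) ^ 2 * (U * (2 * INR D ^ 4 * exp (La / 5))) <= 9 * La ^ 2 * (U * (2 * exp (La / 2))).
    by apply: Rmult_le_compat => //; exact: pow2_ge_0.
  apply: (Rle_trans _ (La * (9 * La ^ 2 * (U * (2 * exp (La / 2)))))); first by apply: Rmult_le_compat_l; lra.
  rewrite ZE.
  have -> : La * (9 * La ^ 2 * (U * (2 * exp (La / 2)))) = 18 * La ^ 3 * (U * exp (La / 2)) by ring.
  have -> : exp 10 * La ^ 3 * U * exp (La / 2) * (18 / 40) = (exp 10 * (18 / 40) * La ^ 3) * (U * exp (La / 2)) by field.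
  apply: Rmult_le_compat_r; first lra.
  apply: Rmult_le_compat_r; first by apply: pow_le; lra.
  lra.
have Zb : Z <= X * exp T.
  rewrite -eX -exp_plus /Z; apply: exp_le.
  have := TEx_lower t apos La1; rewrite -/T -/(c3 k a) => tl.
  have := @ln_le_lin c10 La c101 (ltac:(lra)).
  have : c10 * ln La = 3 * ln La + 9 * sa * ln La + c3 k a * ln La by rewrite /c10; ring.
  have := Rle_abs er; rewrite /Lz in hL; lra.
have Z0 : 0 < Z := exp_pos _.
have : La * \rsum_(1 <= m < Xn.+1) (nu D m * Phi m) <= La * (Mx * SN) + La * ((2 * ln La + 1) ^ 2 * (exp (er + 9 * sa * ln La + La / 20) * (2 * INR D ^ 4 * exp (La / 5)))).
  rewrite -Rmult_plus_distr_l; apply: Rmult_le_compat_l; first lra.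
  apply: Rle_trans mean _; exact: Rplus_le_compat_l.
rewrite /CC; lra.
Qed.

End HybridMoment.

Theorem theorem1p1 :
  GRH ->
  forall (k : nat) (a : nat -> R) (A : R),
    (1 <= k)%nat ->
    (forall j, (j < k)%nat -> 0 < a j) ->
    0 < A ->
    exists (Cst X0 : R), 0 < Cst /\
      forall (X : R) (t : nat -> R),
        X0 <= X ->
        (forall j, (j < k)%nat -> Rabs (t j) <= Rpower X A) ->
        moment_sum k a t X <= Cst * moment_bound k a t X.
Proof.
intros G k a A k1 a0 A0.
destruct (HybridMoment.hybrid_moment G (ssrbool.introT ssrnat.leP k1)
  (fun j hj => a0 j (ssrbool.elimT ssrnat.ltP hj)) A0) as [C [X0 [C0 H]]].
exists C, X0; split; [exact C0 | intros X t hX ht].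
apply H; [exact hX | intros j hj; exact (ht j (ssrbool.elimT ssrnat.ltP hj))].
Qed.
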